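(* The linearized operator $\mathcal{L}$, acting on $\dot H^1(\mathbb{H}^1)\cap V_0^+$, is non degenerate: $$\mathrm{Ker}(\mathcal{L})=\mathrm{Vect}_{\mathbb{R}}(\partial_sQ_+,\ iQ_+,\ Q_++2i\partial_sQ_+).$$
   Context: $\mathbb{H}^1$ is the Heisenberg group identified with $\mathbb{R}^3$, with coordinates $(x,y,s)$ and Lebesgue measure. Functions are complex valued. Set $\Delta_{\mathbb{H}^1}=\frac14(\partial_x^2+\partial_y^2)+(x^2+y^2)\partial_s^2$ and $D_s=-i\partial_s$. $\dot H^1(\mathbb{H}^1)$ is the completion of the Schwartz space for $\|u\|_{\dot H^1}=\|(-\Delta_{\mathbb{H}^1})^{1/2}u\|_{L^2}$; $\dot H^{-1}$ is its dual. With $\widehat u(x,y,\sigma)=\frac1{\sqrt{2\pi}}\int_{\mathbb{R}}e^{-is\sigma}u(x,y,s)\,ds$, for $k\in\{-1,0,1\}$ the space $\dot H^k(\mathbb{H}^1)\cap V_0^+$ is the closed subspace of those $u\in\dot H^k(\mathbb{H}^1)$ (with $\dot H^0=L^2$) such that $\widehat u(x,y,\sigma)=f(\sigma)\frac1{\sqrt\pi}e^{-(x^2+y^2)\sigma}\mathbf 1_{\sigma\ge0}$ for some function $f$; then $\|u\|_{\dot H^k}^2=\int_0^\infty|f(\sigma)|^2\frac{d\sigma}{2\sigma^{1-k}}$. On $V_0^+$ one has $-\Delta_{\mathbb{H}^1}=D_s$. $\Pi_0^+$ is the orthogonal projector of $L^2(\mathbb{H}^1)$ onto $L^2(\mathbb{H}^1)\cap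 V_0^+$, extended to $L^{4/3}(\mathbb{H}^1)\subset\dot H^{-1}(\mathbb{H}^1)$. $Q_+(x,y,s)=\dfrac{\sqrt2\,i}{s+i(x^2+y^2)+i}$, and for $h\in\dot H^1(\mathbb{H}^1)\cap V_0^+$, $$\mathcal{L}h=-\Delta_{\mathbb{H}^1}h-2\Pi_0^+(|Q_+|^2h)-\Pi_0^+(Q_+^2\overline h).$$ $\mathrm{Vect}_{\mathbb{R}}$ denotes the real linear span. *)

(* Defs.v *)
From HB Require Import structures.
From mathcomp Require Import all_boot all_order all_algebra.
From mathcomp Require Import complex.
From mathcomp Require Import all_classical all_reals all_analysis.

Set Implicit Arguments.
Unset Strict Implicit.
Unset Printing Implicit Defensive.

Import Order.TTheory GRing.Theory Num.Theory.
Import numFieldNormedType.Exports.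

Local Open Scope classical_set_scope.
Local Open Scope ring_scope.
Local Open Scope complex_scope.

(* Complex-valued functions are measured, integrated and differentiated
   through their real and imaginary parts. *)
Section complex_integration.
Context {R : realType} {d : measure_display} {T : measurableType d}.
Variable mu : {measure set T -> \bar R}.
Implicit Types f u : T -> R[i].

Definition cmeasurable f :=
  measurable_fun [set: T] (fun p => complex.Re (f p)) /\
  measurable_fun [set: T] (fun p => complex.Im (f p)).

Definition cintegrable f :=
  mu.-integrable [set: T] (fun p => (complex.Re (f p))%:E) /\
  mu.-integrable [set: T] (fun p => (complex.Im (f p))%:E).

Definition cintegral f : R[i] :=
  Rintegral mu [set: T] (fun p => complex.Re (f p))
  +i* Rintegral mu [set: T] (fun p => complex.Im (f p)).

Definition cLnorm (p : R) u : \bar R :=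
  Lnorm mu p%:E (fun x => (ComplexField.Normc.normc (u x))%:E).

Definition cLp (p : R) u := cmeasurable u /\ (cLnorm p u < +oo)%E.

End complex_integration.

Section heisenberg.
Variable R : realType.

(* Points are written ((x, y), s). *)
Definition H1 : Type := ((R * R) * R)%type.

Definition muH := ((@lebesgue_measure R \x @lebesgue_measure R)
                   \x @lebesgue_measure R)%E.

Definition partial (v : R * R * R) (u : H1 -> R[i]) : H1 -> R[i] := fun p =>
  ('D_v (fun q : R * R * R => complex.Re (u q) : R) p)
  +i* ('D_v (fun q : R * R * R => complex.Im (u q) : R) p).

Definition dx := partial ((1, 0), 0).
Definition dy := partial ((0, 1), 0).
Definition ds := partial ((0, 0), 1).

Definition rho2 (p : H1) : R := p.1.1 ^+ 2 + p.1.2 ^+ 2.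

Definition Lap (u : H1 -> R[i]) : H1 -> R[i] := fun p =>
  (4^-1)%:C * (dx (dx u) p + dy (dy u) p) + (rho2 p)%:C * ds (ds u) p.

Definition schwartz (phi : H1 -> R[i]) :=
  forall a b c : nat, let D := iter a dx (iter b dy (iter c ds phi)) in
  (forall p : R * R * R,
     differentiable (fun q : R * R * R => complex.Re (D q) : R) p /\
     differentiable (fun q : R * R * R => complex.Im (D q) : R) p) /\
  (forall N : nat, exists M : R, forall p : H1,
     (1 + rho2 p + p.2 ^+ 2) ^+ N * ComplexField.Normc.normc (D p) <= M).

(* The norm |(-Lap)^(1/2) phi|_(L^2) of a Schwartz function, using
   |A^(1/2) phi|^2 = <A phi, phi> for the nonnegative operator A = -Lap. *)
Definition Hdot1_norm (phi : H1 -> R[i]) : R :=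
  Num.sqrt (complex.Re (cintegral muH (fun p => - Lap phi p * (phi p)^*%C))).

(* The completion of the Schwartz space for Hdot1_norm, realized as a space of
   functions by means of the Sobolev embedding into L^4: its elements are the
   L^4 limits of the Hdot1_norm-Cauchy sequences of Schwartz functions.  As
   everywhere below, functions equal almost everywhere are not distinguished. *)
Definition Hdot1 (u : H1 -> R[i]) :=
  cLp muH 4 u /\
  exists phi : nat -> H1 -> R[i],
    [/\ forall n, schwartz (phi n),
        forall e : R, 0 < e -> exists N : nat, forall m n : nat,
          (N <= m)%N -> (N <= n)%N ->
          Hdot1_norm (fun p => phi m p - phi n p) < e
      & cLnorm muH 4 (fun p => phi n p - u p) @[n --> \oo] --> 0%E].

(* Distributions are linear forms on Schwartz functions, and a function u acts
   by the bilinear (unconjugated) pairing. *)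
Definition distr (u : H1 -> R[i]) (phi : H1 -> R[i]) : R[i] :=
  cintegral muH (fun p => u p * phi p).

(* The dual of Hdot1: linear forms on the dense subspace of Schwartz functions
   that are bounded for Hdot1_norm; Hdotm1_norm is the dual norm. *)
Definition Hdotm1_norm (T : (H1 -> R[i]) -> R[i]) : \bar R :=
  ereal_sup [set (ComplexField.Normc.normc (T phi))%:E
            | phi in [set phi | schwartz phi /\ Hdot1_norm phi <= 1]].

Definition Hdotm1 (T : (H1 -> R[i]) -> R[i]) :=
  (forall (a : R[i]) (phi psi : H1 -> R[i]), schwartz phi -> schwartz psi ->
     T (fun p => a * phi p + psi p) = a * T phi + T psi) /\
  (Hdotm1_norm T < +oo)%E.

Definition cis (t : R) : R[i] := cos t +i* sin t.

Definition Fourier_s (u : H1 -> R[i]) : H1 -> R[i] := fun p =>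
  ((Num.sqrt (2 * pi))^-1)%:C *
  cintegral (@lebesgue_measure R) (fun s : R => cis (- (s * p.2)) * u (p.1, s)).

(* The function f(sigma) pi^(-1/2) exp(-(x^2+y^2) sigma) 1_(sigma >= 0). *)
Definition V0p_profile (f : R -> R[i]) : H1 -> R[i] := fun p =>
  if 0 <= p.2 then f p.2 * ((Num.sqrt pi)^-1 * expR (- (rho2 p * p.2)))%:C
  else 0.

(* The partial Fourier transform of u, which need not be integrable, is taken
   in the sense of tempered distributions: <u^, phi> = <u, phi^>. *)
Definition V0p (u : H1 -> R[i]) :=
  exists f : R -> R[i], cmeasurable f /\
    forall phi, schwartz phi ->
      cintegrable muH (fun p => V0p_profile f p * phi p) /\
      distr u (Fourier_s phi) = distr (V0p_profile f) phi.

(* w is the orthogonal projection of g on the intersection of L^2 and V0p. *)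
Definition is_Pi0p (g w : H1 -> R[i]) :=
  [/\ cLp muH 2 g, cLp muH 2 w, V0p w
    & forall v, cLp muH 2 v -> V0p v ->
        cintegral muH (fun p => (g p - w p) * (v p)^*%C) = 0].

(* T is the value at g of the continuous extension of the projector from L^2 to
   L^(4/3), with values in Hdotm1. *)
Definition is_Pi0p_ext (g : H1 -> R[i]) (T : (H1 -> R[i]) -> R[i]) :=
  [/\ cLp muH (4 / 3) g, Hdotm1 T
    & exists gn wn : nat -> H1 -> R[i],
      [/\ forall n, cLp muH (4 / 3) (gn n),
          forall n, is_Pi0p (gn n) (wn n),
          cLnorm muH (4 / 3) (fun p => gn n p - g p) @[n --> \oo] --> 0%E
        & Hdotm1_norm (fun phi => distr (wn n) phi - T phi)
            @[n --> \oo] --> 0%E]].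

Definition Qp : H1 -> R[i] := fun p =>
  (Num.sqrt 2)%:C * 'i%C / ((p.2)%:C + 'i%C * (rho2 p)%:C + 'i%C).

(* T is the element
     -Lap h - 2 Pi0p(|Qp|^2 h) - Pi0p(Qp^2 conj(h))
   of Hdotm1; the term -Lap h is understood as a distribution. *)
Definition is_calL (h : H1 -> R[i]) (T : (H1 -> R[i]) -> R[i]) :=
  exists T1 T2 : (H1 -> R[i]) -> R[i],
    [/\ is_Pi0p_ext (fun p => (ComplexField.Normc.normc (Qp p) ^+ 2)%:C * h p) T1,
        is_Pi0p_ext (fun p => Qp p ^+ 2 * (h p)^*%C) T2
      & forall phi, schwartz phi ->
          T phi = distr h (fun p => - Lap phi p) - 2 * T1 phi - T2 phi].

Definition KerL (h : H1 -> R[i]) :=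
  [/\ Hdot1 h, V0p h & is_calL h (fun=> 0)].

(* The real linear span of a finite family, up to equality almost everywhere. *)
Definition VectR (s : seq (H1 -> R[i])) (h : H1 -> R[i]) :=
  cmeasurable h /\
  exists a : 'I_(size s) -> R,
    {ae muH, forall p : H1,
      h p = \sum_(i < size s) (a i)%:C * nth (fun=> 0) s i p}.

End heisenberg.

(* Main.v *)
Require Import Defs.
From HB Require Import structures.
From mathcomp Require Import all_boot all_order all_algebra.
From mathcomp Require Import complex.
From mathcomp Require Import all_classical all_reals all_analysis.
From mathcomp Require Import measurable_realfun.
From mathcomp Require Import ring lra.

(**
Write zeta = 1 + x^2 + y^2 - i s, so that Qp = sqrt 2 / zeta, and z = 1 - zeta.
An element of V0+ is a superposition over t > 0, with a profile f, of the waves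
e^(t z): it is the boundary value E f of the Laplace transform of f
([V0p_repr]), and -Lap acts on it as d/dz ([Lap_hol]). Two computations carry
everything: multiplication by 1/zeta is the convolution of the profile with
e^-t ([conv_laplace_int]), and E f is paired with the conjugate of E k by
pi^2 times the integral of f conj(k) / t ([plancherel]), the weight 1/t coming
from the Gaussian integral over (x, y).

Let h = E f be in the kernel. Tested against conjugates of E u, with u a smooth
bump, the equation becomes an integral equation for f that involves conj(f) only
through the Laplace transform of f at -1 ([kernel_weak]). In terms of P, the
primitive of f e^t corrected by a multiple of t, it is a linear differential
equation of second order, for which t (1 - t) is a solution; a Wronskian argument and P(0) = 0 leave no
other ([ode_solution], [profile_solution]). Hence f = e^-t (a + b t), that is
h = a / zeta + b / zeta^2; evaluating the transform of f at -1 gives the real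
relation Re a + Re b / 2 = 0 ([kernel_form]).

Conversely, for such a, b the two projections are explicit combinations of
zeta^-2 and zeta^-3. Orthogonality to V0+ is an identity between moments
([orthogonal_moments]), which the two computations above evaluate. Membership in
the spaces of the statement follows from the energy identity ([Lap_ibp]) and
from Schwartz approximants of h ([Hdot1_comb], [comb_dual]); the relation between
a and b is what makes the three terms of the equation cancel ([KerL_lcomb]).

Since ds Qp = sqrt 2 i / zeta^2, the pairs (a, b) obeying the relation form the
real span of the pairs of the three generators ([span_lcomb]).

A function on a half plane is called holomorphic here through a quadratic
remainder ([hol]); smooth bumps and Schwartz functions are handled through
classes of functions stable under differentiation ([bumpy], [schwartz_cspan]).
*)

Set Implicit Arguments.
Unset Strict Implicit.
Unset Printing Implicit Defensive.

Import Order.TTheory GRing.Theory Num.Theory.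
Import numFieldNormedType.Exports.
Import ComplexField.Normc.

Local Open Scope classical_set_scope.
Local Open Scope ring_scope.
Local Open Scope complex_scope.

Local Notation Re := complex.Re.
Local Notation Im := complex.Im.
Local Notation Rintegrable m f := (m.-integrable setT (EFin \o f)).
Local Notation RintegrableZl := (integrableZl measurableT).
Local Notation RintegrableD := (integrableD measurableT).

(** * Complex-valued integration *)

Section normc_facts.
Context {R : rcfType}.
Implicit Types x y z : R[i].

Lemma normc_ge0 z : 0 <= normc z.
Proof. by case: z => a b; exact: sqrtr_ge0. Qed.

Lemma sqr_normcE z : normc z ^+ 2 = Re z ^+ 2 + Im z ^+ 2.
Proof. by case: z => a b /=; rewrite sqr_sqrtr// addr_ge0// sqr_ge0. Qed.

Lemma normc_Re z : `|Re z| <= normc z.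
Proof.
rewrite -(@ler_pXn2r _ 2)// ?nnegrE ?normr_ge0 ?normc_ge0// sqr_normcE.
by rewrite real_normK ?num_real// lerDl sqr_ge0.
Qed.

Lemma normc_Im z : `|Im z| <= normc z.
Proof.
rewrite -(@ler_pXn2r _ 2)// ?nnegrE ?normr_ge0 ?normc_ge0// sqr_normcE.
by rewrite real_normK ?num_real// lerDr sqr_ge0.
Qed.

Lemma normc_le z : normc z <= `|Re z| + `|Im z|.
Proof.
rewrite -(@ler_pXn2r _ 2)// ?nnegrE ?normc_ge0 ?addr_ge0// sqr_normcE sqrrD.
rewrite !real_normK ?num_real//; rewrite -addrA lerD2l lerDr.
by rewrite mulrn_wge0// mulr_ge0.
Qed.

Lemma normc_conj z : normc z^* = normc z.
Proof. by case: z => a b /=; rewrite sqrrN. Qed.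

Lemma normc_real (a : R) : normc a%:C = `|a|.
Proof. by rewrite /normc /= expr0n /= addr0 sqrtr_sqr. Qed.

Lemma normcX z n : normc (z ^+ n) = normc z ^+ n.
Proof. by elim: n => [|n ih]; rewrite ?normc1// !exprS normcM ih. Qed.

Lemma normcB x y : normc (x - y) <= normc x + normc y.
Proof. by rewrite (le_trans (le_normcD _ _))// normcN. Qed.

Lemma le_normcD_trans x y (c : R) : normc x + normc y <= c -> normc (x + y) <= c.
Proof. exact: le_trans (le_normcD _ _). Qed.

Lemma normcB_trans x y (c : R) : normc x + normc y <= c -> normc (x - y) <= c.
Proof. exact: le_trans (normcB _ _). Qed.

Lemma ReM x y :
 Re (x * y) = Re x * Re y - Im x * Im y.
Proof. by case: x y => [? ?] []. Qed.

Lemma ImM x y :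
 Im (x * y) = Re x * Im y + Im x * Re y.
Proof. by case: x y => [? ?] []. Qed.

Lemma ReD x y : Re (x + y) = Re x + Re y.
Proof. by case: x y => [? ?] []. Qed.

Lemma ImD x y : Im (x + y) = Im x + Im y.
Proof. by case: x y => [? ?] []. Qed.

Lemma ReN x : Re (- x) = - Re x.
Proof. by case: x. Qed.

Lemma ImN x : Im (- x) = - Im x.
Proof. by case: x. Qed.

Lemma Re_conj x : Re x^* = Re x.
Proof. by case: x. Qed.

Lemma Im_conj x : Im x^* = - Im x.
Proof. by case: x. Qed.

Lemma eqcE x y : Re x = Re y -> Im x = Im y -> x = y.
Proof. by case: x y => [? ?] [? ?] /= -> ->. Qed.

Lemma mulc_conj z : z * z^* = (normc z ^+ 2)%:C.
Proof. by rewrite sqr_normcE; case: z => a b; apply: eqcE => /=; ring. Qed.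

Lemma normc_eq0 z : (normc z == 0) = (z == 0).
Proof. by apply/eqP/eqP => [/eq0_normc//|->]; rewrite normc0. Qed.

Lemma normc_gt0 z : (0 < normc z) = (z != 0).
Proof. by rewrite lt0r normc_eq0 normc_ge0 andbT. Qed.

End normc_facts.

Arguments ComplexField.Normc.normc : simpl never.

Definition cE := (@ReM, @ImM, @ReD, @ImD, @ReN, @ImN, @Re_conj, @Im_conj).

Lemma mfun_integrable {R : realType} {d} {T : measurableType d} (m : {measure set T -> \bar R})
 (f : T -> R) : Rintegrable m f -> measurable_fun setT f.
Proof. by move=> /measurable_int/measurable_EFinP. Qed.

Section cmeasurable.
Context {R : realType} {d : measure_display} {T : measurableType d}.
Implicit Types f g : T -> R[i].

Lemma cmeas_cst c : cmeasurable (fun _ : T => c : R[i]).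
Proof. by split; exact: measurable_cst. Qed.

Lemma cmeasD f g : cmeasurable f -> cmeasurable g ->
 cmeasurable (fun x => f x + g x).
Proof.
move=> [fr fi] [gr gi]; split; under eq_fun do rewrite cE; exact: measurable_funD.
Qed.

Lemma cmeasN f : cmeasurable f -> cmeasurable (fun x => - f x).
Proof.
by move=> [fr fi]; split; under eq_fun do rewrite cE; exact: measurableT_comp.
Qed.

Lemma cmeasB f g : cmeasurable f -> cmeasurable g ->
 cmeasurable (fun x => f x - g x).
Proof. by move=> mf mg; exact/cmeasD/cmeasN. Qed.

Lemma cmeasM f g : cmeasurable f -> cmeasurable g ->
 cmeasurable (fun x => f x * g x).
Proof.
move=> [fr fi] [gr gi]; split; under eq_fun do rewrite cE.
 by apply: measurable_funB; exact: measurable_funM.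
by apply: measurable_funD; exact: measurable_funM.
Qed.

Lemma cmeas_conj f : cmeasurable f -> cmeasurable (fun x => (f x)^*).
Proof.
move=> [fr fi]; split.
 by under eq_fun do rewrite cE.
by under eq_fun do rewrite cE; exact: measurableT_comp.
Qed.

Lemma cmeas_real (f : T -> R) : measurable_fun [set: T] f ->
 cmeasurable (fun x => (f x)%:C).
Proof. by move=> mf; split => //=; exact: measurable_cst. Qed.

Lemma cmeas_complex (a b : T -> R) : measurable_fun [set: T] a ->
 measurable_fun [set: T] b -> cmeasurable (fun x => a x +i* b x).
Proof. by move=> ma mb; split. Qed.

Lemma measurable_normc f : cmeasurable f ->
 measurable_fun [set: T] (fun x => normc (f x)).
Proof.
move=> [fr fi].
rewrite (_ : (fun x => _) =
 Num.sqrt \o (fun x => Re (f x) ^+ 2 + Im (f x) ^+ 2)); last first.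
 by apply/funext => x /=; case: (f x).
apply: measurableT_comp.
 by apply: continuous_measurable_fun => x; exact: sqrt_continuous.
by apply: measurable_funD; exact: measurable_funX.
Qed.

Lemma cmeas_comp d' (T' : measurableType d') (g : T' -> T) f :
 cmeasurable f -> measurable_fun [set: T'] g -> cmeasurable (fun x => f (g x)).
Proof.
move=> [fr fi] mg; split.
 exact: (measurableT_comp (f := fun x => Re (f x))).
exact: (measurableT_comp (f := fun x => Im (f x))).
Qed.

Lemma cmeasV f : cmeasurable f -> cmeasurable (fun x => (f x)^-1).
Proof.
move=> mf; have mn := measurable_normc mf.
have -> : (fun x => (f x)^-1) = fun x => (f x)^* * ((normc (f x) ^- 2)%:C).
 apply/funext => x; have [->|fx0] := eqVneq (f x) 0.
  by rewrite invr0 rmorph0 mul0r.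
 apply: (mulfI fx0); rewrite divff// mulrA mulc_conj -rmorphM/= divff//.
 by rewrite expf_neq0// normc_eq0.
apply: cmeasM; first exact: cmeas_conj.
apply: cmeas_real.
under eq_fun do rewrite -powR_inv1 ?exprn_ge0 ?normc_ge0//.
apply: (measurableT_comp (f := fun r : R => r `^ (-1))); first exact: measurable_powR.
exact: measurable_funX.
Qed.

Lemma cmeasX f n : cmeasurable f -> cmeasurable (fun x => f x ^+ n).
Proof.
move=> mf; elim: n => [|n ih]; first exact: cmeas_cst.
by under eq_fun do rewrite exprS; exact: cmeasM.
Qed.

Lemma cmeas_if (P : T -> bool) f g :
 measurable_fun [set: T] P -> cmeasurable f -> cmeasurable g ->
 cmeasurable (fun x => if P x then f x else g x).
Proof.
move=> mP [fr fi] [gr gi]; split.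
 under eq_fun do rewrite (fun_if (@complex.Re R)).
 exact: measurable_fun_ifT.
under eq_fun do rewrite (fun_if (@complex.Im R)).
exact: measurable_fun_ifT.
Qed.

End cmeasurable.

Section cintegral.
Context {R : realType} {d : measure_display} {T : measurableType d}.
Variable mu : {measure set T -> \bar R}.
Implicit Types f g : T -> R[i].

Lemma cintegr_measurable f : cintegrable mu f -> cmeasurable f.
Proof. by move=> [/measurable_int/measurable_EFinP ? /measurable_int/measurable_EFinP]. Qed.

Lemma cintegr_le f (g : T -> R) : cmeasurable f ->
 Rintegrable mu g -> (forall x, normc (f x) <= g x) ->
 cintegrable mu f.
Proof.
move=> [fr fi] ig fg; split; apply: (le_integrable _ _ _ ig) => //.
- exact/measurable_EFinP.
- move=> x _ /=; rewrite lee_fin (le_trans (normc_Re _))// (le_trans (fg _))//.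
 exact: ler_norm.
- exact/measurable_EFinP.
- move=> x _ /=; rewrite lee_fin (le_trans (normc_Im _))// (le_trans (fg _))//.
 exact: ler_norm.
Qed.

Lemma integrable_normc f : cintegrable mu f ->
 Rintegrable mu (fun x => normc (f x)).
Proof.
move=> cf; have mf := cintegr_measurable cf; case: cf => fr fi.
have ifs := RintegrableD (integrable_norm fr) (integrable_norm fi).
apply: (le_integrable _ _ _ ifs) => //.
 exact/measurable_EFinP/measurable_normc.
move=> x _ /=; rewrite lee_fin ger0_norm ?normc_ge0// ger0_norm ?addr_ge0//.
exact: normc_le.
Qed.

Lemma cintegrP f : cintegrable mu f <-> cmeasurable f /\
 Rintegrable mu (fun x => normc (f x)).
Proof.
split=> [cf|[mf nf]].
 by split; [exact: cintegr_measurable|exact: integrable_normc].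
exact: cintegr_le nf _.
Qed.

Lemma eq_cintegral f g : (forall x, f x = g x) -> cintegral mu f = cintegral mu g.
Proof. by move=> fg; congr cintegral; exact/funext. Qed.

Lemma eq_cintegrable f g : (forall x, f x = g x) -> cintegrable mu f ->
 cintegrable mu g.
Proof. by move=> /funext ->. Qed.

Lemma cintegrD f g : cintegrable mu f -> cintegrable mu g ->
 cintegrable mu (fun x => f x + g x).
Proof.
move=> [fr fi] [gr gi]; split; under eq_fun do rewrite cE EFinD; exact: integrableD.
Qed.

Lemma cintegrN f : cintegrable mu f -> cintegrable mu (fun x => - f x).
Proof.
move=> [fr fi]; split; under eq_fun do rewrite cE EFinN; exact: integrableN.
Qed.

Lemma cintegrB f g : cintegrable mu f -> cintegrable mu g ->
 cintegrable mu (fun x => f x - g x).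
Proof. by move=> cf cg; exact/cintegrD/cintegrN. Qed.

Lemma cintegr_real (f : T -> R) : Rintegrable mu f ->
 cintegrable mu (fun x => (f x)%:C).
Proof. by move=> fi; split => //=; exact: integrable0. Qed.

Lemma cintegrZl c f : cintegrable mu f -> cintegrable mu (fun x => c * f x).
Proof.
move=> cf; have /cintegrP[mf nf] := cf.
have nf' := RintegrableZl (normc c) nf.
apply: (cintegr_le (g := fun x => normc c * normc (f x))) => //.
 exact: cmeasM (cmeas_cst _) mf.
by move=> x; rewrite normcM.
Qed.

Lemma cintegr_conj f : cintegrable mu f -> cintegrable mu (fun x => (f x)^*).
Proof.
move=> [fr fi]; split; first by under eq_fun do rewrite cE.
by under eq_fun do rewrite cE EFinN; exact: integrableN.
Qed.

Lemma cintegr_bounded f g M : cintegrable mu f -> cmeasurable g ->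
 (forall x, normc (g x) <= M) -> cintegrable mu (fun x => f x * g x).
Proof.
move=> /cintegrP[mf nf] mg gM.
apply: (cintegr_le (g := fun x => M * normc (f x))).
- exact: cmeasM.
- exact: (RintegrableZl M nf).
- by move=> x; rewrite normcM mulrC ler_wpM2r// normc_ge0.
Qed.

Lemma cintegralD f g : cintegrable mu f -> cintegrable mu g ->
 cintegral mu (fun x => f x + g x) = cintegral mu f + cintegral mu g.
Proof.
move=> [fr fi] [gr gi]; apply: eqcE; rewrite cE /cintegral /= -RintegralD//;
 by apply: eq_Rintegral => x _; rewrite cE.
Qed.

Lemma cintegral_real (f : T -> R) :
 cintegral mu (fun x => (f x)%:C) = (Rintegral mu setT f)%:C.
Proof. by rewrite /cintegral /= Rintegral_cst// mul0r. Qed.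

Lemma cintegralZl c f : cintegrable mu f ->
 cintegral mu (fun x => c * f x) = c * cintegral mu f.
Proof.
move=> [fr fi].
have i1 (a : R) : Rintegrable mu (fun x => a * Re (f x)).
 exact: (RintegrableZl a fr).
have i2 (a : R) : Rintegrable mu (fun x => a * Im (f x)).
 exact: (RintegrableZl a fi).
apply: eqcE; rewrite cE /cintegral /= -!RintegralZl//.
 by rewrite -RintegralB//; apply: eq_Rintegral => x _; rewrite cE.
by rewrite -RintegralD//; apply: eq_Rintegral => x _; rewrite cE.
Qed.

Lemma cintegralZr c f : cintegrable mu f ->
 cintegral mu (fun x => f x * c) = cintegral mu f * c.
Proof.
by move=> cf; rewrite mulrC -cintegralZl//; apply: eq_cintegral => x; rewrite mulrC.
Qed.

Lemma cintegralN f : cintegrable mu f ->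
 cintegral mu (fun x => - f x) = - cintegral mu f.
Proof.
move=> cf; rewrite -mulN1r -cintegralZl//.
by apply: eq_cintegral => x; rewrite mulN1r.
Qed.

Lemma cintegralB f g : cintegrable mu f -> cintegrable mu g ->
 cintegral mu (fun x => f x - g x) = cintegral mu f - cintegral mu g.
Proof.
by move=> cf cg; rewrite cintegralD ?cintegralN//; exact: cintegrN.
Qed.

Lemma cintegral_conj f : cintegrable mu f ->
 cintegral mu (fun x => (f x)^*) = (cintegral mu f)^*.
Proof.
move=> [fr fi]; apply: eqcE; rewrite cE /cintegral /=.
 by apply: eq_Rintegral => x _; rewrite cE.
rewrite -mulN1r -RintegralZl//; apply: eq_Rintegral => x _.
by rewrite cE mulN1r.
Qed.

Lemma cintegral0 : cintegral mu (fun=> 0) = 0.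
Proof. by rewrite (cintegral_real (fun=> 0)) Rintegral_cst// mul0r. Qed.

Lemma normc_cintegral f : cintegrable mu f ->
 normc (cintegral mu f) <= Rintegral mu setT (fun x => normc (f x)).
Proof.
move=> cf; have nf := integrable_normc cf.
set I := cintegral mu f; have [I0|I0] := eqVneq I 0.
 by rewrite I0 normc0; apply: Rintegral_ge0 => x _; exact: normc_ge0.
(* rotate the integral onto the positive half-line *)
pose u := I^* * ((normc I)^-1)%:C.
have nI : normc I != 0 by rewrite normc_eq0.
have nu : normc u = 1.
 by rewrite normcM normc_conj normc_real ger0_norm ?invr_ge0 ?normc_ge0// divff.
have -> : normc I = Re (u * I).
 rewrite /u mulrAC [_^* * _]mulrC mulc_conj -rmorphM/= expr2 -mulrA divff//.
 by rewrite mulr1.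
rewrite -cintegralZl//= ; apply: le_Rintegral => //.
 by case: (cintegrZl u cf).
move=> x _; rewrite (le_trans (ler_norm _))// (le_trans (normc_Re _))//.
by rewrite normcM nu mul1r.
Qed.

Lemma ae_imp (P Q : T -> Prop) : {ae mu, forall x, P x} -> (forall x, P x -> Q x) ->
 {ae mu, forall x, Q x}.
Proof. by move=> h PQ; apply: filterS h. Qed.

Lemma ae_and (P Q : T -> Prop) : {ae mu, forall x, P x} -> {ae mu, forall x, Q x} ->
 {ae mu, forall x, P x /\ Q x}.
Proof. by move=> h1 h2; apply: filterS2 h1 h2. Qed.

Lemma ae_eq_Rintegral (f g : T -> R) : measurable_fun setT f ->
 measurable_fun setT g -> {ae mu, forall x, f x = g x} ->
 Rintegral mu setT f = Rintegral mu setT g.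
Proof.
move=> mf mg fg; congr fine; apply: ae_eq_integral => //.
- exact/measurable_EFinP.
- exact/measurable_EFinP.
- by apply: filterS fg => x fgx _; rewrite fgx.
Qed.

Lemma ae_eq_cintegral f g : cmeasurable f -> cmeasurable g ->
 {ae mu, forall x, f x = g x} -> cintegral mu f = cintegral mu g.
Proof.
move=> [fr fi] [gr gi] fg; rewrite /cintegral; congr Complex;
 by apply: ae_eq_Rintegral => //; apply: filterS fg => x ->.
Qed.

Lemma ae_eq_integrable (f g : T -> R) : measurable_fun setT g ->
 {ae mu, forall x, f x = g x} -> Rintegrable mu f ->
 Rintegrable mu g.
Proof.
move=> mg fg /integrableP[mf fi]; apply/integrableP; split.
 exact/measurable_EFinP.
rewrite (@ae_eq_integral _ _ _ mu setT (fun x => `|(EFin \o f) x|)%E)//.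
- by apply: measurableT_comp => //; exact/measurable_EFinP.
- exact: measurableT_comp.
- by apply: filterS fg => x /= -> _.
Qed.

Lemma ae_eq_cintegrable f g : cmeasurable g -> {ae mu, forall x, f x = g x} ->
 cintegrable mu f -> cintegrable mu g.
Proof.
move=> [gr gi] fg [fr fi]; split.
 by apply: ae_eq_integrable fr => //; apply: filterS fg => x ->.
by apply: ae_eq_integrable fi => //; apply: filterS fg => x ->.
Qed.

Lemma ge0_Rintegral_eq0 (f : T -> R) : (forall x, 0 <= f x) ->
 Rintegrable mu f -> Rintegral mu setT f = 0 ->
 {ae mu, forall x, f x = 0}.
Proof.
move=> f0 fi If0.
have H : (\int[mu]_x (`|(EFin \o f) x|) = 0)%E.
 under eq_integral => x _ do rewrite gee0_abs ?lee_fin//.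
 have := integrable_fin_num measurableT fi.
 by move=> /fineK <-; congr EFin; exact: If0.
have /(ae_eq_integral_abs mu measurableT) := measurable_int _ fi.
move=> [/(_ H) + _].
by apply: filterS => x /= /(_ I)[].
Qed.

(** Dominated convergence, in the form of convergence in L^1. *)
Lemma R_dct (f_ : nat -> T -> R) (g : T -> R) :
 (forall n, measurable_fun setT (f_ n)) -> (forall n x, 0 <= f_ n x <= g x) ->
 Rintegrable mu g -> (forall x, f_ n x @[n --> \oo] --> (0 : R)) ->
 Rintegral mu setT (f_ n) @[n --> \oo] --> (0 : R).
Proof.
move=> mf fg ig f0.
have mf' n : measurable_fun setT (EFin \o f_ n) by exact/measurable_EFinP.
have cv : {ae mu, forall x, setT x -> (EFin \o f_ n) x @[n --> \oo] --> (cst 0 x)%E}.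
 by apply: aeW => x _ /=; apply: cvg_EFin; [exact: nearW|exact: f0].
have bd : {ae mu, forall x n, setT x -> (`|(EFin \o f_ n) x| <= (EFin \o g) x)%E}.
 apply: aeW => x n _ /=; rewrite lee_fin; have /andP[? ?] := fg n x.
 by rewrite ger0_norm.
have [_ _] := dominated_convergence measurableT mf' (measurable_cst _) cv ig bd.
rewrite integral0 => /fine_cvgP[_]; apply: cvg_trans.
by apply: near_eq_cvg; apply: nearW => n.
Qed.

Lemma cintegral_cvg (f_ : nat -> T -> R[i]) f (g : T -> R) :
 (forall n, cmeasurable (f_ n)) -> cmeasurable f ->
 (forall n x, normc (f_ n x) <= g x) -> Rintegrable mu g ->
 (forall x, normc (f_ n x - f x) @[n --> \oo] --> (0 : R)) ->
 Rintegral mu setT (fun x => normc (f_ n x - f x)) @[n --> \oo] --> (0 : R).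
Proof.
move=> mf_ mf fg ig f_f.
have fg' x : normc (f x) <= g x.
 apply/ler_addgt0Pr => e e0.
 have /cvgrPdist_lt/(_ _ e0)[N _ /(_ N)/=] := f_f x.
 rewrite sub0r normrN ger0_norm ?normc_ge0// => /(_ (leqnn _)) He.
 have := le_normcD (f_ N x) (f x - f_ N x); rewrite subrKC => /le_trans; apply.
 by rewrite lerD// -normcN opprB ltW.
apply: (R_dct (g := fun x => 2 * g x)) => //.
- by move=> n; apply: measurable_normc; exact: cmeasB.
- move=> n x; rewrite normc_ge0/= mulr2n mulrDl mul1r.
 by rewrite (le_trans (normcB _ _))// lerD.
- exact: (RintegrableZl 2 ig).
Qed.

End cintegral.

Arguments cintegr_le {R d T} mu f g.
Arguments cintegr_bounded {R d T} mu f g M.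
Arguments ae_imp {R d T mu P Q}.
Arguments ae_and {R d T mu P Q}.
Arguments ae_eq_Rintegral {R d T} mu f g.
Arguments ae_eq_cintegral {R d T} mu f g.
Arguments ae_eq_cintegrable {R d T} mu f g.
Arguments R_dct {R d T} mu f_ g.
Arguments cintegral_cvg {R d T} mu f_ f g.
Arguments ae_eq_integrable {R d T} mu f g.

Lemma squeeze0 {R : realType} (u v : nat -> R) :
 (forall n, 0 <= u n <= v n) -> v n @[n --> \oo] --> (0 : R) ->
 u n @[n --> \oo] --> (0 : R).
Proof.
move=> uv v0; apply: (@squeeze_cvgr _ _ _ _ (fun=> 0) v) => //.
 by apply: nearW => n; exact: uv.
exact: cvg_cst.
Qed.

Section cfubini.
Context {R : realType} {d1 d2 : measure_display}.
Context {T1 : measurableType d1} {T2 : measurableType d2}.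
Variables (m1 : {sigma_finite_measure set T1 -> \bar R}).
Variables (m2 : {sigma_finite_measure set T2 -> \bar R}).

Lemma Rfubini1 (f : T1 * T2 -> R) :
 Rintegrable (m1 \x m2)%E f ->
 Rintegral (m1 \x m2)%E setT f =
 Rintegral m1 setT (fun x => Rintegral m2 setT (fun y => f (x, y))).
Proof.
move=> fi; congr fine; rewrite -integral12_prod_meas1//.
apply: ae_eq_integral => //.
- exact: (measurable_fubini_F fi).
- apply/measurable_EFinP; apply: measurableT_comp; first exact: fine_measurable.
 exact: (measurable_fubini_F fi).
- have := ae_integrable1 fi; apply: filterS => x ix _.
 by rewrite /fubini_F /Rintegral fineK//; exact: integrable_fin_num.
Qed.

Lemma Rfubini2 (f : T1 * T2 -> R) :
 Rintegrable (m1 \x m2)%E f ->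
 Rintegral (m1 \x m2)%E setT f =
 Rintegral m2 setT (fun y => Rintegral m1 setT (fun x => f (x, y))).
Proof.
move=> fi; congr fine; rewrite -integral21_prod_meas1//.
apply: ae_eq_integral => //.
- exact: (measurable_fubini_G fi).
- apply/measurable_EFinP; apply: measurableT_comp; first exact: fine_measurable.
 exact: (measurable_fubini_G fi).
- have := ae_integrable2 fi; apply: filterS => x ix _.
 by rewrite /fubini_G /Rintegral fineK//; exact: integrable_fin_num.
Qed.

Lemma cfubini1 (f : T1 * T2 -> R[i]) : cintegrable (m1 \x m2)%E f ->
 cintegral (m1 \x m2)%E f = cintegral m1 (fun x => cintegral m2 (fun y => f (x, y))).
Proof. by move=> [fr fi]; congr Complex; exact: Rfubini1. Qed.

Lemma cfubini2 (f : T1 * T2 -> R[i]) : cintegrable (m1 \x m2)%E f ->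
 cintegral (m1 \x m2)%E f = cintegral m2 (fun y => cintegral m1 (fun x => f (x, y))).
Proof. by move=> [fr fi]; congr Complex; exact: Rfubini2. Qed.

(** Tonelli criterion through a product bound. *)
Lemma integrable_prod (g : T1 -> R) (h : T2 -> R) :
 Rintegrable m1 g -> Rintegrable m2 h ->
 Rintegrable (m1 \x m2)%E (fun p => g p.1 * h p.2).
Proof.
move=> gi hi.
have mg : measurable_fun setT g by exact: (mfun_integrable gi).
have mh : measurable_fun setT h by exact: (mfun_integrable hi).
have mgh : measurable_fun setT (fun p : T1 * T2 => g p.1 * h p.2).
 by apply: measurable_funM; apply: measurableT_comp.
apply/integrable12ltyP; first exact/measurable_EFinP.
have /integrableP[_ goo] := gi; have /integrableP[_ hoo] := hi.
rewrite (eq_integral (fun x => `|(g x)%:E| * \int[m2]_y `|(h y)%:E|))%E; last first.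
 move=> x _; rewrite -ge0_integralZl//.
  by apply: eq_integral => y _ /=; rewrite normrM EFinM.
 by apply: measurableT_comp => //; exact/measurable_EFinP.
rewrite ge0_integralZr//; last 2 first.
 by apply: measurableT_comp => //; exact/measurable_EFinP.
 exact: integral_ge0.
rewrite lte_mul_pinfty ?integral_ge0// ge0_fin_numE// integral_ge0//.
Qed.

(** Integrability on a product from iterated absolute integrability. *)
Lemma integrable_tonelli2 (f : T1 * T2 -> R) (k : T2 -> R) :
 measurable_fun setT f -> (forall p, 0 <= f p) ->
 (forall y, m1.-integrable setT (fun x => (f (x, y))%:E)) ->
 (forall y, Rintegral m1 setT (fun x => f (x, y)) <= k y) ->
 Rintegrable m2 k ->
 Rintegrable (m1 \x m2)%E f.
Proof.
move=> mf f0 f1 fk ki; apply/integrable21ltyP; first exact/measurable_EFinP.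
have /integrableP[mk koo] := ki; apply: le_lt_trans koo.
have mF : measurable_fun setT (EFin \o f) by exact/measurable_EFinP.
have mF' : measurable_fun setT (abse \o (EFin \o f)) by exact: measurableT_comp.
apply: ge0_le_integral => //.
- by move=> y _; exact: integral_ge0.
- exact: (measurable_fun_fubini_tonelli_G (m1 := m1) _ mF' (fun=> abse_ge0 _)).
- exact: measurableT_comp.
move=> y _; rewrite (eq_integral (fun x => (f (x, y))%:E)); last first.
 by move=> x _ /=; rewrite ger0_norm.
have := integrable_fin_num measurableT (f1 y) => /fineK <-.
rewrite lee_fin (le_trans (fk y))//= ler_norm//.
Qed.

Lemma cmeas_cintegral2 (f : T1 * T2 -> R[i]) :
 cmeasurable f -> cmeasurable (fun x => cintegral m2 (fun y => f (x, y))).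
Proof.
have H (g : T1 * T2 -> R) : measurable_fun setT g ->
  measurable_fun setT (fun x => Rintegral m2 setT (fun y => g (x, y))).
 move=> mg; rewrite /Rintegral; apply: measurableT_comp.
  exact: fine_measurable.
 have mG : measurable_fun setT (EFin \o g) by exact/measurable_EFinP.
 have -> : (fun x => \int[m2]_y (g (x, y))%:E)%E =
  ((fun x => \int[m2]_y (EFin \o g)^\+ (x, y)) \-
   (fun x => \int[m2]_y (EFin \o g)^\- (x, y)))%E.
  rewrite -[LHS]/(fubini_F m2 (EFin \o g)); apply/funext => x; rewrite [LHS]integralE.
  under eq_integral do rewrite funepos_comp/=.
  by under [X in (_ - X)%E = _]eq_integral do rewrite funeneg_comp/=.
 apply: emeasurable_funB.
  exact: (measurable_fun_fubini_tonelli_F (m2 := m2) _ (measurable_funepos mG)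
   (funepos_ge0 _)).
 exact: (measurable_fun_fubini_tonelli_F (m2 := m2) _ (measurable_funeneg mG)
   (funeneg_ge0 _)).
by move=> [fr fi]; split; [exact: (H (fun p => Re (f p)))|exact: (H (fun p => Im (f p)))].
Qed.

End cfubini.

(** * Calculus on the real line *)

Section line_calculus.
Context {R : realType}.
Notation mu := (@lebesgue_measure R).
Implicit Types (F f g : R -> R) (a b x : R).

Lemma continuous_is_derive F f : (forall x, is_derive x 1 F (f x)) -> continuous F.
Proof.
move=> dF x; apply: differentiable_continuous; apply/derivable1_diffP.
by have [] := dF x.
Qed.

Lemma measurable_continuous f : continuous f -> measurable_fun [set: R] f.
Proof. exact: continuous_measurable_fun. Qed.

Lemma measurable_ltr a : measurable_fun [set: R] (fun x => a < x).
Proof. by apply: measurable_fun_ltr; [exact: measurable_cst|exact: measurable_id]. Qed.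

Lemma FTC_itv F f a b : a < b -> (forall x, is_derive x 1 F (f x)) -> continuous f ->
 \int[mu]_(x in `[a, b]) f x = F b - F a.
Proof.
move=> ab dF cf; have cF := continuous_is_derive dF.
rewrite /Rintegral (@continuous_FTC2 _ f F)//.
- exact: continuous_subspaceT.
- split.
 + by move=> x _; have [] := dF x.
 + exact/cvg_at_right_filter/cF.
 + exact/cvg_at_left_filter/cF.
- by move=> x _; rewrite derive1E; have [_ ->] := dF x.
Qed.

Lemma Rintegral_itv_cvg f : Rintegrable mu f ->
 \int[mu]_(x in `[- n%:R, n%:R]) f x @[n --> \oo] --> \int[mu]_x f x.
Proof.
move=> fi; have mf : measurable_fun setT f by exact: (mfun_integrable fi).
pose g (n : nat) x : R := f x * \1_(`[- n%:R, n%:R]%classic : set R) x.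
have mg n : measurable_fun setT (g n).
 by apply: measurable_funM => //; exact: measurable_indic.
have gE n x : `|f x - g n x| <= `|f x|.
 rewrite /g indicE; case: (x \in _); rewrite ?mulr1 ?subrr ?normr0//.
 by rewrite mulr0 subr0.
have gi n : Rintegrable mu (g n).
 have mgn : measurable_fun setT (EFin \o g n) by exact/measurable_EFinP.
 apply: (@le_integrable _ _ _ mu setT measurableT _ (EFin \o f)) => //.
 move=> x _ /=; rewrite lee_fin /g indicE normrM ler_piMr//.
 by case: (_ \in _); rewrite /= ?normr1 ?normr0.
have -> : (fun n => \int[mu]_(x in `[- n%:R, n%:R]) f x) = (fun n => \int[mu]_x g n x).
 apply/funext => n; rewrite Rintegral_mkcond; apply: eq_Rintegral => x _.
 by rewrite /g patchE indicE; case: ifP; rewrite ?mulr1 ?mulr0.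
have H : \int[mu]_x `|f x - g n x| @[n --> \oo] --> (0 : R).
 apply: (R_dct mu (fun n x => `|f x - g n x|) (fun x => `|f x|)).
 - by move=> n; apply: measurableT_comp => //; apply: measurable_funB;
   [exact: mf|exact: mg].
 - by move=> n x; rewrite normr_ge0 gE.
 - exact: integrable_norm.
 - move=> x; apply: cvg_near_cst; near=> n; apply/eqP.
  rewrite normr_eq0 /g indicE mem_set ?mulr1 ?subrr//=.
  rewrite in_itv/= -ler_norml.
  by near: n; exact: nbhs_infty_ger.
apply/cvgrPdist_le => e e0; have /cvgrPdist_le/(_ _ e0) := H.
apply: filterS => n; rewrite sub0r normrN ger0_norm; last first.
 by apply: Rintegral_ge0.
apply: le_trans; rewrite -RintegralB//; apply: le_normr_Rintegral => //.
exact: (integrableB measurableT fi (gi n)).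
Unshelve. all: by end_near.
Qed.

Lemma Rintegral_derive0 F f : (forall x, is_derive x 1 F (f x)) -> continuous f ->
 Rintegrable mu f -> F x @[x --> +oo] --> (0 : R) ->
 F x @[x --> -oo] --> (0 : R) -> \int[mu]_x f x = 0.
Proof.
move=> dF cf fi Fy FNy; have H := Rintegral_itv_cvg fi.
have nat_y : (n%:R : R) @[n --> \oo] --> +oo by exact: cvgr_idn.
have G : F n%:R - F (- n%:R) @[n --> \oo] --> (0 : R).
 rewrite -[X in _ --> X](subrr (0 : R)); apply: cvgB.
  exact: cvg_comp nat_y Fy.
 apply: cvg_comp FNy; apply/cvgNry.
 rewrite (_ : (- _) = fun n => n%:R)//; apply/funext => n /=.
 by rewrite /GRing.opp /= opprK.
apply: cvg_unique H _ => //.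
apply: cvg_trans G; apply: near_eq_cvg; near=> n.
have n0 : 0 < n%:R :> R by near: n; exact: nbhs_infty_gtr.
by rewrite (FTC_itv _ dF cf)// gtrN.
Unshelve. all: by end_near.
Qed.

Lemma Rintegral_derive_gt F f a (l : R) : (forall x, is_derive x 1 F (f x)) -> continuous f ->
 Rintegrable mu (fun x => if a < x then f x else 0) ->
 F x @[x --> +oo] --> l -> \int[mu]_x (if a < x then f x else 0) = l - F a.
Proof.
move=> dF cf fi Fy; have H := Rintegral_itv_cvg fi.
have nat_y : (n%:R : R) @[n --> \oo] --> +oo by exact: cvgr_idn.
have G : F n%:R - F a @[n --> \oo] --> l - F a.
 by apply: cvgB; [exact: cvg_comp nat_y Fy|exact: cvg_cst].
apply: cvg_unique H _ => //.
apply: cvg_trans G; apply: near_eq_cvg; near=> n.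
have n0 : `|a| < n%:R :> R by near: n; exact: nbhs_infty_gtr.
have [an na] : - n%:R < a /\ a < n%:R by move: n0; rewrite ltr_norml => /andP.
rewrite -(FTC_itv na dF cf) -Rintegral_itv_obnd_cbnd; last first.
 apply: (@integrableS _ _ _ mu `[a, n%:R]%classic) => //.
  by apply: subset_itv; rewrite bnd_simp.
 apply: continuous_compact_integrable; first exact: segment_compact.
 exact: continuous_subspaceT.
rewrite Rintegral_mkcond [RHS]Rintegral_mkcond; apply: eq_Rintegral => x _.
rewrite !patchE !mem_setE !in_itv/=; case: (ltP a x) => ax /=.
 by rewrite (le_trans (ltW an) (ltW ax)).
by case: ifP.
Unshelve. all: by end_near.
Qed.

(** A nonnegative derivative with bounded primitive is integrable. *)
Lemma integrable_derive_gt F f a (l : R) :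
 (forall x, a <= x -> is_derive x 1 F (f x)) ->
 (forall x, a <= x -> continuous_at x f) ->
 (forall x, a <= x -> 0 <= f x) -> F x @[x --> +oo] --> l ->
 measurable_fun setT (fun x => if a < x then f x else 0) ->
 Rintegrable mu (fun x => if a < x then f x else 0).
Proof.
move=> dF cf f0 Fy mf.
apply/integrableP; split; first exact/measurable_EFinP.
have -> : (\int[mu]_x `|(EFin \o (fun x => if (a < x)%R then f x else 0%R)) x| =
 \int[mu]_(x in `]a, +oo[) (f x)%:E)%E.
 rewrite [RHS]integral_mkcond; apply: eq_integral => x _ /=; rewrite patchE.
 rewrite mem_setE in_itv/= andbT; case: ifP => ax; rewrite ?normr0// ger0_norm//.
 exact/f0/ltW.
rewrite integral_itv_obnd_cbnd; last first.
 apply/measurable_EFinP; move/(measurable_funS measurableT (@subsetT _ `]a, +oo[)) : mf.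
 apply: eq_measurable_fun => x; rewrite mem_setE in_itv/= andbT => -> //.
rewrite (@ge0_continuous_FTC2y _ f F a l)//.
- by rewrite -EFinB ltry.
- apply: continuous_in_subspaceT => x; rewrite mem_setE in_itv/= andbT.
 exact: cf.
- by move=> x ax; have [] := dF _ (ltW ax).
- apply: cvg_at_right_filter; apply: differentiable_continuous.
 by apply/derivable1_diffP; have [] := dF _ (lexx a).
- move=> x; rewrite in_itv/= andbT => ax.
 by rewrite derive1E; have [_ ->] := dF _ (ltW ax).
Qed.

End line_calculus.

(** * The complex exponential and its integrals *)

Section cexp.
Context {R : realType}.
Notation mu := (@lebesgue_measure R).
Implicit Types (z w : R[i]) (t : R).

Fact cexp_key : unit. Proof. exact: tt. Qed.

(** Locked, so that rewriting with product rules does not unfold it. *)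
Definition cexp : R[i] -> R[i] :=
 locked_with cexp_key (fun z => (expR (Re z))%:C * cis (Im z)).

Lemma cexpE z : cexp z = (expR (Re z))%:C * cis (Im z).
Proof. by rewrite /cexp unlock. Qed.

Lemma Re_cexp z : Re (cexp z) = expR (Re z) * cos (Im z).
Proof. by rewrite cexpE cE /= mul0r subr0. Qed.

Lemma Im_cexp z : Im (cexp z) = expR (Re z) * sin (Im z).
Proof. by rewrite cexpE cE /= mul0r addr0. Qed.

Lemma cexpD z w : cexp (z + w) = cexp z * cexp w.
Proof.
by apply: eqcE; rewrite !(cE, @Re_cexp, @Im_cexp) expRD ?cosD ?sinD; ring.
Qed.

Lemma cexp0 : cexp 0 = 1.
Proof. by apply: eqcE; rewrite ?Re_cexp ?Im_cexp /= expR0 ?cos0 ?sin0 ?mulr1 ?mulr0. Qed.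

Lemma normc_cis t : normc (cis t) = 1.
Proof. by rewrite /normc /cis cos2Dsin2 sqrtr1. Qed.

Lemma normc_cexp z : normc (cexp z) = expR (Re z).
Proof. by rewrite cexpE normcM normc_cis mulr1 normc_real ger0_norm// expR_ge0. Qed.

Lemma cexp_conj z : cexp z^* = (cexp z)^*.
Proof. by apply: eqcE; rewrite !(cE, @Re_cexp, @Im_cexp) ?cosN ?sinN ?mulrN. Qed.

Lemma cisE t : cis t = cexp (0 +i* t).
Proof. by apply: eqcE; rewrite ?Re_cexp ?Im_cexp /= expR0 mul1r. Qed.

Lemma cexp_real (a : R) : cexp a%:C = (expR a)%:C.
Proof. by apply: eqcE; rewrite ?Re_cexp ?Im_cexp /= ?cos0 ?sin0 ?mulr1 ?mulr0. Qed.

Lemma cmeas_cexp d (T : measurableType d) (g : T -> R[i]) :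
 cmeasurable g -> cmeasurable (fun x => cexp (g x)).
Proof.
move=> [gr gi]; split.
 under eq_fun do rewrite Re_cexp; apply: measurable_funM.
  by apply: measurableT_comp => //; exact: measurable_expR.
 by apply: (measurableT_comp (f := @cos R)) => //; apply: measurable_continuous;
  exact: continuous_cos.
under eq_fun do rewrite Im_cexp; apply: measurable_funM.
 by apply: measurableT_comp => //; exact: measurable_expR.
by apply: (measurableT_comp (f := @sin R)) => //; apply: measurable_continuous;
 exact: continuous_sin.
Qed.

Definition cderiv (f : R -> R[i]) t (df : R[i]) :=
 is_derive t 1 (fun x => Re (f x)) (Re df) /\
 is_derive t 1 (fun x => Im (f x)) (Im df).

Definition ccont (f : R -> R[i]) :=
 continuous (fun x => Re (f x)) /\ continuous (fun x => Im (f x)).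

Lemma cderiv_eq f t (d d' : R[i]) : cderiv f t d -> d = d' -> cderiv f t d'.
Proof. by move=> ? <-. Qed.

Lemma cderiv_cst (c : R[i]) t : cderiv (fun=> c) t 0.
Proof. by split; exact: is_derive_cst. Qed.

Lemma cderivD f g t df dg : cderiv f t df -> cderiv g t dg ->
 cderiv (fun x => f x + g x) t (df + dg).
Proof.
move=> [fr fi] [gr gi]; split; rewrite cE.
 rewrite (_ : (fun x => _) = (fun x => Re (f x)) + fun x => Re (g x)).
  exact: is_deriveD.
 by apply/funext => x; rewrite cE.
rewrite (_ : (fun x => _) = (fun x => Im (f x)) + fun x => Im (g x)).
 exact: is_deriveD.
by apply/funext => x; rewrite cE.
Qed.

Lemma cderivM f g t df dg : cderiv f t df -> cderiv g t dg ->
 cderiv (fun x => f x * g x) t (df * g t + f t * dg).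
Proof.
move=> [fr fi] [gr gi]; split.
 rewrite (_ : (fun x => _) =
  (fun x => Re (f x)) * (fun x => Re (g x)) -
  (fun x => Im (f x)) * (fun x => Im (g x))); last first.
  by apply/funext => x; rewrite cE.
 apply: (is_derive_eq (is_deriveB (is_deriveM fr gr) (is_deriveM fi gi))).
 by rewrite ReD !ReM /GRing.scale /=; ring.
rewrite (_ : (fun x => _) =
  (fun x => Re (f x)) * (fun x => Im (g x)) +
  (fun x => Im (f x)) * (fun x => Re (g x))); last first.
 by apply/funext => x; rewrite cE.
apply: (is_derive_eq (is_deriveD (is_deriveM fr gi) (is_deriveM fi gr))).
by rewrite ImD !ImM /GRing.scale /=; ring.
Qed.

Lemma cderiv_real (f : R -> R) t df : is_derive t 1 f df ->
 cderiv (fun x => (f x)%:C) t df%:C.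
Proof. by move=> h; split => //=; exact: is_derive_cst. Qed.

Lemma cderivZ c f t df : cderiv f t df -> cderiv (fun x => c * f x) t (c * df).
Proof.
by move=> h; apply: cderiv_eq (cderivM (cderiv_cst c t) h) _; rewrite mul0r add0r.
Qed.

Lemma cderiv_cexp z t :
 cderiv (fun x => cexp (x%:C * z)) t (z * cexp (t%:C * z)).
Proof.
have hE (x a : R) : is_derive x 1 (fun y : R => a * y) a.
 by apply: is_derive_eq; rewrite /GRing.scale/= mulr1.
have dx (a : R) : is_derive t 1 (fun x => expR (a * x)) (expR (a * t) * a).
 exact: (is_derive1_comp (f := expR)).
have dc (a : R) : is_derive t 1 (fun x => cos (a * x)) (- sin (a * t) * a).
 exact: (is_derive1_comp (f := cos)).
have ds (a : R) : is_derive t 1 (fun x => sin (a * x)) (cos (a * t) * a).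
 exact: (is_derive1_comp (f := sin)).
have zE x : cexp (x%:C * z) = expR (Re z * x) * cos (Im z * x) +i*
  (expR (Re z * x) * sin (Im z * x)).
 apply: eqcE; rewrite ?Re_cexp ?Im_cexp /= !cE /= !mul0r ?addr0 ?subr0;
 by rewrite ![_ * x]mulrC.
split.
 under eq_fun do rewrite zE /=.
 have := is_deriveM (dx (Re z)) (dc (Im z)) => /is_derive_eq; apply.
 by rewrite cE zE /= /GRing.scale/=; ring.
under eq_fun do rewrite zE /=.
have := is_deriveM (dx (Re z)) (ds (Im z)) => /is_derive_eq; apply.
by rewrite cE zE /= /GRing.scale/=; ring.
Qed.

Lemma ccont_is_cderive f df : (forall t, cderiv f t (df t)) -> ccont f.
Proof.
move=> h; split.
 by apply: (continuous_is_derive (f := fun t => Re (df t))) => t; have [] := h t.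
by apply: (continuous_is_derive (f := fun t => Im (df t))) => t; have [] := h t.
Qed.

Lemma ccontD f g : ccont f -> ccont g ->
 ccont (fun x => f x + g x).
Proof.
move=> [fr fi] [gr gi]; split => x.
 by under eq_fun do rewrite cE; apply: cvgD; [exact: fr|exact: gr].
by under eq_fun do rewrite cE; apply: cvgD; [exact: fi|exact: gi].
Qed.

Lemma ccontM f g : ccont f -> ccont g ->
 ccont (fun x => f x * g x).
Proof.
move=> [fr fi] [gr gi]; split => x; under eq_fun do rewrite cE.
 by apply: cvgB; apply: cvgM; [exact: fr|exact: gr|exact: fi|exact: gi].
by apply: cvgD; apply: cvgM;
 [exact: fr|exact: gi|exact: fi|exact: gr].
Qed.

Lemma ccont_real (f : R -> R) : continuous f -> ccont (fun x => (f x)%:C).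
Proof. by move=> cf; split => // x; exact: cvg_cst. Qed.

Lemma ccont_cst (c : R[i]) : ccont (fun=> c).
Proof. by split => x; exact: cvg_cst. Qed.

Lemma ccont_measurable f : ccont f -> cmeasurable (f : R -> R[i]).
Proof. by move=> [? ?]; split; exact: measurable_continuous. Qed.

Lemma cvg_normc0 {T : Type} (F : set_system T) {FF : ProperFilter F} (f : T -> R[i]) :
 normc (f x) @[x --> F] --> (0 : R) ->
 (Re (f x) @[x --> F] --> (0 : R)) /\ (Im (f x) @[x --> F] --> (0 : R)).
Proof.
move=> /cvgrPdist_le h; split; apply/cvgrPdist_le => e /h; apply: filterS => x;
 rewrite !sub0r !normrN [X in X <= _ -> _]ger0_norm ?normc_ge0//; apply: le_trans.
 exact: normc_Re.
exact: normc_Im.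
Qed.

Lemma cintegral_derive_gt (F f : R -> R[i]) a : (forall t, cderiv F t (f t)) ->
 ccont f -> cintegrable mu (fun x => if a < x then f x else 0) ->
 normc (F x) @[x --> +oo] --> (0 : R) ->
 cintegral mu (fun x => if a < x then f x else 0) = - F a.
Proof.
move=> dF [cr ci] [ir ii] /cvg_normc0[Fr Fi].
have hr : Rintegrable mu (fun x => if a < x then Re (f x) else 0).
 by move: ir; apply: eq_integrable => // x _ /=; case: ifP.
have hi : Rintegrable mu (fun x => if a < x then Im (f x) else 0).
 by move: ii; apply: eq_integrable => // x _ /=; case: ifP.
have er := Rintegral_derive_gt (fun x => (dF x).1) cr hr Fr.
have ei := Rintegral_derive_gt (fun x => (dF x).2) ci hi Fi.
apply: eqcE; rewrite cE /cintegral /= -[RHS]add0r.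
 by rewrite -er; apply: eq_Rintegral => x _; case: ifP.
by rewrite -ei; apply: eq_Rintegral => x _; case: ifP.
Qed.

Lemma cintegral_derive0 (F f : R -> R[i]) : (forall t, cderiv F t (f t)) ->
 ccont f -> cintegrable mu f ->
 normc (F x) @[x --> +oo] --> (0 : R) -> normc (F x) @[x --> -oo] --> (0 : R) ->
 cintegral mu f = 0.
Proof.
move=> dF [cr ci] [ir ii] /cvg_normc0[Fr Fi] /cvg_normc0[Gr Gi].
apply: eqcE; rewrite /cintegral /=.
 apply: (@Rintegral_derive0 _ (fun x => Re (F x))) => //.
 by move=> x; have [] := dF x.
apply: (@Rintegral_derive0 _ (fun x => Im (F x))) => //.
by move=> x; have [] := dF x.
Qed.

Lemma cvg_expRM (r : R) : r < 0 -> expR (r * x) @[x --> +oo] --> (0 : R).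
Proof.
move=> r0; have := @cvgr_expR R; under eq_fun do rewrite -[X in - X]mulr1.
have h : (- r * x) @[x --> +oo] --> +oo.
 by apply: gt0_cvgMry => //; rewrite oppr_gt0.
move=> H; have := cvg_comp _ _ h (@cvgr_expR R).
by apply: cvg_trans; apply: near_eq_cvg; apply: nearW => x /=; rewrite mulNr opprK.
Qed.

Lemma integrable_expR_gt a (r : R) : r < 0 ->
 Rintegrable mu (fun x => if a < x then expR (r * x) else 0).
Proof.
move=> r0; have hE (x c : R) : is_derive x 1 (fun y : R => c * y) c.
 by apply: is_derive_eq; rewrite /GRing.scale/= mulr1.
have d1 (x : R) : is_derive x 1 (fun y : R => expR (r * y)) (expR (r * x) * r).
 exact: (is_derive1_comp (f := expR)).
have cE' := continuous_is_derive d1.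
apply: (@integrable_derive_gt _ (fun x => r^-1 * expR (r * x)) _ _ 0).
- move=> x _; have := is_deriveM (is_derive_cst r^-1 x 1) (d1 x) => /is_derive_eq; apply.
 by rewrite /GRing.scale/= mulr0 addr0; field; rewrite lt_eqF.
- by move=> x _; exact: cE'.
- by move=> x _; exact: expR_ge0.
- by rewrite -[X in _ --> X](mulr0 r^-1); apply: cvgM; [exact: cvg_cst|exact: cvg_expRM].
- apply: measurable_fun_ifT; first exact: measurable_ltr.
  exact: measurable_continuous.
 exact: measurable_cst.
Qed.

Lemma powle_expR (n : nat) (c x : R) : 0 < c -> 0 <= x ->
 x ^+ n <= (n.+1%:R / c) ^+ n * expR (c * x).
Proof.
move=> c0 x0; set m : R := n.+1%:R; have m0 : 0 < m by rewrite ltr0n.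
have -> : expR (c * x) = expR (c * x / m) ^+ n.+1.
 by rewrite -expRM_natl -[in RHS]/m mulrCA divff ?mulr1// gt_eqF.
have h : c * x / m <= expR (c * x / m).
 by rewrite (le_trans _ (expR_ge1Dx _))// lerDr.
have h0 : 0 <= c * x / m by rewrite !mulr_ge0// ?invr_ge0 ltW.
have h1 : 1 <= expR (c * x / m) by rewrite -[X in X <= _]expR0 ler_expR.
have -> : x ^+ n = (m / c) ^+ n * (c * x / m) ^+ n.
 by rewrite -exprMn; congr (_ ^+ _); field; rewrite !gt_eqF.
rewrite ler_wpM2l//; first by rewrite exprn_ge0// divr_ge0// ltW.
rewrite (@le_trans _ _ (expR (c * x / m) ^+ n))//; first by rewrite lerXn2r// nnegrE expR_ge0.
by rewrite exprS ler_peMl// exprn_ge0// expR_ge0.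
Qed.

Lemma integrable_powexpR_gt (n : nat) (r : R) : r < 0 ->
 Rintegrable mu (fun x => if 0 < x then x ^+ n * expR (r * x) else 0).
Proof.
move=> r0; pose c := - r / 2.
have c0 : 0 < c by rewrite divr_gt0// oppr_gt0.
have r2 : r / 2 < 0 by rewrite pmulr_llt0.
have := RintegrableZl ((n.+1%:R / c) ^+ n) (integrable_expR_gt 0 r2).
apply: (@le_integrable _ _ _ mu setT measurableT) => //.
 apply/measurable_EFinP; apply: measurable_fun_ifT; first exact: measurable_ltr.
  apply: measurable_funM; first exact: exprn_measurable.
  by apply: (measurableT_comp (f := expR)); [exact: measurable_expR|exact: measurable_funM].
 exact: measurable_cst.
move=> x _; rewrite /comp; case: ifP => x0; last by rewrite mule0.
rewrite /= lee_fin !ger0_norm ?mulr_ge0 ?exprn_ge0 ?expR_ge0 ?(ltW c0) ?(ltW x0)//; last first.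
 by rewrite divr_ge0// ltW.
have -> : expR (r * x) = expR (r / 2 * x) / expR (c * x).
 by rewrite -expRN -expRD; congr expR; rewrite /c; field.
rewrite mulrCA [leRHS]mulrC ler_wpM2l ?expR_ge0//.
by rewrite ler_pdivrMr ?expR_gt0// powle_expR// ltW.
Qed.

Lemma cintegr_powcexp_gt (n : nat) z : Re z < 0 ->
 cintegrable mu (fun t => if 0 < t then (t ^+ n)%:C * cexp (t%:C * z) else 0).
Proof.
move=> z0; apply: (cintegr_le mu _ _ _ (integrable_powexpR_gt n z0)).
 apply: cmeas_if; [exact: measurable_ltr| |exact: cmeas_cst].
 apply: cmeasM; first by apply: cmeas_real; exact: exprn_measurable.
 apply: cmeas_cexp; apply: cmeasM; last exact: cmeas_cst.
 by apply: cmeas_real.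
move=> t; case: ifP => t0; rewrite ?normc0//.
rewrite normcM normc_real normc_cexp cE /= mul0r subr0 mulrC [t * _]mulrC.
by rewrite ger0_norm 1?mulrC// exprn_ge0// ltW.
Qed.

Lemma cvg_powexpR (n : nat) (r : R) : r < 0 ->
 x ^+ n * expR (r * x) @[x --> +oo] --> (0 : R).
Proof.
move=> r0; pose c := - r / 2.
have c0 : 0 < c by rewrite divr_gt0// oppr_gt0.
have r2 : r / 2 < 0 by rewrite pmulr_llt0.
apply: (@squeeze_cvgr _ _ _ _ (fun=> 0) (fun x => (n.+1%:R / c) ^+ n * expR (r / 2 * x))).
- near=> x; have x0 : 0 <= x by near: x; exact: nbhs_pinfty_ge.
 rewrite mulr_ge0 ?exprn_ge0 ?expR_ge0//=.
 have -> : expR (r * x) = expR (r / 2 * x) / expR (c * x).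
  by rewrite -expRN -expRD; congr expR; rewrite /c; field.
 rewrite mulrCA [leRHS]mulrC ler_wpM2l ?expR_ge0//.
 by rewrite ler_pdivrMr ?expR_gt0// powle_expR.
- exact: cvg_cst.
- by rewrite -[X in _ --> X](mulr0 ((n.+1%:R / c) ^+ n)); apply: cvgM;
  [exact: cvg_cst|exact: cvg_expRM].
Unshelve. all: by end_near.
Qed.

Lemma cvg_normc_powcexp (n : nat) z (c : R[i]) : Re z < 0 ->
 normc (c * ((t ^+ n)%:C * cexp (t%:C * z))) @[t --> +oo] --> (0 : R).
Proof.
move=> z0; have h := cvg_powexpR n z0.
have H : normc c * (x ^+ n * expR (Re z * x)) @[x --> +oo] --> (0 : R).
 by rewrite -[X in _ --> X](mulr0 (normc c)); apply: cvgM => //; exact: cvg_cst.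
apply: cvg_trans H; apply: near_eq_cvg; near=> t.
have t0 : 0 <= t by near: t; exact: nbhs_pinfty_ge.
rewrite !normcM normc_real (ger0_norm (exprn_ge0 _ t0)) normc_cexp cE /= mul0r subr0.
by rewrite [t * _]mulrC.
Unshelve. all: by end_near.
Qed.

Lemma cintegral_cexp_gt a z : Re z < 0 ->
 cintegrable mu (fun t => if a < t then cexp (t%:C * z) else 0) /\
 cintegral mu (fun t => if a < t then cexp (t%:C * z) else 0) = - (cexp (a%:C * z) / z).
Proof.
move=> z0; have zn0 : z != 0 by apply: contraTneq z0 => ->; rewrite ltxx.
have dz t : cderiv (fun t => z^-1 * cexp (t%:C * z)) t (cexp (t%:C * z)).
 by apply: cderiv_eq (cderivZ z^-1 (cderiv_cexp z t)) _; rewrite mulrA mulVf ?mul1r.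
have cz := ccont_is_cderive (cderiv_cexp z).
have iz : cintegrable mu (fun t => if a < t then cexp (t%:C * z) else 0).
 apply: (cintegr_le mu _ _ _ (integrable_expR_gt a z0)).
  apply: cmeas_if; [exact: measurable_ltr| |exact: cmeas_cst].
  exact: ccont_measurable.
 move=> t; case: ifP => t0; rewrite ?normc0//.
 by rewrite normc_cexp cE /= mul0r subr0 mulrC.
split => //; rewrite (cintegral_derive_gt dz)// 1?mulrC//.
have := cvg_normc_powcexp 0 z^-1 z0.
by under eq_fun do rewrite expr0 mul1r.
Qed.

Lemma cintegral_powcexp_gt (n : nat) z : Re z < 0 ->
 cintegral mu (fun t => if 0 < t then (t ^+ n)%:C * cexp (t%:C * z) else 0)
 = (n`!%:R)%:C / (- z) ^+ n.+1.
Proof.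
move=> z0; have zn0 : z != 0 by apply: contraTneq z0 => ->; rewrite ltxx.
elim: n => [|n ih].
 transitivity (cintegral mu (fun t => if 0 < t then cexp (t%:C * z) else 0)).
  by apply: eq_cintegral => t; rewrite expr0 mul1r.
 have [_ ->] := cintegral_cexp_gt 0 z0.
 by rewrite mul0r cexp0 fact0 expr1 invrN mulrN.
have dX (m : nat) t : is_derive t 1 (fun x : R => x ^+ m.+1) (m.+1%:R * t ^+ m).
 rewrite (_ : (fun x => _) = (id : R -> R) ^+ m.+1); last first.
  by apply/funext => x; rewrite exprfctE.
 by apply: is_derive_eq; rewrite /GRing.scale/= mulr1.
pose f t : R[i] := (n.+1%:R * t ^+ n)%:C * cexp (t%:C * z) +
          (t ^+ n.+1)%:C * (z * cexp (t%:C * z)).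
have dF t : cderiv (fun t => (t ^+ n.+1)%:C * cexp (t%:C * z)) t (f t).
 by apply: cderivM; [exact: cderiv_real|exact: cderiv_cexp].
have i1 := cintegrZl (n.+1%:R)%:C (cintegr_powcexp_gt n z0).
have i2 := cintegrZl z (cintegr_powcexp_gt n.+1 z0).
have fE t : (if 0 < t then f t else 0) =
  (n.+1%:R)%:C * (if 0 < t then (t ^+ n)%:C * cexp (t%:C * z) else 0) +
  z * (if 0 < t then (t ^+ n.+1)%:C * cexp (t%:C * z) else 0).
 case: ifP => _; last by rewrite !mulr0 addr0.
 by rewrite /f rmorphM/=; ring.
have : cintegral mu (fun t => if 0 < t then f t else 0) = 0.
 rewrite (cintegral_derive_gt dF).
 - by rewrite expr0n /= mul0r oppr0.
 - have ce := ccont_is_cderive (cderiv_cexp z).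
  apply: ccontD; apply: ccontM => //; last first.
  + by apply: ccontM => //; exact: ccont_cst.
  + by apply: ccont_real => x; exact: exprn_continuous.
  + by apply: ccont_real => x; apply: cvgM; [exact: cvg_cst|exact: exprn_continuous].
 - by apply: eq_cintegrable (cintegrD i1 i2) => t; rewrite -fE.
 - by have := cvg_normc_powcexp n.+1 1 z0; under eq_fun do rewrite mul1r.
under eq_cintegral do rewrite fE.
rewrite cintegralD// !cintegralZl ?ih; last 2 first.
 exact: cintegr_powcexp_gt.
 exact: cintegr_powcexp_gt.
move=> /eqP; rewrite addr_eq0 -mulrN => /eqP H.
set I := cintegral _ _ in H *.
have -> : I = - ((n.+1%:R)%:C * ((n`!%:R)%:C / (- z) ^+ n.+1)) / z.
 by rewrite H mulrN opprK mulrC mulKf.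
rewrite [(- z) ^+ n.+2]exprS factS natrM rmorphM/=.
have : (- z) ^+ n.+1 != 0 by rewrite expf_neq0 ?oppr_eq0.
by move: ((- z) ^+ n.+1) => w w0; field; rewrite w0 zn0.
Qed.

End cexp.

(** * Fourier inversion on the line *)

Section fourier_inversion.
Context {R : realType}.
Notation mu := (@lebesgue_measure R).

(** Invariance of Lebesgue measure under reflection and translation. *)
Lemma Rintegral_pushforward (phi : R -> R) (f : R -> R) :
 measurable_fun [set: R] phi ->
 (forall A : set R, measurable A -> pushforward mu (phi : _ -> measurableTypeR R) A = mu A) ->
 measurable_fun [set: R] f -> Rintegrable mu (f \o phi) ->
 Rintegrable mu f /\ \int[mu]_x f (phi x) = \int[mu]_x f x.
Proof.
move=> mphi inv mf fi.
pose phi' : measurableTypeR R -> measurableTypeR R := phi.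
have mphi' : measurable_fun [set: measurableTypeR R] phi' by exact: mphi.
have mF : measurable_fun [set: measurableTypeR R] (EFin \o f).
 by have : measurable_fun [set: R] (EFin \o f) by exact/measurable_EFinP.
have fi' : mu.-integrable (phi' @^-1` setT) ((EFin \o f) \o phi').
 by rewrite preimage_setT.
have h1 := integrable_pushforward mphi' mF fi' measurableT.
have h2 := integral_pushforward mphi' mF fi' measurableT.
have E : forall g : R -> \bar R, (\int[pushforward mu phi']_x g x =
  \int[mu]_x g x)%E.
 by move=> g; apply: eq_measure_integral => /= A mA _; exact: inv.
split.
 have /integrableP[_ fin] := h1.
 by apply/integrableP; split => //; rewrite -E.
by rewrite /Rintegral -[in RHS]E h2 preimage_setT.
Qed.

Lemma measurable_translate (c : R) : measurable_fun [set: R] (fun x : R => x + c).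
Proof. by apply: measurable_funD => //; exact: measurable_cst. Qed.

Lemma lebesgue_measure_translate (c : R) (A : set R) : measurable A ->
 pushforward mu ((fun x : R => x + c) : _ -> measurableTypeR R) A = mu A.
Proof.
move=> mA; pose phi : measurableTypeR R -> measurableTypeR R := fun x : R => x + c.
have mphi : measurable_fun setT phi by exact: (measurable_translate c).
pose m := isMeasurableFun.Build _ _ _ _ _ mphi.
pose phi' : {mfun _ >-> _} := HB.pack phi m.
apply/esym; apply: (@lebesgue_measure_unique R (pushforward mu phi')) => // _ [[a b]] _ <-.
have E : phi @^-1` `]a, b]%classic = `]a - c, b - c]%classic.
 by apply/seteqP; split => x /=; rewrite !in_itv/= /phi ltrBlDr lerBrDr.
change (mu `]a, b]%classic = mu (phi @^-1` `]a, b]%classic)).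
rewrite E !lebesgue_measure_itv/= !lte_fin ltrD2r; case: ifP => //.
by rewrite -!EFinB => _; congr EFin; ring.
Qed.

Lemma Rintegral_translate (c : R) (f : R -> R) : measurable_fun [set: R] f ->
 Rintegrable mu f ->
 Rintegrable mu (fun x => f (x + c)) /\
 \int[mu]_x f (x + c) = \int[mu]_x f x.
Proof.
move=> mf fi.
have mfc : measurable_fun [set: R] (fun x => f (x + c)).
 exact: (measurableT_comp mf (measurable_translate c)).
have h := Rintegral_pushforward (measurable_translate (- c))
 (fun A mA => lebesgue_measure_translate (- c) mA) mfc.
have [|h1 h2] := h.
 by move: fi; apply: eq_integrable => // x _ /=; rewrite subrK.
split => //; rewrite -h2; apply: eq_Rintegral => x _; by rewrite subrK.
Qed.

Lemma Rintegral_reflect (f : R -> R) : measurable_fun [set: R] f ->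
 Rintegrable mu f ->
 Rintegrable mu (fun x => f (- x)) /\
 \int[mu]_x f (- x) = \int[mu]_x f x.
Proof.
move=> mf fi.
have mN : measurable_fun [set: R] (-%R : R -> R) by exact: oppr_measurable.
have mfc : measurable_fun [set: R] (fun x => f (- x)).
 exact: (measurableT_comp mf mN).
have [|h1 h2] := Rintegral_pushforward mN (fun A mA => lebesgue_measureN mA) mfc.
 by move: fi; apply: eq_integrable => // x _ /=; rewrite opprK.
split => //; rewrite -h2; apply: eq_Rintegral => x _; by rewrite opprK.
Qed.

Lemma cintegral_reflect (f : R -> R[i]) : cintegrable mu f ->
 cintegrable mu (fun x => f (- x)) /\ cintegral mu (fun x => f (- x)) = cintegral mu f.
Proof.
move=> cf; have [mr mi] := cintegr_measurable cf; case: cf => fr fi.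
have [h1 h2] := Rintegral_reflect mr fr; have [h3 h4] := Rintegral_reflect mi fi.
by split; [split|rewrite /cintegral h2 h4].
Qed.

Lemma cintegral_translate (c : R) (f : R -> R[i]) : cintegrable mu f ->
 cintegrable mu (fun x => f (x + c)) /\
 cintegral mu (fun x => f (x + c)) = cintegral mu f.
Proof.
move=> cf; have [mr mi] := cintegr_measurable cf; case: cf => fr fi.
have [h1 h2] := Rintegral_translate c mr fr.
have [h3 h4] := Rintegral_translate c mi fi.
by split; [split|rewrite /cintegral h2 h4].
Qed.

Lemma aeneq_lebesgue (a : R) : {ae mu, forall x, x != a}.
Proof.
exists [set a]; split; [exact: measurable_set1|exact: lebesgue_measure_set1|].
by move=> x /= /negP; rewrite negbK => /eqP.
Qed.

Lemma measurable_cis d (T : measurableType d) (f : T -> R) :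
 measurable_fun setT f -> cmeasurable (fun x => cis (f x)).
Proof.
move=> mf; under eq_fun do rewrite cisE; apply: cmeas_cexp.
by split => //=; exact: measurable_cst.
Qed.

(** The Fourier transform of exp(-e|s|) is the Poisson kernel. *)
Lemma fourier_expR_abs (e x : R) : 0 < e ->
 cintegrable mu (fun s => cis (x * s) * (expR (- (e * `|s|)))%:C) /\
 cintegral mu (fun s => cis (x * s) * (expR (- (e * `|s|)))%:C) =
 (2 * e / (e ^+ 2 + x ^+ 2))%:C.
Proof.
move=> e0; pose f (z : R[i]) s := if 0 < s then cexp (s%:C * z) else 0.
have ne0 : - e < 0 by rewrite oppr_lt0.
have [i1 e1] := @cintegral_cexp_gt R 0 ((- e) +i* x) ne0.
have [i2 e2] := @cintegral_cexp_gt R 0 ((- e) +i* (- x)) ne0.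
have [i3 e3] := cintegral_reflect i2.
have mg : cmeasurable (fun s : R => cis (x * s) * (expR (- (e * `|s|)))%:C).
 apply: cmeasM; first by apply: measurable_cis; exact: measurable_funM.
 apply: cmeas_real; apply: (measurableT_comp (f := expR)) => //.
 by apply: measurableT_comp => //; apply: measurable_funM => //;
  exact: measurableT_comp.
have aeE : {ae mu, forall s, f ((- e) +i* x) s + f ((- e) +i* (- x)) (- s) =
  cis (x * s) * (expR (- (e * `|s|)))%:C}.
 apply: (ae_imp (aeneq_lebesgue 0)) => s s0; rewrite /f oppr_gt0.
 case: (ltrgtP s 0) s0 => // s0 _.
 - rewrite add0r ltr0_norm// cisE -cexp_real -cexpD; congr cexp.
  by apply: eqcE; rewrite !cE /=; ring.
 - rewrite addr0 gtr0_norm// cisE -cexp_real -cexpD; congr cexp.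
  by apply: eqcE; rewrite !cE /=; ring.
have i4 := cintegrD i1 i3.
split; first exact: (ae_eq_cintegrable mu _ _ mg aeE i4).
rewrite -(ae_eq_cintegral mu _ _ (cintegr_measurable i4) mg aeE).
rewrite cintegralD// e1 e3 e2 !mul0r !cexp0.
have h0 : e ^+ 2 + x ^+ 2 != 0 by rewrite gt_eqF// ltr_pwDl ?exprn_gt0// sqr_ge0.
by apply: eqcE => /=; field; rewrite ?sqrrN ?h0.
Qed.

Lemma poisson_kernel (e t : R) : 0 < e ->
 Rintegrable mu (fun x => 2 * e / (e ^+ 2 + (x - t) ^+ 2)) /\
 \int[mu]_x (2 * e / (e ^+ 2 + (x - t) ^+ 2)) = 2 * pi.
Proof.
move=> e0.
pose k (x : R) := 2 * e / (e ^+ 2 + x ^+ 2).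
have den x : 0 < e ^+ 2 + x ^+ 2 by rewrite ltr_pwDl ?exprn_gt0// sqr_ge0.
have k0 x : 0 <= k x by rewrite divr_ge0 ?mulr_ge0 ?ltW.
have dk (x : R) : is_derive x 1 (fun y : R => 2 * atan (y / e)) (k x).
 have h1 : is_derive x 1 (fun y : R => y / e) e^-1.
  by apply: is_derive_eq; rewrite /GRing.scale/= ?mulr0 ?add0r ?addr0 ?mulr1.
 have h2 : is_derive x 1 (fun y : R => atan (y / e)) ((1 + (x / e) ^+ 2)^-1 * e^-1).
  exact: (is_derive1_comp (f := atan)).
 have := is_deriveM (is_derive_cst (2 : R) x 1) h2 => /is_derive_eq; apply.
 rewrite /GRing.scale/= mulr0 addr0 /k; field.
 by rewrite !gt_eqF.
have ck : continuous k.
 move=> x; apply: cvgM; first exact: cvg_cst.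
 apply: cvgV; first by rewrite gt_eqF.
 apply: cvgD; first exact: cvg_cst.
 exact: exprn_continuous.
have Fy : 2 * atan (x / e) @[x --> +oo] --> (pi : R).
 rewrite [X in _ --> X](_ : _ = 2 * (pi / 2)); last by field.
 apply: cvgM; first exact: cvg_cst.
 have h : x / e @[x --> +oo] --> +oo.
  by under eq_fun do rewrite mulrC; apply: gt0_cvgMry => //; rewrite invr_gt0.
 exact: cvg_comp h (@cvgy_atan R).
have mk : measurable_fun [set: R] k by exact: measurable_continuous.
have igt : Rintegrable mu (fun x => if 0 < x then k x else 0).
 apply: (@integrable_derive_gt _ (fun y : R => 2 * atan (y / e)) _ _ pi) => //.
 exact: (measurable_fun_ifT (measurable_ltr 0) mk (measurable_cst _)).
have egt : \int[mu]_x (if 0 < x then k x else 0) = pi.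
 by rewrite (Rintegral_derive_gt dk ck igt Fy) mul0r atan0 mulr0 subr0.
have mif : measurable_fun [set: R] (fun x => if 0 < x then k x else 0).
 exact: (measurable_fun_ifT (measurable_ltr 0) mk (measurable_cst _)).
have [ilt elt] := Rintegral_reflect mif igt.
have aeE : {ae mu, forall x, (if 0 < x then k x else 0) + (if 0 < - x then k (- x) else 0) = k x}.
 apply: (ae_imp (aeneq_lebesgue 0)) => x x0; rewrite oppr_gt0.
 by case: (ltrgtP x 0) x0 => // _ _; rewrite ?add0r ?addr0// /k sqrrN.
have ii := RintegrableD igt ilt.
have ik : Rintegrable mu k by exact: (ae_eq_integrable mu _ _ mk aeE ii).
have ek : \int[mu]_x k x = 2 * pi.
 have mii : measurable_fun [set: R] (fun x => (if 0 < x then k x else 0) +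
   (if 0 < - x then k (- x) else 0)).
  apply: measurable_funD => //; apply: (measurableT_comp mif).
  exact: oppr_measurable.
 rewrite -(ae_eq_Rintegral mu _ _ mii mk aeE).
 by rewrite RintegralD// egt elt egt mulr2n mulrDl mul1r.
have := Rintegral_translate (- t) mk ik.
by rewrite ek.
Qed.

(** Inversion at a point of continuity. The integral of the transform is
  regularized by exp(-e|s|); the regularized integral is the mean of u
  against the Poisson kernel of width e centred at t. *)
Lemma fourier_inversion (u : R -> R[i]) (t : R) : cintegrable mu u ->
 normc (u x - u t) @[x --> t] --> (0 : R) ->
 cintegrable mu (fun s => cintegral mu (fun x => u x * cis (x * s))) ->
 cintegral mu (fun s => cintegral mu (fun x => u x * cis (x * s)) * cis (- (t * s)))
 = (2 * pi)%:C * u t.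
Proof.
move=> iu ut iU; set U := fun s => cintegral _ _ in iU *.
have mu' := cintegr_measurable iu.
have mU := cintegr_measurable iU.
pose e (n : nat) : R := n.+1%:R^-1.
have e0 n : 0 < e n by rewrite invr_gt0 ltr0n.
pose k (n : nat) (x : R) := 2 * e n / (e n ^+ 2 + (x - t) ^+ 2).
have den n x : 0 < e n ^+ 2 + (x - t) ^+ 2 by rewrite ltr_pwDl ?exprn_gt0// sqr_ge0.
have k0 n x : 0 <= k n x by rewrite divr_ge0 ?mulr_ge0 ?ltW.
have ik n : Rintegrable mu (k n) by have [] := poisson_kernel t (e0 n).
have ek n : \int[mu]_x k n x = 2 * pi by have [] := poisson_kernel t (e0 n).
have mk n : measurable_fun setT (k n) by exact: (mfun_integrable (ik n)).
pose w (n : nat) (s : R) : R[i] := (expR (- (e n * `|s|)))%:C.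
have mw n : cmeasurable (w n : R -> R[i]).
 apply: cmeas_real; apply: (measurableT_comp (f := expR)) => //.
 by apply: measurableT_comp => //; apply: measurable_funM => //;
  exact: measurableT_comp.
have nw n s : normc (w n s) <= 1.
 rewrite normc_real ger0_norm ?expR_ge0// -[leRHS]expR0 ler_expR oppr_le0.
 by rewrite mulr_ge0// ltW.
(* the regularized integrals, computed in two ways *)
pose A (n : nat) := cintegral mu (fun s => U s * cis (- (t * s)) * w n s).
have AE n : A n = cintegral mu (fun x => u x * (k n x)%:C).
 pose G (p : R * R) : R[i] := u p.1 * cis (p.1 * p.2) * cis (- (t * p.2)) * w n p.2.
 have m1 : measurable_fun setT (fun p : R * R => p.1 * p.2).
  by apply: measurable_funM.
 have m2 : measurable_fun setT (fun p : R * R => - (t * p.2)).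
  by apply: measurableT_comp => //; apply: measurable_funM.
 have mG : cmeasurable G.
  apply: cmeasM; last exact: (cmeas_comp (mw n)).
  apply: cmeasM; last exact: measurable_cis.
  by apply: cmeasM; [exact: (cmeas_comp mu')|exact: measurable_cis].
 have [iw _] := fourier_expR_abs 0 (e0 n).
 have iw' := integrable_normc iw.
 have iG : cintegrable (mu \x mu)%E G.
  apply: (@cintegr_le _ _ _ (mu \x mu)%E G (fun p => normc (u p.1) *
   normc (cis (0 * p.2) * (expR (- (e n * `|p.2|)))%:C))).
  - exact: mG.
  - exact: (integrable_prod (integrable_normc iu) iw').
  - by move=> p; rewrite /G !normcM !normc_cis !mulr1 mul1r.
 transitivity (cintegral mu (fun s => cintegral mu (fun x => G (x, s)))).
  apply: eq_cintegral => s; rewrite /G /= -mulrA -cintegralZr.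
   by apply: eq_cintegral => x; rewrite !mulrA.
  apply: (cintegr_bounded mu _ _ 1 iu) => [|x]; last by rewrite normc_cis.
  by apply: measurable_cis; apply: measurable_funM.
 rewrite -cfubini2// cfubini1//; apply: eq_cintegral => x; rewrite /G /=.
 have [i1 <-] := fourier_expR_abs (x - t) (e0 n).
 rewrite -cintegralZl//; apply: eq_cintegral => s.
 rewrite -!mulrA; congr (_ * _); rewrite mulrA; congr (_ * _).
 rewrite cisE [cis (- _)]cisE -cexpD cisE; congr (cexp _).
 by apply: eqcE; rewrite !cE /=; ring.
have e_0 : e n @[n --> \oo] --> (0 : R) by exact: cvg_harmonic.
pose L := cintegral mu (fun s => U s * cis (- (t * s))).
have mc : cmeasurable (fun s : R => cis (- (t * s)) : R[i]).
 by apply: measurable_cis; apply: measurableT_comp => //; apply: measurable_funM.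
have iUc : cintegrable mu (fun s => U s * cis (- (t * s))).
 by apply: (cintegr_bounded mu _ _ 1 iU) => // s; rewrite normc_cis.
have iUcw n : cintegrable mu (fun s => U s * cis (- (t * s)) * w n s).
 exact: (cintegr_bounded mu _ _ 1 iUc (mw n) (nw n)).
have AL : normc (A n - L) @[n --> \oo] --> (0 : R).
 have := @cintegral_cvg _ _ _ mu (fun n s => U s * cis (- (t * s)) * w n s)
  (fun s => U s * cis (- (t * s))) (fun s => normc (U s)).
 move=> /(_ _ _ _ (integrable_normc iU) _)/squeeze0; apply.
 - move=> n; rewrite normc_ge0/= /A /L -cintegralB//.
  by apply: normc_cintegral; exact: cintegrB.
 - by move=> n; exact: (cintegr_measurable (iUcw n)).
 - exact: (cintegr_measurable iUc).
 - move=> n s; rewrite !normcM normc_cis mulr1 ler_piMr ?normc_ge0//.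
 - move=> s; rewrite (_ : (fun n => _) = fun n =>
   normc (U s) * `|expR (- (e n * `|s|)) - 1|); last first.
   apply/funext => n; rewrite -[X in _ - X]mulr1 -mulrBr !normcM normc_cis mulr1.
   by rewrite /w -(rmorph1 (real_complex R)) -rmorphB normc_real.
  rewrite -(mulr0 (normc (U s))); apply: cvgM; first exact: cvg_cst.
  rewrite -(normr0 R) -(subrr (1 : R)); apply: cvg_norm; apply: cvgB; last exact: cvg_cst.
  have h : - (e n * `|s|) @[n --> \oo] --> (0 : R).
   rewrite -[X in _ --> X]oppr0; apply: cvgN.
   by rewrite -(mul0r `|s|); apply: cvgM => //; exact: cvg_cst.
  by rewrite -expR0; exact: (cvg_comp _ _ h (@continuous_expR R 0)).
have AU : normc (A n - (2 * pi)%:C * u t) @[n --> \oo] --> (0 : R).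
 have iuk n : cintegrable mu (fun x => u x * (k n x)%:C).
  have mkc : cmeasurable (fun x => (k n x)%:C) by exact: cmeas_real.
  apply: (cintegr_bounded mu _ _ (2 / e n) iu); first exact: mkc.
  move=> x; rewrite normc_real ger0_norm// /k ler_pdivrMr ?den//.
  rewrite mulrDr exprS expr1 mulrA divfK ?gt_eqF// lerDl.
  by rewrite mulr_ge0 ?sqr_ge0// divr_ge0// ltW.
 have icst n : cintegrable mu (fun x => u t * (k n x)%:C).
  by apply: cintegrZl; exact: cintegr_real.
 have bnd n : normc (A n - (2 * pi)%:C * u t) <=
   \int[mu]_x (normc (u x - u t) * k n x).
  rewrite AE -(ek n) -cintegral_real mulrC -cintegralZl; last exact: cintegr_real.
  rewrite -cintegralB//.
  apply: (le_trans (normc_cintegral (cintegrB (iuk n) (icst n)))).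
  rewrite le_eqVlt; apply/orP; left; apply/eqP; apply: eq_Rintegral => x _.
  by rewrite -mulrBl normcM normc_real ger0_norm.
 have ibnd n : Rintegrable mu (fun x => normc (u x - u t) * k n x).
  have := integrable_normc (cintegrB (iuk n) (icst n)).
  apply: eq_integrable => // x _ /=.
  by rewrite -mulrBl normcM normc_real ger0_norm.
 have mut : measurable_fun setT (fun x => normc (u x - u t)).
  by apply: measurable_normc; apply: cmeasB; [exact: mu'|exact: cmeas_cst].
 apply/cvgrPdist_le => eta eta0.
 have pi0 : 0 < 4 * pi :> R by rewrite mulr_gt0// pi_gt0.
 have /cvgrPdist_le/(_ (eta / (4 * pi))) := ut.
 rewrite divr_gt0// => /(_ isT) /nbhs_ballP[d /= d0 near_t].
 pose far n x := (if `|x - t| < d then 0 else normc (u x - u t) * k n x).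
 have mfar n : measurable_fun setT (far n).
  have m1 : measurable_fun setT (fun x : R => `|x - t| < d).
   apply: measurable_fun_ltr; last exact: measurable_cst.
   by apply: measurableT_comp => //; exact: measurable_translate.
  have m2 : measurable_fun setT (fun x => normc (u x - u t) * k n x).
   by apply: measurable_funM; [exact: mut|exact: mk].
  exact: (measurable_fun_ifT m1 (measurable_cst _) m2).
 have far0 n x : 0 <= far n x by rewrite /far; case: ifP => // _; rewrite mulr_ge0 ?normc_ge0.
 have ifar n : Rintegrable mu (far n).
  apply: (@le_integrable _ _ _ mu setT measurableT _ (EFin \o (fun x => normc (u x - u t) * k n x))) => //.
   by apply/measurable_EFinP; exact: mfar.
  move=> x _ /=; rewrite lee_fin /far; case: ifP => // _; rewrite ?normr0//.
 have cvfar : \int[mu]_x far n x @[n --> \oo] --> (0 : R).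
  pose C : R := (2 / d ^+ 2) + 1.
  apply: (R_dct mu far (fun x => (2 / d ^+ 2) * normc (u x) +
    normc (u t) * ((1 + 1 / d ^+ 2) * k 0%N x))) => //.
  - have d2 : 0 < d ^+ 2 by rewrite exprn_gt0.
   have c1 : 0 <= 2 / d ^+ 2 by rewrite divr_ge0// ltW.
   have c2 : 0 <= 1 + 1 / d ^+ 2 by rewrite addr_ge0// divr_ge0// ltW.
   move=> n x; rewrite far0/= /far; case: ifPn => [_|].
    by rewrite addr_ge0//; apply: mulr_ge0 => //; rewrite ?normc_ge0// mulr_ge0.
   rewrite -leNgt => xd.
   have x2 : d ^+ 2 <= (x - t) ^+ 2.
    by rewrite -(@real_normK _ (x - t)) ?num_real// lerXn2r// nnegrE ltW.
   have x20 : 0 < (x - t) ^+ 2 by rewrite (lt_le_trans d2).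
   have en1 : e n <= 1 by rewrite /e invf_le1 ?ltr0n// ler1n.
   have kd : k n x <= 2 / (x - t) ^+ 2.
    rewrite /k -mulrA ler_pM2l// ler_pdivrMr// mulrC ler_pdivlMr//.
    apply: (@le_trans _ _ ((x - t) ^+ 2)); first by rewrite ler_piMl// ltW.
    by rewrite lerDr sqr_ge0.
   have kd1 : k n x <= 2 / d ^+ 2.
    by rewrite (le_trans kd)// ler_pM2l// lef_pV2 ?posrE.
   have kd2 : k n x <= (1 + 1 / d ^+ 2) * k 0%N x.
    apply: (le_trans kd); rewrite /k /e invr1 !expr1n mulr1.
    rewrite mulrCA ler_pM2l// ler_pdivlMr; last by rewrite ltr_pwDl// sqr_ge0.
    by rewrite mulrDr mulr1 mulVf ?gt_eqF// addrC lerD2l div1r lef_pV2 ?posrE.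
   rewrite (le_trans (ler_wpM2r (k0 n x) (normcB _ _)))// mulrDl lerD//.
    by rewrite mulrC ler_wpM2r ?normc_ge0.
   by rewrite ler_wpM2l ?normc_ge0.
  - have h1 := RintegrableZl (2 / d ^+ 2) (integrable_normc iu).
   have h2 := RintegrableZl (normc (u t) * (1 + 1 / d ^+ 2)) (ik 0%N).
   have := RintegrableD h1 h2.
   apply: eq_integrable => // x _ /=.
   by rewrite mulrA.
  - move=> x; rewrite /far; case: (ltP `|x - t| d) => xd; first exact: cvg_cst.
   rewrite -(mulr0 (normc (u x - u t))).
   apply: cvgM; first exact: cvg_cst.
   rewrite /k -(mul0r ((0 ^+ 2 + (x - t) ^+ 2)^-1)) -{1}(mulr0 (2 : R)).
   have xn0 : (x - t) ^+ 2 != 0.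
    by rewrite sqrf_eq0 -normr_gt0 (lt_le_trans d0).
   apply: cvgM; first by apply: cvgM => //; exact: cvg_cst.
   apply: cvgV; first by rewrite expr0n/= add0r.
   apply: cvgD; last exact: cvg_cst.
   by rewrite [X in _ --> X]expr2; under eq_fun do rewrite expr2; exact: cvgM.
 have eta2 : 0 < eta / 2 by rewrite divr_gt0.
 have /cvgrPdist_le/(_ _ eta2) := cvfar; apply: filterS => n.
 rewrite !sub0r !normrN ger0_norm ?Rintegral_ge0// => hfar.
 rewrite ger0_norm ?normc_ge0// (le_trans (bnd n))//.
 apply: (@le_trans _ _ (\int[mu]_x (eta / (4 * pi) * k n x + far n x))).
  apply: le_Rintegral => //.
   exact: (RintegrableD (RintegrableZl (eta / (4 * pi)) (ik n)) (ifar n)).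
  move=> x _; rewrite /far; case: ifPn => xd.
   rewrite addr0 ler_wpM2r//.
   have := near_t x; rewrite /ball/= distrC => /(_ xd).
   by rewrite sub0r normrN ger0_norm ?normc_ge0.
  by rewrite lerDr mulr_ge0// divr_ge0 ?ltW.
 rewrite RintegralD//; last exact: (RintegrableZl (eta / (4 * pi)) (ik n)).
 rewrite RintegralZl// ek [leRHS](splitr eta) lerD//.
 have E (q : R) : q != 0 -> eta / (4 * q) * (2 * q) = eta / 2 by move=> q0; field.
 by rewrite E// gt_eqF// pi_gt0.
apply/eqP; rewrite -subr_eq0 -normc_eq0; apply/eqP.
have : normc (L - (2 * pi)%:C * u t) @[n --> \oo] --> (0 : R).
 apply: (squeeze0 (v := fun n => normc (A n - L) + normc (A n - (2 * pi)%:C * u t))).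
  move=> n; rewrite normc_ge0/= -[normc (A n - L)]normcN opprB.
  by rewrite (le_trans _ (le_normcD _ _))// addrA subrK.
 by rewrite -(addr0 (0 : R)); exact: cvgD.
by move/cvg_lim => <-//; rewrite lim_cst.
Qed.

End fourier_inversion.

(** * Smooth bump functions *)

Section bump.
Context {R : realType}.
Notation mu := (@lebesgue_measure R).
Implicit Types (u v w : R -> R) (a b c t x : R).

Lemma is_derive_quad (f : R -> R) (x d C r : R) : 0 < r ->
 (forall h, `|h| < r -> `|f (x + h) - f x - h * d| <= C * h ^+ 2) -> is_derive x 1 f d.
Proof.
move=> r0 H.
have cv : h^-1 *: ((f \o shift x) (h *: (1 : R)) - f x) @[h --> 0^'] --> d.
 apply/subr_cvg0; apply: (@cvg_to_0_linear _ _ C r) => // h /andP[h0 hr].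
 have hn0 : h != 0 by rewrite -normr_gt0.
 rewrite /= /shift /GRing.scale/= mulr1 [h + x]addrC.
 have -> : h^-1 * (f (x + h) - f x) - d = h^-1 * (f (x + h) - f x - h * d) by field.
 rewrite normrM normfV mulrC ler_pdivrMr// -mulrA -expr2 real_normK ?num_real//.
 exact: H.
by apply: DeriveDef; [apply/cvg_ex; exists d|exact: cvg_lim cv].
Qed.

Lemma near_eq_is_derive (f g : R -> R) x d : (\forall y \near x, f y = g y) ->
 is_derive x 1 f d -> is_derive x 1 g d.
Proof.
move=> fg [df <-]; apply: DeriveDef; first exact: near_eq_derivable df.
by apply/esym/near_eq_derive.
Qed.

Definition flat (k : nat) t : R := if 0 < t then (t^-1) ^+ k * expR (- t^-1) else 0.

Lemma flat_ge0 k t : 0 <= flat k t.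
Proof. by rewrite /flat; case: ifP => // t0; rewrite mulr_ge0 ?expR_ge0// exprn_ge0// invr_ge0 ltW. Qed.

(** All orders of flatness: t^-k exp(-1/t) is O(t^m) for every m. *)
Lemma flat_le k m t : 0 < t -> flat k t <= (k + m).+1%:R ^+ (k + m) * t ^+ m.
Proof.
move=> t0; rewrite /flat t0.
have tn0 : t != 0 by rewrite gt_eqF.
have i0 : 0 <= t^-1 by rewrite invr_ge0 ltW.
have := @powle_expR R (k + m) 1 t^-1 ltr01 i0; rewrite mul1r divr1 exprD => h.
rewrite expRN ler_pdivrMr ?expR_gt0// -mulrA [t ^+ m * _]mulrC mulrA.
rewrite -ler_pdivrMr ?exprn_gt0//; apply: le_trans h.
by rewrite [t^-1 ^+ m]exprVn.
Qed.

Lemma flat_bounded k t : `|flat k t| <= k.+1%:R ^+ k.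
Proof.
rewrite ger0_norm ?flat_ge0//; have [t0|t0] := ltP 0 t.
 by have := flat_le k 0 t0; rewrite addn0 expr0 mulr1.
by rewrite /flat ltNge t0/= exprn_ge0.
Qed.

Lemma is_derive_flat k t : is_derive t 1 (flat k) (flat k.+2 t - k%:R * flat k.+1 t).
Proof.
case: (ltrgtP t 0) => [t0|t0|->].
- have -> : flat k.+2 t - k%:R * flat k.+1 t = 0.
  by rewrite /flat ltNge (ltW t0)/= mulr0 subr0.
 apply: (@near_eq_is_derive (fun=> 0) (flat k) t 0).
 near=> y; have y0 : y < 0 by near: y; exact: lt_nbhsl.
 by rewrite /flat ltNge (ltW y0).
- apply: (@near_eq_is_derive (fun y => (y^-1) ^+ k * expR (- y^-1))).
  near=> y; have y0 : 0 < y by near: y; exact: lt_nbhsr.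
  by rewrite /flat y0.
 have tn0 : t != 0 by rewrite gt_eqF.
 have dV : is_derive t 1 (fun y : R => y^-1) (- t ^- 2).
  have := @is_deriveV _ id t 1 1 tn0 (is_derive_id _ _).
  by move=> /is_derive_eq; apply; rewrite /GRing.scale/= mulr1.
 have dX : is_derive t 1 (fun y : R => (y^-1) ^+ k) (k%:R * (t^-1) ^+ k.-1 * - t ^- 2).
  case: k => [|k]; first by rewrite mul0r mul0r; exact: is_derive_cst.
  rewrite (_ : (fun y => _) = (fun y : R => y^-1) ^+ k.+1); last first.
   by apply/funext => y; rewrite exprfctE.
  by apply: is_derive_eq; rewrite /GRing.scale.
 have dN : is_derive t 1 (fun y : R => - y^-1) (t ^- 2).
  by have := is_deriveN dV => /is_derive_eq; apply; rewrite opprK.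
 have dE : is_derive t 1 (fun y : R => expR (- y^-1)) (expR (- t^-1) * t ^- 2).
  exact: (is_derive1_comp (f := expR)).
 have := is_deriveM dX dE => /is_derive_eq; apply.
 rewrite /flat t0 /GRing.scale/= -[t ^- 2]exprVn.
 by case: k {dX} => [|k]; rewrite ?mul0r ?mulr0 /= ?exprS; ring.
- rewrite /flat ltxx mulr0 subr0.
 apply: (@is_derive_quad _ _ _ ((k + 2).+1%:R ^+ (k + 2)) 1) => // h _.
 rewrite add0r mulr0 subr0 -/(flat k h) ltxx subr0 ger0_norm ?flat_ge0//.
 have [h0|h0] := ltP 0 h; first exact: flat_le.
 by rewrite /flat ltNge h0/= mulr_ge0 ?sqr_ge0// exprn_ge0.
Unshelve. all: by end_near.
Qed.

(** Smooth functions supported in ]a, b[, by coinduction: a class of bounded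
  functions vanishing off ]a, b[, stable under differentiation and under
  multiplication by the variable. *)
Definition bumpy a b u := exists P : (R -> R) -> Prop, P u /\
 forall v, P v -> [/\ forall t, ~~ (a < t < b) -> v t = 0,
  exists M, forall t, `|v t| <= M,
  exists2 w, P w & forall t, is_derive t 1 v (w t) & P (fun t => t * v t)].

Lemma bumpy_supp a b u t : bumpy a b u -> ~~ (a < t < b) -> u t = 0.
Proof. by move=> [P [Pu H]]; have [h _ _ _] := H _ Pu; exact: h. Qed.

Lemma bumpy_bounded a b u : bumpy a b u -> exists M, forall t, `|u t| <= M.
Proof. by move=> [P [Pu H]]; have [_ h _ _] := H _ Pu. Qed.

Lemma bumpy_derive a b u : bumpy a b u ->
 exists2 w, bumpy a b w & forall t, is_derive t 1 u (w t).
Proof. by move=> [P [Pu H]]; have [_ _ [w Pw h] _] := H _ Pu; exists w => //; exists P. Qed.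

Lemma bumpy_mulX a b u : bumpy a b u -> bumpy a b (fun t => t * u t).
Proof. by move=> [P [Pu H]]; have [_ _ _ h] := H _ Pu; exists P. Qed.

Lemma bumpy_continuous a b u : bumpy a b u -> continuous u.
Proof. by move=> /bumpy_derive[w _]; exact: continuous_is_derive. Qed.

Inductive bump_span a b c : (R -> R) -> Prop :=
| bump_gen j k : bump_span a b c (fun t => t ^+ j * flat k (c * ((t - a) * (b - t))))
| bump_add u v : bump_span a b c u -> bump_span a b c v ->
  bump_span a b c (fun t => u t + v t)
| bump_scale r u : bump_span a b c u -> bump_span a b c (fun t => r * u t).

Definition bump a b c t : R := flat 0 (c * ((t - a) * (b - t))).

Lemma bump_arg_le0 a b c t : 0 < c -> a < b -> ~~ (a < t < b) ->
 c * ((t - a) * (b - t)) <= 0.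
Proof.
move=> c0 ab; rewrite negb_and -!leNgt => /orP[h|h]; rewrite pmulr_rle0//.
 by rewrite mulr_le0_ge0// ?subr_le0// subr_ge0 (le_trans h)// ltW.
by rewrite mulr_ge0_le0// ?subr_le0// subr_ge0 (le_trans _ h)// ltW.
Qed.

Lemma bump_bumpy a b c : 0 < c -> a < b -> bumpy a b (bump a b c).
Proof.
move=> c0 ab; exists (bump_span a b c); split.
 rewrite (_ : bump a b c = fun t => t ^+ 0 * flat 0 (c * ((t - a) * (b - t)))).
  exact: bump_gen.
 by apply/funext => t; rewrite mul1r.
have supp v : bump_span a b c v -> forall t, ~~ (a < t < b) -> v t = 0.
 elim=> [j k|u w _ hu _ hw|r u _ hu] t tab.
 - by rewrite /flat ltNge bump_arg_le0//= mulr0.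
 - by rewrite hu// hw// addr0.
 - by rewrite hu// mulr0.
move=> v Pv; split; first exact: supp.
- elim: Pv => [j k|u w _ [M hM] _ [N hN]|r u _ [M hM]].
 + exists ((`|a| + `|b|) ^+ j * k.+1%:R ^+ k) => t.
  have [/andP[ta tb]|h] := boolP (a < t < b).
   rewrite normrM ler_pM// ?flat_bounded// normrX lerXn2r// ?nnegrE ?addr_ge0//.
   rewrite ler_norml; apply/andP; split.
    by rewrite (le_trans _ (ltW ta))// lerNl (le_trans (ler_norm _))// normrN lerDl.
   by rewrite (le_trans (ltW tb))// (le_trans (ler_norm _))// lerDr.
  by rewrite /flat ltNge bump_arg_le0//= mulr0 normr0 mulr_ge0 ?exprn_ge0// addr_ge0.
 + by exists (M + N) => t; rewrite (le_trans (ler_normD _ _))// lerD.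
 + by exists (`|r| * M) => t; rewrite normrM ler_wpM2l.
- elim: Pv => [j k|u w _ [u' Pu hu] _ [w' Pw hw]|r u _ [u' Pu hu]].
 + pose g t := c * ((t - a) * (b - t)).
  exists (fun t => j%:R * (t ^+ j.-1 * flat k (g t)) +
   ((c * (a + b)) * (t ^+ j * flat k.+2 (g t) + (- k%:R) * (t ^+ j * flat k.+1 (g t))) +
    (- (c * 2)) * (t ^+ j.+1 * flat k.+2 (g t) + (- k%:R) * (t ^+ j.+1 * flat k.+1 (g t))))).
   apply: bump_add; first by apply: bump_scale; exact: bump_gen.
   apply: bump_add; apply: bump_scale; apply: bump_add; do ?apply: bump_scale;
    exact: bump_gen.
  move=> t.
  have dg : is_derive t 1 g (c * (a + b - 2 * t)).
   by apply: is_derive_eq; rewrite /GRing.scale/= /cst; ring.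
  have dX : is_derive t 1 (fun y : R => y ^+ j) (j%:R * t ^+ j.-1).
   case: j => [|j]; first by rewrite mul0r; exact: is_derive_cst.
   rewrite (_ : (fun y => _) = (id : R -> R) ^+ j.+1); last first.
    by apply/funext => y; rewrite exprfctE.
   by apply: is_derive_eq; rewrite /GRing.scale/= mulr1.
  have dF := is_derive1_comp (is_derive_flat k (g t)) dg.
  have := is_deriveM dX dF => /is_derive_eq; apply.
  by rewrite /GRing.scale/= [t ^+ j.+1]exprS; ring.
 + exists (fun t => u' t + w' t); first exact: bump_add.
  by move=> t; exact: (is_deriveD (hu t) (hw t)).
 + exists (fun t => r * u' t); first exact: bump_scale.
  by move=> t; exact: (is_deriveZ r (hu t)).
- elim: Pv => [j k|u w _ hu _ hw|r u _ hu].
 + rewrite (_ : (fun t => _) = fun t => t ^+ j.+1 * flat k (c * ((t - a) * (b - t)))).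
   exact: bump_gen.
  by apply/funext => t; rewrite exprS mulrA.
 + rewrite (_ : (fun t => _) = fun t => t * u t + t * w t); first exact: bump_add.
  by apply/funext => t; rewrite mulrDr.
 + rewrite (_ : (fun t => _) = fun t => r * (t * u t)); first exact: bump_scale.
  by apply/funext => t; rewrite mulrCA.
Qed.

Lemma bump_ge0 a b c t : 0 <= bump a b c t.
Proof. exact: flat_ge0. Qed.

Lemma bump_le1 a b c t : bump a b c t <= 1.
Proof. by have := flat_bounded 0 (c * ((t - a) * (b - t))); rewrite ger0_norm ?flat_ge0// expr0. Qed.

(** As the steepness grows the bumps fill the indicator of ]a, b[. *)
Lemma bump_cvg a b t : a < b ->
 bump a b n.+1%:R t @[n --> \oo] --> (if a < t < b then 1 else 0 : R).
Proof.
move=> ab; case: ifP => [/andP[ta tb]|/negbT h]; last first.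
 rewrite (_ : (fun n => _) = fun=> 0); first exact: cvg_cst.
 by apply/funext => n; exact: (bumpy_supp (bump_bumpy (ltr0Sn _ n) ab)).
pose g := (t - a) * (b - t).
have g0 : 0 < g by rewrite mulr_gt0 ?subr_gt0.
have h : - (g^-1 * n.+1%:R^-1) @[n --> \oo] --> (0 : R).
 rewrite -[X in _ --> X]oppr0; apply: cvgN; rewrite -(mulr0 g^-1).
 by apply: cvgM; [exact: cvg_cst|exact: cvg_harmonic].
rewrite -[X in _ --> X](expR0 R); have := cvg_comp _ _ h (@continuous_expR R 0).
apply: cvg_trans; apply: near_eq_cvg; apply: nearW => n /=.
have ng : 0 < n.+1%:R * g by rewrite mulr_gt0.
rewrite /bump /flat -/g ng expr0 mul1r; congr (expR (- _)).
by rewrite [RHS]invfM mulrC.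
Qed.

End bump.

(** * Laplace transforms of bump functions *)

Section laplace.
Context {R : realType}.
Notation mu := (@lebesgue_measure R).
Implicit Types (u v : R -> R) (a b t : R) (z w : R[i]).

Lemma integrable_oo a b M : a < b ->
 Rintegrable mu (fun t => if a < t < b then M else 0) /\
 \int[mu]_t (if a < t < b then M else 0) = M * (b - a).
Proof.
move=> ab.
have E : (fun t => if a < t < b then M else 0) = (fun t => M * \1_(`]a, b[%classic) t).
 apply/funext => t; rewrite indicE; have [h|h] := boolP (a < t < b).
  by rewrite mem_set ?mulr1//= in_itv.
 by rewrite memNset ?mulr0//= in_itv/=; apply/negP.
have I : Rintegrable mu (\1_(`]a, b[%classic)).
 exact: (@integrable_indic_itv R a b false true).
rewrite E; split.
 exact: (RintegrableZl M I).
rewrite RintegralZl//; congr (_ * _).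
rewrite /Rintegral integral_indic//= setIT lebesgue_measure_itv/= lte_fin ab/=.
by [].
Qed.

Lemma cintegr_oo (f : R -> R[i]) a b M : a < b -> cmeasurable f ->
 (forall t, normc (f t) <= if a < t < b then M else 0) ->
 cintegrable mu f /\ normc (cintegral mu f) <= M * (b - a).
Proof.
move=> ab mf fM; have [gi <-] := integrable_oo M ab.
have ci : cintegrable mu f by exact: (cintegr_le mu _ _ mf gi fM).
split => //; apply: le_trans (normc_cintegral ci) _.
by apply: le_Rintegral => //; exact: integrable_normc.
Qed.

Lemma taylor1 (F F' F'' : R -> R) M : (forall t : R, is_derive t 1 F (F' t)) ->
 (forall t : R, is_derive t 1 F' (F'' t)) ->
 (forall t, 0 <= t <= 1 -> `|F'' t| <= M) -> `|F 1 - F 0 - F' 0| <= M.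
Proof.
move=> dF dF' hM.
have cF := continuous_is_derive dF; have cF' := continuous_is_derive dF'.
have [c] := MVT (@ltr01 R) (fun x _ => dF x) (continuous_subspaceT cF).
rewrite in_itv/= subr0 mulr1 => /andP[c0 c1] ->.
have [d] := MVT c0 (fun x _ => dF' x) (continuous_subspaceT cF').
rewrite in_itv/= subr0 => /andP[d0 dc] ->.
rewrite normrM (ger0_norm (ltW c0)) -[leRHS]mulr1 ler_pM// ?(ltW c0)// ?(ltW c1)//.
by apply: hM; rewrite (ltW d0) ltW// (lt_trans dc).
Qed.

Lemma normc_cexp_taylor z :
 normc (cexp z - 1 - z) <= 2 * normc z ^+ 2 * expR (normc z).
Proof.
have D t : cderiv (fun x => cexp (x%:C * z)) t (z * cexp (t%:C * z)) by exact: cderiv_cexp.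
have D2 t : cderiv (fun x => z * cexp (x%:C * z)) t (z * (z * cexp (t%:C * z))).
 exact: cderivZ (D t).
have B (t : R) : 0 <= t <= 1 -> normc (z * (z * cexp (t%:C * z))) <= normc z ^+ 2 * expR (normc z).
 move=> /andP[t0 t1]; rewrite !normcM mulrA -expr2 ler_wpM2l ?sqr_ge0// normc_cexp ler_expR.
 rewrite cE/= mul0r subr0 (le_trans (ler_norm _))// normrM (ger0_norm t0).
 by rewrite -[leRHS]mul1r ler_pM// normc_Re.
have h1 := taylor1 (fun t => (D t).1) (fun t => (D2 t).1)
 (fun t h => le_trans (normc_Re _) (B t h)).
have h2 := taylor1 (fun t => (D t).2) (fun t => (D2 t).2)
 (fun t h => le_trans (normc_Im _) (B t h)).
apply: le_trans (normc_le _) _; rewrite -mulrA mulr2n mulrDl mul1r.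
move: h1 h2; rewrite !mul1r !mul0r cexp0 mulr1 => h1 h2.
by rewrite lerD// !cE.
Qed.

(** The Laplace transform, with the sign for which it decays on the left half
  plane: laplace f z = int f(t) e^(tz) dt. *)
Definition laplace (f : R -> R[i]) z : R[i] := cintegral mu (fun t => f t * cexp (t%:C * z)).

Definition blaplace u : R[i] -> R[i] := laplace (fun t => (u t)%:C).

Lemma cmeas_cexpX z : cmeasurable (fun t : R => cexp (t%:C * z)).
Proof.
by apply: cmeas_cexp; apply: cmeasM; [apply: cmeas_real|exact: cmeas_cst].
Qed.

Lemma bumpy_measurable a b u : bumpy a b u -> measurable_fun [set: R] u.
Proof. by move=> /bumpy_continuous; exact: measurable_continuous. Qed.

Lemma ReCM (t : R) z : Re (t%:C * z) = t * Re z.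
Proof. by rewrite cE/= mul0r subr0. Qed.

Lemma ImCM (t : R) z : Im (t%:C * z) = t * Im z.
Proof. by rewrite cE/= mul0r addr0. Qed.

Lemma bumpy_cexp_integrable a b u z : a < b -> bumpy a b u ->
 cintegrable mu (fun t => (u t)%:C * cexp (t%:C * z)).
Proof.
move=> ab bu; have [M hM] := bumpy_bounded bu.
pose B := (`|a| + `|b|) * normc z.
apply: (proj1 (@cintegr_oo _ a b (M * expR B) ab _ _)).
 apply: cmeasM; last exact: cmeas_cexpX.
 by apply: cmeas_real; exact: bumpy_measurable bu.
move=> t; case: ifPn => [/andP[ta tb]|h]; last by rewrite (bumpy_supp bu h) mul0r normc0.
rewrite normcM normc_real normc_cexp ler_pM ?expR_ge0// ler_expR ReCM.
apply: le_trans (ler_norm _) _; rewrite normrM ler_pM ?normc_Re//.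
rewrite ler_norml; apply/andP; split.
 by rewrite (le_trans _ (ltW ta))// lerNl (le_trans (ler_norm _))// normrN lerDl.
by rewrite (le_trans (ltW tb))// (le_trans (ler_norm _))// lerDr.
Qed.

Lemma blaplace_bounded a b u : a < b -> bumpy a b u -> exists C, forall z,
 (forall t, a < t < b -> t * Re z <= 0) -> normc (blaplace u z) <= C.
Proof.
move=> ab bu; have [M hM] := bumpy_bounded bu; exists (M * (b - a)) => z hz.
apply: (proj2 (@cintegr_oo _ a b M ab _ _)).
 apply: cmeasM; last exact: cmeas_cexpX.
 by apply: cmeas_real; exact: bumpy_measurable bu.
move=> t; case: ifPn => [h|h]; last by rewrite (bumpy_supp bu h) mul0r normc0.
rewrite normcM normc_real normc_cexp -[leRHS]mulr1 ler_pM ?expR_ge0//.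
by rewrite -expR0 ler_expR ReCM hz.
Qed.

(** Second order Taylor bound: the derivative of blaplace u is
  blaplace (t u). *)
Lemma blaplace_quad a b u z : a < b -> bumpy a b u ->
 (forall t, a < t < b -> t * Re z <= 0) ->
 exists K, forall w, normc w <= 1 ->
 normc (blaplace u (z + w) - blaplace u z - w * blaplace (fun t => t * u t) z)
  <= K * normc w ^+ 2.
Proof.
move=> ab bu hz; have [M hM] := bumpy_bounded bu.
pose B := `|a| + `|b|; exists (M * (2 * B ^+ 2 * expR B) * (b - a)) => w w1.
have i1 := bumpy_cexp_integrable (z + w) ab bu; have i2 := bumpy_cexp_integrable z ab bu.
have i3 := cintegrZl w (bumpy_cexp_integrable z ab (bumpy_mulX bu)).
have -> : blaplace u (z + w) - blaplace u z - w * blaplace (fun t => t * u t) z =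
 cintegral mu (fun t => (u t)%:C * cexp (t%:C * z) *
   (cexp (t%:C * w) - 1 - t%:C * w)).
 rewrite /blaplace /laplace -cintegralZl; last first.
  exact: (bumpy_cexp_integrable z ab (bumpy_mulX bu)).
 rewrite -cintegralB// -cintegralB//; last exact: cintegrB.
 apply: eq_cintegral => t; rewrite mulrDr cexpD.
 by rewrite rmorphM/=; ring.
rewrite [leRHS]mulrAC.
apply: (proj2 (@cintegr_oo _ a b _ ab _ _)).
 apply: cmeasM.
  apply: cmeasM; last exact: cmeas_cexpX.
  by apply: cmeas_real; exact: bumpy_measurable bu.
 apply: cmeasB; first by apply: cmeasB; [exact: cmeas_cexpX|exact: cmeas_cst].
 by apply: cmeasM; [exact: cmeas_real|exact: cmeas_cst].
move=> t; case: ifPn => [h|h]; last by rewrite (bumpy_supp bu h) !mul0r normc0.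
have tB : `|t| <= B.
 case/andP: h => ta tb; rewrite ler_norml; apply/andP; split.
  by rewrite (le_trans _ (ltW ta))// lerNl (le_trans (ler_norm _))// normrN lerDl.
 by rewrite (le_trans (ltW tb))// (le_trans (ler_norm _))// lerDr.
have B0 : 0 <= B by rewrite addr_ge0.
rewrite normcM -[leRHS]mulrA ler_pM ?normc_ge0//.
 rewrite normcM normc_real normc_cexp -[leRHS]mulr1 ler_pM ?expR_ge0//.
 by rewrite -expR0 ler_expR ReCM hz.
apply: le_trans (normc_cexp_taylor _) _; rewrite normcM normc_real.
rewrite exprMn mulrA [leRHS]mulrAC.
rewrite ler_pM ?expR_ge0//.
- by rewrite mulr_ge0 ?sqr_ge0// mulr_ge0 ?sqr_ge0.
- by rewrite ler_wpM2r ?sqr_ge0// ler_wpM2l// lerXn2r// nnegrE.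
- by rewrite ler_expR -[leRHS]mulr1 ler_pM ?normc_ge0.
Qed.

Lemma cderiv_blaplace a b u (s : R) : a < b -> bumpy a b u ->
 cderiv (fun x => blaplace u (0 +i* x)) s ('i%C * blaplace (fun t => t * u t) (0 +i* s)).
Proof.
move=> ab bu.
have [t _|K hK] := blaplace_quad (z := 0 +i* s) ab bu; first by rewrite /= mulr0.
have H h : `|h| < 1 -> normc (blaplace u (0 +i* (s + h)) - blaplace u (0 +i* s) -
  h%:C * ('i%C * blaplace (fun t => t * u t) (0 +i* s))) <= K * h ^+ 2.
 move=> h1; have := hK (0 +i* h).
 have -> : normc (0 +i* h) = `|h|.
  by rewrite /normc/= expr0n/= add0r sqrtr_sqr.
 move=> /(_ (ltW h1)); rewrite real_normK ?num_real//.
 have -> : (0 +i* s) + (0 +i* h) = 0 +i* (s + h) :> R[i].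
  by apply: eqcE; rewrite !cE/= ?addr0.
 have -> : 0 +i* h = h%:C * 'i%C :> R[i] by apply: eqcE; rewrite !cE/=; ring.
 by rewrite mulrA.
split; apply: (@is_derive_quad _ _ _ _ K 1) => // h h1; apply: le_trans (H h h1).
 by apply: le_trans (normc_Re _); rewrite !(@ReCM, @ReD, @ReN).
by apply: le_trans (normc_Im _); rewrite !(@ImCM, @ImD, @ImN).
Qed.

(** Integration by parts: multiplication by z is minus differentiation under
  the transform, so transforms of bumps decay faster than any power. *)
Lemma blaplace_mulz a b u u' z : a < b -> bumpy a b u -> bumpy a b u' ->
 (forall t, is_derive t 1 u (u' t)) -> z * blaplace u z = - blaplace u' z.
Proof.
move=> ab bu bu' du; apply/eqP; rewrite -addr_eq0; apply/eqP.
have i1 := bumpy_cexp_integrable z ab bu; have i2 := bumpy_cexp_integrable z ab bu'.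
have i1' := cintegrZl z i1.
rewrite /blaplace /laplace -cintegralZl// -cintegralD//.
have D t : cderiv (fun t => (u t)%:C * cexp (t%:C * z)) t
  (z * ((u t)%:C * cexp (t%:C * z)) + (u' t)%:C * cexp (t%:C * z)).
 apply: cderiv_eq (cderivM (cderiv_real (du t)) (cderiv_cexp z t)) _.
 by ring.
have C v v' : bumpy a b v -> bumpy a b v' -> (forall t, is_derive t 1 v (v' t)) ->
  ccont (fun t => (v t)%:C * cexp (t%:C * z)).
 move=> bv _ dv; apply: ccontM; first by apply: ccont_real; exact: bumpy_continuous bv.
 exact: ccont_is_cderive (cderiv_cexp z).
have [u'' bu'' du'] := bumpy_derive bu'.
have Z : forall t, (b < t) || (t < a) -> normc ((u t)%:C * cexp (t%:C * z)) = 0.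
 move=> t ht; rewrite (bumpy_supp bu) ?mul0r ?normc0// negb_and -!leNgt.
 by case/orP: ht => /ltW ->; rewrite ?orbT.
apply: cintegral_derive0 D _ _ _ _.
- apply: ccontD; last exact: C du'.
 by apply: ccontM; [exact: ccont_cst|exact: C du].
- exact: cintegrD.
- apply: cvg_near_cst; near=> t; apply: Z; apply/orP; left; near: t; apply: nbhs_pinfty_gt; exact: num_real.
- apply: cvg_near_cst; near=> t; apply: Z; apply/orP; right; near: t; apply: nbhs_ninfty_lt; exact: num_real.
Unshelve. all: by end_near.
Qed.

Lemma blaplace_decay a b u N : a < b -> bumpy a b u -> exists C, forall z,
 (forall t, a < t < b -> t * Re z <= 0) ->
 normc z ^+ N * normc (blaplace u z) <= C.
Proof.
move=> ab; elim: N u => [|N ih] u bu.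
 by have [C hC] := blaplace_bounded ab bu; exists C => z hz; rewrite expr0 mul1r hC.
have [u' bu' du] := bumpy_derive bu; have [C hC] := ih _ bu'.
exists C => z hz; rewrite exprSr -mulrA -normcM (blaplace_mulz z ab bu bu' du) normcN.
exact: hC.
Qed.

End laplace.

(** * Differentiability on the Heisenberg group *)

Section cdiff.
Context {R : realType}.
Local Notation R3 := (R * R * R)%type.
Implicit Types (p q : H1 R) (u v : H1 R -> R[i]) (a b c z w : R[i]).

Definition lin3 (a b c : R) (v : R3) : R := v.1.1 * a + v.1.2 * b + v.2 * c.

Lemma lin3_is_linear (a b c : R) : linear (lin3 a b c).
Proof. by move=> k [[x1 x2] x3] [[y1 y2] y3]; rewrite /lin3 /GRing.scale/=; rewrite /GRing.scale/=; ring. Qed.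

HB.instance Definition _ (a b c : R) :=
 GRing.isLinear.Build R R3 R _ (lin3 a b c) (lin3_is_linear a b c).

Lemma lin3_continuous (a b c : R) : continuous (lin3 a b c).
Proof.
have c1 : continuous (fun v : R3 => v.1.1).
 by move=> x; apply: (@cvg_comp _ _ _ (fst : R3 -> _) fst); [exact: cvg_fst|exact: cvg_fst].
have c2 : continuous (fun v : R3 => v.1.2).
 by move=> x; apply: (@cvg_comp _ _ _ (fst : R3 -> _) snd); [exact: cvg_fst|exact: cvg_snd].
have c3 : continuous (fun v : R3 => v.2) by move=> x; exact: cvg_snd.
move=> x; apply: cvgD; first apply: cvgD.
- by apply: cvgM; [exact: c1|exact: cvg_cst].
- by apply: cvgM; [exact: c2|exact: cvg_cst].
- by apply: cvgM; [exact: c3|exact: cvg_cst].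
Qed.

Lemma is_diff_quad (f : R3 -> R) (p : R3) (a b c K r : R) : 0 < r ->
 (forall v : R3, `|v| < r -> `|f (p + v) - f p - lin3 a b c v| <= K * `|v| ^+ 2) ->
 is_diff p f (lin3 a b c).
Proof.
move=> r0 H.
have O : f \o shift p = cst (f p) + lin3 a b c +o_ (0 : R3) id.
 apply/eqaddoP => e e0.
 have K1 : 0 < `|K| + 1 by rewrite ltr_wpDl.
 have eK : 0 < e / (`|K| + 1) by rewrite divr_gt0.
 near=> v.
 rewrite /= (_ : (_ - _) v = f (p + v) - f p - lin3 a b c v); last first.
  by rewrite /= !fctE/= [v + p]addrC opprD addrA.
 have vr : `|v| < r by near: v; exact: (@nbhs0_lt _ R3 _ r0).
 apply: le_trans (H v vr) _; rewrite expr2 mulrA ler_wpM2r//.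
 have : `|v| < e / (`|K| + 1) by near: v; exact: (@nbhs0_lt _ R3 _ eK).
 rewrite ltr_pdivlMr// => /ltW; apply: le_trans; rewrite mulrC ler_wpM2l//.
 by rewrite (le_trans (ler_norm _))// lerDl.
have D := @diff_unique _ _ _ f (lin3 a b c) p (@lin3_continuous a b c) O.
apply: DiffDef => //; apply/diff_locallyP; split; first by rewrite D; exact: lin3_continuous.
by rewrite D.
Unshelve. all: by end_near.
Qed.

(** The differential of u at p is a dx + b dy + c ds. *)
Definition cdiff u p a b c :=
 is_diff (p : R3) (fun q : R3 => Re (u q) : R)
  (lin3 (Re a) (Re b) (Re c)) /\
 is_diff (p : R3) (fun q : R3 => Im (u q) : R)
  (lin3 (Im a) (Im b) (Im c)).

Lemma cdiff_differentiable u p a b c : cdiff u p a b c ->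
 differentiable (fun q : R3 => Re (u q) : R) (p : R3) /\
 differentiable (fun q : R3 => Im (u q) : R) (p : R3).
Proof. by move=> [[d1 _] [d2 _]]. Qed.

Lemma cdiff_partials u p a b c : cdiff u p a b c ->
 [/\ dx u p = a, dy u p = b & ds u p = c].
Proof.
move=> [[d1 e1] [d2 e2]]; rewrite /dx /dy /ds /partial.
have D1 (v : R3) : 'D_v (fun q : R3 => Re (u q)) (p : R3) = lin3 (Re a) (Re b) (Re c) v.
 exact: etrans (deriveE v d1) (congr1 (fun f => f v) e1).
have D2 (v : R3) : 'D_v (fun q : R3 => Im (u q)) (p : R3) = lin3 (Im a) (Im b) (Im c) v.
 exact: etrans (deriveE v d2) (congr1 (fun f => f v) e2).
by split; rewrite D1 D2 /lin3 /= !(mul0r, mul1r, add0r, addr0); case: (a) (b) (c) => [? ?] [? ?] [].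
Qed.

Lemma cdiff_eq u p a b c a' b' c' : cdiff u p a b c -> a = a' -> b = b' -> c = c' ->
 cdiff u p a' b' c'.
Proof. by move=> h <- <- <-. Qed.

Lemma is_diff_eqf (f df dg : R3 -> R) (p : R3) : is_diff p f df -> (forall v : R3, df v = dg v) ->
 is_diff p f dg.
Proof. by move=> h e; have <- : df = dg by apply/funext. Qed.

Lemma cdiffD u v p a b c a' b' c' : cdiff u p a b c -> cdiff v p a' b' c' ->
 cdiff (fun q => u q + v q) p (a + a') (b + b') (c + c').
Proof.
move=> [u1 u2] [v1 v2]; split; under eq_fun do rewrite cE.
 by apply: is_diff_eqf (is_diffD u1 v1) _ => w; rewrite /lin3 /= !fctE/= !cE; ring.
by apply: is_diff_eqf (is_diffD u2 v2) _ => w; rewrite /lin3 /= !fctE/= !cE; ring.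
Qed.

Lemma cdiffM u v p a b c a' b' c' : cdiff u p a b c -> cdiff v p a' b' c' ->
 cdiff (fun q => u q * v q) p
  (a * v p + u p * a') (b * v p + u p * b') (c * v p + u p * c').
Proof.
move=> [u1 u2] [v1 v2]; split; under eq_fun do rewrite cE.
 apply: is_diff_eqf (is_diffB (is_diffM u1 v1) (is_diffM u2 v2)) _ => w.
 by rewrite /lin3 /= !fctE/= /GRing.scale/= !cE; ring.
apply: is_diff_eqf (is_diffD (is_diffM u1 v2) (is_diffM u2 v1)) _ => w.
by rewrite /lin3 /= !fctE/= /GRing.scale/= !cE; ring.
Qed.

Lemma cdiff_cst z p : cdiff (fun=> z) p 0 0 0.
Proof.
by split; apply: is_diff_eqf (is_diff_cst _ _) _ => w; rewrite /lin3/= !mulr0 !addr0.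
Qed.

Lemma cdiffZ z u p a b c : cdiff u p a b c ->
 cdiff (fun q => z * u q) p (z * a) (z * b) (z * c).
Proof.
by move=> h; apply: cdiff_eq (cdiffM (cdiff_cst z p) h) _ _ _; rewrite mul0r add0r.
Qed.

Lemma is_diff_coord (g : R3 -> R) (a b c : R) p : (forall v : R3, g v = lin3 a b c v) ->
 is_diff (p : R3) g (lin3 a b c).
Proof.
move=> e; have -> : g = lin3 a b c by apply/funext.
apply: (@is_diff_quad _ _ a b c 0 1) => // v _.
have -> : lin3 a b c (p + v) = lin3 a b c p + lin3 a b c v by rewrite /lin3/=; ring.
by rewrite (_ : _ - _ - _ = 0) ?normr0 ?mul0r//; ring.
Qed.

Lemma cdiff_coord (g : R3 -> R) (a b c : R) (f : R -> R[i]) p d :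
 (forall v : R3, g v = lin3 a b c v) -> cderiv f (g p) d ->
 cdiff (fun q => f (g q)) p (a%:C * d) (b%:C * d) (c%:C * d).
Proof.
move=> hg [f1 f2].
have C (F : R -> R) D : is_derive (g p) 1 F D -> is_diff (p : R3) (F \o g)
  (lin3 (a * D) (b * D) (c * D)).
 move=> [dF eF]; have dF' : differentiable F (g p) by apply/derivable1_diffP.
 have := @is_diff_comp _ _ _ _ g _ F _ p (is_diff_coord p hg) (differentiableP dF').
 move=> h; apply: is_diff_eqf h _ => v /=.
 by rewrite diff1E//= derive1E eF /lin3 /GRing.scale/=; ring.
split.
 by apply: is_diff_eqf (C _ _ f1) _ => v; rewrite !(@ReCM).
by apply: is_diff_eqf (C _ _ f2) _ => v; rewrite !(@ImCM).
Qed.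

Lemma cdiff_x f p d : cderiv f p.1.1 d -> cdiff (fun q => f q.1.1) p d 0 0.
Proof.
move=> h; have e (v : R3) : v.1.1 = lin3 1 0 0 v by rewrite /lin3; ring.
by apply: cdiff_eq (cdiff_coord e h) _ _ _; rewrite ?mul1r ?mul0r.
Qed.

Lemma cdiff_y f p d : cderiv f p.1.2 d -> cdiff (fun q => f q.1.2) p 0 d 0.
Proof.
move=> h; have e (v : R3) : v.1.2 = lin3 0 1 0 v by rewrite /lin3; ring.
by apply: cdiff_eq (cdiff_coord e h) _ _ _; rewrite ?mul1r ?mul0r.
Qed.

Lemma cdiff_s f p d : cderiv f p.2 d -> cdiff (fun q => f q.2) p 0 0 d.
Proof.
move=> h; have e (v : R3) : v.2 = lin3 0 0 1 v by rewrite /lin3; ring.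
by apply: cdiff_eq (cdiff_coord e h) _ _ _; rewrite ?mul1r ?mul0r.
Qed.

(** Complex differentiability on the closed left half plane, with quadratic
  remainder. *)
Definition hol (F F' : R[i] -> R[i]) := forall z, Re z <= 0 ->
 exists K, forall w, Re (z + w) <= 0 -> normc w <= 1 ->
  normc (F (z + w) - F z - w * F' z) <= K * normc w ^+ 2.

(** On functions of z = - (x^2+y^2) + i e s the Heisenberg derivatives act by
  complex differentiation; e = 1 gives holomorphic functions, e = -1 their
  conjugates. *)
Definition zc (e : R) p : R[i] := (- rho2 p) +i* (e * p.2).

Lemma Re_zc_le0 e p : Re (zc e p) <= 0.
Proof. by rewrite /= oppr_le0 addr_ge0// sqr_ge0. Qed.

Lemma cdiff_hol F F' e p : hol F F' -> cdiff (fun q => F (zc e q)) p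
 (- 2 * p.1.1%:C * F' (zc e p)) (- 2 * p.1.2%:C * F' (zc e p)) ('i%C * e%:C * F' (zc e p)).
Proof.
move=> hF; have [K hK] := hF _ (Re_zc_le0 e p).
set D := F' (zc e p).
pose C : R := 2 * `|p.1.1| + 2 * `|p.1.2| + 2 + `|e|.
have C0 : 0 < C by rewrite /C ltr_wpDr// ltr_wpDl// addr_ge0// mulr_ge0.
pose r := Num.min 1 (C^-1).
have r0 : 0 < r by rewrite lt_min ltr01 invr_gt0.
have H (v : R3) : `|v| < r ->
  normc (F (zc e (p + v)) - F (zc e p) - (v.1.1%:C * (- 2 * p.1.1%:C * D) +
   v.1.2%:C * (- 2 * p.1.2%:C * D) + v.2%:C * ('i%C * e%:C * D)))
  <= (`|K| * C ^+ 2 + 2 * normc D) * `|v| ^+ 2.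
 rewrite lt_min => /andP[v1 vC].
 have n1 : `|v.1.1| <= `|v| by rewrite !prod_normE !le_max lexx.
 have n2 : `|v.1.2| <= `|v| by rewrite !prod_normE !le_max lexx orbT.
 have n3 : `|v.2| <= `|v| by rewrite !prod_normE !le_max lexx orbT.
 pose w : R[i] := zc e (p + v) - zc e p.
 have Re_w : Re w = - (2 * p.1.1 * v.1.1 + 2 * p.1.2 * v.1.2 + (v.1.1 ^+ 2 + v.1.2 ^+ 2)).
  by rewrite /w !cE/= /rho2/=; ring.
 have Im_w : Im w = e * v.2 by rewrite /w !cE/=; ring.
 have q2 (x : R) : `|x| <= `|v| -> x ^+ 2 <= `|v| ^+ 2.
  by move=> h; rewrite -(real_normK (num_real x)) lerXn2r// nnegrE.
 have vv : `|v| ^+ 2 <= `|v| by rewrite expr2 -[leRHS]mulr1 ler_wpM2l// ltW.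
 have nw : normc w <= C * `|v|.
  apply: le_trans (normc_le _) _; rewrite Re_w Im_w normrN.
  have -> : C * `|v| = 2 * `|p.1.1| * `|v| + 2 * `|p.1.2| * `|v| + (`|v| + `|v|) + `|e| * `|v|.
   by rewrite /C; ring.
  rewrite normrM.
  rewrite lerD ?ler_wpM2l// (le_trans (ler_normD _ _))// lerD//.
   rewrite (le_trans (ler_normD _ _))// lerD//.
    by rewrite !normrM (@ger0_norm _ 2)// ler_wpM2l// mulr_ge0.
   by rewrite !normrM (@ger0_norm _ 2)// ler_wpM2l// mulr_ge0.
  rewrite ger0_norm ?addr_ge0 ?sqr_ge0//.
  by rewrite lerD// (le_trans _ vv)// q2.
 have w1 : normc w <= 1.
  apply: le_trans nw _; rewrite mulrC -ler_pdivlMr// mul1r; exact: ltW.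
 have zw : zc e (p + v) = zc e p + w by rewrite /w; ring.
 have hw : Re (zc e p + w) <= 0 by rewrite -zw Re_zc_le0.
 have := hK w hw w1; rewrite -/D zw => hK'.
 rewrite (_ : _ - _ - _ = (F (zc e p + w) - F (zc e p) - w * D) +
   (- (v.1.1 ^+ 2 + v.1.2 ^+ 2))%:C * D); last first.
  have -> : w = - (2 * p.1.1%:C * v.1.1%:C + 2 * p.1.2%:C * v.1.2%:C
    + (v.1.1 ^+ 2 + v.1.2 ^+ 2)%:C) + 'i%C * e%:C * v.2%:C.
   by apply: eqcE; rewrite ?Re_w ?Im_w !cE/=; ring.
  by rewrite rmorphN/=; ring.
 apply: le_normcD_trans; rewrite [leRHS]mulrDl lerD//.
  apply: le_trans hK' _; rewrite -mulrA; apply: (@le_trans _ _ (`|K| * normc w ^+ 2)).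
   by rewrite ler_wpM2r ?sqr_ge0// ler_norm.
  by rewrite ler_wpM2l// -exprMn lerXn2r// nnegrE ?normc_ge0// mulr_ge0// ltW.
 rewrite normcM normc_real normrN ger0_norm ?addr_ge0 ?sqr_ge0// mulrAC ler_wpM2r ?normc_ge0//.
 by rewrite mulr2n mulrDl mul1r lerD// q2.
split; apply: (@is_diff_quad _ _ _ _ _ (`|K| * C ^+ 2 + 2 * normc D) r) => // v vr.
 apply: le_trans (H v vr); apply: le_trans (normc_Re _).
 by rewrite /lin3 !(@ReD, @ReN, @ReCM).
apply: le_trans (H v vr); apply: le_trans (normc_Im _).
by rewrite /lin3 !(@ImD, @ImN, @ImCM).
Qed.

Lemma holM F F' G G' : hol F F' -> hol G G' ->
 hol (fun z => F z * G z) (fun z => F' z * G z + F z * G' z).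
Proof.
move=> hF hG z z0; have [K hK] := hF z z0; have [M hM] := hG z z0.
have nz := normc_ge0.
exists (`|K| * (normc (G z) + normc (G' z) + `|M|) + normc (F' z) * (normc (G' z) + `|M|)
  + normc (F z) * `|M|) => w zw w1.
have w0 := normc_ge0 w.
have w2 : normc w ^+ 2 <= normc w by rewrite expr2 -[leRHS]mulr1 ler_wpM2l.
have hK' : normc (F (z + w) - F z - w * F' z) <= `|K| * normc w ^+ 2.
 by apply: le_trans (hK w zw w1) _; rewrite ler_wpM2r ?sqr_ge0// ler_norm.
have hM' : normc (G (z + w) - G z - w * G' z) <= `|M| * normc w ^+ 2.
 by apply: le_trans (hM w zw w1) _; rewrite ler_wpM2r ?sqr_ge0// ler_norm.
have dG : normc (G (z + w) - G z) <= (normc (G' z) + `|M|) * normc w.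
 rewrite (_ : _ - _ = (G (z + w) - G z - w * G' z) + w * G' z); last by ring.
 apply: le_normcD_trans; rewrite addrC mulrDl normcM [normc w * _]mulrC lerD2l.
 by apply: le_trans hM' _; rewrite ler_wpM2l.
have bG : normc (G (z + w)) <= normc (G z) + normc (G' z) + `|M|.
 rewrite (_ : G (z + w) = G z + (G (z + w) - G z)); last by ring.
 apply: le_normcD_trans; rewrite -addrA lerD2l; apply: le_trans dG _.
 by rewrite -[leRHS]mulr1 ler_wpM2l// addr_ge0 ?nz.
rewrite (_ : _ - _ - _ = (F (z + w) - F z - w * F' z) * G (z + w) +
 w * F' z * (G (z + w) - G z) + F z * (G (z + w) - G z - w * G' z)); last by ring.
apply: le_normcD_trans; rewrite [leRHS]mulrDl lerD//; last first.
 by rewrite normcM -mulrA ler_wpM2l ?nz.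
apply: le_normcD_trans; rewrite [leRHS]mulrDl lerD//.
 by rewrite normcM mulrAC ler_pM ?nz.
rewrite !normcM (_ : _ * normc w ^+ 2 =
 normc w * normc (F' z) * ((normc (G' z) + `|M|) * normc w)); last by ring.
by rewrite ler_wpM2l ?mulr_ge0 ?nz.
Qed.

End cdiff.

(** * Schwartz functions *)

Section schwartz_class.
Context {R : realType}.
Implicit Types (p q : H1 R) (u : H1 R -> R[i]) (e : R).

Definition rapid u := forall N : nat, exists M : R, forall p : H1 R,
 (1 + rho2 p + p.2 ^+ 2) ^+ N * normc (u p) <= M.

Lemma weight_ge1 p : 1 <= 1 + rho2 p + p.2 ^+ 2.
Proof. by rewrite -addrA lerDl addr_ge0 ?sqr_ge0// addr_ge0 ?sqr_ge0. Qed.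

Inductive cspan (G : (H1 R -> R[i]) -> Prop) : (H1 R -> R[i]) -> Prop :=
| cspan_gen u : G u -> cspan G u
| cspan_add (u v : H1 R -> R[i]) : cspan G u -> cspan G v -> cspan G (fun p => u p + v p)
| cspan_scale (c : R[i]) u : cspan G u -> cspan G (fun p => c * u p).

(** Schwartz functions by coinduction: a family of rapidly decreasing functions
  whose derivatives stay in its span consists of Schwartz functions. *)
Lemma schwartz_cspan (G : (H1 R -> R[i]) -> Prop) :
 (forall u, G u -> rapid u /\ exists ux uy us, [/\ cspan G ux, cspan G uy, cspan G us &
   forall p, cdiff u p (ux p) (uy p) (us p)]) ->
 forall u, cspan G u -> schwartz u.
Proof.
move=> hG.
have H u : cspan G u -> rapid u /\ exists ux uy us, [/\ cspan G ux, cspan G uy, cspan G us &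
   forall p, cdiff u p (ux p) (uy p) (us p)].
 elim=> [w /hG//|w w' _ [hr [wx [wy [ws [h1 h2 h3 h4]]]]] _ [hr' [wx' [wy' [ws' [h1' h2' h3' h4']]]]]
  |c w _ [hr [wx [wy [ws [h1 h2 h3 h4]]]]]].
  split.
   move=> N; have [M hM] := hr N; have [M' hM'] := hr' N; exists (M + M') => p.
   apply: le_trans (lerD (hM p) (hM' p)); rewrite -mulrDr ler_wpM2l ?le_normcD//.
   by rewrite exprn_ge0// (le_trans ler01) ?weight_ge1.
  exists (fun p => wx p + wx' p), (fun p => wy p + wy' p), (fun p => ws p + ws' p).
  split; try exact: cspan_add.
  by move=> p; exact: cdiffD.
 split.
  move=> N; have [M hM] := hr N; exists (normc c * M) => p.
  by rewrite normcM mulrCA ler_wpM2l ?normc_ge0.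
 exists (fun p => c * wx p), (fun p => c * wy p), (fun p => c * ws p).
 split; try exact: cspan_scale.
 by move=> p; exact: cdiffZ.
have Hs u : cspan G u -> [/\ cspan G (dx u), cspan G (dy u) & cspan G (ds u)].
 move=> /H[_ [ux [uy [us [h1 h2 h3 h4]]]]].
 have -> : dx u = ux by apply/funext => p; have [] := cdiff_partials (h4 p).
 have -> : dy u = uy by apply/funext => p; have [] := cdiff_partials (h4 p).
 by have -> : ds u = us by apply/funext => p; have [] := cdiff_partials (h4 p).
move=> u Gu a b c D.
have GD : cspan G D.
 have h1 : cspan G (iter c (@ds R) u) by elim: c {D} => //= c ih; have [] := Hs _ ih.
 have h2 : cspan G (iter b (@dy R) (iter c (@ds R) u)).
  by elim: b {D} => //= b ih; have [] := Hs _ ih.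
 by rewrite /D; elim: a {D} => //= a ih; have [] := Hs _ ih.
have [hr [ux [uy [us [_ _ _ hd]]]]] := H _ GD; split => // p.
exact: cdiff_differentiable (hd p).
Qed.

Definition rapid1 (f : R -> R[i]) := exists P : (R -> R[i]) -> Prop, P f /\
 forall v : R -> R[i], P v -> (forall N, exists M, forall t, (1 + t ^+ 2) ^+ N * normc (v t) <= M) /\
  exists2 w, P w & forall t, cderiv v t (w t).

Lemma schwartz_tensor f g k : rapid1 f -> rapid1 g -> rapid1 k ->
 schwartz (fun p : H1 R => f p.1.1 * g p.1.2 * k p.2).
Proof.
move=> [Pf [Pff hf]] [Pg [Pgg hg]] [Pk [Pkk hk]].
pose G u := exists f g k, [/\ Pf f, Pg g, Pk k & forall p, u p = f p.1.1 * g p.1.2 * k p.2].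
apply: (@schwartz_cspan G); last by apply: cspan_gen; exists f, g, k.
move=> u [{Pff Pgg Pkk}f' [g' [k' [Pf' Pg' Pk' eu]]]].
have {eu} -> : u = fun p => f' p.1.1 * g' p.1.2 * k' p.2 by apply/funext.
have [rf [fd Pfd df]] := hf _ Pf'; have [rg [gd Pgd dg]] := hg _ Pg'.
have [rk [kd Pkd dk]] := hk _ Pk'; split.
 move=> N; have [M hM] := rf N; have [M' hM'] := rg N; have [M'' hM''] := rk N.
 exists (M * M' * M'') => p.
 have W (t : R) : 1 <= 1 + t ^+ 2 by rewrite lerDl sqr_ge0.
 have W0 (t : R) : 0 <= 1 + t ^+ 2 by rewrite (le_trans ler01).
 have w : 1 + rho2 p + p.2 ^+ 2 <= (1 + p.1.1 ^+ 2) * (1 + p.1.2 ^+ 2) * (1 + p.2 ^+ 2).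
  rewrite /rho2; move: (sqr_ge0 p.1.1) (sqr_ge0 p.1.2) (sqr_ge0 p.2).
  move: (p.1.1 ^+ 2) (p.1.2 ^+ 2) (p.2 ^+ 2) => x y s hx hy hs.
  have := mulr_ge0 hx hy; have := mulr_ge0 hx hs; have := mulr_ge0 hy hs.
  by have := mulr_ge0 (mulr_ge0 hx hy) hs; lra.
 apply: (@le_trans _ _ (((1 + p.1.1 ^+ 2) ^+ N * normc (f' p.1.1)) *
   ((1 + p.1.2 ^+ 2) ^+ N * normc (g' p.1.2)) * ((1 + p.2 ^+ 2) ^+ N * normc (k' p.2)))).
  rewrite !normcM [leRHS](_ : _ = ((1 + p.1.1 ^+ 2) * (1 + p.1.2 ^+ 2) * (1 + p.2 ^+ 2)) ^+ N *
    (normc (f' p.1.1) * normc (g' p.1.2) * normc (k' p.2))); last first.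
   by rewrite !exprMn; ring.
  rewrite ler_wpM2r ?mulr_ge0 ?normc_ge0// lerXn2r// nnegrE.
   by rewrite (le_trans ler01) ?weight_ge1.
  by rewrite !mulr_ge0.
 by rewrite !ler_pM// ?mulr_ge0 ?exprn_ge0 ?normc_ge0.
exists (fun p => fd p.1.1 * g' p.1.2 * k' p.2), (fun p => f' p.1.1 * gd p.1.2 * k' p.2),
  (fun p => f' p.1.1 * g' p.1.2 * kd p.2); split.
- by apply: cspan_gen; exists fd, g', k'.
- by apply: cspan_gen; exists f', gd, k'.
- by apply: cspan_gen; exists f', g', kd.
move=> p; have := cdiffM (cdiffM (cdiff_x (df p.1.1)) (cdiff_y (dg p.1.2))) (cdiff_s (dk p.2)).
by move=> h; apply: cdiff_eq h _ _ _; rewrite !(mul0r, mulr0, add0r, addr0).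
Qed.

Lemma bumpy_rapid1 a b f : bumpy a b f -> rapid1 (fun t => (f t)%:C).
Proof.
move=> bf; exists (fun v : R -> R[i] => exists2 g, bumpy a b g & v = fun t => (g t)%:C); split.
 by exists f.
move=> v [g bg ->]; split.
 move=> N; have [M hM] := bumpy_bounded bg.
 exists ((1 + (`|a| + `|b|) ^+ 2) ^+ N * M) => t; rewrite normc_real.
 have p0 (x : R) : 0 <= 1 + x ^+ 2 by rewrite addr_ge0 ?sqr_ge0.
 have [/andP[ta tb]|h] := boolP (a < t < b); last first.
  by rewrite (bumpy_supp bg h) normr0 mulr0 mulr_ge0 ?exprn_ge0// (le_trans _ (hM t)).
 rewrite ler_pM ?exprn_ge0// lerXn2r ?nnegrE// lerD2l -(real_normK (num_real t)).
 rewrite lerXn2r ?nnegrE ?addr_ge0// ler_norml; apply/andP; split.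
  by rewrite (le_trans _ (ltW ta))// lerNl (le_trans (ler_norm _))// normrN lerDl.
 by rewrite (le_trans (ltW tb))// (le_trans (ler_norm _))// lerDr.
have [w bw dw] := bumpy_derive bg; exists (fun t => (w t)%:C); first by exists w.
by move=> t; exact: cderiv_real.
Qed.

Lemma blaplace_rapid1 a b f : a < b -> bumpy a b f ->
 rapid1 (fun t : R => blaplace f (0 +i* t)).
Proof.
move=> ab bf.
exists (fun v : R -> R[i] => exists2 g, bumpy a b g & exists c : R[i], v = fun t => c * blaplace g (0 +i* t)).
split; first by exists f => //; exists 1; apply/funext => t; rewrite mul1r.
move=> v [g bg [c ->]]; split.
 move=> N; have [C hC] := blaplace_decay (N.*2) ab bg; have [C' hC'] := blaplace_decay 0 ab bg.
 exists (normc c * (2 ^+ N * (C + C'))) => t; rewrite normcM mulrCA ler_wpM2l ?normc_ge0//.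
 have z0 s : a < s < b -> s * Re (0 +i* t) <= 0 by rewrite /= mulr0.
 have := hC _ z0; have := hC' _ z0; rewrite expr0 mul1r.
 have -> : normc (0 +i* t) = `|t| by rewrite /normc expr0n/= add0r sqrtr_sqr.
 rewrite -mul2n exprM real_normK ?num_real//.
 set n := normc _ => h1 h2; have n0 : 0 <= n by exact: normc_ge0.
 have : (1 + t ^+ 2) ^+ N <= 2 ^+ N * (t ^+ 2 ^+ N + 1).
  have t0 := sqr_ge0 t; have t1 : 0 <= 1 + t ^+ 2 by rewrite addr_ge0.
  have [h|h] := leP 1 (t ^+ 2).
   apply: (@le_trans _ _ ((2 * t ^+ 2) ^+ N)).
    rewrite lerXn2r ?nnegrE//; first by rewrite mulr_ge0.
    by rewrite [leRHS](_ : _ = t ^+ 2 + t ^+ 2) ?lerD2r//; ring.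
   by rewrite exprMn ler_wpM2l ?exprn_ge0// lerDl.
  apply: (@le_trans _ _ (2 ^+ N)).
   by rewrite lerXn2r ?nnegrE// [leRHS](_ : _ = 1 + 1) ?lerD2l ?ltW.
  by rewrite -[leLHS]mulr1 ler_wpM2l ?exprn_ge0// lerDr exprn_ge0.
 move=> /(ler_wpM2r n0) h; apply: le_trans h _; rewrite -mulrA ler_wpM2l ?exprn_ge0//.
 by rewrite mulrDl mul1r lerD.
exists (fun t => (c * 'i%C) * blaplace (fun s => s * g s) (0 +i* t)).
 by exists (fun s => s * g s); [exact: bumpy_mulX|exists (c * 'i%C)].
by move=> t; rewrite -mulrA; apply: cderivZ; exact: cderiv_blaplace ab bg.
Qed.

Definition expcut b (k : nat) (t : R) : R := flat k (t + 1) * expR (- (b * t)).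

Inductive expcut_span b : (R -> R[i]) -> Prop :=
| expcut0 : expcut_span b (fun=> 0)
| expcut_add (v : R -> R[i]) c j : expcut_span b v ->
  expcut_span b (fun t => v t + (c * expcut b j t)%:C).

Lemma expcut_rapid1 b k : 0 < b -> rapid1 (fun t => (expcut b k t)%:C).
Proof.
move=> b0.
exists (expcut_span b); split.
 rewrite (_ : (fun t => _) = fun t => 0 + (1 * expcut b k t)%:C).
  exact: (expcut_add _ _ (expcut0 b)).
 by apply/funext => t; rewrite add0r mul1r.
have der (j : nat) (t : R) : is_derive t 1 (expcut b j)
  (expcut b j.+2 t + (- j%:R) * expcut b j.+1 t + (- b) * expcut b j t).
 have d1 : is_derive t 1 (fun s : R => s + 1) 1 by apply: is_derive_eq; rewrite addr0.
 have d2 : is_derive t 1 (fun s : R => - (b * s)) (- b).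
  by apply: is_derive_eq; rewrite /GRing.scale/= mulr1.
 have e1 := @is_derive1_comp _ (flat j) (fun s : R => s + 1) t _ _ (is_derive_flat j (t + 1)) d1.
 have e2 := @is_derive1_comp _ expR (fun s : R => - (b * s)) t _ _ (is_derive_expR _) d2.
 by have := is_deriveM e1 e2 => /is_derive_eq; apply; rewrite /GRing.scale/= /expcut; ring.
have dec j N : exists M, forall t, (1 + t ^+ 2) ^+ N * `|expcut b j t| <= M.
 pose F : R := j.+1%:R ^+ j.
 have F0 : 0 <= F by rewrite exprn_ge0.
 exists (2 ^+ N * F * expR b + (2 ^+ N * F) * ((N.*2.+1)%:R / b) ^+ N.*2) => t.
 have A0 : 0 <= 2 ^+ N * F * expR b by rewrite !mulr_ge0 ?exprn_ge0 ?expR_ge0.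
 have B0 : 0 <= (2 ^+ N * F) * ((N.*2.+1)%:R / b) ^+ N.*2.
  by rewrite !mulr_ge0 ?exprn_ge0// divr_ge0 ?ler0n ?(ltW b0).
 have t1 : 0 <= 1 + t ^+ 2 by rewrite addr_ge0 ?sqr_ge0.
 have [tm|tm] := leP t (-1).
  by rewrite /expcut /flat ltNge (_ : t + 1 <= 0) /= ?mul0r ?normr0 ?mulr0 ?addr_ge0//; lra.
 have h1 : `|expcut b j t| <= F * expR (- (b * t)).
  by rewrite normrM (ger0_norm (expR_ge0 _)) ler_wpM2r ?expR_ge0 ?flat_bounded.
 have [t1'|t1'] := leP 1 t; last first.
  apply: le_trans (_ : 2 ^+ N * F * expR b <= _); last by rewrite lerDl.
  rewrite -mulrA ler_pM ?exprn_ge0//.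
   rewrite lerXn2r ?nnegrE//.
   by have : t ^+ 2 <= 1; [rewrite -[leRHS](expr1n _ 2) -(real_normK (num_real t)) lerXn2r ?nnegrE// ler_norml ltW//= ltW|lra].
  apply: le_trans h1 _; rewrite ler_wpM2l// ler_expR -mulrN -[leRHS]mulr1 ler_wpM2l// ?(ltW b0)//.
  by lra.
 apply: le_trans (_ : 2 ^+ N * F * ((N.*2.+1)%:R / b) ^+ N.*2 <= _); last by rewrite lerDr.
 have t0 : 0 <= t by rewrite (le_trans ler01).
 have h2 : (1 + t ^+ 2) ^+ N <= 2 ^+ N * t ^+ N.*2.
  rewrite -mul2n exprM -exprMn lerXn2r ?nnegrE//.
   by rewrite mulr_ge0 ?sqr_ge0.
  by rewrite [leRHS](_ : _ = t ^+ 2 + t ^+ 2) ?lerD2r ?exprn_ege1//; ring.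
 have h3 := powle_expR N.*2 b0 t0.
 have h4 := ler_pM (exprn_ge0 _ t1) (normr_ge0 _) h2 h1.
 apply: le_trans h4 _.
 rewrite expRN mulrA ler_pdivrMr ?expR_gt0//.
 by rewrite mulrAC -[leRHS]mulrA ler_wpM2l// mulr_ge0// exprn_ge0.
move=> v; elim=> [|{}v c j Pv ih].
 split; first by move=> N; exists 0 => t; rewrite normc0 mulr0.
 by exists (fun=> 0); [exact: expcut0|move=> t; exact: cderiv_cst].
have [rw [w' Pw' dw]] := ih; split.
 move=> N; have [M hM] := rw N; have [M' hM'] := dec j N.
 exists (M + `|c| * M') => t.
 have t1 : 0 <= (1 + t ^+ 2) ^+ N by rewrite exprn_ge0// addr_ge0 ?sqr_ge0.
 apply: le_trans (ler_wpM2l t1 (le_normcD _ _)) _; rewrite mulrDr lerD//.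
 by rewrite normc_real normrM mulrCA ler_wpM2l.
exists (fun t => w' t + (c * expcut b j.+2 t)%:C + (c * - j%:R * expcut b j.+1 t)%:C
  + (c * - b * expcut b j t)%:C).
 by do 3 apply: expcut_add.
move=> t; apply: cderiv_eq (cderivD (dw t) (cderiv_real (is_deriveZ c (der j t)))) _.
by rewrite /GRing.scale/= -!addrA -!rmorphD/=; congr (_ + _); congr (_%:C); ring.
Qed.

End schwartz_class.

(** * Functions of z = - (x^2+y^2) + i s *)

Section holomorphic.
Context {R : realType}.
Implicit Types (p q : H1 R) (F G : R[i] -> R[i]) (z w : R[i]) (e a b : R).

Lemma hol_eq F F' G' : hol F F' -> (forall z, Re z <= 0 -> F' z = G' z) -> hol F G'.
Proof. by move=> h e z z0; have [K hK] := h z z0; exists K => w; rewrite -e//; exact: hK. Qed.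

Lemma hol_cst (c : R[i]) : hol (fun=> c) (fun=> 0).
Proof. by move=> z _; exists 0 => w _ _; rewrite subrr mulr0 subrr normc0 mul0r. Qed.

Lemma holD F F' G G' : hol F F' -> hol G G' -> hol (fun z => F z + G z) (fun z => F' z + G' z).
Proof.
move=> hF hG z z0; have [K hK] := hF z z0; have [M hM] := hG z z0.
exists (K + M) => w h1 h2; rewrite mulrDl; apply: le_trans (lerD (hK w h1 h2) (hM w h1 h2)).
rewrite [X in normc X <= _](_ : _ = (F (z + w) - F z - w * F' z) +
 (G (z + w) - G z - w * G' z)); [exact: le_normcD|ring].
Qed.

Lemma holZ c F F' : hol F F' -> hol (fun z => c * F z) (fun z => c * F' z).
Proof.
by move=> /(holM (hol_cst c)) /hol_eq; apply => z _; rewrite mul0r add0r.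
Qed.

Lemma normc_1B z : Re z <= 0 -> 1 <= normc (1 - z).
Proof.
move=> z0; apply: le_trans (normc_Re _); rewrite !cE/=.
by rewrite ger0_norm; [rewrite lerDl oppr_ge0|rewrite addr_ge0// oppr_ge0].
Qed.

Lemma neq_1B z : Re z <= 0 -> 1 - z != 0.
Proof. by move=> /normc_1B h; rewrite -normc_gt0 (lt_le_trans _ h). Qed.

Lemma normc_inv_1B z : Re z <= 0 -> normc (1 - z)^-1 <= 1.
Proof. by move=> z0; have h := normc_1B z0; rewrite normcV invf_le1 ?(lt_le_trans ltr01). Qed.

Lemma hol_inv : hol (fun z => (1 - z)^-1) (fun z => (1 - z)^-1 ^+ 2 : R[i]).
Proof.
move=> z z0; exists 1 => w zw _; rewrite mul1r.
have n1 := neq_1B z0; have n2 := neq_1B zw.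
rewrite (_ : _ - _ - _ = w ^+ 2 * ((1 - z)^-1 ^+ 2 * (1 - (z + w))^-1)); last first.
 by field; rewrite n1 n2.
rewrite normcM normcX -[leRHS]mulr1 ler_wpM2l ?sqr_ge0// normcM normcX -[leRHS]mulr1.
by rewrite ler_pM ?exprn_ge0 ?normc_ge0 ?exprn_ile1 ?normc_ge0 ?normc_inv_1B.
Qed.

Lemma hol_pow k : hol (fun z => (1 - z)^-1 ^+ k) (fun z => k%:R * (1 - z)^-1 ^+ k.+1).
Proof.
elim: k => [|k ih].
 by apply: hol_eq (hol_cst 1) _ => z _; rewrite mul0r.
have := holM hol_inv ih; under eq_fun do rewrite -exprS.
by move=> /hol_eq; apply => z _; rewrite !exprS -natr1; ring.
Qed.

Lemma hol_blaplace a b f : 0 <= a -> a < b -> bumpy a b f ->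
 hol (blaplace f) (blaplace (fun t => t * f t)).
Proof.
move=> a0 ab bf z z0.
have [t /andP[ta _]|K hK] := blaplace_quad (z := z) ab bf.
 by rewrite mulr_ge0_le0// (le_trans a0) ?ltW.
by exists K => w _; exact: hK.
Qed.

Lemma hol_scale (r : R) F F' : 0 <= r -> r <= 1 -> hol F F' ->
 hol (fun z => F (r%:C * z)) (fun z => r%:C * F' (r%:C * z)).
Proof.
move=> r0 r1 hF z z0; have rz y : Re y <= 0 -> Re (r%:C * y) <= 0.
 by rewrite ReCM => h; rewrite mulr_ge0_le0.
have [K hK] := hF _ (rz _ z0); exists (`|K| * r ^+ 2) => w zw w1.
have := hK (r%:C * w); rewrite -mulrDr => /(_ (rz _ zw)).
rewrite normcM normc_real ger0_norm// => h.
have {}h := h (mulr_ile1 r0 (normc_ge0 _) r1 w1).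
rewrite mulrA [w * _]mulrC; apply: le_trans h _; rewrite exprMn mulrA.
by rewrite !ler_wpM2r ?sqr_ge0// ler_norm.
Qed.

Definition hfun (k : nat) (f : R -> R) (r : R) z : R[i] :=
 (1 - z)^-1 ^+ k * blaplace f (r%:C * z).

Lemma hol_hfun a b f k r : 0 <= a -> a < b -> bumpy a b f -> 0 <= r -> r <= 1 ->
 hol (hfun k f r) (fun z => k%:R * hfun k.+1 f r z + r%:C * hfun k (fun t => t * f t) r z).
Proof.
move=> a0 ab bf r0 r1.
have := holM (hol_pow k) (hol_scale r0 r1 (hol_blaplace a0 ab bf)).
by move=> /hol_eq; apply => z _; rewrite /hfun; ring.
Qed.

Lemma weight_split (x : R) N : 0 <= x -> (1 + x) ^+ N <= 2 ^+ N * (x ^+ N + 1).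
Proof.
move=> x0; have x1 : 0 <= 1 + x by rewrite addr_ge0.
have [h|h] := leP 1 x.
 apply: (@le_trans _ _ ((2 * x) ^+ N)).
  rewrite lerXn2r ?nnegrE//; first by rewrite mulr_ge0.
  by rewrite [leRHS](_ : _ = x + x) ?lerD2r//; ring.
 by rewrite exprMn ler_wpM2l ?exprn_ge0// lerDl.
apply: (@le_trans _ _ (2 ^+ N)).
 by rewrite lerXn2r ?nnegrE// [leRHS](_ : _ = 1 + 1) ?lerD2l ?ltW.
by rewrite -[leLHS]mulr1 ler_wpM2l ?exprn_ge0// lerDr exprn_ge0.
Qed.

Lemma blaplace_weight a b f N : 0 <= a -> a < b -> bumpy a b f -> exists C, forall z,
 Re z <= 0 -> (1 + normc z) ^+ N * normc (blaplace f z) <= C.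
Proof.
move=> a0 ab bf; have [C hC] := blaplace_decay N ab bf; have [C' hC'] := blaplace_decay 0 ab bf.
exists (2 ^+ N * (C + C')) => z z0.
have z0' t : a < t < b -> t * Re z <= 0.
 by move=> /andP[ta _]; rewrite mulr_ge0_le0// (le_trans a0) ?ltW.
have := hC _ z0'; have := hC' _ z0'; rewrite expr0 mul1r => h1 h2.
have := ler_wpM2r (normc_ge0 (blaplace f z)) (weight_split N (normc_ge0 z)).
by move=> h; apply: le_trans h _; rewrite -mulrA ler_wpM2l ?exprn_ge0// mulrDl mul1r lerD.
Qed.

Lemma normc_zc_ge e p : e ^+ 2 = 1 ->
 rho2 p <= normc (zc e p) /\ `|p.2| <= normc (zc e p).
Proof.
move=> e1; have h1 := normc_Re (zc e p); have h2 := normc_Im (zc e p).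
split; first by apply: le_trans h1; rewrite /= normrN ler_norm.
apply: le_trans h2; rewrite /= normrM.
by rewrite (_ : `|e| = 1) ?mul1r//; apply/eqP; rewrite -(@eqrXn2 _ 2)// expr1n real_normK ?num_real ?e1.
Qed.

Lemma zc_weight e p : e ^+ 2 = 1 -> [/\ 1 + rho2 p + p.2 ^+ 2 <= (1 + normc (zc e p)) ^+ 2,
 `|p.1.1| <= 1 + normc (zc e p) & `|p.1.2| <= 1 + normc (zc e p)].
Proof.
move=> e1; have [h1 h2] := normc_zc_ge p e1; move: h1 h2; set n := normc _ => h1 h2.
have n0 : 0 <= n by exact: normc_ge0.
have X (x : R) : `|x| <= 1 + x ^+ 2.
 rewrite -(real_normK (num_real x)); have := sqr_ge0 (1 - `|x|).
 have := normr_ge0 x; move: `|x| => y y0; rewrite sqrrB mul1r expr1n => h; lra.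
have q0 := sqr_ge0 p.1.1; have q0' := sqr_ge0 p.1.2.
split.
- have : p.2 ^+ 2 <= n ^+ 2 by rewrite -(real_normK (num_real p.2)) lerXn2r// nnegrE.
 by move=> h; rewrite sqrrD expr1n mul1r -mulr_natl; lra.
- by apply: le_trans (X _) _; rewrite lerD2l; apply: le_trans h1; rewrite lerDl.
- by apply: le_trans (X _) _; rewrite lerD2l; apply: le_trans h1; rewrite lerDr.
Qed.

(** The test functions x^i y^j (1 - z)^-k E(r z), with E the transform of a
  bump supported in the positive half line, are Schwartz functions. *)
Definition hgen (a b e : R) (u : H1 R -> R[i]) := exists i j k f r, [/\ bumpy a b f, 0 < r, r <= 1 &
 u = fun p => (p.1.1 ^+ i)%:C * (p.1.2 ^+ j)%:C * hfun k f r (zc e p)].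

Lemma schwartz_hspan a b e u : 0 <= a -> a < b -> e ^+ 2 = 1 -> cspan (hgen a b e) u -> schwartz u.
Proof.
move=> a0 ab e1; apply: schwartz_cspan => {}u [i [j [k [f [r [bf r0 r1 ->]]]]]]; split.
 move=> N; pose m := (2 * N + i + j)%N.
 have [C hC] := blaplace_weight m a0 ab bf.
 exists ((r^-1) ^+ m * C) => p.
 have [w1 w2 w3] := zc_weight p e1.
 have z0 := Re_zc_le0 e p; have n0 := normc_ge0 (zc e p).
 have n1 : 0 <= 1 + normc (zc e p) by rewrite addr_ge0.
 have rz : Re (r%:C * zc e p) <= 0 by rewrite ReCM mulr_ge0_le0// ltW.
 rewrite /hfun !normcM !normc_real.
 apply: (@le_trans _ _ ((1 + normc (zc e p)) ^+ m * normc (blaplace f (r%:C * zc e p)))).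
  have -> : (1 + normc (zc e p)) ^+ m = ((1 + normc (zc e p)) ^+ 2) ^+ N *
    (1 + normc (zc e p)) ^+ i * (1 + normc (zc e p)) ^+ j.
   by rewrite /m exprD exprD exprM.
  rewrite -!mulrA ler_pM ?exprn_ge0//.
  - by rewrite (le_trans ler01) ?weight_ge1.
  - by rewrite !mulr_ge0// normc_ge0.
  - by rewrite lerXn2r ?nnegrE// ?sqr_ge0// (le_trans ler01) ?weight_ge1.
  rewrite ler_pM//; first by rewrite !mulr_ge0// normc_ge0.
   by rewrite normrX lerXn2r ?nnegrE.
  rewrite ler_pM//; first by rewrite !mulr_ge0// normc_ge0.
   by rewrite normrX lerXn2r ?nnegrE.
  by rewrite ler_piMl ?normc_ge0// normcX exprn_ile1 ?normc_ge0 ?normc_inv_1B.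
 apply: le_trans (_ : (r^-1) ^+ m * ((1 + normc (r%:C * zc e p)) ^+ m * normc (blaplace f (r%:C * zc e p))) <= _).
  rewrite mulrA ler_wpM2r ?normc_ge0// -exprMn lerXn2r ?nnegrE//.
   by rewrite mulr_ge0 ?invr_ge0 ?(ltW r0)// addr_ge0 ?normc_ge0.
  rewrite normcM normc_real (gtr0_norm r0) mulrDr mulr1 mulKf ?gt_eqF// lerD2r.
  by rewrite invf_ge1.
 by rewrite ler_wpM2l ?exprn_ge0 ?invr_ge0 ?(ltW r0)// hC.
have bf' := bumpy_mulX bf.
have dX (n : nat) (t : R) : cderiv (fun x : R => (x ^+ n)%:C) t (n%:R * t ^+ n.-1)%:C.
 apply: cderiv_real; case: n => [|n]; first by rewrite mul0r; exact: is_derive_cst.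
 rewrite (_ : (fun y => _) = (id : R -> R) ^+ n.+1); last first.
  by apply/funext => y; rewrite exprfctE.
 by apply: is_derive_eq; rewrite /GRing.scale/= mulr1.
pose g i j k f p := (p.1.1 ^+ i)%:C * (p.1.2 ^+ j)%:C * hfun k f r (zc e p) : R[i].
have Gg i0 j0 k0 f0 : bumpy a b f0 -> cspan (hgen a b e) (g i0 j0 k0 f0).
 by move=> b0; apply: cspan_gen; exists i0, j0, k0, f0, r.
exists (fun p => i%:R * g i.-1 j k f p +
  (-2) * (k%:R * g i.+1 j k.+1 f p + r%:C * g i.+1 j k (fun t => t * f t) p)).
exists (fun p => j%:R * g i j.-1 k f p +
  (-2) * (k%:R * g i j.+1 k.+1 f p + r%:C * g i j.+1 k (fun t => t * f t) p)).
exists (fun p => ('i%C * e%:C) * (k%:R * g i j k.+1 f p + r%:C * g i j k (fun t => t * f t) p)).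
split.
- by do ![apply: cspan_add|apply: cspan_scale|apply: Gg].
- by do ![apply: cspan_add|apply: cspan_scale|apply: Gg].
- by do ![apply: cspan_add|apply: cspan_scale|apply: Gg].
move=> p.
have := cdiffM (cdiffM (cdiff_x (dX i p.1.1)) (cdiff_y (dX j p.1.2)))
 (cdiff_hol e p (hol_hfun k a0 ab bf (ltW r0) r1)).
move=> h; apply: cdiff_eq h _ _ _; rewrite /g ?[_ ^+ i.+1]exprS ?[_ ^+ j.+1]exprS.
- by rewrite !rmorphM/= rmorph_nat; ring.
- by rewrite !rmorphM/= rmorph_nat; ring.
- by ring.
Qed.

Lemma hgen_hfun a b f k e r : bumpy a b f -> 0 < r -> r <= 1 ->
 hgen a b e (fun p => hfun k f r (zc e p)).
Proof.
move=> bf r0 r1; exists 0%N, 0%N, k, f, r; split => //.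
by apply/funext => p; rewrite !expr0 !mul1r.
Qed.

Lemma schwartz_hfun a b f k e r : 0 <= a -> a < b -> bumpy a b f -> e ^+ 2 = 1 ->
 0 < r -> r <= 1 -> schwartz (fun p : H1 R => hfun k f r (zc e p)).
Proof.
move=> a0 ab bf e1 r0 r1; apply: (schwartz_hspan a0 ab e1); apply: cspan_gen; exact: hgen_hfun.
Qed.

Lemma schwartz_blaplace a b f e : 0 <= a -> a < b -> bumpy a b f -> e ^+ 2 = 1 ->
 schwartz (fun p : H1 R => blaplace f (zc e p)).
Proof.
move=> a0 ab bf e1; have := schwartz_hfun 0 a0 ab bf e1 ltr01 (lexx 1).
by congr schwartz; apply/funext => p; rewrite /hfun expr0 !mul1r.
Qed.

(** Boundary values of holomorphic functions, and their conjugates: the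
  sublaplacian reduces to complex differentiation. *)
Lemma Lap_hol F F' F'' e p : e ^+ 2 = 1 -> hol F F' -> hol F' F'' ->
 - Lap (fun q => F (zc e q)) p = F' (zc e p).
Proof.
move=> e1 h1 h2; rewrite /Lap.
have -> : dx (fun q => F (zc e q)) = fun q => - 2 * q.1.1%:C * F' (zc e q).
 by apply/funext => q; have [] := cdiff_partials (cdiff_hol e q h1).
have -> : dy (fun q => F (zc e q)) = fun q => - 2 * q.1.2%:C * F' (zc e q).
 by apply/funext => q; have [] := cdiff_partials (cdiff_hol e q h1).
have -> : ds (fun q => F (zc e q)) = fun q => 'i%C * e%:C * F' (zc e q).
 by apply/funext => q; have [] := cdiff_partials (cdiff_hol e q h1).
have d1 (t : R) : cderiv (fun x : R => - 2 * x%:C) t (-2).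
 apply: cderiv_eq (cderivZ (-2) (cderiv_real (is_derive_id _ _))) _.
 by rewrite mulr1.
have H := cdiff_hol e p h2.
have [-> _ _] := cdiff_partials (cdiffM (cdiff_x (d1 p.1.1)) H).
have [_ -> _] := cdiff_partials (cdiffM (cdiff_y (d1 p.1.2)) H).
have [_ _ ->] := cdiff_partials (cdiffZ ('i%C * e%:C) H).
have i2 : 'i%C * 'i%C = -1 :> R[i] by rewrite -expr2 sqr_i.
have e2 : e%:C * e%:C = 1 :> R[i] by rewrite -rmorphM/= -expr2 e1.
rewrite (_ : 'i%C * e%:C * ('i%C * e%:C * F'' (zc e p)) = - F'' (zc e p)); last first.
 by rewrite (_ : _ * _ = ('i%C * 'i%C) * (e%:C * e%:C) * F'' (zc e p)); [rewrite i2 e2; ring|ring].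
rewrite /rho2 rmorphD/= !rmorphXn/= fmorphV rmorph_nat.
by field.
Qed.

End holomorphic.

(** * Measurability and slices of Schwartz functions *)

Section prodsf.
Context {R : realType} {d1 d2 : measure_display} {T1 : measurableType d1} {T2 : measurableType d2}.
Variables (m1 : {sigma_finite_measure set T1 -> \bar R}) (m2 : {sigma_finite_measure set T2 -> \bar R}).
Let prodm : set (T1 * T2) -> \bar R := (m1 \x m2)%E.

Lemma sigma_finite_prod : sigma_finite setT (m1 \x m2)%E.
Proof.
have /sigma_finiteP[A [TA hA fA]] := sigma_finiteT m1.
have /sigma_finiteP[B [TB hB fB]] := sigma_finiteT m2.
exists (fun n => A n `*` B n) => [|n].
 rewrite -setXTT TA TB; apply/seteqP; split => [[x y] [[i _ Ai] [j _ Bj]]|[x y] [i _ [Ai Bi]]].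
  exists (maxn i j) => //; split => /=.
   by have /subsetPset := hA _ _ (leq_maxl i j); apply.
  by have /subsetPset := hB _ _ (leq_maxr i j); apply.
 by split; exists i.
have [mA lA] := fA n; have [mB lB] := fB n; split; first exact: measurableX.
by rewrite product_measure1E// lte_mul_pinfty// ge0_fin_numE.
Qed.

Definition prodsf : {sigma_finite_measure set (T1 * T2)%type -> \bar R} :=
 HB.pack prodm (Measure.on prodm) (Measure_isSigmaFinite.Build _ _ _ prodm sigma_finite_prod).
End prodsf.

Section caratheodory.
Context {R : realType} {d : measure_display} {T : measurableType d}.

(** A function continuous in its real variable and measurable in the other one
  is jointly measurable. *)
Lemma measurable_continuous2 (f : T * R -> R) :
 (forall y, measurable_fun setT (fun t => f (t, y))) ->
 (forall t, continuous (fun y => f (t, y))) -> measurable_fun setT f.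
Proof.
move=> mf cf.
pose g (n : nat) (y : R) : R := (Num.floor (n.+1%:R * y))%:~R / n.+1%:R.
pose f_ n (p : T * R) := f (p.1, g n p.2).
have gd n y : `|y - g n y| <= n.+1%:R^-1.
 have n0 : 0 < n.+1%:R :> R by [].
 have /andP[h1 h2] := floor_itv (n.+1%:R * y).
 rewrite intrD1 in h2.
 set k : R := (Num.floor _)%:~R in h1 h2 *.
 have -> : y - g n y = (n.+1%:R * y - k) / n.+1%:R by rewrite /g -/k; field.
 rewrite normrM [`|_^-1|]gtr0_norm ?invr_gt0// ler_piMl ?invr_ge0 ?(ltW n0)//.
 by rewrite ger0_norm ?subr_ge0// lerBlDl ltW.
apply: (@measurable_fun_cvg _ _ _ _ f_ f).
 move=> n _ A mA; rewrite setTI.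
 have -> : f_ n @^-1` A = \bigcup_(k in [set: int])
   ([set t | A (f (t, k%:~R / n.+1%:R))] `*` [set y | Num.floor (n.+1%:R * y) = k]).
  apply/seteqP; split => [[t y] /= h|[t y] [k _ [/= h1 h2]]].
   by exists (Num.floor (n.+1%:R * y)).
  by rewrite /f_ /g /= h2.
 apply: countable_bigcupT_measurable; first exact: countableP.
 move=> k; apply: measurableX.
  by have := mf (k%:~R / n.+1%:R) measurableT A mA; rewrite setTI.
 have -> : [set y : R | Num.floor (n.+1%:R * y) = k] =
   `[k%:~R / n.+1%:R, (k + 1)%:~R / n.+1%:R[%classic.
  apply/seteqP; split => y /=; rewrite in_itv/= ler_pdivrMr// ltr_pdivlMr// [y * _]mulrC.
   by move=> <-; exact: floor_itv.
  by move=> h; apply/eqP; rewrite floor_eq.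
 exact: measurable_itv.
move=> [t y] _; rewrite /f_/=.
apply: (@cvg_comp _ _ _ (fun n => g n y) (fun z => f (t, z)) _ (nbhs y)); last exact: cf.
apply/subr_cvg0.
have h : - n.+1%:R^-1 @[n --> \oo] --> (0 : R).
 by rewrite -[X in _ --> X]oppr0; apply: cvgN; exact: cvg_harmonic.
apply: (squeeze_cvgr _ h (@cvg_harmonic R)); apply: nearW => n.
by rewrite -ler_norml -opprB normrN gd.
Qed.

End caratheodory.

Section schwartz_slices.
Context {R : realType}.
Notation mu := (@lebesgue_measure R).
Local Notation R3 := (R * R * R)%type.
Implicit Types (p q : H1 R) (x y s t : R).

Lemma continuous_pair {S : topologicalType} (f : S -> R) {S' : topologicalType} (g : S -> S') :
 continuous f -> continuous g ->
 continuous (fun x : S => (g x, f x)) /\ continuous (fun x : S => (f x, g x)).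
Proof. by move=> cf cg; split => x; [exact: (cvg_pair (cg x) (cf x))|exact: (cvg_pair (cf x) (cg x))]. Qed.

Lemma measurable_continuous3 (f : R3 -> R) : continuous f -> measurable_fun setT f.
Proof.
move=> cf; have ccst (S S' : topologicalType) (c : S') : continuous (fun _ : S => c).
 by move=> x; exact: cvg_cst.
have cid : continuous (fun x : R => x) by move=> x; exact: cvg_id.
apply: measurable_continuous2 => [s|xy]; last first.
 have h := (continuous_pair cid (ccst R _ xy)).1.
 by move=> s; apply: (@continuous_comp _ _ _ (fun s => (xy, s)) f); [exact: h|exact: cf].
suff h : measurable_fun [set: (R * R)%type] (fun q : R * R => f (q, s)) by exact: h.
apply: measurable_continuous2 => [y|x].
 apply: measurable_continuous.
 have h := (continuous_pair (ccst R _ s) (continuous_pair (ccst R _ y) cid).1).1.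
 by move=> x; apply: (@continuous_comp _ _ _ (fun x => ((x, y), s)) f); [exact: h|exact: cf].
have h := (continuous_pair (ccst R _ s) (continuous_pair cid (ccst R _ x)).1).1.
by move=> y; apply: (@continuous_comp _ _ _ (fun y => ((x, y), s)) f); [exact: h|exact: cf].
Qed.

Definition cdifferentiable (u : H1 R -> R[i]) := forall p : R3,
 differentiable (fun q : R3 => Re (u q) : R) p /\
 differentiable (fun q : R3 => Im (u q) : R) p.

Lemma cdifferentiable_measurable u : cdifferentiable u -> cmeasurable (u : R3 -> R[i]).
Proof.
by move=> du; split; apply: measurable_continuous3 => p;
 apply: differentiable_continuous; have [] := du p.
Qed.

Lemma slice_derive (f : R3 -> R) (p v : R3) (c : R -> R3) t :
 (forall h, c (t + h) = p + h *: v) -> differentiable f p ->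
 is_derive t 1 (fun s => f (c s)) ('D_v f p).
Proof.
move=> hc df.
have E : (fun h => h^-1 *: (((fun s => f (c s)) \o shift t) (h *: (1 : R)) - f (c t))) =
     (fun h : R => h^-1 *: ((f \o shift p) (h *: v) - f p)).
 apply/funext => h; rewrite /= /shift [h *: (1 : R)]mulr1 [h + t]addrC hc [h *: v + p]addrC.
 by have := hc 0; rewrite addr0 scale0r addr0 => ->.
have D : derivable f p v by exact: diff_derivable.
by apply: DeriveDef; [rewrite /derivable E|rewrite /derive E].
Qed.

Lemma cslice_x u x y s : cdifferentiable u ->
 cderiv (fun t => u ((t, y), s)) x (dx u ((x, y), s)).
Proof.
move=> du; have [d1 d2] := du ((x, y), s); split.
 apply: (slice_derive (c := fun t => ((t, y), s)) _ d1) => h.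
 by change (((x + h), y, s) = (x + h * 1, y + h * 0, s + h * 0)); rewrite mulr1 !mulr0 !addr0.
apply: (slice_derive (c := fun t => ((t, y), s)) _ d2) => h.
by change (((x + h), y, s) = (x + h * 1, y + h * 0, s + h * 0)); rewrite mulr1 !mulr0 !addr0.
Qed.

Lemma cslice_y u x y s : cdifferentiable u ->
 cderiv (fun t => u ((x, t), s)) y (dy u ((x, y), s)).
Proof.
move=> du; have [d1 d2] := du ((x, y), s); split.
 apply: (slice_derive (c := fun t => ((x, t), s)) _ d1) => h.
 by change ((x, (y + h), s) = (x + h * 0, y + h * 1, s + h * 0)); rewrite mulr1 !mulr0 !addr0.
apply: (slice_derive (c := fun t => ((x, t), s)) _ d2) => h.
by change ((x, (y + h), s) = (x + h * 0, y + h * 1, s + h * 0)); rewrite mulr1 !mulr0 !addr0.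
Qed.

Lemma cslice_s u (q : R * R) s : cdifferentiable u ->
 cderiv (fun t => u (q, t)) s (ds u (q, s)).
Proof.
case: q => x y du; have [d1 d2] := du ((x, y), s); split.
 apply: (slice_derive (c := fun t => ((x, y), t)) _ d1) => h.
 by change ((x, y, (s + h)) = (x + h * 0, y + h * 0, s + h * 1)); rewrite mulr1 !mulr0 !addr0.
apply: (slice_derive (c := fun t => ((x, y), t)) _ d2) => h.
by change ((x, y, (s + h)) = (x + h * 0, y + h * 0, s + h * 1)); rewrite mulr1 !mulr0 !addr0.
Qed.

Lemma ccont_slices u : cdifferentiable u ->
 [/\ forall y s, ccont (fun x => u ((x, y), s)),
   forall x s, ccont (fun y => u ((x, y), s)) &
   forall q : R * R, ccont (fun s => u (q, s))].
Proof.
move=> du; split.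
- by move=> y s; apply: (ccont_is_cderive (df := fun x => dx u ((x, y), s))) => x; exact: cslice_x.
- by move=> x s; apply: (ccont_is_cderive (df := fun y => dy u ((x, y), s))) => y; exact: cslice_y.
- by move=> q; apply: (ccont_is_cderive (df := fun s => ds u (q, s))) => s; exact: cslice_s.
Qed.

Definition iker t : R := (1 + t ^+ 2)^-1.

Lemma iker_gt0 t : 0 < iker t.
Proof. by rewrite invr_gt0 ltr_wpDr ?sqr_ge0. Qed.

Lemma iker_le1 t : iker t <= 1.
Proof. by rewrite invf_le1 ?lerDl ?sqr_ge0// ltr_wpDr ?sqr_ge0. Qed.

Lemma integrable_iker : Rintegrable mu iker.
Proof.
have [h _] := @poisson_kernel R 1 0 ltr01.
have := RintegrableZl (2^-1) h; congr (_.-integrable _ _).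
apply/funext => x; rewrite /= -EFinM mulr1 expr1n subr0 /iker; congr EFin.
by rewrite mulrA mulVf ?mul1r.
Qed.

Definition iker3 p : R := iker p.1.1 * iker p.1.2 * iker p.2.

Lemma iker3_gt0 p : 0 < iker3 p.
Proof. by rewrite !mulr_gt0 ?iker_gt0. Qed.

Lemma integrable_iker3 : Rintegrable (@muH R) iker3.
Proof.
have h := integrable_prod integrable_iker integrable_iker.
exact: (@integrable_prod R _ _ _ _ (prodsf mu mu) mu _ _ h integrable_iker).
Qed.

Definition rapid3 (u : H1 R -> R[i]) := exists M, forall p, normc (u p) <= M * iker3 p.

Lemma rapid_rapid3 u : rapid u -> rapid3 u.
Proof.
move=> /(_ 3%N) [M hM]; exists M => p; have := hM p.
have w0 (t : R) : 0 < 1 + t ^+ 2 by rewrite ltr_wpDr ?sqr_ge0.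
have W : 0 < (1 + p.1.1 ^+ 2) * (1 + p.1.2 ^+ 2) * (1 + p.2 ^+ 2) by rewrite !mulr_gt0.
rewrite /iker3 /iker -!invfM ler_pdivlMr// mulrC; apply: le_trans.
rewrite ![normc _ * _]mulrC ler_wpM2r ?normc_ge0//.
have E (w : R) : w ^+ 3 = w * w * w by ring.
rewrite E.
have h1 : 1 + p.1.1 ^+ 2 <= 1 + rho2 p + p.2 ^+ 2.
 by rewrite /rho2 -!addrA lerD2l lerDl addr_ge0 ?sqr_ge0.
have h2 : 1 + p.1.2 ^+ 2 <= 1 + rho2 p + p.2 ^+ 2.
 by rewrite /rho2 -!addrA lerD2l addrCA lerDl addr_ge0 ?sqr_ge0.
have h3 : 1 + p.2 ^+ 2 <= 1 + rho2 p + p.2 ^+ 2.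
 by rewrite /rho2 -!addrA lerD2l addrA lerDr addr_ge0 ?sqr_ge0.
by rewrite !ler_pM ?mulr_ge0 ?(ltW (w0 _))// addr_ge0 ?sqr_ge0.
Qed.

Lemma rapid3_integrable u : cmeasurable (u : R3 -> R[i]) -> rapid3 u ->
 cintegrable (@muH R) u.
Proof.
move=> mu_ [M hM].
have h := RintegrableZl M integrable_iker3.
exact: (cintegr_le (@muH R) _ _ mu_ h hM).
Qed.

Lemma schwartzE phi a b c : schwartz phi ->
 cdifferentiable (iter a (@dx R) (iter b (@dy R) (iter c (@ds R) phi))) /\
 rapid (iter a (@dx R) (iter b (@dy R) (iter c (@ds R) phi))).
Proof. by move=> /(_ a b c). Qed.

Lemma schwartz_rapid3 phi a b c : schwartz phi ->
 rapid3 (iter a (@dx R) (iter b (@dy R) (iter c (@ds R) phi))).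
Proof. by move=> /(schwartzE a b c)[_ h]; exact: rapid_rapid3. Qed.

Lemma schwartz_measurable phi : schwartz phi -> cmeasurable (phi : R3 -> R[i]).
Proof. by move=> /(schwartzE 0 0 0)[h _]; exact: cdifferentiable_measurable. Qed.

Lemma schwartz_integrable phi : schwartz phi -> cintegrable (@muH R) phi.
Proof.
move=> s; apply: rapid3_integrable; first exact: schwartz_measurable.
exact: (schwartz_rapid3 0 0 0 s).
Qed.

Lemma iker_cvg (M : R) : (M * iker t @[t --> +oo] --> (0 : R)) /\
 (M * iker t @[t --> -oo] --> (0 : R)).
Proof.
have D t : t != 0 -> iker t <= `|t^-1|.
 move=> t0; rewrite normfV lef_pV2 ?posrE ?normr_gt0// ?ltr_wpDr ?sqr_ge0//.
 rewrite -(real_normK (num_real t)); have := sqr_ge0 (1 - `|t|).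
 have := normr_ge0 t; move: `|t| => z z0; rewrite sqrrB mul1r expr1n => h; lra.
have N t e : 0 < e -> e^-1 < `|t| -> `|iker t| < e.
 move=> e0 et; have t0 : t != 0 by rewrite -normr_gt0 (lt_trans _ et) ?invr_gt0.
 rewrite ger0_norm ?(ltW (iker_gt0 _))//; apply: le_lt_trans (D t t0) _.
 by rewrite normfV invf_plt ?posrE ?normr_gt0.
split; rewrite -(mulr0 M); apply: cvgM; try exact: cvg_cst.
 apply/cvgr0Pnorm_lt => e e0; near=> t; apply: N => //.
 rewrite (@lt_le_trans _ _ t)// ?ler_norm//; near: t; apply: nbhs_pinfty_gt; exact: num_real.
apply/cvgr0Pnorm_lt => e e0; near=> t; apply: N => //.
rewrite -normrN (@lt_le_trans _ _ (- t))// ?ler_norm// ltrNr.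
by near: t; apply: nbhs_ninfty_lt; exact: num_real.
Unshelve. all: by end_near.
Qed.

Lemma normc_cvg_iker (f : R -> R[i]) M : (forall t, normc (f t) <= M * iker t) ->
 (normc (f t) @[t --> +oo] --> (0 : R)) /\ (normc (f t) @[t --> -oo] --> (0 : R)).
Proof.
move=> fM; have [h1 h2] := iker_cvg M; split.
 by apply: (squeeze_cvgr _ (cvg_cst 0) h1); apply: nearW => t; rewrite normc_ge0 fM.
by apply: (squeeze_cvgr _ (cvg_cst 0) h2); apply: nearW => t; rewrite normc_ge0 fM.
Qed.

Lemma cintegr_iker (f : R -> R[i]) M : cmeasurable f -> (forall t, normc (f t) <= M * iker t) ->
 cintegrable mu f.
Proof.
move=> mf fM; exact: (cintegr_le mu _ _ mf (RintegrableZl M integrable_iker) fM).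
Qed.

End schwartz_slices.

(** * The partial Fourier transform and the pairing formula *)

Section pairing.
Context {R : realType}.
Notation mu := (@lebesgue_measure R).
Local Notation R3 := (R * R * R)%type.
Implicit Types (p : H1 R) (q : R * R) (s t : R) (f g : R -> R[i]).

Definition mu2 : {sigma_finite_measure set (measurableTypeR R * measurableTypeR R)%type -> \bar R} :=
 prodsf mu mu.

Definition muHs : {sigma_finite_measure set ((measurableTypeR R * measurableTypeR R) * measurableTypeR R)%type -> \bar R} :=
 prodsf mu2 mu.

Lemma Rintegral_iker : \int[mu]_t iker t = pi.
Proof.
have [h1 h2] := @poisson_kernel R 1 0 ltr01.
have e : (fun t : R => 2 * 1 / (1 ^+ 2 + (t - 0) ^+ 2)) = fun t => 2 * iker t.
 by apply/funext => t; rewrite mulr1 expr1n subr0.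
move: h2; rewrite e RintegralZl//; last exact: integrable_iker.
by move/(mulfI _) => -> //; rewrite pnatr_eq0.
Qed.

Lemma fourier1_integrable f M s : cmeasurable f -> (forall t, normc (f t) <= M * iker t) ->
 cintegrable mu (fun t => f t * cis (t * s)).
Proof.
move=> mf fM; apply: (@cintegr_iker _ _ M).
 apply: cmeasM => //; apply: measurable_cis; exact: measurable_funM.
by move=> t; rewrite normcM normc_cis mulr1.
Qed.

Lemma normc_fourier1 f M s : cmeasurable f -> (forall t, normc (f t) <= M * iker t) ->
 normc (cintegral mu (fun t => f t * cis (t * s))) <= M * pi.
Proof.
move=> mf fM; have ci := fourier1_integrable s mf fM.
apply: le_trans (normc_cintegral ci) _; rewrite -Rintegral_iker.
have i1 := integrable_iker (R := R).
rewrite -RintegralZl//; apply: le_Rintegral => //.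
- exact: integrable_normc.
- exact: (RintegrableZl M i1).
- by move=> t _; rewrite normcM normc_cis mulr1.
Qed.

Lemma fourier1_derive f g M s : (forall t, cderiv f t (g t)) -> ccont g ->
 (forall t, normc (f t) <= M * iker t) -> (forall t, normc (g t) <= M * iker t) ->
 cintegral mu (fun t => g t * cis (t * s)) =
 - ('i%C * s%:C) * cintegral mu (fun t => f t * cis (t * s)).
Proof.
move=> df cg fM gM; have cf := ccont_is_cderive df.
have i1 := fourier1_integrable s (ccont_measurable cf) fM.
have i2 := fourier1_integrable s (ccont_measurable cg) gM.
have E t : cis (t * s) = cexp (t%:C * (0 +i* s)).
 by rewrite cisE; congr cexp; apply: eqcE; rewrite !cE/=; ring.
have D t : cderiv (fun t => f t * cis (t * s)) t
  (g t * cis (t * s) + ('i%C * s%:C) * (f t * cis (t * s))).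
 under eq_fun do rewrite E.
 apply: cderiv_eq (cderivM (df t) (cderiv_cexp _ t)) _.
 rewrite E (_ : 0 +i* s = 'i%C * s%:C); first by ring.
 by apply: eqcE; rewrite !cE/=; ring.
have cc : ccont (fun t : R => cis (t * s)).
 under eq_fun do rewrite E; exact: ccont_is_cderive (cderiv_cexp _).
have i3 := cintegrZl ('i%C * s%:C) i1.
have B t : normc (f t * cis (t * s)) <= M * iker t by rewrite normcM normc_cis mulr1.
have [l1 l2] := normc_cvg_iker B.
have := cintegral_derive0 D _ (cintegrD i2 i3) l1 l2.
rewrite cintegralD// cintegralZl// => h; apply/eqP; rewrite mulNr -addr_eq0; apply/eqP; apply: h.
apply: ccontD; first exact: ccontM.
by apply: ccontM; [exact: ccont_cst|exact: ccontM].
Qed.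

Lemma fourier1_decay f f' f'' M s : (forall t, cderiv f t (f' t)) ->
 (forall t, cderiv f' t (f'' t)) -> ccont f'' ->
 (forall t, normc (f t) <= M * iker t) -> (forall t, normc (f' t) <= M * iker t) ->
 (forall t, normc (f'' t) <= M * iker t) ->
 normc (cintegral mu (fun t => f t * cis (t * s))) <= 2 * M * pi * iker s.
Proof.
move=> d1 d2 c2 b0 b1 b2; have c0 := ccont_is_cderive d1; have c1 := ccont_is_cderive d2.
have h0 := normc_fourier1 s (ccont_measurable c0) b0.
have h2 := normc_fourier1 s (ccont_measurable c2) b2.
rewrite (fourier1_derive s d2 c2 b1 b2) (fourier1_derive s d1 c1 b0 b1) mulrA in h2.
rewrite normcM in h2; set n := normc _ in h0; rewrite -/n in h2 *.
have e : normc (- ('i%C * s%:C) * - ('i%C * s%:C)) = s ^+ 2.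
 rewrite mulrNN -expr2 normcX normcM normc_real.
 by rewrite (_ : normc 'i%C = 1 :> R) ?mul1r ?real_normK ?num_real// /normc/= expr0n expr1n add0r sqrtr1.
rewrite e in h2.
rewrite /iker ler_pdivlMr ?ltr_wpDr ?sqr_ge0// mulrDr mulr1 [n * _]mulrC.
by rewrite (_ : 2 * M * pi = M * pi + M * pi) ?lerD//; ring.
Qed.

Section schwartz_fourier.
Variable phi : H1 R -> R[i].
Hypothesis sphi : schwartz phi.

Lemma schwartz_s_slices : exists2 M, 0 <= M & forall q, exists f' f'' : R -> R[i],
 [/\ forall t, cderiv (fun t => phi (q, t)) t (f' t), forall t, cderiv f' t (f'' t),
   ccont f'', forall t, normc (phi (q, t)) <= M * iker q.1 * iker q.2 * iker t &
   (forall t, normc (f' t) <= M * iker q.1 * iker q.2 * iker t) /\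
   (forall t, normc (f'' t) <= M * iker q.1 * iker q.2 * iker t)].
Proof.
have [d0 _] := schwartzE 0 0 0 sphi; have [M0 h0] := schwartz_rapid3 0 0 0 sphi.
have [d1 _] := schwartzE 0 0 1 sphi; have [M1 h1] := schwartz_rapid3 0 0 1 sphi.
have [d2 _] := schwartzE 0 0 2 sphi; have [M2 h2] := schwartz_rapid3 0 0 2 sphi.
exists (`|M0| + `|M1| + `|M2|); first by rewrite !addr_ge0.
move=> q; exists (fun t => ds phi (q, t)), (fun t => ds (ds phi) (q, t)).
have B (u : H1 R -> R[i]) M t : (forall p, normc (u p) <= M * iker3 p) ->
  M <= `|M0| + `|M1| + `|M2| ->
  normc (u (q, t)) <= (`|M0| + `|M1| + `|M2|) * iker q.1 * iker q.2 * iker t.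
 move=> hu hM; apply: le_trans (hu _) _; rewrite -!mulrA [iker q.1 * _]mulrA.
 by rewrite ler_wpM2r// ltW// iker3_gt0.
have L0 : M0 <= `|M0| + `|M1| + `|M2| by rewrite -addrA (le_trans (ler_norm _))// lerDl addr_ge0.
have L1 : M1 <= `|M0| + `|M1| + `|M2|.
 by rewrite addrAC (le_trans (ler_norm _))// lerDr addr_ge0.
have L2 : M2 <= `|M0| + `|M1| + `|M2| by rewrite (le_trans (ler_norm _))// lerDr addr_ge0.
split.
- by move=> t; exact: cslice_s.
- by move=> t; exact: cslice_s.
- by have [_ _ h] := ccont_slices d2; exact: h.
- by move=> t; exact: B h0 L0.
- by split=> t; [exact: (B (ds phi) M1)|exact: (B (ds (ds phi)) M2)].
Qed.

Lemma Fourier_sE p : Fourier_s phi p = ((Num.sqrt (2 * pi))^-1)%:C *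
 cintegral mu (fun t => phi (p.1, t) * cis (t * - p.2)).
Proof. by rewrite /Fourier_s; congr (_ * _); apply: eq_cintegral => t; rewrite mulrC mulrN. Qed.

Lemma Fourier_s_measurable : cmeasurable (Fourier_s phi : R3 -> R[i]).
Proof.
apply: cmeasM; first exact: cmeas_cst.
have [M M0 hM] := schwartz_s_slices.
have mp : measurable_fun setT (fun x : R3 * R => (x.1.1, x.2) : R3).
 apply: measurable_fun_pair; last exact: measurable_snd.
 exact: (measurableT_comp measurable_fst measurable_fst).
have h : cmeasurable (fun x : R3 * R => cis (- (x.2 * x.1.2)) * phi (x.1.1, x.2)).
 apply: cmeasM; last exact: (cmeas_comp (schwartz_measurable sphi) mp).
 apply: measurable_cis; apply: measurableT_comp => //; apply: measurable_funM.
  exact: measurable_snd.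
 exact: (measurableT_comp measurable_snd measurable_fst).
exact: (cmeas_cintegral2 mu h).
Qed.

Lemma Fourier_s_rapid3 : rapid3 (Fourier_s phi).
Proof.
have [M M0 hM] := schwartz_s_slices.
exists ((Num.sqrt (2 * pi))^-1 * (2 * M * pi)) => p; rewrite Fourier_sE normcM normc_real.
have c0 : 0 <= (Num.sqrt (2 * pi))^-1 :> R by rewrite invr_ge0 sqrtr_ge0.
rewrite ger0_norm// -[leRHS]mulrA ler_wpM2l//.
have [f' [f'' [d1 d2 c2 b0 [b1 b2]]]] := hM p.1.
apply: le_trans (fourier1_decay (- p.2) d1 d2 c2 b0 b1 b2) _.
by rewrite /iker3 /iker sqrrN [leRHS](_ : _ = 2 * (M * (1 + p.1.1 ^+ 2)^-1 * (1 + p.1.2 ^+ 2)^-1) * pi * (1 + p.2 ^+ 2)^-1)//; ring.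
Qed.

Lemma Fourier_s_integrable : cintegrable (@muH R) (Fourier_s phi).
Proof. exact: (rapid3_integrable Fourier_s_measurable Fourier_s_rapid3). Qed.

Lemma Fourier_s_inversion q t :
 cintegral mu (fun s => Fourier_s phi (q, s) * cis (t * s)) =
 (Num.sqrt (2 * pi))%:C * phi (q, t).
Proof.
have [M M0 hM] := schwartz_s_slices; have [f' [f'' [d1 d2 c2 b0 [b1 b2]]]] := hM q.
have cf := ccont_is_cderive d1.
pose F s := cintegral mu (fun x => phi (q, x) * cis (x * s)).
have iu := cintegr_iker (ccont_measurable cf) b0.
have iF : cintegrable mu F.
 have B s : normc (F s) <= 2 * (M * iker q.1 * iker q.2) * pi * iker s.
  exact: fourier1_decay d1 d2 c2 b0 b1 b2.
 apply: cintegr_iker B.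
 have h : cmeasurable (fun x : R * R => phi (q, x.2) * cis (x.2 * x.1)).
  apply: cmeasM.
   exact: (cmeas_comp (ccont_measurable cf) measurable_snd).
  apply: measurable_cis; apply: measurable_funM; [exact: measurable_snd|exact: measurable_fst].
 exact: (cmeas_cintegral2 mu h).
have lim : normc (phi (q, x) - phi (q, t)) @[x --> t] --> (0 : R).
 have [c1 c3] := cf.
 have h : (`|Re (phi (q, x)) - Re (phi (q, t))| +
   `|Im (phi (q, x)) - Im (phi (q, t))|) @[x --> t] --> (0 : R).
  rewrite -[X in _ --> X](addr0 0); apply: cvgD.
   by rewrite -[X in _ --> X](@normr0 _ R); apply: cvg_norm; apply/subr_cvg0; exact: c1.
  by rewrite -[X in _ --> X](@normr0 _ R); apply: cvg_norm; apply/subr_cvg0; exact: c3.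
 apply: (squeeze_cvgr _ (cvg_cst 0) h); apply: nearW => x; rewrite normc_ge0/=.
 by apply: le_trans (normc_le _) _; rewrite !cE.
have := fourier_inversion iu lim iF; rewrite -/F => inv.
have ig : cintegrable mu (fun s => F s * cis (- (t * s))).
 apply: (cintegr_bounded mu _ _ 1 iF); last by move=> s; rewrite normc_cis.
 by apply: measurable_cis; apply: measurableT_comp => //; exact: measurable_funM.
have [ig' eg] := cintegral_reflect ig.
have e1 : cintegral mu (fun s => Fourier_s phi (q, s) * cis (t * s)) =
  ((Num.sqrt (2 * pi))^-1)%:C * cintegral mu (fun s => F (- s) * cis (- (t * - s))).
 rewrite -cintegralZl//; apply: eq_cintegral => s.
 by rewrite Fourier_sE -mulrA mulrN opprK.
rewrite e1 eg inv mulrA -rmorphM/=; congr (_%:C * _).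
have p0 : 0 <= 2 * pi :> R by rewrite mulr_ge0 ?pi_ge0.
by rewrite -{2}(sqr_sqrtr p0) expr2 mulrA mulVf ?mul1r// gt_eqF// sqrtr_gt0 mulr_gt0 ?pi_gt0.
Qed.

End schwartz_fourier.

Lemma cmeas_zc e : cmeasurable (zc e : R3 -> R[i]).
Proof.
have m1 : measurable_fun setT (fun p : R3 => p.1.1).
 exact: (measurableT_comp measurable_fst measurable_fst).
have m2 : measurable_fun setT (fun p : R3 => p.1.2).
 exact: (measurableT_comp measurable_snd measurable_fst).
apply: cmeas_complex; last by apply: measurable_funM => //; exact: measurable_snd.
by apply: measurableT_comp => //; apply: measurable_funD; exact: measurable_funX.
Qed.

(** The basic computation: pairing a superposition of the waves
  e^(t (i s - x^2 - y^2)) with psi, and integrating in s first. *)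
Lemma pairing (b : R * R -> bool) (d : R) f (psi : H1 R -> R[i]) :
 measurable_fun setT b -> cmeasurable f -> (forall t, t <= 0 -> f t = 0) ->
 cintegrable mu (fun t => f t * (expR (- (d * t)))%:C) ->
 (forall q, b q -> d <= q.1 ^+ 2 + q.2 ^+ 2) -> cintegrable (@muH R) psi ->
 (forall q, b q -> cintegrable mu (fun s => psi (q, s))) ->
 let J t q := cintegral mu (fun s => psi (q, s) * cis (t * s)) in
 cintegrable (@muH R) (fun p => if b p.1 then psi p * laplace f (zc 1 p) else 0) /\
 cintegral (@muH R) (fun p => if b p.1 then psi p * laplace f (zc 1 p) else 0) =
 cintegral mu (fun t => f t * cintegral mu2 (fun q =>
  if b q then (expR (- (t * (q.1 ^+ 2 + q.2 ^+ 2))))%:C * J t q else 0)).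
Proof.
move=> mb mf f0 fd bd ipsi spsi J.
have mpsi := cintegr_measurable ipsi.
have nf := integrable_normc fd; have npsi := integrable_normc ipsi.
pose K (x : R3 * R) : R[i] :=
 if b x.1.1 then psi x.1 * (f x.2 * cexp (x.2%:C * zc 1 x.1)) else 0.
have mK : cmeasurable K.
 apply: cmeas_if; last exact: cmeas_cst.
  exact: (measurableT_comp mb (measurableT_comp measurable_fst measurable_fst)).
 apply: cmeasM; first exact: (cmeas_comp mpsi measurable_fst).
 apply: cmeasM; first exact: (cmeas_comp mf measurable_snd).
 apply: cmeas_cexp; apply: cmeasM.
  by apply: cmeas_real; exact: measurable_snd.
 exact: (cmeas_comp (cmeas_zc 1) measurable_fst).
have Bf p t : b p.1 -> normc (f t * cexp (t%:C * zc 1 p)) <= normc (f t * (expR (- (d * t)))%:C).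
 move=> bp; have [t0|t0] := leP t 0; first by rewrite f0// !mul0r.
 rewrite !normcM ler_wpM2l ?normc_ge0// normc_cexp normc_real ger0_norm ?expR_ge0//.
 by rewrite ler_expR ReCM /= mulrN lerN2 mulrC ler_wpM2l ?(ltW t0)//; exact: bd.
have BK x : normc (K x) <= normc (psi x.1) * normc (f x.2 * (expR (- (d * x.2)))%:C).
 rewrite /K; case: ifPn => bx; last by rewrite normc0 mulr_ge0 ?normc_ge0.
 by rewrite normcM ler_wpM2l ?normc_ge0// Bf.
have iK : cintegrable (muHs \x mu)%E K.
 have h := @integrable_prod R _ _ _ _ muHs mu _ _ npsi nf.
 exact: (@cintegr_le R _ _ (muHs \x mu)%E K _ mK h BK).
have sf p : b p.1 -> cintegrable mu (fun t => f t * cexp (t%:C * zc 1 p)).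
 move=> bp; apply: (cintegr_le mu _ _ _ nf) => [|t]; last exact: Bf.
 by apply: cmeasM => //; exact: cmeas_cexpX.
pose F1 (p : R3) : R[i] := if b p.1 then psi p * laplace f (zc 1 p) else 0.
have EF p : cintegral mu (fun t => K (p, t)) = F1 p.
 rewrite /K /F1 /=; case: ifPn => bp; last exact: cintegral0.
 by rewrite cintegralZl//; exact: sf.
have mF1 : cmeasurable F1.
 have h := cmeas_cintegral2 mu mK.
 have e : F1 = (fun p => cintegral mu (fun t => K (p, t))) by apply/funext => p; rewrite EF.
 by rewrite e; exact: h.
have iF1 : cintegrable (@muH R) F1.
 pose C := Rintegral mu setT (fun t => normc (f t * (expR (- (d * t)))%:C)).
 have h := RintegrableZl C npsi.
 apply: (cintegr_le (@muH R) _ _ mF1 h) => p /=.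
 rewrite /F1; case: ifPn => bp.
  rewrite normcM mulrC ler_wpM2r ?normc_ge0//.
  apply: le_trans (normc_cintegral (sf p bp)) _.
  apply: le_Rintegral => //; first exact: integrable_normc (sf p bp).
  by move=> t _; exact: Bf.
 by rewrite normc0 mulr_ge0 ?normc_ge0//; apply: Rintegral_ge0 => t _; exact: normc_ge0.
split; first exact: iF1.
have h1 := @cfubini1 R _ _ _ _ muHs mu K iK; have h2 := @cfubini2 R _ _ _ _ muHs mu K iK.
transitivity (cintegral muHs (fun p => cintegral mu (fun t => K (p, t)))).
 by apply: eq_cintegral => p; rewrite EF.
rewrite -h1 h2; apply: eq_cintegral => t.
have [t0|t0] := leP t 0.
 rewrite f0// mul0r -(cintegral0 muHs); apply: eq_cintegral => p.
 by rewrite /K /= f0// mul0r mulr0; case: ifP.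
pose k (p : R3) : R[i] := if b p.1 then
 (expR (- (t * (p.1.1 ^+ 2 + p.1.2 ^+ 2))))%:C * (psi p * cis (t * p.2)) else 0.
have mk : cmeasurable k.
 have e : k = fun p : R3 => if b p.1 then psi p * cexp (t%:C * zc 1 p) else 0.
  apply/funext => p; rewrite /k; case: ifP => // _.
  rewrite cexpE ReCM ImCM /= mul1r /rho2 mulrN; ring.
 rewrite e; apply: cmeas_if; last exact: cmeas_cst.
  exact: (measurableT_comp mb measurable_fst).
 apply: cmeasM => //; apply: cmeas_cexp; apply: cmeasM.
  exact: cmeas_cst.
 exact: cmeas_zc.
have ik : cintegrable muHs k.
 apply: (cintegr_le muHs _ _ mk npsi) => p.
 rewrite /k; case: ifP => _; last by rewrite normc0 normc_ge0.
 rewrite !normcM normc_cis mulr1 normc_real ler_piMl ?normc_ge0//.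
 rewrite ger0_norm ?expR_ge0// -expR0 ler_expR oppr_le0 mulr_ge0 ?(ltW t0)//.
 by rewrite addr_ge0 ?sqr_ge0.
transitivity (f t * cintegral muHs k).
 rewrite -cintegralZl//; apply: eq_cintegral => p.
 rewrite /K /k /=; case: ifP => _; last by rewrite mulr0.
 by rewrite cexpE ReCM ImCM /= mul1r /rho2 mulrN; ring.
congr (_ * _); rewrite (@cfubini1 R _ _ _ _ mu2 mu k ik); apply: eq_cintegral => q.
rewrite /k /=; case: ifPn => bq; last exact: cintegral0.
rewrite cintegralZl//.
apply: (cintegr_bounded mu _ _ 1 (spsi q bq)); last by move=> s; rewrite normc_cis.
by apply: measurable_cis; exact: measurable_funM.
Qed.

End pairing.

(** * Functions determined by their integrals over boxes *)

Section boxes.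
Context {R : realType}.
Notation mu := (@lebesgue_measure R).

Section dynkin.
Context {d : measure_display} {T : measurableType d} (m : {measure set T -> \bar R}).
Variable g : T -> R.
Hypothesis ig : Rintegrable m g.

Let I (A : set T) := Rintegral m setT (fun x => g x * \1_A x).

Lemma integrable_indic_mul (A : set T) : measurable A ->
 Rintegrable m (fun x => g x * \1_A x).
Proof.
move=> mA; have mg : measurable_fun setT g by exact: (mfun_integrable ig).
apply: (@le_integrable _ _ _ m setT measurableT _ (EFin \o g) _ _ ig).
 by apply/measurable_EFinP; apply: measurable_funM => //; exact: measurable_indic.
move=> x _ /=; rewrite lee_fin normrM indicE ler_piMr//.
by case: (x \in A); rewrite ?normr1 ?normr0.
Qed.

(** The sets on which g integrates to zero form a Dynkin system. *)
Lemma dynkin_indic_null {d' : measure_display} {S : measurableType d'} (phi : T -> S)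
  (G : set (set S)) (B : set T) (A_ : nat -> set S) :
 measurable_fun setT phi -> measurable B -> setI_closed G ->
 @measurable _ S = <<s G >> -> (forall n, G (A_ n)) ->
 {homo A_ : n k / (n <= k)%N >-> (n <= k)%O} -> \bigcup_n A_ n = setT ->
 (forall A, G A -> I (phi @^-1` A `&` B) = 0) ->
 forall A, measurable A -> I (phi @^-1` A `&` B) = 0.
Proof.
move=> mphi mB GI GE GA hA UA H A mA.
have mpre X : measurable X -> measurable (phi @^-1` X `&` B).
 move=> mX; apply: measurableI => //; rewrite -[X in measurable X]setTI; exact: mphi.
pose D := [set X : set S | measurable X /\ I (phi @^-1` X `&` B) = 0].
have mG X : G X -> measurable X by rewrite GE; exact: sub_gen_smallest.
have ND : ndseq_closed D.
 move=> F hF DF; split; first by apply: bigcup_measurable => n _; exact: (DF n).1.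
 have mU : measurable (\bigcup_i F i) by apply: bigcup_measurable => n _; exact: (DF n).1.
 pose f_ n x := `|g x * \1_(phi @^-1` (\bigcup_i F i) `&` B) x - g x * \1_(phi @^-1` (F n) `&` B) x|.
 have i1 := integrable_indic_mul (mpre _ mU).
 have i2 n := integrable_indic_mul (mpre _ (DF n).1).
 have ia : Rintegrable m (fun x => `|g x|) by exact: integrable_abse ig.
 have L : Rintegral m setT (f_ n) @[n --> \oo] --> (0 : R).
  apply: (R_dct m f_ (fun x => `|g x|)) => //.
  - move=> n; have /measurable_EFinP := measurable_int _ (integrable_abse (integrableB measurableT i1 (i2 n))).
   by [].
  - move=> n x; rewrite normr_ge0/= /f_ -mulrBr normrM ler_piMr// !indicE.
   have s : (x \in phi @^-1` F n `&` B) -> (x \in phi @^-1` (\bigcup_i F i) `&` B).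
    by rewrite !inE => -[h1 h2]; split => //; exists n.
   by move: s; case: (x \in _); case: (x \in _) => //= s; rewrite ?subrr ?subr0 ?sub0r ?normr0 ?normrN ?normr1//; have := s isT.
  - move=> x; apply: cvg_near_cst.
   have [[[k _ Fk] Bx]|nx] := pselect ((phi @^-1` (\bigcup_i F i) `&` B) x).
    exists k => // n /= kn; rewrite /f_ !indicE !mem_set ?subrr ?normr0//.
     by split => //; move: Fk; have /subsetPset := hF _ _ kn; apply.
    by split => //; exists k.
   apply: nearW => n; rewrite /f_ !indicE !memNset ?subrr ?normr0//.
   by move=> [Fn Bx]; apply: nx; split => //; exists n.
 have /eqP : `|I (phi @^-1` (\bigcup_i F i) `&` B)| = 0; last by rewrite normr_eq0 => /eqP.
 apply/eqP; rewrite eq_le normr_ge0 andbT.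
 apply: (ler_cvg_to (cvg_cst _) L); apply: nearW => n; rewrite -[I _]subr0 -(DF n).2 /I -RintegralB//.
 apply: le_normr_Rintegral => //; exact: (integrableB measurableT i1 (i2 n)).
have DT : D setT.
 rewrite -UA; apply: ND => // n; split; [exact: mG|exact: H].
have LD : lambda_system setT D.
 split => // X Y YX [mX hX] [mY hY]; split; first exact: measurableD.
 have -> : phi @^-1` (X `\` Y) `&` B = (phi @^-1` X `&` B) `\` (phi @^-1` Y `&` B).
  apply/seteqP; split => x /=; first by move=> [[h1 h2] h3]; split => // -[].
  by move=> [[h1 h2] h3]; split => //; split => // h4; apply: h3.
 rewrite /I (_ : (fun x => _) = fun x => g x * \1_(phi @^-1` X `&` B) x - g x * \1_(phi @^-1` Y `&` B) x).
  rewrite RintegralB//; try exact: integrable_indic_mul (mpre _ _).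
  by move: hX hY; rewrite /I => -> ->; rewrite subrr.
 apply/funext => x; rewrite -mulrBr; congr (_ * _); rewrite !indicE.
 rewrite in_setD; have s : (x \in phi @^-1` Y `&` B) -> (x \in phi @^-1` X `&` B).
  by rewrite !inE => -[h1 h2]; split => //; exact: YX.
 by move: s; case: (x \in _ `&` _); case: (x \in _ `&` _) => //= s; rewrite ?subrr ?subr0//; have := s isT.
have := @lambda_system_subset _ G GI setT D LD.
move=> /(_ _ _ A); rewrite -GE => h.
by apply: (h _ _ mA).2 => // X GX; split; [exact: mG|exact: H].
Qed.

Lemma indic_null_ae : (forall A, measurable A -> I A = 0) -> {ae m, forall x, g x = 0}.
Proof.
move=> H; have mg : measurable_fun setT g by exact: (mfun_integrable ig).
have mP : measurable [set x | 0 < g x].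
 have := mg measurableT _ (measurable_itv `]0, +oo[); rewrite setTI.
 by congr measurable; apply/seteqP; split => x /=; rewrite in_itv/= andbT.
have mN : measurable [set x | g x < 0].
 have := mg measurableT _ (measurable_itv `]-oo, 0[); rewrite setTI.
 by congr measurable; apply/seteqP; split => x /=; rewrite in_itv/=.
have P0 x : 0 <= g x * \1_[set x | 0 < g x] x.
 rewrite indicE; have [h|h] := ltP 0 (g x); first by rewrite mem_set//= mulr1 ltW.
 by rewrite memNset ?mulr0//= ltNge h.
have N0 x : 0 <= - (g x * \1_[set x | g x < 0] x).
 rewrite indicE; have [h|h] := ltP (g x) 0; first by rewrite mem_set//= mulr1 oppr_ge0 ltW.
 by rewrite memNset ?mulr0 ?oppr0//= ltNge h.
have a1 := ge0_Rintegral_eq0 P0 (integrable_indic_mul mP) (H _ mP).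
have iN : Rintegrable m (fun x => - (g x * \1_[set x | g x < 0] x)).
 exact: (integrableN (integrable_indic_mul mN)).
have e0 : Rintegral m setT (fun x => - (g x * \1_[set x | g x < 0] x)) = 0.
 have := H _ mN; rewrite /I => h.
 rewrite (_ : (fun x => - _) = fun x => (-1) * (g x * \1_[set x | g x < 0] x)).
  by rewrite RintegralZl ?h ?mulr0//; exact: integrable_indic_mul.
 by apply/funext => x; rewrite mulN1r.
have a2 := ge0_Rintegral_eq0 N0 iN e0.
apply: (ae_imp (ae_and a1 a2)) => x [h1 h2].
case: (ltrgtP (g x) 0) => // h.
 by move: h2; rewrite indicE mem_set//= mulr1 => /eqP; rewrite oppr_eq0 => /eqP.
by move: h1; rewrite indicE mem_set//= mulr1.
Qed.

End dynkin.

Lemma measurable_preim {d d'} {T : measurableType d} {S : measurableType d'} (f : T -> S) A :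
 measurable_fun setT f -> measurable A -> measurable (f @^-1` A).
Proof. by move=> mf mA; rewrite -[X in measurable X]setTI; exact: mf. Qed.

Lemma rect_setI_closed {d1 d2} {T1 : measurableType d1} {T2 : measurableType d2} :
 setI_closed [set A `*` B | A in @measurable _ T1 & B in @measurable _ T2].
Proof.
move=> _ _ [A mA [B mB <-]] [A' mA' [B' mB' <-]].
exists (A `&` A'); first exact: measurableI.
by exists (B `&` B'); [exact: measurableI|rewrite setXI].
Qed.

Lemma rays_setI_closed : setI_closed (@RGenOInfty.G R).
Proof.
move=> _ _ [x ->] [y ->]; exists (Num.max x y); apply/seteqP; split => t /=;
 by rewrite !in_itv/= !andbT gt_max => /andP.
Qed.

Lemma rays_nd : {homo (fun n : nat => `](- n%:R : R), +oo[%classic) : n k / (n <= k)%N >-> (n <= k)%O}.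
Proof.
move=> n k nk; apply/subsetPset => t /=; rewrite !in_itv/= !andbT; apply: le_lt_trans.
by rewrite lerN2 ler_nat.
Qed.

Lemma rays_cover : \bigcup_n `](- n%:R : R), +oo[%classic = setT.
Proof.
apply/seteqP; split => // t _; exists (Num.bound `|t|) => //=; rewrite in_itv/= andbT.
rewrite ltrNl; apply: le_lt_trans (archi_boundP (normr_ge0 t)).
by rewrite -normrN ler_norm.
Qed.

Definition orthant (x y s : R) : set ((measurableTypeR R * measurableTypeR R) * measurableTypeR R) :=
 [set p | x < p.1.1 /\ y < p.1.2 /\ s < p.2].

Lemma orthant_null_ae (g : R * R * R -> R) : Rintegrable (@muHs R) g ->
 (forall x y s, Rintegral (@muHs R) setT (fun p => g p * \1_(orthant x y s) p) = 0) ->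
 {ae (@muHs R), forall p, g p = 0}.
Proof.
move=> ig H; apply: (indic_null_ae (ig)).
pose Rm := measurableTypeR R.
have px : measurable_fun setT (fun p : (Rm * Rm) * Rm => p.1.1).
 exact: (measurableT_comp measurable_fst measurable_fst).
have py : measurable_fun setT (fun p : (Rm * Rm) * Rm => p.1.2).
 exact: (measurableT_comp measurable_snd measurable_fst).
have ps : measurable_fun setT (fun p : (Rm * Rm) * Rm => p.2) by exact: measurable_snd.
have pq : measurable_fun setT (fun p : (Rm * Rm) * Rm => p.1) by exact: measurable_fst.
have mray (x : R) : @measurable _ Rm `]x, +oo[%classic by exact: measurable_itv.
have GR : @measurable _ Rm = <<s @RGenOInfty.G R >> by exact: RGenOInfty.measurableE.
have Gray n : @RGenOInfty.G R `](- n%:R : R), +oo[%classic by exists (- n%:R).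
have S1 A y s : @measurable _ Rm A -> Rintegral (@muHs R) setT (fun p => g p *
  \1_((fun p : (Rm * Rm) * Rm => p.1.1) @^-1` A `&`
    ((fun p : (Rm * Rm) * Rm => p.1.2) @^-1` `]y, +oo[%classic `&`
    (fun p : (Rm * Rm) * Rm => p.2) @^-1` `]s, +oo[%classic)) p) = 0.
 apply: (dynkin_indic_null ig px _ rays_setI_closed GR Gray rays_nd rays_cover).
  by apply: measurableI; exact: measurable_preim.
 move=> _ [x ->]; rewrite -[RHS](H x y s); congr Rintegral; apply/funext => p.
 congr (_ * \1_ _ p); apply/seteqP; split => q /=; rewrite !in_itv/= !andbT.
  by move=> [h1 [h2 h3]].
 by move=> [h1 [h2 h3]].
have S2 A B s : @measurable _ Rm A -> @measurable _ Rm B -> Rintegral (@muHs R) setT (fun p => g p *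
  \1_((fun p : (Rm * Rm) * Rm => p.1.2) @^-1` B `&`
    ((fun p : (Rm * Rm) * Rm => p.1.1) @^-1` A `&`
    (fun p : (Rm * Rm) * Rm => p.2) @^-1` `]s, +oo[%classic)) p) = 0.
 move=> mA; apply: (dynkin_indic_null ig py _ rays_setI_closed GR Gray rays_nd rays_cover).
  by apply: measurableI; exact: measurable_preim.
 move=> _ [y ->]; rewrite -[RHS](S1 A y s mA); congr Rintegral; apply/funext => p.
 by rewrite setICA.
have S3 A B C : @measurable _ Rm A -> @measurable _ Rm B -> @measurable _ Rm C ->
  Rintegral (@muHs R) setT (fun p => g p *
  \1_((fun p : (Rm * Rm) * Rm => p.2) @^-1` C `&`
    ((fun p : (Rm * Rm) * Rm => p.1.1) @^-1` A `&`
    (fun p : (Rm * Rm) * Rm => p.1.2) @^-1` B)) p) = 0.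
 move=> mA mB; apply: (dynkin_indic_null ig ps _ rays_setI_closed GR Gray rays_nd rays_cover).
  by apply: measurableI; exact: measurable_preim.
 move=> _ [s ->]; rewrite -[RHS](S2 A B s mA mB); congr Rintegral; apply/funext => p.
 by rewrite setIC -setIA setICA.
have S4 X C : @measurable _ (Rm * Rm)%type X -> @measurable _ Rm C ->
  Rintegral (@muHs R) setT (fun p => g p *
  \1_((fun p : (Rm * Rm) * Rm => p.1) @^-1` X `&` (fun p : (Rm * Rm) * Rm => p.2) @^-1` C) p) = 0.
 move=> mX mC; move: X mX.
 apply: (dynkin_indic_null (A_ := fun=> setT) ig pq _ (@rect_setI_closed _ _ _ _) (measurable_prod_measurableType _ _)) => //.
 - exact: measurable_preim.
 - by move=> _; exists setT => //; exists setT => //; rewrite setXTT.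
 - by apply/seteqP; split => // x _; exists 0%N.
 - move=> _ [A mA [B mB <-]]; rewrite -[RHS](S3 A B C mA mB mC).
  congr Rintegral; apply/funext => p; congr (_ * \1_ _ p).
  by apply/seteqP; split => q /=; [move=> [[h1 h2] h3]|move=> [h3 [h1 h2]]].
move=> A mA.
have := @dynkin_indic_null _ _ (@muHs R) g ig _ _ id _ setT (fun=> setT)
 (@measurable_id _ _ _) measurableT (@rect_setI_closed _ _ _ _) (measurable_prod_measurableType _ _).
move=> /(_ _ _ _ _ A mA); rewrite setIT; apply => //.
- by move=> _; exists setT => //; exists setT => //; rewrite setXTT.
- by apply/seteqP; split => // x _; exists 0%N.
- move=> _ [X mX [C mC <-]]; rewrite setIT -[RHS](S4 X C mX mC).
 congr Rintegral; apply/funext => p; congr (_ * \1_ _ p).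
Qed.

End boxes.

(** * The space V0+ as a space of Laplace transforms *)

Section repr.
Context {R : realType}.
Notation mu := (@lebesgue_measure R).
Local Notation R3 := (R * R * R)%type.
Implicit Types (p : H1 R) (q : R * R) (s t : R) (f g : R -> R[i]).

Let k : R := Num.sqrt (2 * pi) * Num.sqrt pi.

Lemma sqrtpi_gt0 : 0 < Num.sqrt pi :> R.
Proof. by rewrite sqrtr_gt0 pi_gt0. Qed.

Lemma sqrt2pi_gt0 : 0 < Num.sqrt (2 * pi) :> R.
Proof. by rewrite sqrtr_gt0 mulr_gt0 ?pi_gt0. Qed.

Let k_gt0 : 0 < k.
Proof. by rewrite mulr_gt0 ?sqrtpi_gt0 ?sqrt2pi_gt0. Qed.

Lemma iker2_integrable : Rintegrable (@mu2 R) (fun q : R * R => iker q.1 * iker q.2).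
Proof. exact: (integrable_prod integrable_iker integrable_iker). Qed.

Lemma pair1_measurable q : measurable_fun setT (fun s : R => (q, s) : R3).
Proof. by apply: measurable_fun_pair => //; exact: measurable_cst. Qed.

Lemma pair2_measurable s : measurable_fun setT (fun q : R * R => (q, s) : R3).
Proof. by apply: measurable_fun_pair => //; exact: measurable_cst. Qed.

Lemma iker_ge0 (t : R) : 0 <= iker t.
Proof. exact: ltW (iker_gt0 t). Qed.

(** Laplace transforms of integrable functions belong to V0+; the constant
  compares the normalizations of the profile and of the transform. *)
Lemma V0p_laplace f : cintegrable mu f -> (forall t, t <= 0 -> f t = 0) ->
 V0p (fun p => laplace f (zc 1 p)).
Proof.
move=> fi f0; have mf := cintegr_measurable fi; have nf := integrable_normc fi.
exists (fun t => k%:C * f t); split; first by apply: cmeasM => //; exact: cmeas_cst.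
move=> phi sphi.
have [M0 hM0] := schwartz_rapid3 0 0 0 sphi; pose M := `|M0|; have M_ge0 : 0 <= M by exact: normr_ge0.
have hM p : normc (phi p) <= M * (iker p.1.1 * iker p.1.2).
 apply: le_trans (hM0 p) _; rewrite /iker3; apply: (@le_trans _ _ (M * (iker p.1.1 * iker p.1.2 * iker p.2))).
  by rewrite ler_wpM2r ?ler_norm// ltW// iker3_gt0.
 by rewrite ler_wpM2l// ler_piMr ?iker_le1// mulr_ge0// iker_ge0.
pose c := Num.sqrt (2 * pi) : R.
have c0 : 0 <= c by exact: sqrtr_ge0.
have EP p : V0p_profile (fun t => k%:C * f t) p * phi p =
  if 0 < p.2 then f p.2 * ((c * expR (- (p.2 * rho2 p)))%:C * phi p) else 0.
 rewrite /V0p_profile; have [h|h] := ltP 0 p.2.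
  rewrite (ltW h) /k (_ : (c * _)%:C = (c * Num.sqrt pi)%:C * ((Num.sqrt pi)^-1 * expR (- (rho2 p * p.2)))%:C).
   by ring.
  rewrite -rmorphM/= -/c; congr (_%:C); rewrite mulrA -[c * _ * _]mulrA mulfV ?mulr1 ?gt_eqF ?sqrtpi_gt0//.
  by rewrite [rho2 p * _]mulrC.
 by rewrite f0// mulr0 mul0r if_same mul0r.
pose N (p : R3) := if 0 < p.2 then f p.2 * ((c * expR (- (p.2 * rho2 p)))%:C * phi p) else 0.
have mN : cmeasurable N.
 apply: cmeas_if; last exact: cmeas_cst.
  exact: (measurableT_comp (measurable_ltr 0) measurable_snd).
 apply: cmeasM; first exact: (cmeas_comp mf measurable_snd).
 apply: cmeasM; last exact: schwartz_measurable.
 apply: cmeas_real; apply: measurable_funM => //.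
 apply: measurableT_comp => //; apply: measurableT_comp => //.
 apply: measurable_funM; first exact: measurable_snd.
 have [h _] := @cmeas_zc R 1.
 have e : (@rho2 R : R3 -> R) = (fun p => - Re (zc 1 p)) by apply/funext => p; rewrite opprK.
 by rewrite e; exact: measurableT_comp.
have bE p : 0 < p.2 -> c * expR (- (p.2 * rho2 p)) <= c.
 move=> h; rewrite ler_piMr// -expR0 ler_expR oppr_le0 mulr_ge0 ?(ltW h)//.
 by rewrite addr_ge0 ?sqr_ge0.
have iN : cintegrable (@muH R) N.
 have h := @integrable_prod R _ _ _ _ mu2 mu _ _ iker2_integrable nf.
 have {}h := RintegrableZl (c * M) h.
 apply: (cintegr_le (@muH R) _ _ mN h) => p /=.
 have g0 : 0 <= c * M * (iker p.1.1 * iker p.1.2 * normc (f p.2)).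
  by rewrite !mulr_ge0 ?normc_ge0 ?iker_ge0.
 rewrite /N; case: ifP => p0; last by rewrite normc0.
 rewrite !normcM normc_real mulrC ger0_norm ?mulr_ge0 ?expR_ge0//.
 rewrite [leRHS](_ : _ = c * (M * (iker p.1.1 * iker p.1.2)) * normc (f p.2)); last by ring.
 by rewrite ler_wpM2r ?normc_ge0// ler_pM ?normc_ge0 ?mulr_ge0 ?expR_ge0// bE.
split; first by apply: (eq_cintegrable _ iN) => p; rewrite EP.
have [M' M'0 hM'] := schwartz_s_slices sphi.
have sF q : cintegrable mu (fun s => Fourier_s phi (q, s)).
 have [K hK] := Fourier_s_rapid3 sphi.
 apply: (@cintegr_iker _ _ (K * (iker q.1 * iker q.2))).
  exact: (cmeas_comp (Fourier_s_measurable sphi) (pair1_measurable q)).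
 by move=> s; apply: le_trans (hK _) _; rewrite /iker3 mulrA.
have fi0 : cintegrable mu (fun t => f t * (expR (- (0 * t)))%:C).
 by apply: (eq_cintegrable _ fi) => t; rewrite mul0r oppr0 expR0 mulr1.
have [_ ] := @pairing R xpredT 0 f (Fourier_s phi) (@measurable_cst _ _ _ _ _ _) mf f0 fi0
 (fun q _ => addr_ge0 (sqr_ge0 _) (sqr_ge0 _)) (Fourier_s_integrable sphi) (fun q _ => sF q).
move=> /= E.
transitivity (cintegral (@muH R) (fun p => Fourier_s phi p * laplace f (zc 1 p))).
 by apply: eq_cintegral => p; rewrite mulrC.
rewrite E; transitivity (cintegral (@muH R) N); last first.
 by apply: eq_cintegral => p; rewrite EP.
rewrite (@cfubini2 R _ _ _ _ mu2 mu N iN); apply: eq_cintegral => t; rewrite /N /=.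
have [t0|t0] := ltP 0 t; last by rewrite f0// mul0r cintegral0.
rewrite -cintegralZl.
 apply: eq_cintegral => q /=; rewrite Fourier_s_inversion// -/c rmorphM/= /rho2/=; ring.
have h := RintegrableZl (c * M) iker2_integrable.
apply: (cintegr_le mu2 _ _ _ h) => [|q] /=.
 under eq_fun do rewrite Fourier_s_inversion//.
 apply: cmeasM.
  apply: cmeas_real; apply: measurableT_comp => //; apply: measurableT_comp => //.
  apply: measurable_funM => //; apply: measurable_funD; apply: measurable_funX.
   exact: measurable_fst.
  exact: measurable_snd.
 apply: cmeasM; first exact: cmeas_cst.
 exact: (cmeas_comp (schwartz_measurable sphi) (pair2_measurable t)).
rewrite Fourier_s_inversion// !normcM !normc_real -/c (ger0_norm c0) -[leRHS]mulrA.
rewrite -[leRHS]mul1r ler_pM ?mulr_ge0 ?normc_ge0//.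
 rewrite ger0_norm ?expR_ge0// -expR0 ler_expR oppr_le0 mulr_ge0 ?(ltW t0)//.
 by rewrite addr_ge0 ?sqr_ge0.
by rewrite ler_wpM2l//; exact: (hM (q, t)).
Qed.

Definition expint f := [/\ cmeasurable f, forall t, t <= 0 -> f t = 0 &
 forall d : R, 0 < d -> cintegrable mu (fun t => f t * (expR (- (d * t)))%:C)].

Lemma ae_box_witness (P : R * R -> Prop) (a b : R) : a < b -> {ae (@mu2 R), forall q, P q} ->
 exists q, [/\ a < q.1 < b, a < q.2 < b & P q].
Proof.
move=> ab [N [mN N0 hN]]; apply: contrapT => H.
pose B : set (measurableTypeR R * measurableTypeR R) := `]a, b[%classic `*` `]a, b[%classic.
have mi : measurable (`]a, b[%classic : set (measurableTypeR R)) by exact: measurable_itv.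
have mB : measurable B by exact: measurableX.
have BN : B `<=` N.
 move=> q [/=]; rewrite !in_itv/= => h1 h2; apply: hN => /= Pq; apply: H; exists q; split => //.
have : (@mu2 R) B = 0.
 apply/eqP; rewrite -measure_le0 -N0; apply: le_measure; rewrite ?inE//.
rewrite /mu2 /prodsf /=; rewrite product_measure1E//= lebesgue_measure_itv/= lte_fin ab.
by move=> /eqP; rewrite -EFinB -EFinM eqe mulf_eq0 subr_eq0 (gt_eqF ab).
Qed.

Lemma bump_gt0 (a b c t : R) : 0 < c -> a < t < b -> 0 < bump a b c t.
Proof.
move=> c0 /andP[ta tb]; rewrite /bump /flat mulr_gt0 ?mulr_gt0 ?subr_gt0//.
by rewrite ?expr0 ?mul1r expR_gt0.
Qed.

(** The profile of an element of V0+ is integrable against decaying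
  exponentials: test with a bump in (x, y) concentrated near the center. *)
Lemma V0p_profile_expint (F : R -> R[i]) : cmeasurable F ->
 (forall phi, schwartz phi -> cintegrable (@muH R) (fun p => V0p_profile F p * phi p)) ->
 expint (fun t => if 0 < t then (k^-1)%:C * F t else 0).
Proof.
move=> mF H; have mf : cmeasurable (fun t => if 0 < t then (k^-1)%:C * F t else 0 : R[i]).
 apply: cmeas_if; [exact: measurable_ltr| |exact: cmeas_cst].
 by apply: cmeasM => //; exact: cmeas_cst.
split => // [t t0|d d0]; first by rewrite ltNge t0.
pose r := Num.sqrt d / 2; have r0 : 0 < r by rewrite divr_gt0 ?sqrtr_gt0.
have rr : - r < r by rewrite gtrN.
have r2 : r ^+ 2 + r ^+ 2 = d / 2 by rewrite expr_div_n sqr_sqrtr ?(ltW d0)//; field.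
pose X t : R := bump (- r) r 1 t.
have bX : bumpy (- r) r X by exact: bump_bumpy.
have d2 : 0 < d / 2 by rewrite divr_gt0.
pose phi p : R[i] := (X p.1.1)%:C * (X p.1.2)%:C * (expcut (d / 2) 0 p.2)%:C.
have sphi : schwartz phi.
 exact: (schwartz_tensor (bumpy_rapid1 bX) (bumpy_rapid1 bX) (expcut_rapid1 0 d2)).
have iP := integrable_normc (H phi sphi).
have [q [q1 q2 iq]] := ae_box_witness rr (@ae_integrable1 _ _ _ _ _ mu2 mu _ iP).
have X1 : 0 < X q.1 by exact: bump_gt0.
have X2 : 0 < X q.2 by exact: bump_gt0.
pose K : R := (Num.sqrt pi)^-1 * X q.1 * X q.2 * expR (-1).
have K0 : 0 < K by rewrite !mulr_gt0 ?invr_gt0 ?sqrtpi_gt0 ?expR_gt0.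
have h := RintegrableZl (k^-1 / K) iq.
apply: (cintegr_le mu _ _ _ h) => [|t].
 apply: cmeasM => //; apply: cmeas_real; apply: measurableT_comp => //.
 by apply: measurableT_comp => //; exact: measurable_funM.
have ki : 0 < k^-1 by rewrite invr_gt0.
have n0 z : 0 <= k^-1 / K * normc z by rewrite !mulr_ge0 ?normc_ge0 ?invr_ge0 ?(ltW ki)// ltW.
case: ifPn => t0; last by rewrite mul0r normc0 /=; exact: n0.
rewrite /= /V0p_profile /phi /= (ltW t0) !normcM !normc_real.
rewrite (gtr0_norm ki) (ger0_norm (expR_ge0 _)) (gtr0_norm X1) (gtr0_norm X2).
have e0 : 0 < expcut (d / 2) 0 t.
 by rewrite /expcut mulr_gt0 ?expR_gt0// /flat ltr_wpDl ?(ltW t0)// mulr_gt0 ?expR_gt0 ?exprn_gt0// invr_gt0 ltr_wpDl ?(ltW t0).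
rewrite (gtr0_norm e0) (ger0_norm (mulr_ge0 _ (expR_ge0 _))) ?invr_ge0 ?(ltW sqrtpi_gt0)//.
set e1 := expR (- (rho2 (q, t) * t)); set E := expcut _ _ _.
rewrite [leRHS](_ : _ = k^-1 * normc (F t) *
 (K^-1 * ((Num.sqrt pi)^-1 * (e1 * (X q.1 * (X q.2 * E)))))); last by ring.
rewrite ler_wpM2l ?mulr_ge0 ?normc_ge0 ?(ltW ki)// ler_pdivlMl//.
rewrite /K -!mulrA ler_wpM2l ?invr_ge0 ?(ltW sqrtpi_gt0)//.
rewrite [leRHS]mulrCA ler_wpM2l ?(ltW X1)// [leRHS]mulrCA ler_wpM2l ?(ltW X2)//.
have -> : expR (- (d * t)) = expR (- (d / 2 * t)) * expR (- (d / 2 * t)).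
 by rewrite -expRD; congr expR; field.
rewrite /E /expcut [leRHS]mulrCA.
rewrite ler_pM ?mulr_ge0 ?expR_ge0//.
 rewrite /flat ltr_wpDl ?(ltW t0)// expr0 mul1r ler_expR lerN2 invf_le1 ?ltr_wpDl ?(ltW t0)//.
 by rewrite lerDr ltW.
rewrite ler_wpM2r ?expR_ge0// ler_expR lerN2 ler_wpM2r ?(ltW t0)// -r2 /rho2 /=.
have S (x : R) : - r < x < r -> x ^+ 2 <= r ^+ 2.
 by rewrite -ltr_norml => /ltW hx; rewrite -(real_normK (num_real x)) lerXn2r// nnegrE ltW.
by rewrite lerD ?S.
Qed.

End repr.

(** * Reconstruction of a function of V0+ from its profile *)

Section reconstruction.
Context {R : realType}.
Notation mu := (@lebesgue_measure R).
Local Notation R3 := (R * R * R)%type.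
Implicit Types (p : H1 R) (q : R * R) (s t : R) (f g : R -> R[i]).

Lemma ae_neq_s (a : R) : {ae (@muHs R), forall p : R3, p.2 != a}.
Proof.
exists (setT `*` [set a] : set ((measurableTypeR R * measurableTypeR R) * measurableTypeR R)); split.
- by apply: measurableX => //; exact: measurable_set1.
- have e := @product_measure1E _ _ _ _ R mu2 mu setT [set a] measurableT (measurable_set1 a).
 transitivity (mu2 setT * mu [set a])%E; first exact: e.
 by rewrite [mu [set a]]lebesgue_measure_set1 mule0.
- by move=> p /= /negP; rewrite negbK => /eqP.
Qed.

Lemma ae_neq_x (a : R) : {ae (@muHs R), forall p : R3, p.1.1 != a}.
Proof.
have m1 : measurable ([set a] `*` setT : set (measurableTypeR R * measurableTypeR R)).
 by apply: measurableX => //; exact: measurable_set1.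
exists (([set a] `*` setT) `*` setT : set ((measurableTypeR R * measurableTypeR R) * measurableTypeR R)); split.
- exact: measurableX.
- have e := @product_measure1E _ _ _ _ R mu2 mu _ setT m1 measurableT.
 have e' := @product_measure1E _ _ _ _ R mu mu [set a] setT (measurable_set1 a) measurableT.
 transitivity (mu2 ([set a] `*` setT) * mu setT)%E; first exact: e.
 rewrite (_ : mu2 ([set a] `*` setT) = mu [set a] * mu setT)%E; last exact: e'.
 by rewrite [mu [set a]]lebesgue_measure_set1 !mul0e.
- by move=> p /= /negP; rewrite negbK => /eqP.
Qed.

Lemma cintegr_fubini2 {d1 d2} {T1 : measurableType d1} {T2 : measurableType d2}
  (m1 : {sigma_finite_measure set T1 -> \bar R}) (m2 : {sigma_finite_measure set T2 -> \bar R})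
  (F : T1 * T2 -> R[i]) : cintegrable (m1 \x m2)%E F ->
 cintegrable m2 (fun y => cintegral m1 (fun x => F (x, y))).
Proof.
have H (g : T1 * T2 -> R) : Rintegrable (m1 \x m2)%E g ->
  m2.-integrable setT (fun y => (Rintegral m1 setT (fun x => g (x, y)))%:E).
 move=> ig; pose ga : T1 * T2 -> \bar R := EFin \o (fun z => `|g z|).
 have ia : (m1 \x m2)%E.-integrable setT ga by exact: integrable_abse ig.
 have mG := measurable_fubini_G ig; have mA := measurable_fubini_G ia.
 have A0 y : (0 <= fubini_G m1 ga y)%E.
  by apply: integral_ge0 => x _; rewrite lee_fin.
 have iA : m2.-integrable setT (fubini_G m1 ga).
  apply/integrableP; split => //.
  under eq_integral => y _ do rewrite gee0_abs//.
  rewrite (integral21_prod_meas1 ia); have /integrableP[_] := ia.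
  by under eq_integral => x _ do rewrite gee0_abs ?lee_fin//.
 apply: (le_integrable measurableT _ _ iA) => [|y _].
  apply/measurable_EFinP; apply: (measurableT_comp (@fine_measurable R _ measurableT)); exact: mG.
 apply: (@le_trans _ _ `|fubini_G m1 (EFin \o g) y|%E).
  rewrite /Rintegral -/(fubini_G m1 (EFin \o g) y).
  by case: (fubini_G _ _ _) => //= *; rewrite leey.
 rewrite (gee0_abs (A0 y)); apply: le_abse_integral => //.
 have /measurable_EFinP mg := measurable_int _ ig.
 apply/measurable_EFinP; exact: (measurableT_comp mg (measurable_pair2 _)).
by move=> [fr fi]; split; [exact: (H _ fr)|exact: (H _ fi)].
Qed.

Lemma cmeas_expRN {d} {T : measurableType d} (h : T -> R) : measurable_fun setT h ->
 cmeasurable (fun x => (expR (- h x))%:C).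
Proof.
move=> mh; apply: cmeas_real; apply: measurableT_comp; first exact: measurable_expR.
exact: measurableT_comp.
Qed.

Lemma divfMl (a b : R) : a != 0 -> a / (a * b) = b^-1.
Proof. by move=> a0; rewrite invfM mulrA mulfV// mul1r. Qed.

Lemma normc_expRN (x : R) : 0 <= x -> normc (expR (- x))%:C <= 1.
Proof. by move=> x0; rewrite normc_real ger0_norm ?expR_ge0// -expR0 ler_expR oppr_le0. Qed.

Lemma rapid1_iker f : rapid1 f -> cmeasurable f /\ exists M, forall t, normc (f t) <= M * iker t.
Proof.
move=> [P [Pf H]]; have [hr [w _ dw]] := H _ Pf; split.
 exact: ccont_measurable (ccont_is_cderive dw).
have [M hM] := hr 1%N; exists M => t; rewrite /iker ler_pdivlMr ?ltr_wpDr ?sqr_ge0//.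
by have := hM t; rewrite expr1 mulrC.
Qed.

Lemma cis_cexp (s t : R) : cexp (s%:C * (0 +i* t)) = cis (s * t) :> R[i].
Proof. by rewrite cisE; congr cexp; apply: eqcE; rewrite !cE/=; ring. Qed.

Section bumps.
Variables (l r a2 b2 a3 b3 : R) (X1 X2 X3 : R -> R).
Hypotheses (lr : l < r) (ab2 : a2 < b2) (ab3 : a3 < b3).
Hypotheses (bX1 : bumpy l r X1) (bX2 : bumpy a2 b2 X2) (bX3 : bumpy a3 b3 X3).

Let psi p : R[i] := (X1 p.1.1)%:C * (X2 p.1.2)%:C * (X3 p.2)%:C.
Let B t := blaplace X3 (0 +i* t).
Let phi p : R[i] := (X1 p.1.1)%:C * (X2 p.1.2)%:C * B p.2.

Lemma bump_psi_schwartz : schwartz psi.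
Proof. exact: (schwartz_tensor (bumpy_rapid1 bX1) (bumpy_rapid1 bX2) (bumpy_rapid1 bX3)). Qed.

Lemma bump_phi_schwartz : schwartz phi.
Proof. exact: (schwartz_tensor (bumpy_rapid1 bX1) (bumpy_rapid1 bX2) (blaplace_rapid1 ab3 bX3)). Qed.

Lemma bump_Fourier p : Fourier_s phi p = (Num.sqrt (2 * pi))%:C * psi p.
Proof.
have [mB [M hM]] := rapid1_iker (blaplace_rapid1 ab3 bX3).
have iB := cintegr_iker mB hM.
have iX : cintegrable mu (fun t => (X3 t)%:C).
 have := bumpy_cexp_integrable 0 ab3 bX3; apply: eq_cintegrable => t.
 by rewrite mulr0 cexp0 mulr1.
have BE t : B t = cintegral mu (fun x => (X3 x)%:C * cis (x * t)).
 by rewrite /B /blaplace /laplace; apply: eq_cintegral => x; rewrite cis_cexp.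
have lim : normc ((X3 x)%:C - (X3 p.2)%:C) @[x --> p.2] --> (0 : R).
 have h : `|X3 x - X3 p.2| @[x --> p.2] --> (0 : R).
  rewrite -[X in _ --> X](@normr0 _ R); apply: cvg_norm; apply/subr_cvg0.
  exact: (bumpy_continuous bX3).
 by under eq_fun do rewrite -rmorphB/= normc_real.
have inv := @fourier_inversion R (fun x => (X3 x)%:C) p.2 iX lim.
have iB' : cintegrable mu (fun s => cintegral mu (fun x => (X3 x)%:C * cis (x * s))).
 by apply: (eq_cintegrable _ iB) => s; rewrite -/(B s) BE.
have {}inv := inv iB'.
rewrite Fourier_sE /phi /=.
transitivity (((Num.sqrt (2 * pi))^-1)%:C * ((X1 p.1.1)%:C * (X2 p.1.2)%:C *
  cintegral mu (fun t => B t * cis (- (p.2 * t))))).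
 congr (_ * _); rewrite -cintegralZl.
  by apply: eq_cintegral => t; rewrite mulrA mulrN [t * _]mulrC.
 apply: (cintegr_bounded mu _ _ 1 iB); last by move=> s; rewrite normc_cis.
 by apply: measurable_cis; apply: measurableT_comp => //; exact: measurable_funM.
have -> : cintegral mu (fun t => B t * cis (- (p.2 * t))) = (2 * pi)%:C * (X3 p.2)%:C.
 by rewrite -inv; apply: eq_cintegral => s; rewrite BE.
have p0 : 0 <= 2 * pi :> R by rewrite mulr_ge0 ?pi_ge0.
have -> : (2 * pi)%:C = (Num.sqrt (2 * pi))%:C * (Num.sqrt (2 * pi))%:C :> R[i].
 by rewrite -rmorphM/= -expr2 sqr_sqrtr.
have cc : (Num.sqrt (2 * pi))%:C != 0 :> R[i] by rewrite eq_complex/= eqxx andbT gt_eqF// sqrt2pi_gt0.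
by rewrite /psi fmorphV/=; move: cc; move: ((Num.sqrt (2 * pi))%:C : R[i]) => cc cc0; field.
Qed.

Variables (u : H1 R -> R[i]) (F : R -> R[i]).
Hypothesis mF : cmeasurable F.
Hypothesis hV : forall phi, schwartz phi ->
   cintegrable (@muH R) (fun p => V0p_profile F p * phi p) /\
   distr u (Fourier_s phi) = distr (V0p_profile F) phi.
Let k : R := Num.sqrt (2 * pi) * Num.sqrt pi.
Let f t : R[i] := if 0 < t then (k^-1)%:C * F t else 0.
Variable d : R.
Hypotheses (d0 : 0 < d) (dX : forall x, l < x < r -> d <= x ^+ 2).

(** Both u and the transform of its profile have the same integral against a
  product of bumps, whose partial Fourier transform is Schwartz. *)
Lemma bump_pairing : cintegrable (@muH R) (fun p => u p * psi p) ->
 cintegrable (@muH R) (fun p => psi p * laplace f (zc 1 p)) /\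
 cintegral (@muH R) (fun p => u p * psi p) =
 cintegral (@muH R) (fun p => psi p * laplace f (zc 1 p)).
Proof.
move=> iu; have [mf f0 fd] := V0p_profile_expint mF (fun phi h => (hV h).1).
rewrite -/k -/f in mf f0 fd.
pose b q := l < q.1 < r.
have mb : measurable_fun setT b.
 apply: measurable_and; last first.
  exact: (measurable_fun_ltr measurable_fst (@measurable_cst _ _ _ _ _ _)).
 exact: (measurableT_comp (measurable_ltr l) measurable_fst).
have bd q : b q -> d <= q.1 ^+ 2 + q.2 ^+ 2.
 by move=> /dX h; apply: le_trans h _; rewrite lerDl sqr_ge0.
have iX : cintegrable mu (fun t => (X3 t)%:C).
 have := bumpy_cexp_integrable 0 ab3 bX3; apply: eq_cintegrable => t.
 by rewrite mulr0 cexp0 mulr1.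
have [|iE E] := pairing mb mf f0 (fd d d0) bd (schwartz_integrable bump_psi_schwartz).
 by move=> q _; exact: (cintegrZl ((X1 q.1)%:C * (X2 q.2)%:C) iX).
have eb p : (if b p.1 then psi p * laplace f (zc 1 p) else 0) = psi p * laplace f (zc 1 p).
 by case: ifPn => // h; rewrite /psi (bumpy_supp bX1 h) !mul0r.
split; first by apply: (eq_cintegrable _ iE) => p; exact: eb.
have {eb} -> : cintegral (@muH R) (fun p => psi p * laplace f (zc 1 p)) =
  cintegral (@muH R) (fun p => if b p.1 then psi p * laplace f (zc 1 p) else 0).
 by apply: eq_cintegral => p; rewrite eb.
rewrite {}E.
have [iP eP] := hV bump_phi_schwartz.
pose c : R := Num.sqrt (2 * pi); have c0 : 0 < c by exact: sqrt2pi_gt0.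
have cc : c%:C != 0 :> R[i] by rewrite eq_complex/= eqxx andbT gt_eqF.
apply: (mulfI cc).
have -> : c%:C * cintegral (@muH R) (fun p => u p * psi p) = distr u (Fourier_s phi).
 rewrite -(cintegralZl c%:C iu); apply: eq_cintegral => p.
 by rewrite bump_Fourier mulrCA.
rewrite eP.
have kc : c / k = (Num.sqrt pi)^-1 by exact: (divfMl _ (lt0r_neq0 sqrt2pi_gt0)).
have [mB [M hM]] := rapid1_iker (blaplace_rapid1 ab3 bX3).
pose N (p : R3) : R[i] := c%:C * (f p.2 * ((expR (- (p.2 * (p.1.1 ^+ 2 + p.1.2 ^+ 2))))%:C * phi p)).
have mx : measurable_fun setT (fun q : R * R => q.1 ^+ 2 + q.2 ^+ 2).
 by apply: measurable_funD; apply: measurable_funX; [exact: measurable_fst|exact: measurable_snd].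
have mN : cmeasurable N.
 apply: cmeasM; first exact: cmeas_cst.
 apply: cmeasM; first exact: (cmeas_comp mf measurable_snd).
 apply: cmeasM; last exact: (schwartz_measurable bump_phi_schwartz).
 apply: cmeas_expRN; apply: measurable_funM; first exact: measurable_snd.
 exact: (measurableT_comp mx measurable_fst).
have ePN : {ae (@muHs R), forall p, V0p_profile F p * phi p = N p}.
 apply: (ae_imp (ae_neq_s 0)) => p p0; rewrite /N /f /V0p_profile.
 have [h|h] := ltP 0 p.2; last by rewrite leNgt lt_neqAle p0 h/= !mul0r mulr0.
 rewrite (ltW h) mulrA mulrA mulrA; congr (_ * _).
 rewrite -rmorphM/= [_ * F _]mulrC -mulrA; congr (_ * _).
 rewrite -rmorphM/= /rho2; congr (_%:C).
 by rewrite kc [p.2 * _]mulrC.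
have iN : cintegrable (@muHs R) N by exact: (ae_eq_cintegrable (@muHs R) _ _ mN ePN).
rewrite /distr (ae_eq_cintegral (@muHs R) _ _ (cintegr_measurable iP) mN ePN).
rewrite (@cfubini2 R _ _ _ _ mu2 mu N iN).
have J t q : cintegral mu (fun s => psi (q, s) * cis (t * s)) = phi (q, t).
 rewrite /phi /= /B /blaplace /laplace -cintegralZl.
  by apply: eq_cintegral => s; rewrite cis_cexp /psi/= [t * s]mulrC mulrA.
 exact: (bumpy_cexp_integrable _ ab3 bX3).
have iX12 : cintegrable mu2 (fun q => (X1 q.1)%:C * (X2 q.2)%:C : R[i]).
 have [m1 [M1 hM1]] := rapid1_iker (bumpy_rapid1 bX1).
 have [m2 [M2 hM2]] := rapid1_iker (bumpy_rapid1 bX2).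
 have h := RintegrableZl (M1 * M2) (@iker2_integrable R).
 apply: (cintegr_le mu2 _ _ _ h) => [|q].
  apply: cmeasM; first exact: (cmeas_comp m1 measurable_fst).
  exact: (cmeas_comp m2 measurable_snd).
 by rewrite normcM /= mulrACA ler_pM ?normc_ge0.
have ig t : 0 < t -> cintegrable mu2 (fun q => (expR (- (t * (q.1 ^+ 2 + q.2 ^+ 2))))%:C * phi (q, t)).
 move=> t0; have := cintegrZl (B t) (cintegr_bounded mu2 _
  (fun q => (expR (- (t * (q.1 ^+ 2 + q.2 ^+ 2))))%:C) 1 iX12 _ _).
 move=> h; apply: (eq_cintegrable _ (h _ _)) => [q| |q].
 - by rewrite /phi /=; ring.
 - by apply: cmeas_expRN; exact: measurable_funM.
 - exact: (normc_expRN (mulr_ge0 (ltW t0) (addr_ge0 (sqr_ge0 _) (sqr_ge0 _)))).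
pose G t := f t * cintegral mu2 (fun q => (expR (- (t * (q.1 ^+ 2 + q.2 ^+ 2))))%:C * phi (q, t)).
have e1 t : cintegral mu2 (fun q => N (q, t)) = c%:C * G t.
 have [t0|t0] := ltP 0 t; last first.
  have ft : f t = 0 by exact: f0.
  rewrite /G /N /= ft mul0r mulr0 -[RHS](cintegral0 mu2); apply: eq_cintegral => q.
  by rewrite mul0r mulr0.
 have igt := ig t t0.
 by rewrite /G -(cintegralZl (f t) igt) -(cintegralZl c%:C (cintegrZl (f t) igt)).
have e2 t : f t * cintegral mu2 (fun q => if b q then (expR (- (t * (q.1 ^+ 2 + q.2 ^+ 2))))%:C *
   cintegral mu (fun s => psi (q, s) * cis (t * s)) else 0) = G t.
 apply: (congr1 (fun z => f t * z)); apply: eq_cintegral => q; rewrite J.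
 case: ifP => [_|/negbT h]; first reflexivity.
 by rewrite /phi /= (bumpy_supp bX1 h) !mul0r mulr0.
transitivity (cintegral mu (fun t => c%:C * G t)); first by apply: eq_cintegral => t; rewrite e1.
transitivity (c%:C * cintegral mu G); last first.
 by apply: (congr1 (fun z => c%:C * z)); apply: eq_cintegral => t; rewrite e2.
have iG' : cintegrable mu (fun t => cintegral mu2 (fun q => N (q, t))).
 exact: (@cintegr_fubini2 _ _ _ _ mu2 mu N iN).
have iG : cintegrable mu G.
 apply: (eq_cintegrable _ (cintegrZl (c^-1)%:C iG')) => t; rewrite e1 mulrA -rmorphM/=.
 by rewrite (mulVf (lt0r_neq0 c0)) mul1r.
exact: (cintegralZl c%:C iG).
Qed.

End bumps.

End reconstruction.

Section reconstruction2.
Context {R : realType}.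
Notation mu := (@lebesgue_measure R).
Local Notation R3 := (R * R * R)%type.
Implicit Types (p : H1 R) (q : R * R) (s t : R) (f g : R -> R[i]).

Definition inbox (a1 b1 a2 b2 a3 b3 : R) (p : R3) : bool :=
 [&& a1 < p.1.1 < b1, a2 < p.1.2 < b2 & a3 < p.2 < b3].

Lemma measurable_itvo {d} {T : measurableType d} (h : T -> R) (a b : R) :
 measurable_fun setT h -> measurable_fun setT (fun x => a < h x < b).
Proof.
move=> mh; apply: measurable_and; first exact: (measurableT_comp (measurable_ltr a) mh).
exact: (measurable_fun_ltr mh (@measurable_cst _ _ _ _ _ b)).
Qed.

Lemma measurable_inbox a1 b1 a2 b2 a3 b3 : measurable_fun setT (inbox a1 b1 a2 b2 a3 b3).
Proof.
apply: measurable_and.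
 apply: measurable_itvo; exact: (measurableT_comp measurable_fst measurable_fst).
apply: measurable_and; last by apply: measurable_itvo; exact: measurable_snd.
apply: measurable_itvo; exact: (measurableT_comp measurable_snd measurable_fst).
Qed.

Lemma inbox_integrable a1 b1 a2 b2 a3 b3 : a1 < b1 -> a2 < b2 -> a3 < b3 ->
 cintegrable (@muH R) (fun p => if inbox a1 b1 a2 b2 a3 b3 p then 1 else 0).
Proof.
move=> l1 l2 l3.
have [h1 _] := integrable_oo 1 l1; have [h2 _] := integrable_oo 1 l2.
have [h3 _] := integrable_oo 1 l3.
have h := @integrable_prod R _ _ _ _ mu2 mu _ _ (integrable_prod h1 h2) h3.
apply: (cintegr_le (@muH R) _ _ _ h) => [|p].
 apply: cmeas_if; [exact: measurable_inbox|exact: cmeas_cst|exact: cmeas_cst].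
rewrite /inbox /=; case: (a1 < _ < b1); case: (a2 < _ < b2); case: (a3 < _ < b3);
 by rewrite /= ?(mulr1, mulr0, mul0r) ?normc0 ?normc1.
Qed.

Variables (u : H1 R -> R[i]) (F : R -> R[i]).
Hypothesis mF : cmeasurable F.
Hypothesis hV : forall phi, schwartz phi ->
   cintegrable (@muH R) (fun p => V0p_profile F p * phi p) /\
   distr u (Fourier_s phi) = distr (V0p_profile F) phi.
Hypothesis iu : forall M, 0 < M ->
 cintegrable (@muH R) (fun p => if inbox (- M) M (- M) M (- M) M p then u p else 0).
Let f t : R[i] := if 0 < t then ((Num.sqrt (2 * pi) * Num.sqrt pi)^-1)%:C * F t else 0.

Lemma integrable_box_mul (M : R) (psi : H1 R -> R[i]) : 0 < M ->
 cmeasurable (psi : R3 -> R[i]) -> (forall p, normc (psi p) <= 1) ->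
 (forall p, ~~ inbox (- M) M (- M) M (- M) M p -> psi p = 0) ->
 cintegrable (@muH R) (fun p => u p * psi p).
Proof.
move=> M0 mpsi psi1 psi0.
have := cintegr_bounded (@muH R) _ psi 1 (iu M0) mpsi psi1.
apply: eq_cintegrable => p; case: ifPn => // h; by rewrite psi0// !mulr0.
Qed.

Lemma V0p_box (l r d M : R) : l < r -> 0 < d -> (forall x, l < x < r -> d <= x ^+ 2) -> 0 < M ->
 {ae (@muHs R), forall p : R3, inbox l r (- M) M (- M) M p -> u p = laplace f (zc 1 p)}.
Proof.
move=> lr d0 dX M0.
have [mf f0 fd] := V0p_profile_expint mF (fun phi h => (hV h).1).
have MM : - M < M by rewrite gtrN.
pose E p := laplace f (zc 1 p).
pose ib := inbox l r (- M) M (- M) M.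
pose one p : R[i] := if ib p then 1 else 0.
have m1 : cmeasurable (one : R3 -> R[i]).
 apply: cmeas_if; [exact: measurable_inbox|exact: cmeas_cst|exact: cmeas_cst].
pose M' := `|l| + `|r| + M.
have M'0 : 0 < M' by rewrite ltr_wpDl// addr_ge0.
have bigbox a1 b1 a2 b2 a3 b3 p : l <= a1 -> b1 <= r -> - M <= a2 -> b2 <= M -> - M <= a3 -> b3 <= M ->
  inbox a1 b1 a2 b2 a3 b3 p -> inbox (- M') M' (- M') M' (- M') M' p.
 move=> h1 h2 h3 h4 h5 h6 /and3P[/andP[x1 x2] /andP[y1 y2] /andP[s1 s2]].
 have M'M : M <= M' by rewrite lerDr addr_ge0.
 have NM : - M' <= - M by rewrite lerN2.
 have Ml : - M' <= l.
  rewrite lerNl (le_trans (ler_norm _))// normrN /M' -addrA lerDl addr_ge0//; exact: ltW.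
 have Mr : r <= M' by rewrite (le_trans (ler_norm _))// /M' addrAC lerDr addr_ge0//; exact: ltW.
 apply/and3P; split; apply/andP; split.
 - exact: le_lt_trans Ml (le_lt_trans h1 x1).
 - exact: lt_le_trans x2 (le_trans h2 Mr).
 - exact: le_lt_trans NM (le_lt_trans h3 y1).
 - exact: lt_le_trans y2 (le_trans h4 M'M).
 - exact: le_lt_trans NM (le_lt_trans h5 s1).
 - exact: lt_le_trans s2 (le_trans h6 M'M).
have i1 : cintegrable (@muH R) (fun p => u p * one p).
 apply: (integrable_box_mul M'0 m1) => p; rewrite /one; case: ifP => h.
 - by rewrite normc1.
 - by rewrite normc0.
 - by move=> /negP; case; exact: bigbox h.
 - by [].
pose b q := l < q.1 < r.
have mb : measurable_fun setT b by apply: measurable_itvo; exact: measurable_fst.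
have bd q : b q -> d <= q.1 ^+ 2 + q.2 ^+ 2.
 by move=> /dX h; apply: le_trans h _; rewrite lerDl sqr_ge0.
have i2 : cintegrable (@muH R) (fun p => one p * E p).
 have sone q : b q -> cintegrable mu (fun s => one (q, s)).
  move=> _; have [h _] := integrable_oo 1 MM.
  apply: (cintegr_le mu _ _ _ h) => [|s].
   exact: (cmeas_comp m1 (pair1_measurable q)).
  rewrite /one /ib /inbox /=; case: (l < _ < r); case: (- M < q.2 < M); case: (- M < s < M);
   by rewrite /= ?normc0 ?normc1.
 have [h _] := pairing mb mf f0 (fd d d0) bd (inbox_integrable lr MM MM) sone.
 apply: (eq_cintegrable _ h) => p; rewrite /one /ib /b; case: ifPn => // h'.
 by rewrite /inbox (negbTE h') mul0r.
pose D p := u p * one p - one p * E p.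
have iD : cintegrable (@muHs R) D by exact: cintegrB.
have mD := cintegr_measurable iD.
have key x0 y0 s0 : cintegral (@muHs R) (fun p => D p * (\1_(orthant x0 y0 s0) p)%:C) = 0.
 pose a1 := Num.max x0 l; pose a2 := Num.max y0 (- M); pose a3 := Num.max s0 (- M).
 have EO p : D p * (\1_(orthant x0 y0 s0) p)%:C =
   D p * (if inbox a1 r a2 M a3 M p then 1 else 0).
  rewrite indicE; have [h|h] := boolP (ib p); last first.
   by rewrite /D /one (negbTE h) mulr0 !mul0r subrr !mul0r.
  congr (_ * _); have /and3P[/andP[x1 x2] /andP[y1 y2] /andP[s1 s2]] := h.
  rewrite /inbox !gt_max x1 x2 y1 y2 s1 s2 !andbT.
  have [h1|h1] := boolP [&& x0 < p.1.1, y0 < p.1.2 & s0 < p.2].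
   by rewrite mem_set//; case/and3P: h1.
  by rewrite memNset// => -[k1 [k2 k3]]; move: h1; rewrite k1 k2 k3.
 have [/and3P[l1 l2 l3]|H] := boolP [&& a1 < r, a2 < M & a3 < M]; last first.
  rewrite -[RHS](cintegral0 muHs); apply: eq_cintegral => p; rewrite EO.
  case: ifPn => [/and3P[/andP[x1 x2] /andP[y1 y2] /andP[s1 s2]]|]; last by rewrite mulr0.
  move: H; rewrite (lt_trans x1 x2) (lt_trans y1 y2) (lt_trans s1 s2).
  by [].
 pose B1 (n : nat) := bump a1 r (n.+1%:R : R); pose B2 (n : nat) := bump a2 M (n.+1%:R : R).
 pose B3 (n : nat) := bump a3 M (n.+1%:R : R).
 have bB1 n : bumpy a1 r (B1 n) by apply: bump_bumpy.
 have bB2 n : bumpy a2 M (B2 n) by apply: bump_bumpy.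
 have bB3 n : bumpy a3 M (B3 n) by apply: bump_bumpy.
 pose psi n p : R[i] := (B1 n p.1.1)%:C * (B2 n p.1.2)%:C * (B3 n p.2)%:C.
 have mpsi n : cmeasurable (psi n : R3 -> R[i]).
  exact: (schwartz_measurable (bump_psi_schwartz (bB1 n) (bB2 n) (bB3 n))).
 have la1 : l <= a1 by rewrite le_max lexx orbT.
 have la2 : - M <= a2 by rewrite le_max lexx orbT.
 have la3 : - M <= a3 by rewrite le_max lexx orbT.
 have psi0 n p : ~~ inbox a1 r a2 M a3 M p -> psi n p = 0.
  rewrite /inbox /psi negb_and => /orP[h|].
   by rewrite (bumpy_supp (bB1 n) h) !mul0r.
  rewrite negb_and => /orP[h|h].
   by rewrite (bumpy_supp (bB2 n) h) mulr0 mul0r.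
  by rewrite (bumpy_supp (bB3 n) h) mulr0.
 have psi1 n p : normc (psi n p) <= 1.
  have nb (a c b' t : R) : normc (bump a c b' t)%:C <= 1.
   by rewrite normc_real ger0_norm ?bump_ge0 ?bump_le1.
  by rewrite /psi !normcM !mulr_ile1 ?mulr_ge0 ?normc_ge0 ?nb.
 have e0 n : cintegral (@muHs R) (fun p => D p * psi n p) = 0.
  have j1 : cintegrable (@muH R) (fun p => u p * psi n p).
   apply: (integrable_box_mul M'0 (mpsi n) (psi1 n)) => p h; apply: psi0.
   by apply: contra h; apply: bigbox.
  have dX' x : a1 < x < r -> d <= x ^+ 2.
   by move=> /andP[h1 h2]; apply: dX; rewrite h2 andbT (le_lt_trans la1).
  have [j2 j3] := bump_pairing l3 (bB1 n) (bB2 n) (bB3 n) mF hV d0 dX' j1.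
  transitivity (cintegral (@muH R) (fun p => u p * psi n p - psi n p * E p)).
   apply: eq_cintegral => p; rewrite /D /one; have [h|h] := boolP (ib p).
    by rewrite mulr1 mul1r; ring.
   rewrite psi0 ?mulr0 ?mul0r ?subrr//; apply: contra h.
   move=> /and3P[/andP[x1 x2] /andP[y1 y2] /andP[s1 s2]].
   apply/and3P; split; apply/andP; split => //.
   - exact: le_lt_trans la1 x1.
   - exact: le_lt_trans la2 y1.
   - exact: le_lt_trans la3 s1.
  by rewrite cintegralB// j3 subrr.
 pose lim p : R[i] := if inbox a1 r a2 M a3 M p then 1 else 0.
 have mlim : cmeasurable (lim : R3 -> R[i]).
  apply: cmeas_if; [exact: measurable_inbox|exact: cmeas_cst|exact: cmeas_cst].
 have Dn := integrable_normc iD.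
 have L : Rintegral (@muHs R) setT (fun p => normc (D p * psi n p - D p * lim p)) @[n --> \oo] --> (0 : R).
  apply: (cintegral_cvg muHs _ _ (fun p => normc (D p))).
  - by move=> n; exact: (cmeasM mD (mpsi n)).
  - exact: (cmeasM mD mlim).
  - by move=> n p; rewrite normcM ler_piMr ?normc_ge0.
  - exact: Dn.
  - move=> p; rewrite (_ : (fun n => _) = fun n => normc (D p) * normc (psi n p - lim p)); last first.
    by apply/funext => n; rewrite -mulrBr normcM.
   rewrite -(mulr0 (normc (D p))); apply: cvgM; first exact: cvg_cst.
   rewrite (_ : (fun n => normc _) = fun n => `|B1 n p.1.1 * B2 n p.1.2 * B3 n p.2 -
     (if inbox a1 r a2 M a3 M p then 1 else 0)|); last first.
    apply/funext => n; rewrite -normc_real rmorphB/= !rmorphM/= /psi /lim.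
    by case: ifP.
   rewrite -[X in _ --> X](@normr0 _ R); apply: cvg_norm; apply/subr_cvg0.
   have -> : (if inbox a1 r a2 M a3 M p then 1 else 0 : R) =
     (if a1 < p.1.1 < r then 1 else 0) * (if a2 < p.1.2 < M then 1 else 0) *
     (if a3 < p.2 < M then 1 else 0).
    by rewrite /inbox; case: (a1 < _ < r); case: (a2 < _ < M); case: (a3 < _ < M);
     rewrite /= ?(mulr1, mulr0, mul0r).
   by apply: cvgM; [apply: cvgM|]; exact: bump_cvg.
 have iL : cintegrable (@muHs R) (fun p => D p * lim p).
  apply: (cintegr_bounded muHs _ _ 1 iD mlim) => p.
  by rewrite /lim; case: ifP => _; rewrite ?normc1 ?normc0.
 have iN n : cintegrable (@muHs R) (fun p => D p * psi n p).
  exact: (cintegr_bounded muHs _ _ 1 iD (mpsi n) (psi1 n)).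
 transitivity (cintegral muHs (fun p => D p * lim p)); first by apply: eq_cintegral => p; exact: EO.
 apply/eqP; rewrite -normc_eq0 eq_le normc_ge0 andbT.
 apply: (ler_cvg_to (cvg_cst _) L); apply: nearW => n.
 have := normc_cintegral (cintegrB (iN n) iL).
 by rewrite cintegralB// e0 sub0r normcN.
have iDr := iD.1; have iDi := iD.2.
have a1 := orthant_null_ae iDr; have a2 := orthant_null_ae iDi.
have {}a1 : {ae muHs, forall p, Re (D p) = 0}.
 apply: a1 => x0 y0 s0; have := congr1 (@complex.Re R) (key x0 y0 s0); rewrite /cintegral /=.
 by move=> h; rewrite -[RHS]h; congr Rintegral; apply/funext => p; rewrite [D p * _]mulrC ReCM mulrC.
have {}a2 : {ae muHs, forall p, Im (D p) = 0}.
 apply: a2 => x0 y0 s0; have := congr1 (@complex.Im R) (key x0 y0 s0); rewrite /cintegral /=.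
 by move=> h; rewrite -[RHS]h; congr Rintegral; apply/funext => p; rewrite [D p * _]mulrC ImCM mulrC.
apply: (ae_imp (ae_and a1 a2)) => p [h1 h2] hb.
have : D p = 0 by apply: eqcE.
by rewrite /D /one /ib hb mulr1 mul1r => /eqP; rewrite subr_eq0 => /eqP.
Qed.

Lemma V0p_profile_repr : {ae (@muHs R), forall p : R3, u p = laplace f (zc 1 p)}.
Proof.
have N0 n : 0 < n.+1%:R :> R by [].
have P n : {ae (@muHs R), forall p : R3, inbox n.+1%:R^-1 (n.+1%:R + 1) (- n.+1%:R) n.+1%:R (- n.+1%:R) n.+1%:R p ->
   u p = laplace f (zc 1 p)}.
 apply: (@V0p_box _ _ (n.+1%:R^-1 ^+ 2)) => //.
 - by rewrite (@le_lt_trans _ _ 1)// ?invf_le1// ?ler1n// ltrDr.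
 - move=> x /andP[h _]; rewrite lerXn2r// ?nnegrE ?invr_ge0// ltW//.
  by rewrite (lt_trans _ h)// invr_gt0.
have Q n : {ae (@muHs R), forall p : R3, inbox (- (n.+1%:R + 1)) (- n.+1%:R^-1) (- n.+1%:R) n.+1%:R (- n.+1%:R) n.+1%:R p ->
   u p = laplace f (zc 1 p)}.
 apply: (@V0p_box _ _ (n.+1%:R^-1 ^+ 2)) => //.
 - by rewrite ltrN2 (@le_lt_trans _ _ 1)// ?invf_le1// ?ler1n// ltrDr.
 - move=> x /andP[_ h]; rewrite -[x ^+ 2]sqrrN lerXn2r// ?nnegrE ?invr_ge0// lerNr ?ltW//.
  by rewrite oppr0; apply: lt_trans h _; rewrite oppr_lt0 invr_gt0.
apply: (ae_imp (ae_and (ae_neq_x 0) (ae_and (ae_foralln P) (ae_foralln Q)))) => p [x0 [hP hQ]].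
pose n := Num.bound (`|p.1.1| + `|p.1.1|^-1 + `|p.1.2| + `|p.2|).
have hn : `|p.1.1| + `|p.1.1|^-1 + `|p.1.2| + `|p.2| < n.+1%:R.
 apply: lt_trans (archi_boundP _) _; first by rewrite !addr_ge0.
 by rewrite ltr_nat.
have nx : `|p.1.1| < n.+1%:R + 1.
 apply: (@lt_trans _ _ n.+1%:R); last by rewrite ltrDl.
 by rewrite (le_lt_trans _ hn)// -!addrA lerDl !addr_ge0.
have ny : `|p.1.2| < n.+1%:R by rewrite (le_lt_trans _ hn)// -addrA addrCA lerDl !addr_ge0.
have ns : `|p.2| < n.+1%:R by rewrite (le_lt_trans _ hn)// lerDr !addr_ge0.
have ni : n.+1%:R^-1 < `|p.1.1|.
 rewrite invf_plt ?posrE ?normr_gt0// (le_lt_trans _ hn)// -!addrA addrCA lerDl !addr_ge0//.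
move: ny ns; rewrite !ltr_norml => ny ns.
have [h|h|h] := ltrgtP p.1.1 0; last by rewrite h eqxx in x0.
 apply: (hQ n); apply/and3P; split => //.
 by move: nx ni; rewrite ltr0_norm// ltrNr => nx ni; rewrite ltrNl nx.
apply: (hP n); apply/and3P; split => //.
by move: nx ni; rewrite gtr0_norm// => nx ni; rewrite ni.
Qed.

End reconstruction2.

Section reconstruction3.
Context {R : realType}.

(** An element of V0+, locally integrable, is the Laplace transform of a
  function on the positive half line. *)
Lemma V0p_repr (u : H1 R -> R[i]) : V0p u ->
 (forall M : R, 0 < M ->
  cintegrable (@muH R) (fun p => if inbox (- M) M (- M) M (- M) M p then u p else 0)) ->
 exists2 f, expint f & {ae (@muHs R), forall p : R * R * R, u p = laplace f (zc 1 p)}.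
Proof.
move=> [F [mF hV]] iu; exists (fun t => if 0 < t then
  ((Num.sqrt (2 * pi) * Num.sqrt pi)^-1)%:C * F t else 0).
 exact: V0p_profile_expint mF (fun phi h => (hV phi h).1).
exact: V0p_profile_repr.
Qed.

End reconstruction3.

(** * Gaussian integrals and convolution on the half line *)

Section gauss_conv.
Context {R : realType}.
Notation mu := (@lebesgue_measure R).
Implicit Types (q : R * R) (s t : R) (f g : R -> R[i]).

Lemma gauss1 (c : R) : 0 < c -> Rintegrable mu (fun x => expR (- (c * x ^+ 2))) /\
 \int[mu]_x expR (- (c * x ^+ 2)) = Num.sqrt (pi / c).
Proof.
move=> c0; pose s : R := Num.sqrt ((c * 2)^-1).
have s0 : 0 < s by rewrite sqrtr_gt0 invr_gt0 mulr_gt0.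
have s2 : s ^+ 2 *+ 2 = c^-1.
 by rewrite sqr_sqrtr ?invr_ge0 ?mulr_ge0 ?(ltW c0)// -mulr_natr invfM -mulrA mulVf ?mulr1.
have E x : normal_pdf 0 s x = (Num.sqrt (pi / c))^-1 * expR (- (c * x ^+ 2)).
 rewrite /normal_pdf gt_eqF// /normal_peak /normal_fun subr0 s2 invrK; congr (_ * expR _).
  congr (Num.sqrt _)^-1; rewrite -s2 mulrC mulrnAr; congr (_ *+ _).
 by rewrite mulNr mulrC.
have pc : 0 < Num.sqrt (pi / c) by rewrite sqrtr_gt0 divr_gt0 ?pi_gt0.
have iN : Rintegrable mu (normal_pdf 0 s) by exact: integrable_normal_pdf.
have E' : (fun x => expR (- (c * x ^+ 2))) = fun x => Num.sqrt (pi / c) * normal_pdf 0 s x.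
 by apply/funext => x; rewrite E (mulVKf (lt0r_neq0 pc)).
have I1 : \int[mu]_x normal_pdf 0 s x = 1 by rewrite /Rintegral integral_normal_pdf.
rewrite E'; split; first exact: (RintegrableZl (Num.sqrt (pi / c)) iN).
by rewrite RintegralZl// I1 mulr1.
Qed.

Lemma gauss2 (c : R) : 0 < c ->
 Rintegrable (@mu2 R) (fun q : R * R => expR (- (c * (q.1 ^+ 2 + q.2 ^+ 2)))) /\
 Rintegral (@mu2 R) setT (fun q : R * R => expR (- (c * (q.1 ^+ 2 + q.2 ^+ 2)))) = pi / c.
Proof.
move=> c0; have [i1 e1] := gauss1 c0.
have E : (fun q : R * R => expR (- (c * (q.1 ^+ 2 + q.2 ^+ 2)))) =
  fun q => expR (- (c * q.1 ^+ 2)) * expR (- (c * q.2 ^+ 2)).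
 by apply/funext => q; rewrite -expRD mulrDr opprD.
have h : Rintegrable (@mu2 R) (fun q : R * R => expR (- (c * (q.1 ^+ 2 + q.2 ^+ 2)))).
 by rewrite E; exact: (@integrable_prod R _ _ _ _ mu mu _ _ i1 i1).
split => //; rewrite (@Rfubini1 R _ _ _ _ mu mu _ h).
have -> : (fun x => \int[mu]_y expR (- (c * ((x, y).1 ^+ 2 + (x, y).2 ^+ 2)))) =
  fun x => Num.sqrt (pi / c) * expR (- (c * x ^+ 2)).
 apply/funext => x /=; rewrite -e1 mulrC -RintegralZl//.
 by congr Rintegral; apply/funext => y; rewrite -expRD mulrDr opprD.
by rewrite RintegralZl// e1 -expr2 sqr_sqrtr// divr_ge0 ?pi_ge0// ltW.
Qed.

Lemma cintegr_fubini1 {d1 d2} {T1 : measurableType d1} {T2 : measurableType d2}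
  (m1 : {sigma_finite_measure set T1 -> \bar R}) (m2 : {sigma_finite_measure set T2 -> \bar R})
  (F : T1 * T2 -> R[i]) : cintegrable (m1 \x m2)%E F ->
 cintegrable m1 (fun x => cintegral m2 (fun y => F (x, y))).
Proof.
have H (h : T1 * T2 -> R) : Rintegrable (m1 \x m2)%E h ->
  m1.-integrable setT (fun x => (Rintegral m2 setT (fun y => h (x, y)))%:E).
 move=> ih; have iG := integrable_fubini_F ih.
 have mG := measurable_fubini_F ih.
 apply: (le_integrable measurableT _ _ iG) => [|y _].
  apply/measurable_EFinP; apply: (measurableT_comp (@fine_measurable R _ measurableT)); exact: mG.
 rewrite /Rintegral -/(fubini_F m2 (EFin \o h) y).
 by case: (fubini_F _ _ _) => //= *; rewrite leey.
by move=> [fr fi]; split; [exact: (H _ fr)|exact: (H _ fi)].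
Qed.

Definition conv f g s : R[i] := cintegral mu (fun t => f t * g (s - t)).

Lemma expint_laplace f z : expint f -> Re z < 0 ->
 cintegrable mu (fun t => f t * cexp (t%:C * z)).
Proof.
move=> [mf _ fd] z0.
have d0 : 0 < - Re z by rewrite oppr_gt0.
have mc : cmeasurable (fun t : R => cis (t * Im z)).
 by apply: measurable_cis; exact: measurable_funM.
have := cintegr_bounded mu _ _ 1 (fd _ d0) mc (fun t => eq_ind_r (fun x => x <= 1) (lexx 1) (normc_cis _)).
apply: eq_cintegrable => t; rewrite cexpE ReCM ImCM mulrA mulNr opprK.
by rewrite [Re z * t]mulrC.
Qed.

Section conv.
Variables (f g : R -> R[i]) (M : R).
Hypotheses (ef : expint f) (eg : expint g) (gM : forall t, normc (g t) <= M).

Let gsub_measurable s : cmeasurable (fun t : R => g (s - t)).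
Proof.
have [mg _ _] := eg; apply: (cmeas_comp mg).
by apply: measurable_funB => //; exact: measurable_cst.
Qed.

Lemma conv_section s : cintegrable mu (fun t => f t * g (s - t)).
Proof.
have [mf f0 fd] := ef; have [mg g0 gd] := eg.
have h := RintegrableZl (M * expR s) (integrable_normc (fd 1 ltr01)).
have M0 : 0 <= M by exact: le_trans (normc_ge0 _) (gM 0).
apply: (cintegr_le mu _ _ _ h) => [|t]; first by apply: cmeasM => //; exact: gsub_measurable.
rewrite /= !normcM normc_real (ger0_norm (expR_ge0 _)) mul1r.
have [st|st] := leP s t.
 rewrite g0 ?subr_le0// normc0 mulr0 !mulr_ge0 ?expR_ge0 ?normc_ge0//.
rewrite [leRHS](_ : _ = normc (f t) * (M * (expR s * expR (- t)))); last by ring.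
rewrite ler_wpM2l ?normc_ge0// -[leLHS]mulr1 ler_pM ?normc_ge0//.
by rewrite -expRD -expR0 ler_expR subr_ge0 ltW.
Qed.

Lemma conv_supp s : s <= 0 -> conv f g s = 0.
Proof.
move=> s0; have [_ f0 _] := ef; have [_ g0 _] := eg.
rewrite /conv -[RHS](cintegral0 mu); apply: eq_cintegral => t.
have [t0|t0] := leP t 0; first by rewrite f0// mul0r.
by rewrite g0 ?mulr0// subr_le0 (le_trans s0)// ltW.
Qed.

Lemma conv_measurable : cmeasurable (conv f g).
Proof.
have [mf f0 fd] := ef; have [mg g0 gd] := eg.
have h : cmeasurable (fun x : R * R => f x.2 * g (x.1 - x.2)).
 apply: cmeasM; first exact: (cmeas_comp mf measurable_snd).
 apply: (cmeas_comp mg).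
 by apply: measurable_funB; [exact: measurable_fst|exact: measurable_snd].
exact: (cmeas_cintegral2 mu h).
Qed.

Lemma conv_laplace_int z : cintegrable mu (fun t => f t * cexp (t%:C * z)) ->
 cintegrable mu (fun t => g t * cexp (t%:C * z)) ->
 cintegrable mu (fun s => conv f g s * cexp (s%:C * z)) /\
 laplace (conv f g) z = laplace f z * laplace g z.
Proof.
move=> iF iG; have [mf f0 fd] := ef; have [mg g0 gd] := eg.
pose K (x : R * R) : R[i] := f x.2 * g (x.1 - x.2) * cexp (x.1%:C * z).
have EK s t : K (s, t) = (f t * cexp (t%:C * z)) * (g (s - t) * cexp ((s - t)%:C * z)).
 by rewrite /K /= mulrACA -cexpD -mulrDl -rmorphD/= [t + _]addrC subrK.
have mK : cmeasurable K.
 apply: cmeasM.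
  apply: cmeasM; first exact: (cmeas_comp mf measurable_snd).
  apply: (cmeas_comp mg).
  by apply: measurable_funB; [exact: measurable_fst|exact: measurable_snd].
 exact: (cmeas_comp (cmeas_cexpX z) measurable_fst).
have iGt t : cintegrable mu (fun s => g (s - t) * cexp ((s - t)%:C * z)).
 by have [h _] := cintegral_translate (- t) iG.
have eGt t : cintegral mu (fun s => g (s - t) * cexp ((s - t)%:C * z)) = laplace g z.
 by have [_ h] := cintegral_translate (- t) iG.
pose C := \int[mu]_s normc (g s * cexp (s%:C * z)).
have nG := integrable_normc iG.
have nGm : measurable_fun setT (fun s : R => normc (g s * cexp (s%:C * z))).
 exact: (measurable_normc (cintegr_measurable iG)).
have iK : cintegrable (mu \x mu)%E K.
 apply/cintegrP; split => //.
 apply: (@integrable_tonelli2 R _ _ _ _ mu mu (fun x => normc (K x))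
  (fun t => C * normc (f t * cexp (t%:C * z)))).
 - exact: measurable_normc.
 - by move=> x; exact: normc_ge0.
 - move=> t; have := integrable_normc (cintegrZl (f t * cexp (t%:C * z)) (iGt t)).
  by apply: (eq_integrable measurableT) => s _ /=; rewrite EK.
 - move=> t; rewrite mulrC.
  have [h1 h2] := @Rintegral_translate R (- t) _ nGm nG.
  rewrite /C -h2 -RintegralZl// le_eqVlt; apply/orP; left; apply/eqP.
  by congr Rintegral; apply/funext => s; rewrite EK normcM.
 - exact: (RintegrableZl C (integrable_normc iF)).
have e1 s : cintegral mu (fun t => K (s, t)) = conv f g s * cexp (s%:C * z).
 by rewrite /K /= /conv -cintegralZr//; exact: conv_section.
have e2 t : cintegral mu (fun s => K (s, t)) = f t * cexp (t%:C * z) * laplace g z.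
 rewrite -(eGt t) -cintegralZl//; apply: eq_cintegral => s; exact: EK.
split.
 have h := @cintegr_fubini1 _ _ _ _ mu mu K iK.
 by apply: (eq_cintegrable _ h) => s; rewrite e1.
rewrite /laplace.
transitivity (cintegral mu (fun s => cintegral mu (fun t => K (s, t)))).
 by apply: eq_cintegral => s; rewrite e1.
rewrite -(@cfubini1 R _ _ _ _ mu mu K iK) (@cfubini2 R _ _ _ _ mu mu K iK).
transitivity (cintegral mu (fun t => f t * cexp (t%:C * z) * laplace g z)).
 by apply: eq_cintegral => t; rewrite e2.
exact: cintegralZr.
Qed.

Lemma conv_laplace z : Re z < 0 ->
 cintegrable mu (fun s => conv f g s * cexp (s%:C * z)) /\
 laplace (conv f g) z = laplace f z * laplace g z.
Proof. by move=> z0; apply: conv_laplace_int; exact: expint_laplace. Qed.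

Lemma conv_expint : expint (conv f g).
Proof.
split; [exact: conv_measurable|exact: conv_supp|move=> d d0].
have [|h _] := @conv_laplace (- d)%:C; first by rewrite /= oppr_lt0.
apply: (eq_cintegrable _ h) => s; rewrite -rmorphM/= cexp_real.
by rewrite mulrN [s * d]mulrC.
Qed.

End conv.

End gauss_conv.

(** * The Plancherel-type pairing with antiholomorphic functions *)

Section kernel.
Context {R : realType}.
Notation mu := (@lebesgue_measure R).
Notation R3 := (R * R * R)%type.
Implicit Types (p : R3).

Definition ker32 (t : R) : R := ((1 + `|t|) * Num.sqrt (1 + `|t|))^-1.

Lemma ker32_gt0 t : 0 < ker32 t.
Proof.
have h : 0 < 1 + `|t| by rewrite ltr_pwDl.
by rewrite invr_gt0 mulr_gt0// sqrtr_gt0.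
Qed.

Lemma ker32_continuous : continuous ker32.
Proof.
move=> t; have h : 0 < 1 + `|t| by rewrite ltr_pwDl.
have c1 : {for t, continuous (fun x : R => 1 + `|x|)}.
 by apply: continuousD; [exact: cst_continuous|exact: norm_continuous].
have c2 : {for t, continuous (fun x : R => Num.sqrt (1 + `|x|))}.
 exact: (continuous_comp c1 (@sqrt_continuous R _)).
apply: (continuousV (s := fun x : R => (1 + `|x|) * Num.sqrt (1 + `|x|))); last exact: continuousM.
by rewrite mulf_neq0// gt_eqF// sqrtr_gt0.
Qed.

Lemma integrable_ker32 : Rintegrable mu ker32.
Proof.
pose F (x : R) : R := - 2 * (Num.sqrt (1 + x))^-1.
have a1 (x : R) : 0 <= x -> 0 < 1 + x by move=> ax; lra.
have dF (x : R) : 0 <= x -> is_derive x 1 F (ker32 x).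
 move=> ax; have h := @is_derive1_sqrt R _ (a1 _ ax).
 have h2 : is_derive x 1 (fun x : R => 1 + x) (0 + 1 : R) by exact: is_deriveD.
 have h3 := @is_derive1_comp R (Num.sqrt : R -> R) (fun x : R => 1 + x) x _ _ h h2.
 have q0 : Num.sqrt (1 + x) != 0 by rewrite gt_eqF// sqrtr_gt0 a1.
 have h4 := @is_deriveZ R R R _ (-2) _ _ _ (@is_deriveV R _ x _ 1 q0 h3).
 apply: (is_derive_eq h4); rewrite /ker32 /GRing.scale /= (ger0_norm ax).
 have e : 1 + x = Num.sqrt (1 + x) ^+ 2 by rewrite sqr_sqrtr// ltW// a1.
 rewrite {3}e; move: (Num.sqrt _) q0 => q q0; field.
 exact: q0.
have mk := measurable_continuous ker32_continuous.
have i1 : Rintegrable mu (fun x => if 0 < x then ker32 x else 0).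
 apply: (@integrable_derive_gt R F ker32 0 0) => //.
 - by move=> x _; exact: ker32_continuous.
 - by move=> x _; exact/ltW/ker32_gt0.
 - rewrite -[X in _ --> X](mulr0 (-2)); apply: cvgMr.
  apply/cvgr0Pnorm_lt => e e0; near=> x.
  have xe : e ^- 2 < x by near: x; apply: nbhs_pinfty_gt; exact: num_real.
  have e2 : 0 < e ^- 2 by rewrite invr_gt0 exprn_gt0.
  have x1 : 0 < 1 + x by rewrite a1// ltW// (lt_trans e2).
  rewrite ger0_norm ?invr_ge0 ?sqrtr_ge0// -[e]invrK ltf_pV2 ?posrE ?invr_gt0 ?sqrtr_gt0//.
  rewrite -(@ltr_pXn2r _ 2) ?nnegrE ?invr_ge0 ?(ltW e0) ?sqrtr_ge0// sqr_sqrtr ?(ltW x1)// exprVn.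
  by rewrite (lt_trans xe)// ltrDr ltr01.
 - by apply: measurable_fun_if => //; [exact: measurable_ltr|exact: measurable_funTS].
have m1 : measurable_fun setT (fun x : R => if 0 < x then ker32 x else 0).
 by apply: measurable_fun_if => //; [exact: measurable_ltr|exact: measurable_funTS].
have [i2 _] := @Rintegral_reflect R _ m1 i1.
have h11 : (-1 : R) < 1 by lra.
have [i3 _] := @integrable_oo R (-1) 1 1 h11.
apply: (le_integrable measurableT _ _ (RintegrableD (RintegrableD i1 i2) i3)) => [|x _].
 exact/measurable_EFinP.
rewrite /= lee_fin (le_trans _ (ler_norm _))// (gtr0_norm (ker32_gt0 x)).
have g0 := ltW (ker32_gt0 x); have eN : ker32 (- x) = ker32 x by rewrite /ker32 normrN.
have k0 : ker32 0 = 1 by rewrite /ker32 normr0 addr0 sqrtr1 mulr1 invr1.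
rewrite eN oppr_gt0.
have [x0|x0|<-] := ltgtP 0 x; rewrite ?ltxx ?ltrN10 ?ltr01 /= ?k0 ?add0r//.
 by rewrite addr0 lerDl; case: ifP.
by rewrite lerDl; case: ifP.
Unshelve. all: by end_near.
Qed.

Lemma normc_1B_zc p : normc (1 - zc 1 p) ^+ 2 = (1 + rho2 p) ^+ 2 + p.2 ^+ 2.
Proof. by rewrite sqr_normcE /= mul1r opprK sub0r sqrrN. Qed.

Lemma ker32_zeta p : (normc (1 - zc 1 p))^-1 ^+ 3 <= 27 * (ker32 p.1.1 * ker32 p.1.2 * ker32 p.2).
Proof.
have := normc_1B_zc p; set N := normc _ => N2.
have N1 : 1 <= N by exact/normc_1B/Re_zc_le0.
pose P := (1 + `|p.1.1|) * (1 + `|p.1.2|) * (1 + `|p.2|).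
have P1 : 1 <= P by rewrite !mulr_ege1// lerDl.
have PN : P <= 3 * N ^+ 2.
 rewrite N2 /P /rho2 -(real_normK (num_real p.1.1)) -(real_normK (num_real p.1.2)) -(real_normK (num_real p.2)).
 have := normr_ge0 p.1.1; have := normr_ge0 p.1.2; have := normr_ge0 p.2.
 move: `|p.1.1| `|p.1.2| `|p.2| => x y s s0 y0 x0.
 have h1 : (1 + x) * (1 + y) <= 2 * (1 + (x ^+ 2 + y ^+ 2)).
  by have := sqr_ge0 (x - y); have := sqr_ge0 (x - 1); have := sqr_ge0 (y - 1); nra.
 have h2 : 1 <= 1 + (x ^+ 2 + y ^+ 2) by rewrite lerDl addr_ge0 ?sqr_ge0.
 apply: (le_trans (ler_wpM2r _ h1)); first lra.
 move: (1 + (x ^+ 2 + y ^+ 2)) h2 => A A1.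
 by have := sqr_ge0 (A - s); have := sqr_ge0 s; nra.
have e : ker32 p.1.1 * ker32 p.1.2 * ker32 p.2 = (P * Num.sqrt P)^-1.
 have h (t : R) : 0 <= 1 + `|t| by rewrite addr_ge0.
 rewrite /ker32 -!invfM; congr (_^-1); rewrite /P !sqrtrM ?mulr_ge0//.
 by ring.
rewrite e exprVn -[27]invrK -invfM lef_pV2 ?posrE.
- have q : Num.sqrt P <= 3 * N.
  rewrite -(@ler_pXn2r _ 2) ?nnegrE ?sqrtr_ge0 ?mulr_ge0 ?(le_trans ler01 N1)// sqr_sqrtr ?(le_trans ler01 P1)//.
  by rewrite (le_trans PN)// exprMn ler_wpM2r ?sqr_ge0// -natrX ler_nat.
 rewrite ler_pdivrMl ?ltr0n// [27 * _](_ : _ = (3 * N ^+ 2) * (9 * N)); last by ring.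
 rewrite ler_pM ?sqrtr_ge0 ?(le_trans ler01 P1)// (le_trans q)// ler_wpM2r ?(le_trans ler01 N1)// ler_nat//.
- by rewrite exprn_gt0// (lt_le_trans ltr01 N1).
- by rewrite mulr_gt0 ?invr_gt0 ?ltr0n// mulr_gt0 ?sqrtr_gt0 ?(lt_le_trans ltr01 P1).
Qed.

Lemma integrable_zeta3 : Rintegrable (@muH R) (fun p : R3 => (normc (1 - zc 1 p))^-1 ^+ 3).
Proof.
have m : cmeasurable (fun p : R3 => 1 - zc 1 p).
 by apply: cmeasB; [exact: cmeas_cst|exact: cmeas_zc].
have h := @integrable_prod R _ _ _ _ (@mu2 R) mu _ _
 (@integrable_prod R _ _ _ _ mu mu _ _ integrable_ker32 integrable_ker32) integrable_ker32.
apply: (le_integrable measurableT _ _ (RintegrableZl 27 h)) => [|p _].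
 apply/measurable_EFinP.
 have := measurable_normc (cmeasX 3 (cmeasV m)).
 by apply: eq_measurable_fun => p _; rewrite normcX normcV.
rewrite /= lee_fin (le_trans _ (ler_norm _))// ger0_norm ?exprn_ge0 ?invr_ge0 ?normc_ge0//.
exact: ker32_zeta.
Qed.

End kernel.

Section powexp.
Context {R : realType}.
Notation mu := (@lebesgue_measure R).
Implicit Types (t : R) (z : R[i]).

Definition pexp (k : nat) (m : R) t : R[i] := if 0 < t then (t ^+ k * expR (- (m * t)))%:C else 0.

Lemma pexp_measurable k m : cmeasurable (pexp k m).
Proof.
apply: cmeas_if; [exact: measurable_ltr| |exact: cmeas_cst].
apply: cmeas_real; apply: measurable_funM; first exact: exprn_measurable.
by apply: measurableT_comp => //; apply: measurableT_comp => //; exact: measurable_funM.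
Qed.

Lemma pexp_cexp k m z t : pexp k m t * cexp (t%:C * z) =
 if 0 < t then (t ^+ k)%:C * cexp (t%:C * (z - m%:C)) else 0.
Proof.
rewrite /pexp; case: ifP => _; last by rewrite mul0r.
rewrite rmorphM/= -cexp_real -mulrA -cexpD; congr (_ * cexp _).
by rewrite mulrBr addrC -!rmorphM/= -rmorphN/= [t * m]mulrC.
Qed.

Lemma pexp_expint k m : 0 <= m -> expint (pexp k m).
Proof.
move=> m0; split; first exact: pexp_measurable.
 by move=> t t0; rewrite /pexp ltNge t0.
move=> d d0; have h := @cintegr_powcexp_gt R k ((- d)%:C - m%:C).
have /h : Re ((- d)%:C - m%:C) < 0 by rewrite /= -opprD oppr_lt0 ltr_pwDl.
apply: eq_cintegrable => t; rewrite -pexp_cexp -rmorphM/= cexp_real.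
by rewrite mulrN [t * d]mulrC.
Qed.

Lemma laplace_pexp k m z : 0 < m -> Re z <= 0 ->
 laplace (pexp k m) z = (k`!%:R)%:C / (m%:C - z) ^+ k.+1.
Proof.
move=> m0 z0; rewrite /laplace (eq_cintegral mu (fun t => pexp_cexp k m z t)) cintegral_powcexp_gt ?opprB//=.
by rewrite ReD ReN /= ltrBlDr add0r (le_lt_trans z0).
Qed.

Lemma pexp_bounded k m : 0 < m -> exists M, forall t, normc (pexp k m t) <= M.
Proof.
move=> m0; exists ((k.+1%:R / m) ^+ k) => t; rewrite /pexp.
case: ifP => t0; last by rewrite normc0 exprn_ge0// divr_ge0// ltW.
rewrite normc_real ger0_norm ?mulr_ge0 ?exprn_ge0 ?expR_ge0 ?(ltW t0)//.
by rewrite expRN ler_pdivrMr ?expR_gt0// powle_expR// ltW.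
Qed.

End powexp.

Section plancherel.
Context {R : realType}.
Notation mu := (@lebesgue_measure R).
Notation R3 := (R * R * R)%type.
Implicit Types (t s : R) (q : R * R).

Lemma normc_cvg0 (u : nat -> R[i]) (l : R[i]) : normc (u n - l) @[n --> \oo] --> (0 : R) ->
 forall l', normc (u n - l') @[n --> \oo] --> (0 : R) -> l = l'.
Proof.
move=> h l' h'; apply/eqP; rewrite -subr_eq0 -normc_eq0; apply/eqP.
have h2 : (fun _ : nat => normc (l - l')) @ \oo --> (0 : R).
 apply: (@squeeze0 R _ (fun n => normc (u n - l) + normc (u n - l'))).
  move=> n; rewrite normc_ge0/= [l - l'](_ : _ = (u n - l') - (u n - l)); last by ring.
  by rewrite [leRHS]addrC normcB.
 by rewrite -[X in _ --> X](addr0 0); exact: cvgD.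
exact: (cvg_unique _ (cvg_cst _) h2).
Qed.

Lemma cintegral_dct {d} {T : measurableType d} (m : {measure set T -> \bar R})
  (f_ : nat -> T -> R[i]) f (g : T -> R) l : (forall n, cintegrable m (f_ n)) ->
 cintegrable m f -> Rintegrable m g ->
 (forall n x, normc (f_ n x) <= g x) ->
 (forall x, normc (f_ n x - f x) @[n --> \oo] --> (0 : R)) ->
 normc (cintegral m (f_ n) - l) @[n --> \oo] --> (0 : R) -> cintegral m f = l.
Proof.
move=> if_ iff ig fg cf cl.
apply: (normc_cvg0 _ cl).
apply: (@squeeze0 R _ (fun n => Rintegral m setT (fun x => normc (f_ n x - f x)))).
 move=> n; rewrite normc_ge0/= -cintegralB//; apply: normc_cintegral.
 exact: cintegrB.
apply: cintegral_cvg ig cf => //.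
 by move=> n; exact: cintegr_measurable (if_ n).
exact: cintegr_measurable iff.
Qed.

Lemma measurable_neq0 : measurable_fun setT (fun x : R => x != 0).
Proof.
by apply: measurable_neg; apply: measurable_fun_eqr; [exact: measurable_id|exact: measurable_cst].
Qed.

Lemma ae_neq_x2 (a : R) : {ae (@mu2 R), forall q : R * R, q.1 != a}.
Proof.
exists ([set a] `*` setT : set (measurableTypeR R * measurableTypeR R)); split.
- by apply: measurableX => //; exact: measurable_set1.
- have e := @product_measure1E _ _ _ _ R mu mu [set a] setT (measurable_set1 a) measurableT.
 rewrite (_ : mu2 ([set a] `*` setT) = mu [set a] * mu setT)%E; last exact: e.
 by rewrite [mu [set a]]lebesgue_measure_set1 !mul0e.
- by move=> p /= /negP; rewrite negbK => /eqP.
Qed.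

Definition awayx (n : nat) q := n.+1%:R^-1 < `|q.1|.

Lemma measurable_awayx n : measurable_fun setT (awayx n : R * R -> bool).
Proof.
apply: (measurableT_comp (measurable_ltr (n.+1%:R^-1 : R))).
by apply: measurableT_comp => //; exact: measurable_fst.
Qed.

Lemma awayx0 n q : q.1 = 0 -> awayx n q = false.
Proof. by move=> e; rewrite /awayx e normr0 ltNge invr_ge0 ler0n. Qed.

Lemma awayx_near q : q.1 != 0 -> \forall n \near \oo, awayx n q.
Proof.
move=> q0; have h : 0 < `|q.1| by rewrite normr_gt0.
exact: near_infty_natSinv_lt (PosNum h).
Qed.

Lemma awayx_cvg (F : R * R -> R[i]) q :
 normc ((if awayx n q then F q else 0) - (if q.1 != 0 then F q else 0)) @[n --> \oo] --> (0 : R).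
Proof.
have [q0|q0] := eqVneq q.1 0.
 rewrite (_ : (fun n => _) = fun=> 0); first exact: cvg_cst.
 by apply/funext => n; rewrite awayx0// subrr normc0.
apply: cvg_near_cst; have := awayx_near q0.
by apply: filterS => n ->; rewrite subrr normc0.
Qed.

Lemma gauss_awayx c : 0 < c -> let g n := cintegral (@mu2 R) (fun q =>
  if awayx n q then (expR (- (c * (q.1 ^+ 2 + q.2 ^+ 2))))%:C else 0) in
 [/\ forall n, cintegrable (@mu2 R) (fun q =>
    if awayx n q then (expR (- (c * (q.1 ^+ 2 + q.2 ^+ 2))))%:C else 0),
   forall n, normc (g n) <= pi / c
  & normc (g n - (pi / c)%:C) @[n --> \oo] --> (0 : R)].
Proof.
move=> c0 g; have [ig eg] := gauss2 c0.
pose G q : R[i] := (expR (- (c * (q.1 ^+ 2 + q.2 ^+ 2))))%:C.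
have nG q : normc (G q) = expR (- (c * (q.1 ^+ 2 + q.2 ^+ 2))) by rewrite normc_real ger0_norm ?expR_ge0.
have mG : cmeasurable (G : measurableTypeR R * measurableTypeR R -> R[i]).
 by apply: cmeas_real; have /measurable_EFinP := measurable_int _ ig.
have mg n : cmeasurable (fun q : measurableTypeR R * measurableTypeR R => if awayx n q then G q else 0).
 by apply: cmeas_if => //; exact: measurable_awayx.
have bd n q : normc (if awayx n q then G q else 0) <= expR (- (c * (q.1 ^+ 2 + q.2 ^+ 2))).
 by case: ifP => _; rewrite ?nG// normc0 expR_ge0.
have igc n : cintegrable (@mu2 R) (fun q => if awayx n q then G q else 0).
 exact: (cintegr_le _ _ _ (mg n) ig (bd n)).
have mL : cmeasurable (fun q : measurableTypeR R * measurableTypeR R => if q.1 != 0 then G q else 0).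
 apply: cmeas_if => //.
 exact: (measurableT_comp (measurable_neq0) measurable_fst).
split=> [//|n|].
 apply: (le_trans (normc_cintegral (igc n))); rewrite -eg.
 apply: le_Rintegral => //; exact: (integrable_normc (igc n)).
have -> : (pi / c)%:C = cintegral (@mu2 R) (fun q => if q.1 != 0 then G q else 0).
 transitivity (cintegral (@mu2 R) G); first by rewrite cintegral_real eg.
 apply: ae_eq_cintegral => //; apply: (ae_imp (ae_neq_x2 0)) => q q0.
 by rewrite q0.
have iL : cintegrable (@mu2 R) (fun q => if q.1 != 0 then G q else 0).
 apply: (cintegr_le _ _ _ mL ig) => q; by case: ifP => _; rewrite ?nG// normc0 expR_ge0.
apply: (@squeeze0 R _ (fun n => Rintegral (@mu2 R) setT (fun q =>
  normc ((if awayx n q then G q else 0) - (if q.1 != 0 then G q else 0))))).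
 move=> n; rewrite normc_ge0 /g -cintegralB//=; apply: normc_cintegral.
 exact: cintegrB.
apply: cintegral_cvg ig _ => // q; exact: awayx_cvg.
Qed.

End plancherel.

Section plancherel_pairing.
Context {R : realType}.
Notation mu := (@lebesgue_measure R).
Notation R3 := (R * R * R)%type.
Implicit Types (t s : R) (q : R * R).

Definition ccont_at (f : R -> R[i]) t :=
 {for t, continuous (fun x => Re (f x))} /\ {for t, continuous (fun x => Im (f x))}.

Lemma ccont_at_cvg f t : ccont_at f t -> normc (f x - f t) @[x --> t] --> (0 : R).
Proof.
move=> [cr ci].
have h : `|Re (f x) - Re (f t)| + `|Im (f x) - Im (f t)| @[x --> t] --> (0 : R).
 have l (g : R -> R) : {for t, continuous g} -> `|g x - g t| @[x --> t] --> (0 : R).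
  move=> cg; rewrite -[X in _ --> X](@normr0 _ R) -(subrr (g t)).
  by apply: cvg_norm; apply: cvgB => //; exact: cvg_cst.
 by rewrite -[X in _ --> X](addr0 0); exact: (cvgD (l _ cr) (l _ ci)).
apply: (squeeze_cvgr _ (cvg_cst 0) h).
near=> x; rewrite normc_ge0/=; apply: (le_trans (normc_le _)).
by rewrite !cE.
Unshelve. all: by end_near. Qed.

Section pairing_with_conj.
Variables (kap f : R -> R[i]) (c C C' : R).
Let W (p : R3) : R[i] := (laplace kap (zc 1 p))^*.
Hypotheses (c0 : 0 < c) (mk : cmeasurable kap) (k0 : forall t, t <= 0 -> kap t = 0).
Hypothesis kcont : forall t, 0 < t -> ccont_at kap t.
Hypothesis kB : forall t, 0 < t -> normc (kap t) <= C * (t * expR (- (c * t))).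
Hypothesis iW : cintegrable (@muH R) W.
Hypothesis WB : forall p, normc (W p) <= C' * iker p.2.

Let kap_integrable : cintegrable mu kap.
Proof.
have h := @integrable_powexpR_gt R 1 (- c).
have /h {}h : - c < 0 by rewrite oppr_lt0.
apply: (cintegr_le mu _ _ _ (RintegrableZl C h)) => [|t /=]; first exact: mk.
have [t0|t0] := ltP 0 t; last by rewrite k0// normc0 mulr0.
by rewrite expr1 mulNr kB.
Qed.

Let W_slice q : cintegrable mu (fun s => W (q, s)).
Proof.
apply: (@cintegr_iker R _ C') => [|s]; last exact: (WB (q, s)).
exact: (cmeas_comp (cintegr_measurable iW) (pair1_measurable q)).
Qed.

(** Fourier inversion in the variable s recovers the profile of the function. *)
Let W_fourier q t : 0 < t -> cintegral mu (fun s => W (q, s) * cis (t * s)) =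
 (2 * pi)%:C * ((expR (- (t * (q.1 ^+ 2 + q.2 ^+ 2))))%:C * (kap t)^*).
Proof.
move=> t0; pose r := q.1 ^+ 2 + q.2 ^+ 2.
have r0 : 0 <= r by rewrite addr_ge0 ?sqr_ge0.
pose V x : R[i] := (expR (- (x * r)))%:C * (kap x)^*.
have mV : cmeasurable V.
 apply: cmeasM; last exact: cmeas_conj.
 by apply: cmeas_expRN; exact: measurable_funM.
have iV : cintegrable mu V.
 apply: (cintegr_le mu _ _ _ (integrable_normc kap_integrable)) => [|x]; first exact: mV.
 rewrite normcM normc_conj; have [x0|x0] := leP x 0; first by rewrite k0// normc0 mulr0.
 by rewrite ler_piMl ?normc_ge0// normc_expRN// mulr_ge0// ltW.
have [iU _] := cintegral_reflect iV.
have WE s : W (q, s) = cintegral mu (fun x => V (- x) * cis (x * s)).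
 pose G x := V x * cis (- (x * s)).
 have GE x : (kap x * cexp (x%:C * zc 1 (q, s)))^* = G x.
  rewrite rmorphM/= -cexp_conj cexpE Re_conj Im_conj ReCM ImCM /= mul1r mulrN.
  by rewrite /G /V -/r mulrAC mulrC.
 have iG : cintegrable mu G.
  apply: (cintegr_bounded mu _ _ 1 iV) => [|x]; last by rewrite normc_cis.
  by apply: measurable_cis; apply: measurableT_comp => //; exact: measurable_funM.
 have [_ e] := cintegral_reflect iG.
 transitivity (cintegral mu G); last first.
  by rewrite -e; apply: eq_cintegral => x; rewrite /G mulNr opprK.
 rewrite /W /laplace -cintegral_conj; first by apply: eq_cintegral => x; rewrite GE.
 have h := cintegr_conj iG; apply: (eq_cintegrable _ h) => x.
 by rewrite -GE conjcK.
have cV : ccont_at (fun x => V (- x)) (- t).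
 have h (g : R -> R) : {for t, continuous g} ->
   {for - t, continuous (fun x : R => expR (- (- x * r)) * g (- x))}.
  move=> cg; apply: continuousM; last first.
   by apply: (@continuous_comp _ _ _ (-%R : R -> R) g); [exact: oppr_continuous|rewrite opprK].
  apply: (@continuous_comp _ _ _ (fun x : R => - (- x * r)) expR); last exact: continuous_expR.
  apply: continuousN; apply: continuousM; last exact: cst_continuous.
  exact: oppr_continuous.
 have [kr ki] := kcont t0; split.
  have -> : (fun x : R => Re (V (- x))) =
    fun x => expR (- (- x * r)) * Re (kap (- x)).
   by apply/funext => x; rewrite /V ReCM Re_conj.
  exact: (h (fun x => Re (kap x)) kr).
 have -> : (fun x : R => Im (V (- x))) =
   fun x => expR (- (- x * r)) * - Im (kap (- x)).
  by apply/funext => x; rewrite /V ImCM Im_conj.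
 exact: (h (fun x => - Im (kap x)) (continuousN ki)).
have := @fourier_inversion R (fun x => V (- x)) (- t) iU (ccont_at_cvg cV).
rewrite opprK => <-.
 by apply: eq_cintegral => s; rewrite WE mulNr opprK.
apply: (eq_cintegrable _ (W_slice q)) => s; exact: WE.
Qed.

Hypothesis ef : expint f.
Hypothesis iWf : cintegrable (@muH R) (fun p => W p * laplace f (zc 1 p)).

(** The profiles of a holomorphic and of an antiholomorphic factor are paired
  with the weight 1/t left by the Gaussian integral over (x, y); cutting out a
  neighbourhood of the plane x = 0 makes Fubini available. *)
Lemma plancherel : cintegral (@muH R) (fun p => W p * laplace f (zc 1 p)) =
 (pi ^+ 2)%:C * cintegral mu (fun t => f t * ((kap t)^* / t%:C)).
Proof.
have [mf f0 fd] := ef.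
pose K t : R[i] := (pi ^+ 2)%:C * ((kap t)^* / t%:C).
have KB t : 0 < t -> normc (K t) <= pi ^+ 2 * C * expR (- (c * t)).
 move=> t0; rewrite /K !normcM normcV normc_conj !normc_real (gtr0_norm t0) ger0_norm ?sqr_ge0//.
 rewrite -mulrA ler_wpM2l ?sqr_ge0// ler_pdivrMr// (le_trans (kB t0))//.
 by rewrite [t * _]mulrC mulrA.
have mK : cmeasurable K.
 apply: cmeasM; first exact: cmeas_cst.
 apply: cmeasM; first exact: cmeas_conj.
 by apply: cmeasV; exact: cmeas_real.
pose g t := pi ^+ 2 * C * normc (f t * (expR (- (c * t)))%:C).
have ig : Rintegrable mu g by exact: (RintegrableZl _ (integrable_normc (fd c c0))).
have fg t (k : R[i]) : (0 < t -> normc k <= pi ^+ 2 * C * expR (- (c * t))) -> normc (f t * k) <= g t.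
 move=> hk; rewrite /g !normcM normc_real (ger0_norm (expR_ge0 _)) mulrCA.
 have [t0|t0] := leP t 0; first by rewrite f0// normc0 !mul0r.
 by rewrite ler_wpM2l ?normc_ge0// hk.
have iK : cintegrable mu (fun t => f t * K t).
 apply: (cintegr_le _ _ _ _ ig) => [|t]; first exact: cmeasM.
 by apply: fg; exact: KB.
transitivity (cintegral mu (fun t => f t * K t)); last first.
 rewrite -cintegralZl.
  by apply: eq_cintegral => t; rewrite /K mulrCA.
 have := cintegrZl (((pi ^+ 2)%:C)^-1) iK; apply: eq_cintegrable => t.
 by rewrite /K [f t * _]mulrCA mulKf// fmorph_eq0 expf_neq0// gt_eqF// pi_gt0.
pose d n : R := n.+1%:R^-1 ^+ 2.
have dn n q : awayx n q -> d n <= q.1 ^+ 2 + q.2 ^+ 2.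
 move=> h; rewrite -(real_normK (num_real q.1)); apply: (@le_trans _ _ (`|q.1| ^+ 2)).
  by rewrite ler_pXn2r ?nnegrE ?invr_ge0// ltW.
 by rewrite lerDl sqr_ge0.
have d0 n : 0 < d n by rewrite exprn_gt0// invr_gt0.
have P n := pairing (@measurable_awayx R n) mf f0 (fd _ (d0 n)) (@dn n) iW (fun q _ => W_slice q).
pose An n t : R[i] := cintegral (@mu2 R) (fun q => if awayx n q then
  (expR (- (t * (q.1 ^+ 2 + q.2 ^+ 2))))%:C * cintegral mu (fun s => W (q, s) * cis (t * s)) else 0).
have GA t (t0 : 0 < t) := gauss_awayx (mulr_gt0 (ltr0n R 2) t0).
pose g2 n t : R[i] := cintegral (@mu2 R) (fun q => if awayx n q then
  (expR (- (2 * t * (q.1 ^+ 2 + q.2 ^+ 2))))%:C else 0).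
have AE n t : 0 < t -> An n t = (2 * pi)%:C * (kap t)^* * g2 n t.
 move=> t0; rewrite /g2 -cintegralZl; last by have [h _ _] := GA t t0.
 apply: eq_cintegral => q; case: ifP => _; last by rewrite mulr0.
 have e : expR (- (2 * t * (q.1 ^+ 2 + q.2 ^+ 2))) =
   expR (- (t * (q.1 ^+ 2 + q.2 ^+ 2))) * expR (- (t * (q.1 ^+ 2 + q.2 ^+ 2))).
  by rewrite -expRD; congr expR; ring.
 by rewrite W_fourier// e rmorphM/=; ring.
have An_cvg t : 0 < t -> (forall n, normc (An n t) <= pi ^+ 2 * C * expR (- (c * t))) /\
  normc (An n t - K t) @[n --> \oo] --> (0 : R).
 move=> t0; have [_ h1 h2] := GA t t0.
 have eg n : g2 n t = cintegral (@mu2 R) (fun q => if awayx n q then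
   (expR (- (2 * t * (q.1 ^+ 2 + q.2 ^+ 2))))%:C else 0) by [].
 have p0 := @pi_gt0 R; have t1 := lt0r_neq0 t0; split=> [n|].
  rewrite AE// eg !normcM normc_conj normc_real ger0_norm ?mulr_ge0 ?(ltW p0)//.
  have h := ler_pM (normc_ge0 _) (normc_ge0 _) (kB t0) (h1 n).
  rewrite -mulrA (le_trans (ler_wpM2l _ h)) ?mulr_ge0 ?(ltW p0)//.
  by rewrite le_eqVlt; apply/orP; left; apply/eqP; field.
 rewrite (_ : (fun n => _) = fun n => normc ((2 * pi)%:C * (kap t)^*) * normc (cintegral (@mu2 R) (fun q =>
   if awayx n q then (expR (- (2 * t * (q.1 ^+ 2 + q.2 ^+ 2))))%:C else 0) - (pi / (2 * t))%:C)).
  by rewrite -[X in _ --> X](mulr0 (normc ((2 * pi)%:C * (kap t)^*))); apply: cvgMr.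
 apply/funext => n; rewrite AE// eg -normcM mulrBr; congr (normc (_ - _)).
 rewrite /K -fmorphV mulrCA -rmorphM/= [RHS]mulrAC -rmorphM/= mulrC; congr (_%:C * _).
 by field.
have iA n : cintegrable mu (fun t => f t * An n t).
 suff h : cintegrable mu (fun t => f t * ((2 * pi)%:C * (kap t)^* * g2 n t)).
  by apply: (eq_cintegrable _ h) => t; have [t0|t0] := leP t 0; [rewrite f0// !mul0r|rewrite AE].
 apply: (cintegr_le mu _ _ _ ig) => [|t]; last by apply: fg => t0; rewrite -AE//; exact: (An_cvg t t0).1.
 apply: cmeasM => //; apply: cmeasM.
  by apply: cmeasM; [exact: cmeas_cst|exact: cmeas_conj].
 apply: (cmeas_cintegral2 (@mu2 R) (f := fun x : R * (R * R) =>
   if awayx n x.2 then (expR (- (2 * x.1 * (x.2.1 ^+ 2 + x.2.2 ^+ 2))))%:C else 0)).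
  apply: cmeas_if => //.
   exact: (measurableT_comp (@measurable_awayx R n) measurable_snd).
  apply: cmeas_expRN; apply: measurable_funM.
   by apply: measurable_funM; [exact: measurable_cst|exact: measurable_fst].
  apply: measurable_funD; apply: measurable_funX.
   exact: (measurableT_comp measurable_fst measurable_snd).
  exact: (measurableT_comp measurable_snd measurable_snd).
pose L (p : R3) : R[i] := if p.1.1 != 0 then W p * laplace f (zc 1 p) else 0.
have mL : cmeasurable L.
 apply: cmeas_if => //; last exact: cintegr_measurable iWf.
 exact: (measurableT_comp (@measurable_neq0 R) (measurableT_comp measurable_fst measurable_fst)).
transitivity (cintegral (@muH R) L).
 apply: (ae_eq_cintegral (@muHs R)) => //; first exact: cintegr_measurable iWf.
 by apply: (ae_imp (ae_neq_x 0)) => p; rewrite /L => ->.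
apply: (@cintegral_dct R _ _ (@muH R) (fun n p => if awayx n p.1 then W p * laplace f (zc 1 p) else 0) _
 (fun p => normc (W p * laplace f (zc 1 p)))).
- by move=> n; have [] := P n.
- apply: (cintegr_le (@muH R) _ _ _ (integrable_normc iWf)) => [|p]; first exact: mL.
 by rewrite /L; case: ifP => // _; rewrite normc0 normc_ge0.
- exact: integrable_normc.
- by move=> n p; case: ifP => // _; rewrite normc0 normc_ge0.
- move=> p; exact: (awayx_cvg (fun=> W p * laplace f (zc 1 p)) p.1).
- apply: (@squeeze0 R _ (fun n => Rintegral mu setT (fun t => normc (f t * An n t - f t * K t)))).
  move=> n; rewrite normc_ge0/=; have [_ ->] := P n.
  rewrite -(cintegralB (iA n) iK); exact: (normc_cintegral (cintegrB (iA n) iK)).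
 apply: cintegral_cvg ig _ => //.
 + by move=> n; exact: cintegr_measurable (iA n).
 + exact: cmeasM.
 + by move=> n t; apply: fg => t0; exact: (An_cvg t t0).1.
 + move=> t; have [t0|t0] := leP t 0.
   rewrite (_ : (fun n => _) = fun=> 0); first exact: cvg_cst.
   by apply/funext => n; rewrite f0// !mul0r subrr normc0.
  rewrite (_ : (fun n => _) = fun n => normc (f t) * normc (An n t - K t)).
   rewrite -[X in _ --> X](mulr0 (normc (f t))); apply: cvgMr; exact: (An_cvg t t0).2.
  by apply/funext => n; rewrite -mulrBr normcM.
Qed.

End pairing_with_conj.
End plancherel_pairing.

(** * Moments against negative powers of the conjugate of zeta *)

Section moments.
Context {R : realType}.
Notation mu := (@lebesgue_measure R).
Notation R3 := (R * R * R)%type.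
Implicit Types (p : R3) (t : R).

Lemma ccont_at_pos (k G : R -> R[i]) t : (forall x, 0 < x -> k x = G x) -> ccont G ->
 0 < t -> ccont_at k t.
Proof.
move=> kG [cr ci] t0.
have n : \forall x \near t, G x = k x.
 by near=> x; rewrite kG//; near: x; exact: lt_nbhsr.
have h (L : R[i] -> R) : continuous (fun x => L (G x)) -> {for t, continuous (fun x => L (k x))}.
 move=> c; have := c t; rewrite /continuous_at -kG// => ct.
 apply: cvg_trans ct; apply: near_eq_cvg.
 by apply: filterS n => x ->.
by split; [exact: h cr|exact: h ci].
Unshelve. all: by end_near. Qed.

Lemma ccont_id : ccont (fun x : R => x%:C).
Proof. by apply: ccont_real => x; exact: cvg_id. Qed.

Lemma ccont_expR (m : R) : ccont (fun x => (expR (- (m * x)))%:C).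
Proof.
have := ccont_is_cderive (@cderiv_cexp R (- m)%:C).
congr ccont; apply/funext => x; rewrite -rmorphM/= cexp_real.
by rewrite mulrN [x * m]mulrC.
Qed.

Lemma pexp_laplace_integrable k (m : R) z : 0 < m -> Re z <= 0 ->
 cintegrable mu (fun t => pexp k m t * cexp (t%:C * z)).
Proof.
move=> m0 z0; have h := @cintegr_powcexp_gt R k (z - m%:C).
have /h {}h : Re (z - m%:C) < 0 by rewrite ReD ReN /= ltrBlDr add0r (le_lt_trans z0).
by apply: (eq_cintegrable _ h) => t; rewrite pexp_cexp.
Qed.

Lemma conjR (a : R) : (a%:C)^* = a%:C.
Proof. by apply: eqcE; rewrite ?Re_conj ?Im_conj //= oppr0. Qed.

Lemma conjMR (a : R) (z : R[i]) : (a%:C * z)^* = a%:C * z^*.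
Proof. by apply: eqcE; rewrite ?Re_conj ?Im_conj ?ReCM ?ImCM ?Re_conj ?Im_conj ?mulrN. Qed.

(** The reciprocal of zeta = 1 + x^2 + y^2 - is, which is Qp up to a constant. *)
Definition zi p : R[i] := (1 - zc 1 p)^-1.

Lemma zi_measurable : cmeasurable (zi : R3 -> R[i]).
Proof.
apply: cmeasV; apply: cmeasB; [exact: cmeas_cst|exact: cmeas_zc].
Qed.

Lemma zi_neq0 p : zi p != 0.
Proof. by rewrite invr_eq0 neq_1B// Re_zc_le0. Qed.

Lemma normc_zi_le1 p : normc (zi p) <= 1.
Proof. exact/normc_inv_1B/Re_zc_le0. Qed.

Lemma zi2_iker p : normc (zi p) ^+ 2 <= iker p.2.
Proof.
rewrite /zi normcV exprVn normc_1B_zc /iker lef_pV2 ?posrE.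
- by rewrite lerD2r -[leLHS](expr1n _ 2) ler_pXn2r ?nnegrE ?lerDl// ?addr_ge0// ?addr_ge0 ?sqr_ge0.
- by rewrite ltr_wpDr ?sqr_ge0// exprn_gt0// ltr_wpDr// addr_ge0 ?sqr_ge0.
- by rewrite ltr_wpDr ?sqr_ge0.
Qed.

Lemma zi_laplace k p : laplace (pexp k 1) (zc 1 p) = (k`!%:R)%:C * zi p ^+ k.+1.
Proof. by rewrite laplace_pexp ?Re_zc_le0// exprVn. Qed.

Lemma integrable_zi3 : Rintegrable (@muH R) (fun p => normc (zi p) ^+ 3).
Proof.
have := @integrable_zeta3 R; apply: eq_integrable => // p _ /=.
by rewrite /zi normcV.
Qed.

Lemma zi_integrable (W : R3 -> R[i]) C : cmeasurable W -> (forall p, normc (W p) <= C * normc (zi p) ^+ 3) ->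
 cintegrable (@muH R) W.
Proof.
move=> mW h; apply: (cintegr_le (@muH R) _ _ _ (RintegrableZl C integrable_zi3)) => //.
Qed.

Lemma zi3_moment f : expint f -> cintegrable (@muH R) (fun p => (zi p ^+ 3)^* * laplace f (zc 1 p)) ->
 cintegral (@muH R) (fun p => (zi p ^+ 3)^* * laplace f (zc 1 p)) =
 (pi ^+ 2 / 2)%:C * cintegral mu (fun t => f t * (t * expR (- t))%:C).
Proof.
move=> ef iW; have [mf f0 fd] := ef.
pose W p : R[i] := (laplace (pexp 2 1) (zc 1 p))^*.
have WE p : W p = 2%:C * (zi p ^+ 3)^* by rewrite /W zi_laplace conjMR.
have nE p : normc (W p) = 2 * normc (zi p) ^+ 3.
 by rewrite WE normcM normc_conj normcX normc_real ger0_norm.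
have mW : cmeasurable (W : R3 -> R[i]).
 have := cmeas_conj (cmeasM (@cmeas_cst R _ R3 2%:C) (cmeasX 3 zi_measurable)).
 by congr cmeasurable; apply/funext => p; rewrite WE conjMR.
have iWf : cintegrable (@muH R) (fun p => W p * laplace f (zc 1 p)).
 by apply: (eq_cintegrable _ (cintegrZl 2%:C iW)) => p; rewrite WE mulrA.
have h : cintegral (@muH R) (fun p => W p * laplace f (zc 1 p)) =
  (pi ^+ 2)%:C * cintegral mu (fun t => f t * ((pexp 2 1 t)^* / t%:C)).
 apply: (@plancherel R (pexp 2 1) f 2^-1 4 2) => //.
 - exact: pexp_measurable.
 - by move=> t t0; rewrite /pexp ltNge t0.
 - move=> t; apply: (@ccont_at_pos _ (fun x => (x ^+ 2 * expR (- (1 * x)))%:C)).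
   by move=> x x0; rewrite /pexp x0.
  have := ccontM (ccontM ccont_id ccont_id) (ccont_expR 1).
  by congr ccont; apply/funext => x; rewrite -!rmorphM/=.
 - move=> t t0; rewrite /pexp t0 normc_real ger0_norm; last first.
   by apply: mulr_ge0; [exact: sqr_ge0|exact: expR_ge0].
  have := @powle_expR R 1 2^-1 t; rewrite !expr1 invrK => /(_ _ (ltW t0)) hh.
  rewrite expr2 -!mulrA [leRHS]mulrCA; apply: (ler_wpM2l (ltW t0)).
  have /hh {}hh : 0 < 2^-1 :> R by rewrite invr_gt0.
  apply: (le_trans (ler_wpM2r (expR_ge0 _) hh)).
  rewrite -[leLHS](mulrA (2 * 2)) -expRD [2 * 2](_ : _ = 4); last by ring.
  by rewrite ler_wpM2l// ler_expR; lra.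
 - apply: (@zi_integrable _ 2) => // p; by rewrite nE.
 - move=> p; rewrite nE ler_wpM2l// (le_trans _ (zi2_iker p))//.
  by rewrite exprS ler_piMl ?exprn_ge0 ?normc_ge0 ?normc_zi_le1.
transitivity ((2^-1)%:C * cintegral (@muH R) (fun p => W p * laplace f (zc 1 p))).
 rewrite -cintegralZl//; apply: eq_cintegral => p.
 by rewrite WE !mulrA -rmorphM/= mulVf// mul1r.
rewrite h mulrA -rmorphM/= [2^-1 * _]mulrC; congr (_ * _); apply: eq_cintegral => t.
have [t0|t0] := leP t 0; first by rewrite f0// !mul0r.
congr (_ * _); apply: (@etrans _ _ ((t ^+ 2 * expR (- (1 * t)))%:C / t%:C)).
 by congr (_ / _); rewrite /pexp t0; exact: conjR.
rewrite -fmorphV -rmorphM/= mul1r; congr (_%:C).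
by field; exact: lt0r_neq0.
Qed.

Lemma zi_shift p (m : R) : 0 <= m -> normc ((m + 1)%:C - zc 1 p)^-1 <= normc (zi p) /\
 normc ((m + 1)%:C - zc 1 p)^-1 <= (m + 1)^-1.
Proof.
move=> m0; have r0 : 0 <= rho2 p by rewrite addr_ge0 ?sqr_ge0.
have e : normc ((m + 1)%:C - zc 1 p) ^+ 2 = (m + 1 + rho2 p) ^+ 2 + p.2 ^+ 2.
 by rewrite sqr_normcE /= mul1r opprK sub0r sqrrN.
have h (x : R) : 0 < x -> x ^+ 2 <= (m + 1 + rho2 p) ^+ 2 + p.2 ^+ 2 ->
  (normc ((m + 1)%:C - zc 1 p))^-1 <= x^-1.
 move=> x0; rewrite -e ler_pXn2r ?nnegrE ?normc_ge0 ?(ltW x0)// => hx.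
 by rewrite lef_pV2 ?posrE// (lt_le_trans x0).
rewrite /zi !normcV; split; apply: h.
- by rewrite normc_gt0 neq_1B// Re_zc_le0.
- rewrite normc_1B_zc; apply: lerD => //; apply: lerXn2r; rewrite ?nnegrE; lra.
- by rewrite ltr_wpDl.
- apply: (@le_trans _ _ ((m + 1 + rho2 p) ^+ 2)); last by rewrite lerDl sqr_ge0.
 by apply: lerXn2r; rewrite ?nnegrE; lra.
Qed.

(** The function zeta^-2 is not integrable; the difference zeta^-2 -
 (zeta+n)^-2 is bounded by zeta^-3, hence integrable, and tends to zeta^-2. *)
Lemma zi2_moment f : expint f -> cintegrable (@muH R) (fun p => (zi p ^+ 2)^* * laplace f (zc 1 p)) ->
 cintegral (@muH R) (fun p => (zi p ^+ 2)^* * laplace f (zc 1 p)) =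
 (pi ^+ 2)%:C * cintegral mu (fun t => f t * (expR (- t))%:C).
Proof.
move=> ef iW; have [mf f0 fd] := ef.
pose b (n : nat) p : R[i] := ((n%:R + 1)%:C - zc 1 p)^-1.
have b1 n p : normc (b n p) <= normc (zi p) by have [] := zi_shift p (ler0n R n).
have b2 n p : normc (b n p) <= (n%:R + 1)^-1 by have [] := zi_shift p (ler0n R n).
have mb n : cmeasurable (b n : R3 -> R[i]).
 by apply: cmeasV; apply: cmeasB; [exact: cmeas_cst|exact: cmeas_zc].
pose kap n t : R[i] := pexp 1 1 t - pexp 1 (n%:R + 1) t.
pose D n p : R[i] := zi p ^+ 2 - b n p ^+ 2.
have kE n t : 0 < t -> kap n t = (t * expR (- t) * (1 - expR (- (n%:R * t))))%:C.
 move=> t0; rewrite /kap /pexp t0 -rmorphB /=; congr (_%:C).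
 have -> : expR (- ((n%:R + 1) * t)) = expR (- t) * expR (- (n%:R * t)) by rewrite -expRD; congr expR; ring.
 by rewrite mul1r; ring.
have z0 p := @Re_zc_le0 R 1 p.
have m1 (n : nat) : 0 < n%:R + 1 :> R by rewrite ltr_wpDl.
have u01 (n : nat) t : 0 < t -> 0 <= 1 - expR (- (n%:R * t)) <= 1.
 move=> t0; rewrite gerBl expR_ge0 andbT.
 by rewrite subr_ge0 -[leRHS]expR0 ler_expR oppr_le0 mulr_ge0// ltW.
have lap n p : laplace (kap n) (zc 1 p) = D n p.
 have i0 := pexp_laplace_integrable 1 ltr01 (z0 p).
 have i1 := pexp_laplace_integrable 1 (m1 n) (z0 p).
 rewrite /laplace (eq_cintegral mu (fun t => mulrBl _ _ _)) (cintegralB i0 i1).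
 by rewrite -!/(laplace _ _) !laplace_pexp// !mul1r -!exprVn.
have DB n p : normc (D n p) <= 2 * normc (zi p) ^+ 2.
 rewrite mulr_natl mulr2n; apply: normcB_trans.
 by rewrite !normcX lerD2l lerXn2r ?nnegrE ?normc_ge0.
have D3 n p : normc (D n p) <= (2 * n%:R) * normc (zi p) ^+ 3.
 have Z1 : 1 - zc 1 p != 0 by exact: neq_1B.
 have Zn : 1 - zc 1 p + n%:R != 0.
  have h : Re (1 - zc 1 p + n%:R) >= 1.
   by rewrite -(rmorph_nat (real_complex R) n) ReD ReD ReN /= -addrA lerDl addr_ge0// oppr_ge0 z0.
  by apply/eqP => e; rewrite e /= ler10 in h.
 have -> : D n p = n%:R%:C * (zi p * b n p * (zi p + b n p)).
  rewrite /D /zi (_ : b n p = (1 - zc 1 p + n%:R)^-1); last first.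
   by rewrite /b rmorphD rmorph_nat/=; congr (_^-1); ring.
  rewrite rmorph_nat; move: (1 - zc 1 p) Z1 Zn => Z h1 h2.
  by field; rewrite h1 h2.
 rewrite (normcM n%:R%:C) normc_real ger0_norm// -(mulrA 2) mulrCA; apply: ler_wpM2l => //.
 rewrite normcM [leRHS](_ : _ = normc (zi p) ^+ 2 * (normc (zi p) *+ 2)); last by ring.
 apply: ler_pM; rewrite ?normc_ge0//.
  by rewrite normcM expr2; apply: ler_wpM2l; rewrite ?normc_ge0.
 by rewrite mulr2n; apply: le_normcD_trans; rewrite lerD2l.
have mD n : cmeasurable (fun p : R3 => (D n p)^*).
 by apply: cmeas_conj; apply: cmeasB; apply: cmeasX => //; exact: zi_measurable.
have mE : cmeasurable (fun p : R3 => laplace f (zc 1 p)).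
 have := cmeasM (cmeasV (cmeas_conj (cmeasX 2 zi_measurable))) (cintegr_measurable iW).
 congr cmeasurable; apply/funext => p; rewrite mulKf//.
 by rewrite -normc_eq0 normc_conj normc_eq0 expf_neq0// zi_neq0.
have DW n p : normc ((D n p)^* * laplace f (zc 1 p)) <= 2 * normc ((zi p ^+ 2)^* * laplace f (zc 1 p)).
 by rewrite !normcM !normc_conj normcX mulrA ler_wpM2r ?normc_ge0.
have iDW := RintegrableZl 2 (integrable_normc iW).
have iD n : cintegrable (@muH R) (fun p => (D n p)^* * laplace f (zc 1 p)).
 by apply: (cintegr_le (@muH R) _ _ _ iDW) => [|p]; [exact: (cmeasM (mD n) mE)|exact: DW].
pose J n t : R[i] := f t * (expR (- t) * (1 - expR (- (n%:R * t))))%:C.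
have P n : cintegral (@muH R) (fun p => (D n p)^* * laplace f (zc 1 p)) =
  (pi ^+ 2)%:C * cintegral mu (J n).
 transitivity (cintegral (@muH R) (fun p => (laplace (kap n) (zc 1 p))^* * laplace f (zc 1 p))).
  by apply: eq_cintegral => p; rewrite lap.
 rewrite (@plancherel R (kap n) f 1 1 2) //.
 - congr (_ * _); apply: eq_cintegral => t; rewrite /J.
  have [t0|t0] := leP t 0; first by rewrite f0// !mul0r.
  congr (_ * _); apply: (@etrans _ _ ((t * expR (- t) * (1 - expR (- (n%:R * t))))%:C / t%:C)).
   by congr (_ / _); rewrite kE//; exact: conjR.
  rewrite -fmorphV -rmorphM/=; congr (_%:C).
  by field; exact: lt0r_neq0.
 - by apply: cmeasB; exact: pexp_measurable.
 - by move=> t t0; rewrite /kap /pexp ltNge t0 /= subr0.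
 - move=> t; apply: (@ccont_at_pos _ (fun x => x%:C * (expR (- (1 * x)))%:C * (1 + (-1)%:C * (expR (- (n%:R * x)))%:C))).
   move=> x x0; rewrite kE// mul1r.
   transitivity ((x * expR (- x) * (1 + -1 * expR (- (n%:R * x))))%:C); first by congr (_%:C); ring.
   by rewrite !(rmorphM, rmorphD, rmorph1).
  have ce := ccontD (ccont_cst 1) (ccontM (ccont_cst (-1)%:C) (ccont_expR n%:R)).
  exact: (ccontM (ccontM ccont_id (ccont_expR 1)) ce).
 - move=> t t0; have h0 : 0 <= t * expR (- t) by rewrite mulr_ge0 ?expR_ge0 ?(ltW t0).
  have /andP[v0 v1] := u01 n _ t0.
  rewrite kE// normc_real ger0_norm; last exact: mulr_ge0.
  by rewrite !mul1r; exact: ler_piMr.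
 - apply: (@zi_integrable _ (2 * n%:R)) => [|p].
   by have := mD n; congr cmeasurable; apply/funext => p; rewrite lap.
  by rewrite lap normc_conj.
 - move=> p; rewrite lap normc_conj (le_trans (DB n p))// ler_wpM2l//; exact: zi2_iker.
 - by apply: (eq_cintegrable _ (iD n)) => p; rewrite lap.
apply: (@cintegral_dct R _ _ (@muH R) (fun n p => (D n p)^* * laplace f (zc 1 p)) _
 (fun p => 2 * normc ((zi p ^+ 2)^* * laplace f (zc 1 p)))) => //.
- move=> p; apply: (@squeeze0 R _ (fun n => normc (laplace f (zc 1 p)) * harmonic n)).
  move=> n; rewrite normc_ge0 /= -mulrBl normcM [leRHS]mulrC ler_wpM2r ?normc_ge0//.
  rewrite -rmorphB/= normc_conj /D addrAC subrr add0r normcN normcX expr2.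
  apply: (@le_trans _ _ (1 * (n%:R + 1)^-1)); last by rewrite mul1r natr1.
  by apply: ler_pM; rewrite ?normc_ge0// (le_trans (b1 n p)) ?normc_zi_le1.
 rewrite -[X in _ --> X](mulr0 (normc (laplace f (zc 1 p)))); apply: cvgMr; exact: cvg_harmonic.
- have iJ : cintegrable mu (fun t => f t * (expR (- t))%:C).
  by apply: (eq_cintegrable _ (fd 1 ltr01)) => t; rewrite mul1r.
 have JB n t : normc (J n t) <= normc (f t * (expR (- t))%:C).
  have [t0|t0] := leP t 0; first by rewrite /J f0// !mul0r.
  have /andP[v0 v1] := u01 n _ t0.
  have h0 := expR_ge0 (- t); rewrite /J !normcM; apply: ler_wpM2l; first exact: normc_ge0.
  by rewrite !normc_real (ger0_norm h0) ger0_norm ?mulr_ge0// ler_piMr.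
 have mJ n : cmeasurable (J n).
  apply: cmeasM => //; apply: cmeas_real; apply: measurable_funM; first by apply: measurableT_comp.
  apply: measurable_funB; first exact: measurable_cst.
  by apply: measurableT_comp => //; apply: measurableT_comp => //; exact: measurable_funM.
 have iJn n : cintegrable mu (J n).
  by apply: (cintegr_le mu _ _ _ (integrable_normc iJ)) => [|t]; [exact: mJ|exact: JB].
 apply: (@squeeze0 R _ (fun n => pi ^+ 2 * Rintegral mu setT (fun t => normc (J n t - f t * (expR (- t))%:C)))).
  move=> n; rewrite normc_ge0/= P -mulrBr normcM normc_real ger0_norm ?sqr_ge0//.
  rewrite ler_wpM2l ?sqr_ge0// -(cintegralB (iJn n) iJ).
  exact: (normc_cintegral (cintegrB (iJn n) iJ)).
 rewrite -[X in _ --> X](mulr0 (pi ^+ 2)); apply: cvgMr.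
 apply: cintegral_cvg (integrable_normc iJ) _ => //; first exact: cintegr_measurable iJ.
 move=> t; have [t0|t0] := leP t 0.
  rewrite (_ : (fun n => _) = fun=> 0); first exact: cvg_cst.
  by apply/funext => n; rewrite /J f0// !mul0r subrr normc0.
 have q1 : `|expR (- t)| < 1 by rewrite ger0_norm ?expR_ge0// -expR0 ltr_expR oppr_lt0.
 rewrite (_ : (fun n => _) = fun n => normc (f t * (expR (- t))%:C) * expR (- t) ^+ n); last first.
  apply/funext => n; have x0 : 0 <= expR (- t) ^+ n by rewrite exprn_ge0// expR_ge0.
  rewrite /J -mulrN expRM_natl -mulrBr -rmorphB; move: (expR (- t)) (_ ^+ n) x0 => e x x0.
  rewrite (_ : e * (1 - x) - e = - (e * x)); last by ring.
  by rewrite rmorphN mulrN normcN rmorphM mulrA normcM (normc_real x) ger0_norm.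
 rewrite -[X in _ --> X](mulr0 (normc (f t * (expR (- t))%:C))); apply: cvgMr; exact: cvg_expr.
Qed.

End moments.

(** * Lebesgue spaces *)

Section lebesgue_spaces.
Context {R : realType} {d : measure_display} {T : measurableType d}.
Variable m : {measure set T -> \bar R}.
Implicit Types (u v : T -> R[i]) (p q : R).

Lemma cLp_fin p u : cmeasurable u -> p != 0 ->
 (cLnorm m p u < +oo)%E = Rintegrable m (fun x => powR (normc (u x)) p).
Proof.
move=> mu p0; have mn := measurable_normc mu.
have mp : measurable_fun setT (fun x => powR (normc (u x)) p).
 exact: (measurableT_comp (measurable_powR p) mn).
have e : (cLnorm m p u `^ p = \int[m]_x (powR (normc (u x)) p)%:E)%E.
 rewrite /cLnorm (poweR_Lnorm _ _ p0); apply: eq_integral => x _.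
 by rewrite /= ger0_norm ?normc_ge0.
have h : (\int[m]_x `|(powR (normc (u x)) p)%:E| = \int[m]_x (powR (normc (u x)) p)%:E)%E.
 by apply: eq_integral => x _ /=; rewrite ger0_norm// powR_ge0.
apply/idP/idP => [fin|/integrableP[_]].
 apply/integrableP; split; first exact/measurable_EFinP.
 by rewrite h -e poweR_lty.
rewrite /= h -e => fin; have [//|] := ltP (cLnorm m p u) +oo%E.
rewrite leye_eq => /eqP ny; move: fin; by rewrite ny poweRyr// ltxx.
Qed.

Lemma cLp_bounded p u M : 1 <= p -> cintegrable m u -> (forall x, normc (u x) <= M) -> cLp m p u.
Proof.
move=> p1 iu uM; have mu := cintegr_measurable iu; split => //.
have p0 : p != 0 by rewrite gt_eqF// (lt_le_trans ltr01).
rewrite cLp_fin//; apply: (le_integrable measurableT _ _ (RintegrableZl (powR M (p - 1)) (integrable_normc iu))).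
 apply/measurable_EFinP.
 exact: (measurableT_comp (measurable_powR p) (measurable_normc mu)).
move=> x _ /=; rewrite lee_fin ger0_norm ?powR_ge0//.
rewrite (le_trans _ (ler_norm _))//.
have n0 := normc_ge0 (u x).
have M0 : 0 <= M by exact: le_trans n0 (uM x).
have [->|nz] := eqVneq (normc (u x)) 0; first by rewrite powR0// mulr_ge0 ?powR_ge0.
have -> : powR (normc (u x)) p = powR (normc (u x)) (p - 1) * normc (u x).
 have := @powRD R (normc (u x)) (p - 1) 1; rewrite subrK powRr1// => -> //.
 by apply/implyP.
by apply: ler_wpM2r => //; apply: ge0_ler_powR; rewrite ?nnegrE ?subr_ge0.
Qed.

Lemma cLp_nat n u (g : T -> R) : (0 < n)%N -> cmeasurable u -> Rintegrable m g ->
 (forall x, normc (u x) ^+ n <= g x) -> cLp m n%:R u.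
Proof.
move=> n0 mu ig ug; split => //; rewrite cLp_fin//; last by rewrite pnatr_eq0 -lt0n.
apply: (le_integrable measurableT _ _ ig).
 apply/measurable_EFinP.
 exact: (measurableT_comp (measurable_powR _) (measurable_normc mu)).
move=> x _ /=; rewrite lee_fin ger0_norm ?powR_ge0// powR_mulrn ?normc_ge0//.
by rewrite (le_trans (ug x))// ler_norm.
Qed.

Lemma cLp_hoelder p q u v : 0 < p -> 0 < q -> p^-1 + q^-1 = 1 -> cLp m p u -> cLp m q v ->
 cintegrable m (fun x => u x * v x) /\
 ((normc (cintegral m (fun x => u x * v x)))%:E <= cLnorm m p u * cLnorm m q v)%E.
Proof.
move=> p0 q0 pq [mu fu] [mv fv].
have muv : cmeasurable (fun x => u x * v x) by exact: cmeasM.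
have H := hoelder m (measurable_normc mu) (measurable_normc mv) p0 q0 pq.
have e : (\int[m]_x `|(normc (u x * v x))%:E| <= cLnorm m p u * cLnorm m q v)%E.
 apply: le_trans H; rewrite Lnorm1 le_eqVlt; apply/orP; left; apply/eqP.
 by apply: eq_integral => x _; rewrite normcM.
have iuv : cintegrable m (fun x => u x * v x).
 apply/cintegrP; split => //; apply/integrableP; split.
  by apply/measurable_EFinP; exact: measurable_normc.
 apply: (le_lt_trans e); apply: lte_mul_pinfty => //.
  exact: Lnorm_ge0.
 by rewrite ge0_fin_numE// Lnorm_ge0.
split => //; apply: le_trans e.
have h := normc_cintegral iuv; rewrite -lee_fin in h; apply: (le_trans h).
rewrite /Rintegral fineK.
 rewrite le_eqVlt; apply/orP; left; apply/eqP; apply: eq_integral => x _ /=.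
 by rewrite ger0_norm ?normc_ge0.
exact: (integrable_fin_num measurableT (integrable_normc iuv)).
Qed.

Lemma cLnorm4_cvg0 (u_ : nat -> T -> R[i]) :
 (forall n, cmeasurable (u_ n)) ->
 (forall n, Rintegrable m (fun x => normc (u_ n x) ^+ 4)) ->
 Rintegral m setT (fun x => normc (u_ n x) ^+ 4) @[n --> \oo] --> (0 : R) ->
 cLnorm m 4 (u_ n) @[n --> \oo] --> 0%E.
Proof.
move=> mu iu cu.
have e n : cLnorm m 4 (u_ n) = (Num.sqrt (Num.sqrt (Rintegral m setT (fun x => normc (u_ n x) ^+ 4))))%:E.
 have fi := integrable_fin_num measurableT (iu n).
 have ei : (\int[m]_x (`|(normc (u_ n x))%:E| `^ 4))%E = (Rintegral m setT (fun x => normc (u_ n x) ^+ 4))%:E.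
  rewrite /Rintegral fineK//; apply: eq_integral => x _ /=.
  by rewrite ger0_norm ?normc_ge0// powR_mulrn ?normc_ge0.
 have I0 : 0 <= Rintegral m setT (fun x => normc (u_ n x) ^+ 4).
  by apply: Rintegral_ge0 => x _; rewrite exprn_ge0 ?normc_ge0.
 rewrite /cLnorm unlock ei poweR_EFin [4^-1](_ : _ = 2^-1 * 2^-1); last by field.
 by rewrite powRrM !powR12_sqrt ?sqrtr_ge0.
have h : Num.sqrt (Num.sqrt (Rintegral m setT (fun x => normc (u_ n x) ^+ 4))) @[n --> \oo] --> (0 : R).
 have c0 : Num.sqrt x @[x --> (0 : R)] --> (0 : R) by have := @sqrt_continuous R 0; rewrite /continuous_at sqrtr0.
 exact: (cvg_comp _ _ (cvg_comp _ _ cu c0) c0).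
rewrite (_ : (fun n => _) = fun n => (Num.sqrt (Num.sqrt (Rintegral m setT (fun x => normc (u_ n x) ^+ 4))))%:E); last first.
 by apply/funext => n; rewrite e.
by apply: cvg_EFin => //; exact: nearW.
Qed.

End lebesgue_spaces.

(** * Test functions with smooth profiles *)

Section primitives.
Context {R : realType}.
Notation mu := (@lebesgue_measure R).

Definition primitive (g : R -> R) s : R := \int[mu]_t (if t < s then g t else 0).

Lemma measurable_ltl (s : R) : measurable_fun [set: R] (fun x => x < s).
Proof. by apply: measurable_fun_ltr => //; exact: measurable_cst. Qed.

Lemma primitive_integrable (g : R -> R) s : Rintegrable mu g ->
 Rintegrable mu (fun t => if t < s then g t else 0).
Proof.
move=> ig; apply: (le_integrable measurableT _ _ ig) => [|t _ /=].
 apply/measurable_EFinP; apply: measurable_fun_if => //; first exact: measurable_ltl.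
 by apply: measurable_funTS; have /measurable_EFinP := measurable_int _ ig.
by rewrite lee_fin; case: ifP => // _; rewrite normr0.
Qed.

Lemma primitive_continuous (g : R -> R) : Rintegrable mu g -> continuous (primitive g).
Proof.
move=> ig s0; apply/continuous_withinNx; apply/cvgr_dnbhsP => u [_ us].
have mg : measurable_fun [set: R] g by exact: (mfun_integrable ig).
have ip s := primitive_integrable s ig.
have mc s : measurable_fun [set: R] (fun t => if t < s then g t else 0).
 by exact: (mfun_integrable (ip s)).
pose D0 n t := `|(if t < u n then g t else 0) - (if t < s0 then g t else 0)|.
pose D n t := if t != s0 then D0 n t else 0.
have mD0 n : measurable_fun [set: R] (D0 n).
 by apply: measurableT_comp => //; apply: measurable_funB; exact: mc.
have mD n : measurable_fun [set: R] (D n).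
 apply: measurable_fun_if => //; last exact: measurable_funTS.
 by apply: measurable_neg; apply: measurable_fun_eqr => //; exact: measurable_cst.
have DB n t : 0 <= D n t <= `|g t|.
 rewrite /D /D0; case: ifP => _; last by rewrite lexx /=.
 by rewrite normr_ge0 /=; do 2 case: ifP => _; rewrite ?subrr ?subr0 ?sub0r ?normrN ?normr0.
have ia : Rintegrable mu (fun t => `|g t|) by exact: integrable_abse ig.
have D0int : (fun n => Rintegral mu setT (D n)) @ \oo --> (0 : R).
 apply: (@R_dct R _ _ mu D (fun t => `|g t|) mD DB ia) => t.
 have [->|ts] := eqVneq t s0.
  by rewrite (_ : (fun n => _) = fun=> 0); [exact: cvg_cst|apply/funext => n; rewrite /D eqxx].
 apply: cvg_near_cst; have [lt|gt|e] := ltgtP t s0; last by rewrite e eqxx in ts.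
  near=> n; have h : t < u n by near: n; exact: cvgr_gt us _ lt.
  by rewrite /D ts /D0 h lt subrr normr0.
 near=> n; have h : u n < t by near: n; exact: cvgr_lt us _ gt.
 by rewrite /D ts /D0 !ltNge (ltW h) (ltW gt) subrr normr0.
have h0 : (fun n => primitive g (u n) - primitive g s0) @ \oo --> (0 : R).
 apply/norm_cvg0P; apply: (squeeze0 _ D0int) => n; rewrite normr_ge0/= /primitive -RintegralB//.
 have -> : Rintegral mu setT (D n) = Rintegral mu setT (D0 n).
  apply: ae_eq_Rintegral; [exact: mD|exact: mD0|].
  by apply: (ae_imp (aeneq_lebesgue s0)) => t ts; rewrite /D ts.
 by apply: le_normr_Rintegral => //; exact: (integrableB measurableT (ip _) (ip _)).
have h : (fun n => primitive g (u n) - primitive g s0 + primitive g s0) @ \oo --> 0 + primitive g s0.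
 by apply: cvgD => //; exact: cvg_cst.
rewrite add0r in h; rewrite (_ : (fun n => _) = fun n => primitive g (u n)) in h; first exact: h.
by apply/funext => n; rewrite subrK.
Unshelve. all: by end_near. Qed.

Lemma primitive_derive (g : R -> R) (s : R) : Rintegrable mu g ->
 {for s, continuous g} -> is_derive s 1 (primitive g) (g s).
Proof.
move=> ig cg.
have mg : measurable_fun [set: R] g by exact: (mfun_integrable ig).
have E x : \int[mu]_(t in `]-oo, x]) g t = primitive g x.
 have pE : g \_ `]-oo, x] = fun t => if t <= x then g t else 0.
  apply/funext => t; rewrite patchE (_ : (t \in `]-oo, x]%classic) = (t <= x)) //.
  by rewrite mem_setE in_itv.
 rewrite Rintegral_mkcond pE; apply: ae_eq_Rintegral.
 - apply: measurable_fun_if => //; last exact: measurable_funTS.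
  by apply: measurable_fun_ler => //; exact: measurable_cst.
 - by exact: (mfun_integrable (primitive_integrable x ig)).
 - by apply: (ae_imp (aeneq_lebesgue x)) => t tx; rewrite le_eqVlt (negbTE tx).
have ix : mu.-integrable [set` Interval -oo%O (BRight (s + 1))] (EFin \o g).
 by apply: integrableS ig.
have ss : s < s + 1 by rewrite ltrDl.
have [d1 d2] := @continuous_FTC1 R g -oo%O s (s + 1) ss ix (ltNyr _) cg.
have e : (fun x => \int[mu]_(t in [set` Interval -oo%O (BRight x)]) g t) = primitive g.
 by apply/funext => x; exact: E.
by rewrite e in d1 d2; split; [exact: d1|rewrite -d2 derive1E].
Qed.

End primitives.

Section tests.
Context {R : realType}.
Notation mu := (@lebesgue_measure R).
Notation R3 := (R * R * R)%type.
Implicit Types (p : R3) (t s : R).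

Lemma bumpyZ (a b c : R) u : bumpy a b u -> bumpy a b (fun t => c * u t).
Proof.
move=> [P [Pu hP]]; exists (fun v => exists2 w, P w & v = fun t => c * w t); split; first by exists u.
move=> _ [w Pw ->]; have [h1 [M h2] [w' Pw' dw] h3] := hP _ Pw; split.
- by move=> t /h1 ->; rewrite mulr0.
- by exists (`|c| * M) => t; rewrite normrM ler_wpM2l.
- exists (fun t => c * w' t); first by exists w'.
 by move=> t; have := dw t => dwt; have := is_deriveZ c dwt.
- exists (fun t => t * w t) => //; by apply/funext => t; rewrite mulrCA.
Qed.

Lemma bumpy_expint (a b : R) u : 0 <= a -> a < b -> bumpy a b u -> expint (fun t => (u t)%:C).
Proof.
move=> a0 ab bu; split.
- by apply: cmeas_real; exact: bumpy_measurable bu.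
- by move=> t t0; rewrite (bumpy_supp bu)// negb_and -leNgt (le_trans t0).
- move=> d d0; apply: (eq_cintegrable _ (bumpy_cexp_integrable (- d)%:C ab bu)) => t.
 by rewrite -rmorphM/= cexp_real mulrN [t * d]mulrC.
Qed.

Lemma laplace_zc_measurable f e : cmeasurable f -> cmeasurable (fun p : R3 => laplace f (zc e p)).
Proof.
move=> mf; apply: (cmeas_cintegral2 mu (f := fun x : R3 * R => f x.2 * cexp (x.2%:C * zc e x.1))).
apply: cmeasM; first exact: (cmeas_comp mf measurable_snd).
apply: cmeas_cexp; apply: cmeasM; last exact: (cmeas_comp (cmeas_zc e) measurable_fst).
by apply: cmeas_real; exact: measurable_snd.
Qed.

Lemma zc_conj p : zc (-1) p = (zc 1 p)^*.
Proof. by apply: eqcE; rewrite ?Re_conj ?Im_conj //= mulN1r mul1r. Qed.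

Lemma conj_laplace_bumpy (a b : R) u p : a < b -> bumpy a b u ->
 (laplace (fun t => (u t)%:C) (zc 1 p))^* = blaplace u (zc (-1) p).
Proof.
move=> ab bu; rewrite /blaplace /laplace -cintegral_conj; last exact: bumpy_cexp_integrable ab bu.
apply: eq_cintegral => t; rewrite conjMR; congr (_ * _).
exact: etrans (esym (cexp_conj _)) (congr1 cexp (etrans (conjMR _ _) (congr1 (fun z => t%:C * z) (esym (zc_conj p))))).
Qed.

Lemma blaplace_zi (a b e : R) u k : 0 <= a -> a < b -> bumpy a b u -> e ^+ 2 = 1 ->
 exists C, forall p, normc (blaplace u (zc e p)) <= C * normc (zi p) ^+ k.
Proof.
move=> a0 ab bu e1; have [C hC] := blaplace_weight k a0 ab bu; exists C => p.
have n1 : 0 < normc (1 - zc 1 p) by rewrite normc_gt0 neq_1B// Re_zc_le0.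
rewrite /zi normcV exprVn ler_pdivlMr ?exprn_gt0// mulrC.
apply: le_trans (hC _ (Re_zc_le0 e p)); apply: ler_wpM2r; first exact: normc_ge0.
apply: lerXn2r; rewrite ?nnegrE ?addr_ge0 ?normc_ge0//.
apply: normcB_trans; rewrite normc1 lerD2l le_eqVlt; apply/orP; left.
rewrite -(@eqrXn2 _ 2) ?normc_ge0// !sqr_normcE /= mul1r exprMn e1 mul1r.
by [].
Qed.

End tests.

(** * Weak formulation of the kernel equation *)

Section kernel_test.
Context {R : realType}.
Notation mu := (@lebesgue_measure R).
Notation R3 := (R * R * R)%type.
Implicit Types (p : R3) (t s : R) (g h u v : H1 R -> R[i]).

Lemma V0p_Lp_repr (p q : R) u : 0 < p -> 1 <= q -> p^-1 + q^-1 = 1 -> cLp (@muH R) p u -> V0p u ->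
 exists2 f, expint f & {ae (@muHs R), forall x : R3, u x = laplace f (zc 1 x)}.
Proof.
move=> p0 q1 pq Lu Vu; apply: V0p_repr => // M M0.
have MM : - M < M by rewrite gtrN.
have ib := inbox_integrable MM MM MM.
have Lb : cLp (@muH R) q (fun x : R3 => if inbox (- M) M (- M) M (- M) M x then 1 else 0).
 by apply: (cLp_bounded (M := 1)) => // x; case: ifP; rewrite ?normc1 ?normc0.
have [h _] := cLp_hoelder p0 (lt_le_trans ltr01 q1) pq Lu Lb.
by apply: (eq_cintegrable _ h) => x; case: ifP => _; rewrite ?mulr1 ?mulr0.
Qed.

Lemma conj_34 : (4 / 3)^-1 + 4^-1 = 1 :> R.
Proof. by field. Qed.

Lemma conj_43 : 4^-1 + (4 / 3)^-1 = 1 :> R.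
Proof. by field. Qed.

Lemma conj_22 : 2^-1 + 2^-1 = 1 :> R.
Proof. by field. Qed.

Lemma Hdotm1_le (T : (H1 R -> R[i]) -> R[i]) phi : schwartz phi -> Hdot1_norm phi <= 1 ->
 ((normc (T phi))%:E <= Hdotm1_norm T)%E.
Proof. by move=> sp np; apply: ereal_sup_ubound; exists phi. Qed.

(** Against the conjugate of an element of L^2 and V0+, the extended projector
  is invisible. *)
Lemma Pi0p_ext_test g T v : is_Pi0p_ext g T -> schwartz (fun p => (v p)^*) ->
 Hdot1_norm (fun p => (v p)^*) <= 1 -> cLp (@muH R) 2 v -> cLp (@muH R) 4 v -> V0p v ->
 T (fun p => (v p)^*) = distr g (fun p => (v p)^*).
Proof.
move=> [Lg _ [gn [wn [Lgn Pn gcv Tcv]]]] sv nv L2 L4 Vv.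
have cLpC (r : R) : cLp (@muH R) r v -> cLp (@muH R) r (fun p => (v p)^*).
 move=> [mv fv]; split; first exact: cmeas_conj.
 rewrite /cLnorm (_ : (fun x => _) = fun x => (normc (v x))%:E) //.
 by apply/funext => x; rewrite normc_conj.
have p34 : 0 < 4 / 3 :> R by rewrite divr_gt0.
have p4 : 0 < 4 :> R by [].
have p2 : 0 < 2 :> R by [].
set phi := fun p => (v p)^*.
pose C := cLnorm (@muH R) 4 phi.
have Cfin : (C < +oo)%E by have [] := cLpC _ L4.
have C0 : (0 <= C)%E by exact: Lnorm_ge0.
have E n : distr (wn n) phi = distr (gn n) phi.
 have [Lg2 Lw2 _ orth] := Pn n; have := orth _ L2 Vv.
 have [i1 _] := cLp_hoelder p2 p2 conj_22 Lg2 (cLpC _ L2).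
 have [i2 _] := cLp_hoelder p2 p2 conj_22 Lw2 (cLpC _ L2).
 have e : cintegral (@muH R) (fun p => (gn n p - wn n p) * phi p) =
   cintegral (@muH R) (fun p => gn n p * phi p) - cintegral (@muH R) (fun p => wn n p * phi p).
  by rewrite -cintegralB//; apply: eq_cintegral => p; rewrite mulrBl.
 by move=> o; apply/esym/subr0_eq; rewrite /distr -e.
pose A n := Hdotm1_norm (fun phi => distr (wn n) phi - T phi).
pose G n := cLnorm (@muH R) (4 / 3) (fun p => gn n p - g p).
have B n : (G n < +oo)%E -> ((normc (T phi - distr g phi))%:E <= A n + G n * C)%E.
 move=> fin; have h1 := Hdotm1_le (fun phi => distr (wn n) phi - T phi) sv nv.
 have [i1 _] := cLp_hoelder p34 p4 conj_34 (Lgn n) (cLpC _ L4).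
 have [i2 _] := cLp_hoelder p34 p4 conj_34 Lg (cLpC _ L4).
 have mD : cmeasurable (fun p : R3 => gn n p - g p).
  by apply: cmeasB; [have [] := Lgn n|have [] := Lg].
 have h2 : ((normc (distr (gn n) phi - distr g phi))%:E <=
   G n * C)%E.
  have LD : cLp (@muH R) (4 / 3) (fun p => gn n p - g p) by split.
  have [_] := cLp_hoelder p34 p4 conj_34 LD (cLpC _ L4).
  rewrite (_ : cintegral _ _ = distr (gn n) phi - distr g phi)//.
  by rewrite /distr -cintegralB//; apply: eq_cintegral => p; rewrite mulrBl.
 apply: (le_trans _ (leeD h1 h2)); rewrite -EFinD lee_fin.
 rewrite (_ : T phi - distr g phi = (distr (gn n) phi - distr g phi) - (distr (wn n) phi - T phi)).
  by rewrite [leRHS]addrC normcB.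
 by rewrite E; ring.
apply/eqP; rewrite -subr_eq0 -normc_eq0 eq_le normc_ge0 andbT -lee_fin.
have L : (fun n => A n + G n * C)%E @ \oo --> 0%E.
 rewrite -[X in _ --> X]adde0 -[X in _ --> (_ + X)%E](mul0e C).
 have Cf : C \is a fin_num by rewrite ge0_fin_numE.
 have GC : (fun n => G n * C)%E @ \oo --> (0 * C)%E by apply: cvgeZr.
 by apply: cvgeD; rewrite ?mul0e // -(mul0e C).
apply: (cvge_ge _ L); have /fine_cvgP[fn _] := gcv.
by apply: filterS fn => n; rewrite fin_numE => /andP[_ h]; apply: B; rewrite ltey.
Qed.

End kernel_test.

(** * Convolution of a test profile with the exponential *)

Section test_conv.
Context {R : realType}.
Notation mu := (@lebesgue_measure R).
Notation R3 := (R * R * R)%type.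
Implicit Types (p : R3) (t s : R).

Lemma pexp01E t : pexp 0 1 t = (if 0 < t then (expR (- t))%:C else 0) :> R[i].
Proof. by rewrite /pexp; case: ifP => // _; rewrite expr0 !mul1r. Qed.

Lemma pexp01_le1 t : normc (pexp 0 1 t : R[i]) <= 1.
Proof.
rewrite pexp01E; case: ifP => t0; last by rewrite normc0.
by rewrite normc_expRN// ltW.
Qed.

Lemma QpE p : Qp p = (Num.sqrt 2)%:C * zi p.
Proof.
rewrite /Qp /zi (_ : (p.2)%:C + 'i%C * (rho2 p)%:C + 'i%C = 'i%C * (1 - zc 1 p)).
 rewrite invfM mulrA -[_ * 'i%C / 'i%C]mulrA mulfV ?mulr1//.
 by rewrite -normc_gt0 /normc /= expr0n expr1n add0r sqrtr1.
by apply: eqcE; rewrite !cE /= ?mul0r ?mul1r ?mulr0 ?opprK ?subr0 ?add0r ?addr0 ?sub0r ?opprK// addrC.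
Qed.

Lemma Qp2E p : Qp p ^+ 2 = 2 * zi p ^+ 2.
Proof. by rewrite QpE exprMn -rmorphXn/= sqr_sqrtr// rmorph_nat. Qed.

Lemma normQp2E p : (normc (Qp p) ^+ 2)%:C = 2 * (zi p * (zi p)^*).
Proof.
rewrite mulc_conj QpE normcM exprMn normc_real ger0_norm ?sqrtr_ge0// sqr_sqrtr//.
by rewrite rmorphM/= rmorph_nat.
Qed.

Variables (a b : R) (u : R -> R).
Hypotheses (a0 : 0 < a) (ab : a < b) (bu : bumpy a b u).
Let eta t : R[i] := (u t)%:C.

Let eeta : expint eta. Proof. exact: bumpy_expint (ltW a0) ab bu. Qed.

Let e1 : expint (pexp 0 1 : R -> R[i]). Proof. exact: pexp_expint. Qed.

Lemma bumpy_expR_integrable : Rintegrable mu (fun t => u t * expR t).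
Proof.
have [h _] := bumpy_cexp_integrable 1%:C ab bu.
by apply: (eq_integrable measurableT _ _ _ h) => t _ /=; rewrite -rmorphM/= mulr1 cexp_real ReCM.
Qed.

Lemma conv_bumpyE s : conv eta (pexp 0 1) s = (expR (- s) * primitive (fun t => u t * expR t) s)%:C.
Proof.
rewrite /primitive -RintegralZl//; last exact: primitive_integrable bumpy_expR_integrable.
rewrite -cintegral_real; apply: eq_cintegral => t; rewrite pexp01E subr_gt0.
case: ifP => _; last by rewrite !mulr0.
by rewrite -rmorphM/= mulrCA -expRD opprB addrC.
Qed.

Lemma conv_bumpy_continuous : ccont (conv eta (pexp 0 1)).
Proof.
have c1 := ccont_real (primitive_continuous bumpy_expR_integrable).
have := ccontM (ccont_expR 1) c1.
by congr ccont; apply/funext => s; rewrite conv_bumpyE rmorphM/= mul1r.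
Qed.

Lemma conv_bumpy_bound : exists2 C, 0 <= C & forall s, 0 < s ->
 normc (conv eta (pexp 0 1) s) <= C * (s * expR (- (1 * s))).
Proof.
pose g t := u t * expR t.
have ig : Rintegrable mu g := bumpy_expR_integrable.
pose D := \int[mu]_t `|g t|.
have D0 : 0 <= D by apply: Rintegral_ge0.
have P s : `|primitive g s| <= D.
 apply: (le_trans (le_normr_Rintegral measurableT (primitive_integrable s ig))).
 apply: le_Rintegral => //; first exact: integrable_abse (primitive_integrable s ig).
  exact: integrable_abse ig.
 by move=> t _; case: ifP => // _; rewrite normr0.
have P0 s : s <= a -> primitive g s = 0.
 move=> sa; have z t : (if t < s then g t else 0) = 0.
  case: ifP => // ts; rewrite /g (bumpy_supp bu) ?mul0r// negb_and -leNgt.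
  by rewrite (le_trans (ltW ts)).
 by rewrite /primitive (funext z) /Rintegral integral0.
exists (D / a) => [|s s0]; first by rewrite divr_ge0// ltW.
rewrite conv_bumpyE normc_real normrM ger0_norm ?expR_ge0// mul1r mulrC mulrA.
rewrite ler_wpM2r ?expR_ge0//; have [sa|sa] := leP s a.
 by rewrite P0// normr0 mulr_ge0 ?(ltW s0)// divr_ge0// ltW.
apply: (le_trans (P s)); rewrite mulrAC ler_pdivlMr// ler_wpM2l// ltW//.
Qed.

Lemma conv_bumpy_laplace p : laplace (conv eta (pexp 0 1)) (zc 1 p) = laplace eta (zc 1 p) * zi p.
Proof.
have i1 : cintegrable mu (fun t => eta t * cexp (t%:C * zc 1 p)) by exact: bumpy_cexp_integrable ab bu.
have [_ ->] := conv_laplace_int eeta e1 pexp01_le1 i1 (pexp_laplace_integrable 0 ltr01 (Re_zc_le0 1 p)).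
by rewrite zi_laplace mul1r expr1.
Qed.

Lemma conj_laplace_zi k : exists2 C, 0 <= C & forall p, normc (laplace eta (zc 1 p))^* <= C * normc (zi p) ^+ k.
Proof.
have m1 : (-1) ^+ 2 = 1 :> R by rewrite sqrrN expr1n.
have [C hC] := blaplace_zi k (ltW a0) ab bu m1; exists `|C| => // p.
rewrite (conj_laplace_bumpy p ab bu) (le_trans (hC p))//.
by rewrite ler_wpM2r ?ler_norm// exprn_ge0 ?normc_ge0.
Qed.

Lemma laplace_bumpy_measurable : cmeasurable (fun p : R3 => (laplace eta (zc 1 p))^*).
Proof. by apply: cmeas_conj; apply: laplace_zc_measurable; have [] := eeta. Qed.

Lemma test_Lp (r : R) (w : R3 -> R[i]) M : 1 <= r -> cmeasurable w -> (forall p, normc (w p) <= M) ->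
 cLp (@muH R) r (fun p => w p * (laplace eta (zc 1 p))^*).
Proof.
move=> r1 mw wM; have M0 : 0 <= M by exact: le_trans (normc_ge0 _) (wM (0, 0, 0)).
have [C C0 hC] := conj_laplace_zi 3.
have z1 p : normc (zi p) ^+ 3 <= 1 by rewrite exprn_ile1 ?normc_ge0 ?normc_zi_le1.
have bd p : normc (w p * (laplace eta (zc 1 p))^*) <= (M * C) * normc (zi p) ^+ 3.
 rewrite normcM -mulrA.
 by apply: ler_pM; [exact: normc_ge0|exact: normc_ge0|exact: wM|exact: hC].
apply: (cLp_bounded (M := M * C)) => //.
 apply: zi_integrable bd; apply: cmeasM => //; exact: laplace_bumpy_measurable.
by move=> p; apply: (le_trans (bd p)); rewrite ler_piMr ?mulr_ge0.
Qed.

End test_conv.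

Section kernel_equation.
Context {R : realType}.
Notation mu := (@lebesgue_measure R).
Notation R3 := (R * R * R)%type.
Implicit Types (p : R3) (t s : R).

Lemma ae_cintegrableH (f g : R3 -> R[i]) : cmeasurable g -> {ae (@muHs R), forall p, f p = g p} ->
 cintegrable (@muH R) f -> cintegrable (@muH R) g /\ cintegral (@muH R) f = cintegral (@muH R) g.
Proof.
move=> mg fg jf; split; first exact: (@ae_eq_cintegrable R _ _ (@muHs R) f g mg fg jf).
exact: (@ae_eq_cintegral R _ _ (@muHs R) f g (cintegr_measurable jf) mg fg).
Qed.

Lemma Hdotm1Z T (c : R[i]) (phi : H1 R -> R[i]) : Hdotm1 T -> schwartz phi ->
 T (fun p => c * phi p) = c * T phi.
Proof.
move=> [lin _] sp; have := lin (c - 1) _ _ sp sp.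
rewrite (_ : (fun p => (c - 1) * phi p + phi p) = fun p => c * phi p); last by apply/funext => p; ring.
by move=> ->; ring.
Qed.

Variables (a b : R) (u : R -> R).
Hypotheses (a0 : 0 < a) (ab : a < b) (bu : bumpy a b u).
Let eta t : R[i] := (u t)%:C.
Let phi p : R[i] := (laplace eta (zc 1 p))^*.

Let m1 : (-1) ^+ 2 = 1 :> R. Proof. by rewrite sqrrN expr1n. Qed.

Let phiE : phi = fun p => blaplace u (zc (-1) p).
Proof. by apply/funext => p; exact: conj_laplace_bumpy ab bu. Qed.

Lemma test_schwartz : schwartz phi.
Proof. by rewrite phiE; exact: schwartz_blaplace (ltW a0) ab bu m1. Qed.

Lemma test_Lap p : - Lap phi p = (laplace (fun t => (t * u t)%:C) (zc 1 p))^*.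
Proof.
rewrite phiE (conj_laplace_bumpy p ab (bumpy_mulX bu)).
exact: Lap_hol m1 (hol_blaplace (ltW a0) ab bu) (hol_blaplace (ltW a0) ab (bumpy_mulX bu)).
Qed.

Lemma test_V0p : V0p (fun p => laplace eta (zc 1 p)).
Proof.
apply: V0p_laplace; last by have [_ h _] := bumpy_expint (ltW a0) ab bu.
have := bumpy_cexp_integrable 0 ab bu; apply: eq_cintegrable => t.
by rewrite mulr0 cexp0 mulr1.
Qed.

Lemma phi_Lp r : 1 <= r -> cLp (@muH R) r phi.
Proof.
move=> r1; have := test_Lp a0 ab bu r1 (@cmeas_cst R _ R3 1) (fun=> eq_ind_r (fun x => x <= 1) (lexx 1) (normc1 R)).
by congr cLp; apply/funext => p; rewrite mul1r.
Qed.

Lemma E_Lp r : 1 <= r -> cLp (@muH R) r (fun p => laplace eta (zc 1 p)).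
Proof.
move=> r1; have [mp fp] := phi_Lp r1; split.
 by have := cmeas_conj mp; congr cmeasurable; apply/funext => p; rewrite /phi conjcK.
by move: fp; rewrite /cLnorm; congr (_ < _)%E; congr Lnorm; apply/funext => p; rewrite /phi normc_conj.
Qed.

End kernel_equation.

Section kernel_equation2.
Context {R : realType}.
Notation mu := (@lebesgue_measure R).
Notation R3 := (R * R * R)%type.
Implicit Types (p : R3) (t s : R).

Variables (a b : R).
Hypotheses (a0 : 0 < a) (ab : a < b).

(** The constraint on the norm in the previous statement is removed by scaling. *)
Lemma Pi0p_ext_bumpy g T u : bumpy a b u -> is_Pi0p_ext g T ->
 let phi p := (laplace (fun t => (u t)%:C) (zc 1 p))^* in T phi = distr g phi.
Proof.
move=> bu hT phi.
pose I := Re (cintegral (@muH R) (fun p => - Lap phi p * (phi p)^*%C)).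
pose e := (1 + `|I|)^-1.
have i1 : 0 < 1 + `|I| by rewrite ltr_pwDl.
have e0 : 0 < e by rewrite invr_gt0.
have bv := bumpyZ e bu.
pose psi p : R[i] := (laplace (fun t => (e * u t)%:C) (zc 1 p))^*.
have L w p : laplace (fun t => (e * w t)%:C) (zc 1 p) = e%:C * laplace (fun t => (w t)%:C) (zc 1 p) \/ ~ bumpy a b w.
 have [bw|] := pselect (bumpy a b w); last by right.
 left; rewrite /laplace -cintegralZl; last exact: bumpy_cexp_integrable ab bw.
 by apply: eq_cintegral => t; rewrite rmorphM/= mulrA.
have psiE : psi = fun p => e%:C * phi p.
 by apply/funext => p; have [h|//] := L u p; rewrite /psi h conjMR.
have LapE p : - Lap psi p = e%:C * - Lap phi p.
 apply: (etrans (test_Lap a0 ab bv p)); apply: (etrans _ (esym (congr1 (fun z => e%:C * z) (test_Lap a0 ab bu p)))).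
 apply: (@etrans _ _ ((e%:C * laplace (fun t => (t * u t)%:C) (zc 1 p))^*)); last exact: conjMR.
 apply: (congr1 (fun z : R[i] => z^*)); have [<-|[]] := L (fun t => t * u t) p; last exact: bumpy_mulX.
 by congr (laplace _ _); apply/funext => t; rewrite mulrCA.
have np : Hdot1_norm psi <= 1.
 rewrite /Hdot1_norm (_ : Re _ = e ^+ 2 * I).
  rewrite -sqrtr1 ler_sqrt// /e exprVn mulrC ler_pdivrMr ?exprn_gt0// mul1r.
  by have := ler_norm I; have := normr_ge0 I; nra.
 rewrite /I -ReCM -cintegralZl.
  congr Re; apply: eq_cintegral => p.
  have hc : (psi p)^*%C = e%:C * (phi p)^*%C by rewrite psiE; exact: conjMR.
  apply: (etrans (congr2 *%R (LapE p) hc)); rewrite expr2 rmorphM/=.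
  by move: (- Lap phi p) ((phi p)^*%C) => x y; ring.
 have h2 : 0 < 2 :> R by [].
 have r2 : 1 <= 2 :> R by rewrite ler1n.
 have [h _] := cLp_hoelder h2 h2 (@conj_22 R) (phi_Lp a0 ab (bumpy_mulX bu) r2) (E_Lp a0 ab bu r2).
 apply: (eq_cintegrable _ h) => p; congr (_ * _); first exact/esym/(test_Lap a0 ab bu).
 by rewrite /phi conjcK.
have r2 : 1 <= 2 :> R by rewrite ler1n.
have r4 : 1 <= 4 :> R by rewrite ler1n.
have h : T psi = distr g psi := Pi0p_ext_test hT
 (test_schwartz a0 ab bv) np (E_Lp a0 ab bv r2) (E_Lp a0 ab bv r4) (test_V0p a0 ab bv).
have [Lg hT1 _] := hT.
rewrite psiE (Hdotm1Z _ hT1 (test_schwartz a0 ab bu)) in h.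
have p34 : 0 < 4 / 3 :> R by rewrite divr_gt0.
have p4 : 0 < 4 :> R by [].
have [ig _] := cLp_hoelder p34 p4 (@conj_34 R) Lg (phi_Lp a0 ab bu r4).
have e0' : e%:C != 0 :> R[i] by rewrite fmorph_eq0 gt_eqF.
apply: (mulfI e0'); rewrite h /distr -(cintegralZl _ ig).
by apply: eq_cintegral => p; rewrite mulrCA.
Qed.

End kernel_equation2.

Section kernel_equation3.
Context {R : realType}.
Notation mu := (@lebesgue_measure R).
Notation R3 := (R * R * R)%type.
Implicit Types (p : R3) (t s : R).

Let e1 : R -> R[i] := pexp 0 1.

(** Testing the equation against the conjugate of a test function of V0+ gives
  an equation for the profile f: with E f the function of profile f, the three
  terms are E f, E (f * e1) and E (f * eta) paired with antiholomorphic
  functions. *)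
Lemma kernel_weak h : KerL h -> exists2 f, expint f /\ {ae (@muHs R), forall p : R3, h p = laplace f (zc 1 p)} &
 forall (a b : R) u, 0 < a -> a < b -> bumpy a b u ->
  let eta t := (u t)%:C in
  cintegral mu (fun t => f t * eta t) =
  4 * cintegral mu (fun t => conv f e1 t * ((conv eta e1 t)^* / t%:C)) +
  2 * (laplace f (-1) * laplace eta (-1))^*.
Proof.
move=> [[Lh _] Vh [T1 [T2 [P1 P2 eqT]]]].
have p4 : 0 < 4 :> R by [].
have q1 : 1 <= 4 / 3 :> R by rewrite ler_pdivlMr// mul1r ler_nat.
have q0 : 0 < 4 / 3 :> R by rewrite divr_gt0.
have [f ef hf] := V0p_Lp_repr p4 q1 (@conj_43 R) Lh Vh.
exists f => // a b u a0 ab bu eta.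
have [mh _] := Lh.
have [mf f0 fd] := ef.
have mE g : cmeasurable g -> cmeasurable (fun p : R3 => laplace g (zc 1 p)) by exact: laplace_zc_measurable.
have ee1 : expint e1 by exact: pexp_expint.
have eeta : expint eta := bumpy_expint (ltW a0) ab bu.
pose phi p : R[i] := (laplace eta (zc 1 p))^*.
have sphi : schwartz phi := test_schwartz a0 ab bu.
have mphi : cmeasurable (phi : R3 -> R[i]) := schwartz_measurable sphi.
(* a.e. the exponent has negative real part, so that convolutions may be used *)
have aez : {ae (@muHs R), forall p : R3, Re (zc 1 p) < 0 /\ h p = laplace f (zc 1 p)}.
 apply: ae_and hf; apply: (ae_imp (ae_neq_x 0)) => p x0.
 by rewrite /= oppr_lt0 /rho2 ltr_pwDl ?sqr_ge0// exprn_even_gt0.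
have hT := eqT phi sphi.
have E1 : T1 phi = distr (fun p => (normc (Qp p) ^+ 2)%:C * h p) phi := Pi0p_ext_bumpy a0 ab bu P1.
have E2 : T2 phi = distr (fun p => Qp p ^+ 2 * (h p)^*) phi := Pi0p_ext_bumpy a0 ab bu P2.
have bv := bumpy_mulX bu.
have iA : cintegrable (@muH R) (fun p => h p * (laplace (fun t => (t * u t)%:C) (zc 1 p))^*).
 by have [] := cLp_hoelder p4 q0 (@conj_43 R) Lh (phi_Lp a0 ab bv q1).
have A : distr h (fun p => - Lap phi p) = (pi ^+ 2)%:C * cintegral mu (fun t => f t * eta t).
 have mW : cmeasurable (fun p : R3 => (laplace (fun t => (t * u t)%:C) (zc 1 p))^*) := laplace_bumpy_measurable a0 ab bv.
 have mA : cmeasurable (fun p : R3 => (laplace (fun t => (t * u t)%:C) (zc 1 p))^* * laplace f (zc 1 p)).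
  exact: (cmeasM mW (mE _ mf)).
 have aeA : {ae (@muHs R), forall p : R3, h p * (laplace (fun t => (t * u t)%:C) (zc 1 p))^* =
   (laplace (fun t => (t * u t)%:C) (zc 1 p))^* * laplace f (zc 1 p)}.
  by apply: (ae_imp hf) => p ->; rewrite mulrC.
 have [iA' eA] := ae_cintegrableH mA aeA iA.
 have [M hM] := bumpy_bounded bu.
 have [C3 C30 hC3] := conj_laplace_zi a0 ab bv 3.
 have [C2 C20 hC2] := conj_laplace_zi a0 ab bv 2.
 have := @plancherel R (fun t => (t * u t)%:C) f 1 (`|M| * expR b) C2 ltr01 _ _ _ _ _ _ ef iA'.
 move=> H; transitivity (cintegral (@muH R) (fun p => (laplace (fun t => (t * u t)%:C) (zc 1 p))^* * laplace f (zc 1 p))).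
  apply: (@etrans _ _ (cintegral (@muH R) (fun p => h p * (laplace (fun t => (t * u t)%:C) (zc 1 p))^*))).
   by apply: eq_cintegral => p; congr (_ * _); exact: test_Lap a0 ab bu p.
  exact: eA.
 rewrite H.
 - congr (_ * _); apply: eq_cintegral => t; have [t0|t0] := leP t 0; first by rewrite f0// !mul0r.
  congr (_ * _); apply: (@etrans _ _ ((t * u t)%:C / t%:C)); first by congr (_ / _); exact: conjR.
  by rewrite -fmorphV -rmorphM/= mulrAC mulfV ?mul1r// gt_eqF.
 - by apply: cmeas_real; exact: bumpy_measurable bv.
 - by move=> t t0; have [_ h0 _] := bumpy_expint (ltW a0) ab bv; exact: h0.
 - move=> t; apply: (@ccont_at_pos _ _ (fun t => (t * u t)%:C)) => //.
  by apply: ccont_real; exact: bumpy_continuous bv.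
 - move=> t t0; rewrite normc_real normrM (gtr0_norm t0) mulrCA ler_wpM2l ?(ltW t0)// mul1r.
  have [tb|tb] := ltP t b; last first.
   by rewrite (bumpy_supp bu) ?normr0 ?mulr_ge0 ?expR_ge0// negb_and -!leNgt tb orbT.
  rewrite -mulrA -expRD (le_trans (hM t))// (le_trans (ler_norm M))// ler_peMr//.
  by rewrite -[leLHS]expR0 ler_expR subr_ge0 ltW.
 - exact: zi_integrable mW hC3.
 - by move=> p; apply: (le_trans (hC2 p)); rewrite ler_wpM2l//; exact: zi2_iker.
have mh' := mE _ mf.
pose F := conv f e1; pose kap := conv eta e1.
have eF : expint F := conv_expint ef ee1 pexp01_le1.
have EF p : Re (zc 1 p) < 0 -> laplace F (zc 1 p) = laplace f (zc 1 p) * zi p.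
 by move=> z0; have [_ ->] := conv_laplace ef ee1 pexp01_le1 z0; rewrite zi_laplace mul1r expr1.
have B : distr (fun p => (normc (Qp p) ^+ 2)%:C * h p) phi =
  2 * ((pi ^+ 2)%:C * cintegral mu (fun t => F t * ((kap t)^* / t%:C))).
 have EK p : (laplace kap (zc 1 p))^* = (zi p)^* * phi p.
  by rewrite /kap (conv_bumpy_laplace a0 ab bu) rmorphM mulrC.
 have iB : cintegrable (@muH R) (fun p => h p * (zi p * (zi p)^* * phi p)).
  have [] // := cLp_hoelder p4 q0 (@conj_43 R) Lh
   (@test_Lp R a b u a0 ab bu (4 / 3) (fun p => zi p * (zi p)^*) 1 q1 _ _).
   by apply: cmeasM; [exact: zi_measurable|exact: (cmeas_conj zi_measurable)].
  by move=> p; rewrite normcM normc_conj -expr2 exprn_ile1 ?normc_ge0 ?normc_zi_le1.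
 have aeB : {ae (@muHs R), forall p : R3, h p * (zi p * (zi p)^* * phi p) = (laplace kap (zc 1 p))^* * laplace F (zc 1 p)}.
  apply: (ae_imp aez) => p [z0 hp]; rewrite (EF p z0) hp.
  apply: (@etrans _ _ ((zi p)^* * phi p * (laplace f (zc 1 p) * zi p))); first ring.
  by congr (_ * _); exact/esym/EK.
 have mk : cmeasurable kap := conv_measurable eeta ee1.
 have mW : cmeasurable (fun p : R3 => (laplace kap (zc 1 p))^*) by apply: cmeas_conj; exact: mE.
 have mF : cmeasurable F by have [] := eF.
 have mB : cmeasurable (fun p : R3 => (laplace kap (zc 1 p))^* * laplace F (zc 1 p)).
  exact: (cmeasM mW (mE _ mF)).
 have [iB' eB] := ae_cintegrableH mB aeB iB.
 have [C0 C00 hC0] := conv_bumpy_bound a0 ab bu.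
 have [C2 C20 hC2] := conj_laplace_zi a0 ab bu 2.
 have [C3 C30 hC3] := conj_laplace_zi a0 ab bu 3.
 have bW C k : 0 <= C -> (forall p, normc (phi p) <= C * normc (zi p) ^+ k) ->
   forall p, normc (laplace kap (zc 1 p))^* <= C * normc (zi p) ^+ k.
  move=> C0' hC p; rewrite EK normcM normc_conj (le_trans _ (hC p))//.
  by rewrite ler_piMl ?normc_ge0 ?normc_zi_le1.
 rewrite -(@plancherel R kap F 1 C0 C2) //.
 - rewrite -eB -(cintegralZl _ iB).
  by apply: eq_cintegral => p; rewrite normQp2E; ring.
 - exact: (conv_supp eeta ee1).
 - by move=> t; apply: (@ccont_at_pos _ _ kap) => //; exact: conv_bumpy_continuous ab bu.
 - exact: zi_integrable mW (bW _ _ C30 hC3).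
 - by move=> p; apply: (le_trans (bW _ _ C20 hC2 p)); rewrite ler_wpM2l//; exact: zi2_iker.
have [M hM] := bumpy_bounded bu.
have etaM t : normc (eta t) <= M by rewrite normc_real.
have D : distr (fun p => Qp p ^+ 2 * (h p)^*) phi =
  2 * ((pi ^+ 2)%:C * (laplace f (-1) * laplace eta (-1))^*).
 have eH := conv_expint ef eeta etaM.
 have iD : cintegrable (@muH R) (fun p => h p * ((zi p ^+ 2)^* * (phi p)^*)).
  have mz : cmeasurable (fun p : R3 => zi p ^+ 2) by exact: (cmeasX 2 zi_measurable).
  have z1 p : normc (zi p ^+ 2) <= 1 by rewrite normcX exprn_ile1 ?normc_ge0 ?normc_zi_le1.
  have [mL fL] := @test_Lp R a b u a0 ab bu (4 / 3) (fun p => zi p ^+ 2) 1 q1 mz z1.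
  have LD : cLp (@muH R) (4 / 3) (fun p => (zi p ^+ 2)^* * (phi p)^*).
   split; first exact: (cmeasM (cmeas_conj mz) (cmeas_conj mphi)).
   move: fL; rewrite /cLnorm.
   rewrite (_ : (fun x => (normc ((zi x ^+ 2)^* * (phi x)^*))%:E) =
     fun x => (normc (zi x ^+ 2 * (laplace (fun t => (u t)%:C) (zc 1 x))^*))%:E) //.
   by apply/funext => p; rewrite normcM [in RHS]normcM; congr ((_ * _)%:E); exact: normc_conj.
  by have [] := cLp_hoelder p4 q0 (@conj_43 R) Lh LD.
 have aeD : {ae (@muHs R), forall p : R3, h p * ((zi p ^+ 2)^* * (phi p)^*) = (zi p ^+ 2)^* * laplace (conv f eta) (zc 1 p)}.
  apply: (ae_imp aez) => p [z0 ->]; have [_ ->] := conv_laplace ef eeta etaM z0.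
  rewrite mulrCA; congr (_ * (_ * _)); exact: conjcK.
 have mH : cmeasurable (conv f eta) by have [] := eH.
 have mD : cmeasurable (fun p : R3 => (zi p ^+ 2)^* * laplace (conv f eta) (zc 1 p)).
  exact: (cmeasM (cmeas_conj (cmeasX 2 zi_measurable)) (mE _ mH)).
 have [iD' eD] := ae_cintegrableH mD aeD iD.
 have := zi2_moment eH iD'.
 have -> : cintegral mu (fun t => conv f eta t * (expR (- t))%:C) = laplace f (-1) * laplace eta (-1).
  have n1 : Re (-1 : R[i]) < 0 by rewrite /= oppr_lt0.
  have [_ <-] := conv_laplace ef eeta etaM n1; apply: eq_cintegral => t.
  by congr (_ * _); rewrite -cexp_real rmorphN mulrN mulr1.
 move=> H; apply: (@etrans _ _ (2 * (cintegral (@muH R) (fun p => h p * ((zi p ^+ 2)^* * (phi p)^*)))^*)).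
  apply: (@etrans _ _ (2 * cintegral (@muH R) (fun p => (h p * ((zi p ^+ 2)^* * (phi p)^*))^*))).
   rewrite -(cintegralZl _ (cintegr_conj iD)).
   apply: eq_cintegral => p; rewrite Qp2E -!(mulrA 2); congr (_ * _).
   move: (zi p ^+ 2) (h p) (phi p) => [x1 x2] [y1 y2] [z1 z2].
   by apply: eqcE => /=; ring.
  by congr (_ * _); exact: (cintegral_conj iD).
 congr (_ * _); rewrite eD H; exact: conjMR.
have p20 : (pi ^+ 2)%:C != 0 :> R[i] by rewrite fmorph_eq0 expf_neq0// gt_eqF// pi_gt0.
apply: (mulfI p20); move: hT; rewrite E1 E2 A B D => /esym/eqP.
rewrite subr_eq0 subr_eq => /eqP ->; rewrite /F /kap; ring.
Qed.

End kernel_equation3.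

(** * The ordinary differential equation for the profile *)

Section ode.
Context {R : realType}.
Implicit Types (t s : R) (P q : R -> R).

Lemma is_derive_nonincr (f df : R -> R) (l r : R) : (forall x, l < x < r -> is_derive x 1 f (df x)) ->
 (forall x, l < x < r -> df x <= 0) -> forall s t, l < s -> s <= t -> t < r -> f t <= f s.
Proof.
move=> dF f0 s t ls st tr.
have I x : s <= x <= t -> l < x < r by move=> /andP[sx xt]; rewrite (lt_le_trans ls)//= (le_lt_trans xt).
have [||c ct e] := @MVT_segment R f df s t st.
- by move=> x; rewrite in_itv/= => /andP[sx xt]; apply: dF; apply: I; rewrite !ltW.
- apply: continuous_in_subspaceT => x; rewrite inE/= in_itv/= => /I /dF [d _].
 exact/differentiable_continuous/derivable1_diffP.
- rewrite -subr_le0 e mulr_le0_ge0 ?subr_ge0// f0// I//.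
Qed.

Lemma is_derive_cst_itv (f : R -> R) (l r : R) : (forall x, l < x < r -> is_derive x 1 f 0) ->
 forall s t, l < s < r -> l < t < r -> f t = f s.
Proof.
move=> d0; have N s t : l < s -> s <= t -> t < r -> f t = f s.
 move=> ls st tr; apply/le_anti/andP; split.
  exact: (is_derive_nonincr d0 (fun _ _ => lexx 0)).
 rewrite -lerN2; apply: (is_derive_nonincr (f := fun x => - f x) (df := fun=> 0) _ (fun _ _ => lexx 0) ls st tr).
 by move=> x /d0 h; have := is_deriveN h; rewrite oppr0.
move=> s t /andP[ls sr] /andP[lt tr]; have [st|ts] := leP s t; first exact: N.
by apply/esym; apply: N => //; exact: ltW.
Qed.

Definition pol t : R := t * (1 - t).

Lemma is_derive_pol t : is_derive t 1 pol (1 - 2 * t).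
Proof.
have h := is_deriveB (is_derive_cst (1 : R) t 1) (@is_derive_id R R t 1).
apply: (is_derive_eq (is_deriveM (@is_derive_id R R t 1) h)); rewrite !fctE /GRing.scale /=; ring.
Qed.

Lemma is_derive_expRN2 t : is_derive t 1 (fun s => expR (- 2 * s)) (- 2 * expR (- 2 * t)).
Proof.
have h : is_derive t 1 (fun s : R => -2 * s) (-2).
 by have := is_deriveZ (-2) (@is_derive_id R R t 1); rewrite /GRing.scale /= mulr1.
have := @is_derive1_comp R expR (fun s => -2 * s) t _ _ (is_derive_expR _) h.
by rewrite mulrC.
Qed.

Lemma is_derive_quot (P : R -> R) p t : is_derive t 1 P p -> pol t != 0 ->
 is_derive t 1 (fun s => P s / pol s) ((p * pol t - P t * (1 - 2 * t)) / pol t ^+ 2).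
Proof.
move=> dP p0; apply: (is_derive_eq (is_deriveM dP (is_deriveV p0 (is_derive_pol t)))).
by rewrite /GRing.scale /=; field.
Qed.

Section system.
Variables (P q : R -> R).
Hypothesis dP : forall t, 0 < t -> is_derive t 1 P (q t).
Hypothesis dq : forall t, 0 < t ->
 is_derive t 1 (fun s => expR (- 2 * s) * q s) (- 4 * P t * expR (- 2 * t) / t).

Let W t := expR (- 2 * t) * P t * (1 - 2 * t) - expR (- 2 * t) * q t * pol t.

Lemma wronskian_cst s t : 0 < s -> 0 < t -> W t = W s.
Proof.
move=> s0 t0; apply: (@is_derive_cst_itv W 0 (s + t + 1)); last 2 first.
- by rewrite s0 /= -addrA ltrDl addr_gt0.
- by rewrite t0 /= addrAC ltrDr addr_gt0.
move=> x /andP[x0 _].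
have h2 : is_derive x 1 (fun s : R => 1 - 2 * s) (- 2).
 apply: (is_derive_eq (is_deriveB (is_derive_cst (1 : R) x 1) (is_deriveZ 2 (@is_derive_id R R x 1)))).
 by rewrite /GRing.scale /=; ring.
have h3 := is_deriveM (is_deriveM (is_derive_expRN2 x) (dP x0)) h2.
have h4 := is_deriveM (dq x0) (is_derive_pol x).
apply: (is_derive_eq (is_deriveB h3 h4)); rewrite !fctE /GRing.scale /= /pol.
by field; exact: lt0r_neq0.
Qed.

(** The second solution behaves like 1 near the origin, which the vanishing of
  P at the origin forbids. *)
Lemma wronskian_le0 : P t @[t --> 0^'+] --> (0 : R) -> W 2^-1 <= 0.
Proof.
move=> P0; rewrite leNgt; apply/negP; set C := W _ => C0.
have WC t : 0 < t -> q t * pol t - P t * (1 - 2 * t) = - C * expR (2 * t).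
 move=> t0; have h2 : 0 < 2^-1 :> R by rewrite invr_gt0.
 rewrite /C (wronskian_cst t0 h2) /W.
 have e : expR (- 2 * t) * expR (2 * t) = 1 by rewrite -expRD mulNr addNr expR0.
 rewrite [RHS](_ : _ = (expR (- 2 * t) * expR (2 * t)) * (q t * pol t - P t * (1 - 2 * t))); last by ring.
 by rewrite e mul1r.
have pol0 t : 0 < t < 1 -> 0 < pol t.
 by move=> /andP[t0 t1]; rewrite /pol mulr_gt0// subr_gt0.
pose g t := P t / pol t - C / t.
have mono t : 0 < t -> t <= 2^-1 -> g 2^-1 <= g t.
 move=> t0 t2; apply: (@is_derive_nonincr g (fun t => (q t * pol t - P t * (1 - 2 * t)) / pol t ^+ 2 + C / t ^+ 2) 0 1) => //.
 - move=> x x01; have /andP[x0 x1] := x01; have px := lt0r_neq0 (pol0 _ x01).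
  have h1 := is_derive_quot (dP x0) px.
  have h2 := is_deriveZ C (is_deriveV (lt0r_neq0 x0) (@is_derive_id R R x 1)).
  apply: (is_derive_eq (is_deriveB h1 h2)); rewrite /GRing.scale /=.
  by rewrite mulr1 mulrN opprK.
 - move=> x x01; have /andP[x0 x1] := x01; have px := pol0 _ x01.
  rewrite WC// !mulNr addrC subr_le0 ler_pdivrMr ?exprn_gt0// mulrAC ler_pdivlMr ?exprn_gt0//.
  rewrite -mulrA ler_wpM2l ?(ltW C0)//.
  have e1 : 1 <= expR (2 * x) by rewrite -[leLHS]expR0 ler_expR mulr_ge0// ltW.
  have p1 : pol x ^+ 2 <= x ^+ 2.
   by rewrite lerXn2r ?nnegrE ?(ltW px) ?(ltW x0)// /pol ler_piMr ?(ltW x0)// gerBl (ltW x0).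
  by rewrite (le_trans p1)// ler_peMl ?sqr_ge0.
 - by rewrite invf_lt1// ltr1n.
pose K := g 2^-1.
have B : \forall t \near 0^'+, (1 - t) * (C + K * t) <= P t.
 near=> t; have t0 : 0 < t by near: t; exact: nbhs_right_gt.
 have t2 : t <= 2^-1 by near: t; apply: nbhs_right_le; rewrite invr_gt0.
 have t1 : t < 1 by rewrite (le_lt_trans t2)// invf_lt1// ltr1n.
 have /pol0 px : 0 < t < 1 by rewrite t0.
 have := mono _ t0 t2; rewrite -/K /g lerBrDr ler_pdivlMr//; apply: le_trans.
 rewrite le_eqVlt; apply/orP; left; apply/eqP; rewrite /pol.
 by field; exact: lt0r_neq0.
have L : (1 - t) * (C + K * t) @[t --> 0^'+] --> C.
 have c : continuous (fun t : R => (1 - t) * (C + K * t)).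
  move=> t; apply: cvgM; first by apply: cvgB; [exact: cvg_cst|exact: cvg_id].
  by apply: cvgD; [exact: cvg_cst|apply: cvgM; [exact: cvg_cst|exact: cvg_id]].
 have := c 0; rewrite /continuous_at subr0 mulr0 addr0 mul1r => h.
 exact: cvg_at_right_filter h.
have : C <= 0 by exact: (ler_cvg_to L P0 B).
by rewrite leNgt C0.
Unshelve. all: by end_near. Qed.

End system.

(** The polynomial [pol] is a solution itself, so its Wronskian with P is constant,
 and it vanishes because P tends to 0 at the origin; thus P is proportional to
 [pol], whose derivative is 1 - 2 t. *)
Lemma ode_solution P q : (forall t, 0 < t -> is_derive t 1 P (q t)) ->
 (forall t, 0 < t -> is_derive t 1 (fun s => expR (- 2 * s) * q s) (- 4 * P t * expR (- 2 * t) / t)) ->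
 P t @[t --> 0^'+] --> (0 : R) -> exists A, forall t, 0 < t -> q t = A * (1 - 2 * t).
Proof.
move=> dP dq P0.
pose W t := expR (- 2 * t) * P t * (1 - 2 * t) - expR (- 2 * t) * q t * pol t.
have W0 t : 0 < t -> W t = 0.
 move=> t0; have h2 : 0 < 2^-1 :> R by rewrite invr_gt0.
 rewrite /W (wronskian_cst dP dq h2 t0); apply/le_anti/andP; split; first exact: wronskian_le0.
 have dP' t' : 0 < t' -> is_derive t' 1 (fun s => - P s) (- q t') by move=> /dP h; exact: is_deriveN h.
 have dq' t' : 0 < t' -> is_derive t' 1 (fun s => expR (- 2 * s) * - q s) (- 4 * - P t' * expR (- 2 * t') / t').
  move=> /dq h; have e : (fun s => expR (-2 * s) * - q s) = fun s => - (expR (-2 * s) * q s).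
   by apply/funext => s; rewrite mulrN.
  by rewrite e; apply: (is_derive_eq (is_deriveN h)); ring.
 have N0 : - P t @[t --> 0^'+] --> (0 : R) by rewrite -[X in _ --> X]oppr0; exact: cvgN P0.
 have := wronskian_le0 dP' dq' N0; rewrite -oppr_ge0; congr (_ <= _); ring.
have qE t : 0 < t -> q t * pol t = P t * (1 - 2 * t).
 move=> /W0 /eqP; rewrite /W -!mulrA -mulrBr mulf_eq0 gt_eqF ?expR_gt0//= subr_eq0.
 by move=> /eqP.
have pol1 t : 0 < t -> t != 1 -> pol t != 0.
 by move=> t0 t1; rewrite /pol mulf_neq0 ?(gt_eqF t0)// subr_eq0 eq_sym.
have ratio l r s t : 0 <= l -> (forall x, l < x < r -> x != 1) -> l < s < r -> l < t < r ->
  P t / pol t = P s / pol s.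
 move=> l0 n1; apply: (@is_derive_cst_itv (fun s => P s / pol s) l r) => x xlr; have /andP[lx _] := xlr.
 have x0 : 0 < x by exact: le_lt_trans l0 lx.
 apply: (is_derive_eq (is_derive_quot (dP _ x0) (pol1 _ x0 (n1 _ xlr)))).
 by rewrite qE// subrr mul0r.
have qr t A : 0 < t -> t != 1 -> P t / pol t = A -> q t = A * (1 - 2 * t).
 move=> t0 t1 <-; have p0 := pol1 _ t0 t1; apply: (mulIf p0).
 by rewrite qE// mulrAC divfK.
have h2 : 0 < 2^-1 :> R by rewrite invr_gt0.
have h21 : 2^-1 < 1 :> R by rewrite invf_lt1// ltr1n.
have q1 t : 0 < t < 1 -> q t = P 2^-1 / pol 2^-1 * (1 - 2 * t).
 move=> /andP[t0 t1]; apply: qr => //; first by rewrite lt_eqF.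
 apply: (ratio 0 1) => //; last by rewrite t0.
  by move=> x /andP[_ x1]; rewrite lt_eqF.
 by rewrite h2.
have q2 t : 1 < t -> q t = P 2 / pol 2 * (1 - 2 * t).
 move=> t1; have t0 : 0 < t by exact: lt_trans t1.
 apply: qr => //; first by rewrite gt_eqF.
 apply: (ratio 1 (t + 2)) => //.
 - by move=> x /andP[x1 _]; rewrite gt_eqF.
 - by rewrite ltr1n /= ltrDr.
 - by rewrite t1 /= ltrDl.
have cv : {for 1, continuous (fun s => expR (- 2 * s) * q s)}.
 have [d _] := dq _ ltr01; exact/differentiable_continuous/derivable1_diffP.
have lim (F : set_system R) A : ProperFilter F -> F `=>` nbhs (1 : R) ->
  (\forall s \near F, q s = A * (1 - 2 * s)) -> q 1 = - A.
 move=> PF F1 Fq.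
 have l1 : (fun s => expR (- 2 * s) * q s) @ F --> expR (- 2 * 1) * q 1 by exact: cvg_comp F1 cv.
 have c2 : continuous (fun s => expR (- 2 * s) * (A * (1 - 2 * s))).
  have ce : continuous (fun s : R => expR (- 2 * s)).
   by move=> s; have [d _] := is_derive_expRN2 s; exact/differentiable_continuous/derivable1_diffP.
  move=> s; apply: cvgM; first exact: ce.
  apply: cvgM; first exact: cvg_cst.
  by apply: cvgB; [exact: cvg_cst|apply: cvgM; [exact: cvg_cst|exact: cvg_id]].
 have l2 : (fun s => expR (- 2 * s) * q s) @ F --> expR (- 2 * 1) * (A * (1 - 2 * 1)).
  have l2' : (fun s => expR (- 2 * s) * (A * (1 - 2 * s))) @ F --> expR (- 2 * 1) * (A * (1 - 2 * 1)).
   exact: cvg_comp F1 (c2 1).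
  by apply: cvg_trans l2'; apply: near_eq_cvg; apply: filterS Fq => s ->.
 have e : expR (- 2 * 1) * q 1 = expR (- 2 * 1) * (A * (1 - 2 * 1)).
  exact: (cvg_unique (@norm_hausdorff _ _) l1 l2).
 have {e} := mulfI (lt0r_neq0 (expR_gt0 _)) e => ->; ring.
have A1 : q 1 = - (P 2^-1 / pol 2^-1).
 apply: (lim (1^'-)); first exact: cvg_within.
 near=> s; apply: q1; apply/andP; split.
  by near: s; apply: nbhs_left_gt; exact: ltr01.
 by near: s; exact: nbhs_left_lt.
have A2 : q 1 = - (P 2 / pol 2).
 apply: (lim (1^'+)); first exact: cvg_within.
 by near=> s; apply: q2; near: s; exact: nbhs_right_gt.
exists (P 2^-1 / pol 2^-1) => t t0; have [t1|t1|->] := ltgtP t 1.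
- by apply: q1; rewrite t0.
- by rewrite q2//; congr (_ * _); apply: oppr_inj; rewrite -A2 -A1.
- by rewrite A1; ring.
Unshelve. all: by end_near. Qed.

End ode.

(** * From the weak equation to the differential equation *)

Section profile.
Context {R : realType}.
Notation mu := (@lebesgue_measure R).
Implicit Types (t s : R) (r P : R -> R).

(** The bumps fill the indicator of any subinterval, and the half-lines
 generate the Borel sets. *)
Lemma bump_null (g : R -> R) (a b : R) : a < b ->
 Rintegrable mu (fun t => if a < t < b then g t else 0) ->
 (forall a' b' n, a <= a' -> a' < b' -> b' <= b ->
  \int[mu]_t ((if a < t < b then g t else 0) * bump a' b' n.+1%:R t) = 0) ->
 {ae mu, forall t, a < t < b -> g t = 0}.
Proof.
move=> ab; set h := fun t => if a < t < b then g t else 0 => ih H.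
have mh : measurable_fun [set: R] h by exact: (mfun_integrable ih).
have I x : \int[mu]_t (h t * \1_(`]x, +oo[%classic) t) = 0.
 have [bx|xb] := leP b x.
  rewrite /Rintegral (_ : (fun t => _) = fun=> 0%E) ?integral0//; apply/funext => t.
  rewrite indicE mem_setE in_itv/= andbT /h; case: ifP => [/andP[_ tb]|]; last by rewrite mul0r.
  by rewrite ltNge (ltW (lt_le_trans tb bx)) mulr0.
 pose a' := Num.max a x; have ab' : a' < b by rewrite gt_max ab.
 pose L t : R := h t * (if a' < t < b then 1 else 0).
 have e : (fun t => h t * \1_(`]x, +oo[%classic) t) = L.
  apply/funext => t; rewrite /L indicE mem_setE in_itv/= andbT /h gt_max.
  case: ifP => [/andP[at' tb]|]; last by rewrite !mul0r.
  by rewrite at' tb andbT /=; case: ifP.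
 pose Bn n t : R := h t * bump a' b n.+1%:R t.
 have n0 (n : nat) : 0 < n.+1%:R :> R by rewrite ltr0n.
 have mB n : measurable_fun [set: R] (Bn n).
  by apply: measurable_funM => //; exact: bumpy_measurable (bump_bumpy (n0 n) ab').
 have mL : measurable_fun [set: R] L.
  apply: measurable_funM => //; apply: measurable_fun_if => //; exact: measurable_itvo.
 have ia : Rintegrable mu (fun t => `|h t|) by exact: integrable_abse ih.
 have i01 n t : 0 <= bump a' b n.+1%:R t <= 1 by rewrite bump_ge0 ?bump_le1.
 have iB n : Rintegrable mu (Bn n).
  apply: (le_integrable measurableT _ _ ia) => [|t _]; first by apply/measurable_EFinP; exact: mB.
  rewrite /= lee_fin normr_id normrM ler_piMr//; have /andP[h0 h1] := i01 n t.
  by rewrite ger0_norm.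
 have iL : Rintegrable mu L.
  apply: (le_integrable measurableT _ _ ia) => [|t _]; first by apply/measurable_EFinP; exact: mL.
  by rewrite /= lee_fin normr_id normrM ler_piMr//; case: ifP => _; rewrite ?normr1 ?normr0.
 have c : (fun n => \int[mu]_t (Bn n t)) @ \oo --> \int[mu]_t (L t).
  have h0 : (fun n => \int[mu]_t (Bn n t) - \int[mu]_t (L t)) @ \oo --> (0 : R).
   apply/norm_cvg0P; apply: (@squeeze0 R _ (fun n => \int[mu]_t `|Bn n t - L t|)).
    move=> n; rewrite normr_ge0/= -RintegralB//; apply: le_normr_Rintegral => //.
    exact: (integrableB measurableT (iB n) iL).
   apply: (@R_dct R _ _ mu (fun n t => `|Bn n t - L t|) (fun t => `|h t|) _ _ ia).
   - by move=> n; apply: measurableT_comp => //; exact: (measurable_funB (mB n) mL).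
   - move=> n t; rewrite normr_ge0 /= /Bn /L -mulrBr normrM ler_piMr//.
    have /andP[h0 h1] := i01 n t; rewrite ler_norml.
    by case: ifP => _; rewrite ?subr0; apply/andP; split; lra.
   - move=> t; rewrite -[X in _ --> X](normr0 R); apply: cvg_norm.
    rewrite -[X in _ --> X](subrr (L t)); apply: cvgB; last exact: cvg_cst.
    by apply: cvgM; [exact: cvg_cst|exact: bump_cvg].
  have hh : (fun n => \int[mu]_t (Bn n t) - \int[mu]_t (L t) + \int[mu]_t (L t)) @ \oo --> 0 + \int[mu]_t (L t).
   by apply: cvgD => //; exact: cvg_cst.
  rewrite add0r in hh; rewrite (_ : (fun n => _ + _) = fun n => \int[mu]_t (Bn n t)) in hh; first exact: hh.
  by apply/funext => n; rewrite subrK.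
 have z : (fun n => \int[mu]_t (Bn n t)) = fun=> 0.
  by apply/funext => n; apply: H => //; rewrite le_max lexx.
 rewrite e; rewrite z in c; exact: (cvg_unique (@norm_hausdorff _ _) c (cvg_cst 0)).
have N : {ae mu, forall t, h t = 0}.
 apply: (indic_null_ae ih) => A mA.
 have GR : @measurable _ (measurableTypeR R) = <<s @RGenOInfty.G R >> by exact: RGenOInfty.measurableE.
 have Gray n : @RGenOInfty.G R `](- n%:R : R), +oo[%classic by exists (- n%:R).
 have := @dynkin_indic_null R _ _ mu h ih _ _ id _ setT (fun n => `](- n%:R : R), +oo[%classic)
  (@measurable_id _ _ _) measurableT (@rays_setI_closed R) GR Gray rays_nd rays_cover.
 move=> /(_ _ A mA); rewrite setIT; apply => _ [x ->]; rewrite setIT; exact: I.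
by apply: (ae_imp N) => t + tab; rewrite /h tab.
Qed.

(** The weak equation, with the convolutions written as primitives, determines
  the profile up to one constant. *)
Lemma profile_solution r (k : R) : let P := primitive (fun s => r s * expR s) in
 measurable_fun setT r -> (forall t, t <= 0 -> r t = 0) ->
 (forall d : R, 0 < d -> Rintegrable mu (fun t => r t * expR (- (d * t)))) ->
 Rintegrable mu (fun t => P t * expR (- (2 * t))) ->
 (forall a b u, 0 < a -> a < b -> bumpy a b u -> \int[mu]_t (r t * u t) =
  4 * \int[mu]_t (P t * expR (- t) * (expR (- t) * primitive (fun s => u s * expR s) t / t)) +
  2 * k * \int[mu]_t (u t * expR (- t))) ->
 exists A, {ae mu, forall t, r t = if 0 < t then expR (- t) * (A * (1 - 2 * t) - 2 * k) else 0}.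
Proof.
move=> P mr r0 rd iP weak.
pose pq t := P t * expR (- (2 * t)) / t.
have mP2 : measurable_fun [set: R] (fun t => P t * expR (- (2 * t))) by exact: (mfun_integrable iP).
have mpq : measurable_fun [set: R] pq.
 apply: measurable_funM => //.
 have [h _] := cmeasV (cmeas_real (@measurable_id _ (measurableTypeR R) setT)).
 by move: h; congr (measurable_fun _ _); apply/funext => t; rewrite -fmorphV.
have ipq a : 0 < a -> Rintegrable mu (fun t => if a < t then pq t else 0).
 move=> a0; apply: (le_integrable measurableT _ _ (RintegrableZl a^-1 iP)) => [|t _].
  by apply/measurable_EFinP; apply: measurable_fun_if => //; [exact: measurable_ltr|exact: measurable_funTS].
 rewrite /= lee_fin; case: ifP => at_; last by rewrite normr0.
 rewrite /pq [leRHS]normrM mulrC normrM ler_wpM2r// !ger0_norm ?invr_ge0 ?(ltW a0)//.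
  by rewrite lef_pV2 ?posrE// ?ltW// (lt_trans a0).
 by rewrite ltW// (lt_trans a0).
pose H s := \int[mu]_t (if s < t then pq t else 0).
pose rt s := 4 * (expR s * H s) + 2 * k * expR (- s).
have swap a b u : 0 < a -> a < b -> bumpy a b u ->
  \int[mu]_t (P t * expR (- t) * (expR (- t) * primitive (fun s => u s * expR s) t / t)) =
  \int[mu]_s (u s * (expR s * H s)) /\ Rintegrable mu (fun s => u s * (expR s * H s)).
 move=> a0 ab bu.
 pose K (x : R * R) := (if a < x.1 then pq x.1 else 0) * (if x.2 < x.1 then u x.2 * expR x.2 else 0).
 have iu := bumpy_expR_integrable ab bu.
 have iK : Rintegrable (mu \x mu)%E K.
  have h := @integrable_prod R _ _ _ _ mu mu _ _ (ipq _ a0) iu.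
  apply: (le_integrable measurableT _ _ h) => [|x _].
   apply/measurable_EFinP; apply: measurable_funM.
    have /measurable_EFinP m := measurable_int _ (ipq _ a0).
    exact: (measurableT_comp m measurable_fst).
   apply: measurable_fun_if => //; last first.
    apply: measurable_funTS; have /measurable_EFinP m := measurable_int _ iu.
    exact: (measurableT_comp m measurable_snd).
   by apply: measurable_fun_ltr; [exact: measurable_snd|exact: measurable_fst].
  rewrite /= lee_fin /K [leLHS]normrM [leRHS]normrM ler_wpM2l//; case: ifP => // _.
  by rewrite normr0 normr_ge0.
 have e1 t : \int[mu]_s K (t, s) = P t * expR (- t) * (expR (- t) * primitive (fun s => u s * expR s) t / t).
  rewrite /K /= RintegralZl//; last exact: primitive_integrable iu.
  rewrite -/(primitive (fun s => u s * expR s) t).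
  have [at_|ta] := ltP a t.
   have e : expR (- (2 * t)) = expR (- t) * expR (- t) by rewrite -expRD; congr expR; ring.
   by rewrite /pq e; ring.
  rewrite (_ : primitive _ t = 0) ?mulr0 ?mul0r ?mulr0//.
  have z s : (if s < t then u s * expR s else 0) = 0.
   case: ifP => // st; rewrite (bumpy_supp bu) ?mul0r// negb_and -leNgt.
   by rewrite (le_trans (ltW st)).
  by rewrite /primitive (funext z) /Rintegral integral0.
 have e2 s : \int[mu]_t K (t, s) = u s * (expR s * H s).
  have [as_|sa] := ltP a s; last first.
   have z t : K (t, s) = 0.
    rewrite /K /= (bumpy_supp bu) ?mul0r ?if_same ?mulr0//.
    by rewrite negb_and -leNgt sa.
   by rewrite (funext z) /Rintegral integral0 (bumpy_supp bu) ?mul0r// negb_and -leNgt sa.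
  rewrite /H mulrA -RintegralZl//; last by apply: ipq; exact: lt_trans as_.
  congr Rintegral; apply/funext => t; rewrite /K /=.
  have [st|ts] := ltP s t; last by rewrite !mulr0.
  by rewrite (lt_trans as_ st) mulrC.
 split.
  rewrite -(funext e2) -(@Rfubini2 R _ _ _ _ mu mu _ iK) (@Rfubini1 R _ _ _ _ mu mu _ iK).
  by congr Rintegral; apply/funext => t; rewrite e1.
 have [h _] := @cintegr_fubini2 R _ _ _ _ mu mu (fun x => (K x)%:C) (cintegr_real iK).
 by move: h; apply: eq_integrable => // s _ /=; rewrite -e2.
have HE a : 0 < a -> forall s, a <= s -> H s = \int[mu]_t (if a < t then pq t else 0) - primitive (fun t => if a < t then pq t else 0) s.
 move=> a0 s sa; have i1 := ipq _ a0; have i2 := primitive_integrable s i1.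
 rewrite -RintegralB//; apply: ae_eq_Rintegral.
 - by exact: (mfun_integrable (ipq _ (lt_le_trans a0 sa))).
 - by apply: measurable_funB; [have /measurable_EFinP := measurable_int _ i1|have /measurable_EFinP := measurable_int _ i2].
 apply: (ae_imp (aeneq_lebesgue s)) => t ts.
 have [st|] := ltP s t; first by rewrite (le_lt_trans sa st) ltNge (ltW st) subr0.
 by rewrite le_eqVlt (negbTE ts) /= => ->; rewrite subrr.
pose HC a s := \int[mu]_t (if a < t then pq t else 0) - primitive (fun t => if a < t then pq t else 0) s.
have cHC a : 0 < a -> continuous (HC a).
 by move=> a0 s; apply: cvgB; [exact: cvg_cst|exact: primitive_continuous (ipq _ a0) _].
have cE (s : R) : {for s, continuous (@expR R)} by exact: continuous_expR.
have cEN (s : R) : {for s, continuous (fun x : R => expR (- x))}.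
 by apply: continuous_comp; [exact: opp_continuous|exact: continuous_expR].
pose ra a s := 4 * (expR s * HC a s) + 2 * k * expR (- s).
have cra a : 0 < a -> continuous (ra a).
 move=> a0 s; apply: cvgD; apply: cvgM; first exact: cvg_cst.
 - by apply: cvgM; [exact: cE|exact: cHC].
 - exact: cvg_cst.
 - exact: cEN.
have raE a s : 0 < a -> a <= s -> rt s = ra a s by move=> a0 sa; rewrite /rt /ra /HC -HE.
have loc a b : 0 < a -> a < b -> {ae mu, forall t, a < t < b -> r t - rt t = 0}.
 move=> a0 ab.
 have ir : Rintegrable mu (fun t => if a < t < b then r t else 0).
  apply: (le_integrable measurableT _ _ (RintegrableZl (expR b) (rd _ ltr01))) => [|t _].
   by apply/measurable_EFinP; apply: measurable_fun_if => //; [exact: measurable_itvo|exact: measurable_funTS].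
  rewrite /= lee_fin; case: ifP => [/andP[_ tb]|]; last by rewrite normr0.
  rewrite mulrCA normrM -[leLHS]mulr1 ler_wpM2l// -expRD ger0_norm ?expR_ge0//.
  by rewrite mul1r -expR0 ler_expR subr_ge0 ltW.
 have ira : Rintegrable mu (fun t => if a < t < b then ra a t else 0).
  have h : mu.-integrable `[a, b] (EFin \o ra a).
   apply: continuous_compact_integrable; first exact: segment_compact.
   exact: continuous_subspaceT (cra _ a0).
  have h2 : mu.-integrable setT ((EFin \o ra a) \_ `[a, b]).
   by have [h2 _] := @integrable_mkcond _ _ _ mu `[a, b]%classic (EFin \o ra a) (measurable_itv `[a, b]); exact: h2.
  apply: (le_integrable measurableT _ _ h2) => [|t _].
   apply/measurable_EFinP; apply: measurable_fun_if => //; [exact: measurable_itvo|].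
   by apply: measurable_funTS; exact: continuous_measurable_fun (cra _ a0).
  rewrite /= patchE mem_setE in_itv/=; case: ifP => [/andP[/ltW -> /ltW ->]//|_].
  by rewrite normr0; exact: abse_ge0.
 apply: bump_null => //.
  have := integrableB measurableT ir ira; apply: eq_integrable => // t _ /=.
  rewrite -EFinB; congr EFin; case: ifP => [/andP[at_ _]|_]; last by rewrite subrr.
  by rewrite (raE _ _ a0 (ltW at_)).
 move=> a' b' n aa' ab' bb'; set u := bump _ _ _.
 have n0 : 0 < n.+1%:R :> R by rewrite ltr0n.
 have bu : bumpy a' b' u := bump_bumpy n0 ab'.
 have a'0 : 0 < a' := lt_le_trans a0 aa'.
 have [sw isw] := swap _ _ _ a'0 ab' bu.
 have := weak _ _ _ a'0 ab' bu; rewrite sw => w.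
 have iue : Rintegrable mu (fun t => u t * expR (- t)).
  have [h _] := bumpy_cexp_integrable (-1)%:C ab' bu.
  move: h; apply: eq_integrable => // t _ /=; congr EFin.
  by rewrite -rmorphM/= cexp_real mulrN1 -rmorphM.
 have su t : u t != 0 -> a < t < b.
  move=> ut; have [/andP[h1 h2]|] := boolP (a' < t < b').
   by rewrite (le_lt_trans aa' h1) (lt_le_trans h2 bb').
  by move=> /(bumpy_supp bu) u0; rewrite u0 eqxx in ut.
 have iru : Rintegrable mu (fun t => r t * u t).
  apply: (le_integrable measurableT _ _ (integrable_abse ir)) => [|t _].
   by apply/measurable_EFinP; apply: measurable_funM => //; exact: bumpy_measurable bu.
  rewrite /= lee_fin normr_id; have [u0|ut] := eqVneq (u t) 0; first by rewrite u0 mulr0 normr0.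
  rewrite su// normrM ler_piMr// ger0_norm ?bump_ge0 ?bump_le1//.
 have i4 := RintegrableZl 4 isw.
 have i2 := RintegrableZl (2 * k) iue.
 rewrite (_ : (fun t => _) = fun t => r t * u t - (4 * (u t * (expR t * H t)) + 2 * k * (u t * expR (- t)))); last first.
  apply/funext => t; have [u0|ut] := eqVneq (u t) 0; first by rewrite u0; ring.
  by rewrite su// /rt; ring.
 rewrite RintegralB//; last exact: (RintegrableD i4 i2).
 by rewrite (RintegralD measurableT i4 i2) !RintegralZl// w subrr.
have ra_eq : {ae mu, forall t, 0 < t -> r t = rt t}.
 have inv n : 0 < n.+2%:R^-1 :> R by rewrite invr_gt0 ltr0n.
 have lt n : n.+2%:R^-1 < n.+2%:R :> R.
  by apply: (@lt_trans _ _ 1); rewrite ?invf_lt1 ?ltr0n// ltr1n.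
 apply: (ae_imp (ae_foralln (fun n => loc _ _ (inv n) (lt n)))) => t h t0.
 have [n hn] : exists n : nat, t + t^-1 < n%:R.
  by eexists; apply: archi_boundP; rewrite addr_ge0// ?invr_ge0 ltW.
 apply/eqP; rewrite -subr_eq0; apply/eqP; apply: (h n).
 have e : t + t^-1 < n.+2%:R.
  by apply: (lt_le_trans hn); rewrite ler_nat -addn2 leq_addr.
 apply/andP; split.
  rewrite invf_plt ?posrE ?ltr0n//; apply: le_lt_trans e; by rewrite lerDr ltW.
 by apply: le_lt_trans e; rewrite lerDl invr_ge0 ltW.
pose rc T t := if t < T then r t * expR t else 0.
have irc T : Rintegrable mu (rc T).
 apply: (le_integrable measurableT _ _ (RintegrableZl (expR (2 * T)) (rd _ ltr01))) => [|t _].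
  apply/measurable_EFinP; apply: measurable_fun_if => //; [exact: measurable_ltl|].
  by apply: measurable_funTS; apply: measurable_funM => //; exact: measurable_expR.
 rewrite /= lee_fin /rc; case: ifP => tT; last by rewrite normr0.
 rewrite mulrCA !normrM ler_wpM2l// -normrM -expRD !ger0_norm ?expR_ge0// ler_expR; lra.
have PE T s : s <= T -> P s = primitive (rc T) s.
 move=> sT; congr Rintegral; apply/funext => t; rewrite /rc.
 by case: ifP => // ts; rewrite (lt_le_trans ts sT).
have nP s : \forall x \near s, primitive (rc (s + 1)) x = P x.
 near=> x; rewrite (PE (s + 1))//; apply: ltW; near: x.
 by apply: lt_nbhsl; rewrite ltrDl.
have cP : continuous P.
 move=> s; apply: (cvg_trans (near_eq_cvg _)); last first.
  rewrite (PE (s + 1)) ?lerDl//; exact: primitive_continuous (irc _) s.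
 exact: nP.
have cpq s : 0 < s -> {for s, continuous pq}.
 move=> s0; apply: cvgM; last by apply: cvgV; [rewrite gt_eqF|exact: cvg_id].
 apply: cvgM; first exact: cP.
 have h : {for s, continuous (fun x : R => - (2 * x))} by apply: cvgN; apply: cvgM; [exact: cvg_cst|exact: cvg_id].
 exact: (continuous_comp h (@continuous_expR R _)).
have nlt (c s : R) : c < s -> \forall x \near s, c < x by exact: lt_nbhsr.
have dH s : 0 < s -> is_derive s 1 H (- pq s).
 move=> s0; have a0 : 0 < s / 2 by rewrite divr_gt0.
 have as_ : s / 2 < s by rewrite ltr_pdivrMr// ltr_pMr// ltr1n.
 apply: (@near_eq_is_derive _ (HC (s / 2))).
  by near=> x; rewrite (HE (s/2))//; apply: ltW; near: x; exact: nlt.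
 have cG : {for s, continuous (fun t => if s / 2 < t then pq t else 0)}.
  rewrite /prop_for /continuous_at /= as_; apply: (cvg_trans (near_eq_cvg _)); last exact: cpq s0.
  by near=> x; rewrite (_ : s / 2 < x)//; near: x; exact: nlt.
 have dG := primitive_derive (ipq _ a0) cG; rewrite as_ in dG.
 have := is_deriveB (is_derive_cst (\int[mu]_t (if s / 2 < t then pq t else 0)) s 1) dG.
 by rewrite sub0r.
have dP s : 0 < s -> is_derive s 1 P (rt s * expR s).
 move=> s0; have a0 : 0 < s / 2 by rewrite divr_gt0.
 have as_ : s / 2 < s by rewrite ltr_pdivrMr// ltr_pMr// ltr1n.
 pose g t := if t < s + 1 then (if 0 < t then rt t * expR t else 0) else 0.
 have gE : {ae mu, forall t, rc (s + 1) t = g t}.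
  apply: (ae_imp ra_eq) => t h; rewrite /rc /g; case: ifP => // _.
  by case: ltP => [/h ->//|/r0 ->]; rewrite mul0r.
 have mg : measurable_fun [set: R] g.
  have mH : measurable_fun [set: R] (fun t => if 0 < t then rt t else 0).
   apply: (@measurable_fun_cvg _ (measurableTypeR R) _ _ (fun n (t : R) => if n.+1%:R^-1 < t then ra n.+1%:R^-1 t else 0)).
    move=> n; apply: measurable_fun_if => //; first exact: measurable_ltr.
    by apply: measurable_funTS; apply: continuous_measurable_fun; apply: cra; rewrite invr_gt0.
   move=> t _; have [t0|t0] := ltP 0 t; last first.
    rewrite (_ : (fun n => _) = fun=> 0); first exact: cvg_cst.
    apply/funext => n; rewrite ltNge (le_trans t0)//.
   apply: cvg_near_cst; near=> n.
   have h : n.+1%:R^-1 < t by near: n; exact: near_infty_natSinv_lt (PosNum t0).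
   by rewrite h -raE// ltW.
  apply: measurable_fun_if => //; first exact: measurable_ltl.
  apply: measurable_funTS; rewrite (_ : (fun t => _) = fun t => (if 0 < t then rt t else 0) * expR t).
   by apply: measurable_funM => //; exact: measurable_expR.
  by apply/funext => t; case: ifP => // _; rewrite mul0r.
 have ig : Rintegrable mu g.
  have gE' : {ae mu, forall t, (rc (s + 1) t)%:C = (g t)%:C :> R[i]} by apply: (ae_imp gE) => t ->.
  by have [] := @ae_eq_cintegrable R _ _ mu _ _ (cmeas_real mg) gE' (cintegr_real (irc (s + 1))).
 apply: (@near_eq_is_derive _ (primitive g)).
  near=> x; rewrite -(near (nP s) x)//; apply: ae_eq_Rintegral.
  - by exact: (mfun_integrable (primitive_integrable x ig)).
  - by exact: (mfun_integrable (primitive_integrable x (irc (s + 1)))).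
  - by apply: (ae_imp gE) => t ->.
 have gs : g s = rt s * expR s by rewrite /g ltrDl ltr01 s0.
 rewrite -gs; apply: primitive_derive ig _.
 rewrite /prop_for /continuous_at gs (raE _ _ a0 (ltW as_)).
 apply: (cvg_trans (near_eq_cvg _)); last by apply: cvgM; [exact: (cra _ a0)|exact: cE].
 near=> x; have xs : x < s + 1 by near: x; apply: lt_nbhsl; rewrite ltrDl.
 have ax : s / 2 < x by near: x; exact: nlt.
 by rewrite /g xs (lt_trans a0 ax) (raE _ _ a0 (ltW ax)).
have P0 : P 0 = 0.
 have z t : (if t < 0 then r t * expR t else 0) = 0 by case: ifP => // /ltW/r0 ->; rewrite mul0r.
 by rewrite /P /primitive (funext z) /Rintegral integral0.
pose q t := 4 * (expR (2 * t) * H t) + 4 * k.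
have dexp2 t : is_derive t 1 (fun s : R => expR (- 2 * s)) (- 2 * expR (- 2 * t)) := is_derive_expRN2 t.
have [A hA] : exists A, forall t, 0 < t -> q t = A * (1 - 2 * t).
 apply: (ode_solution (P := fun t => P t + 2 * k * t)).
 - move=> t t0; have h := is_deriveZ (2 * k) (@is_derive_id R R t 1).
  apply: (is_derive_eq (is_deriveD (dP _ t0) h)); rewrite /GRing.scale /= /q /rt mulr1.
  have e1 : expR (2 * t) = expR t * expR t by rewrite -expRD; congr expR; ring.
  have e2 : expR (- t) * expR t = 1 by rewrite -expRD addNr expR0.
  by rewrite e1 mulrDl -(mulrA _ (expR (- t))) e2; ring.
 - move=> t t0.
  have e s : 4 * H s + 4 * k * expR (- 2 * s) = expR (- 2 * s) * q s.
   have e1 : expR (- 2 * s) * expR (2 * s) = 1 by rewrite -expRD mulNr addNr expR0.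
   transitivity (expR (- 2 * s) * expR (2 * s) * (4 * H s) + 4 * k * expR (- 2 * s)); first by rewrite e1 mul1r.
   by rewrite /q; ring.
  rewrite -(funext e).
  have h1 := is_deriveZ 4 (dH _ t0); have h2 := is_deriveZ (4 * k) (dexp2 t).
  apply: (is_derive_eq (is_deriveD h1 h2)); rewrite /GRing.scale /= /pq.
  rewrite (_ : - (2 * t) = - 2 * t) ?mulNr//; rewrite -mulNr.
  by field; rewrite gt_eqF.
 - apply: cvg_at_right_filter.
  have h : (fun t : R => P t + 2 * k * t) @ (0 : R) --> P 0 + 2 * k * 0.
   by apply: cvgD; [exact: cP|apply: cvgM; [exact: cvg_cst|exact: cvg_id]].
  by move: h; rewrite P0 mulr0 addr0.
exists A; apply: (ae_imp ra_eq) => t h; case: ltP => [t0|/r0//].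
rewrite (h t0) -(hA t t0) /rt /q.
have e1 : expR (2 * t) = expR t * expR t by rewrite -expRD; congr expR; ring.
have e2 : expR (- t) * expR t = 1 by rewrite -expRD addNr expR0.
rewrite e1; have -> : expR (- t) * (4 * (expR t * expR t * H t) + 4 * k - 2 * k) =
 4 * ((expR (- t) * expR t) * (expR t * H t)) + 2 * k * expR (- t) by ring.
by rewrite e2 mul1r.
Unshelve. all: by end_near. Qed.

End profile.

(** * The kernel is made of combinations of zeta^-1 and zeta^-2 *)

Section kernel_form.
Context {R : realType}.
Notation mu := (@lebesgue_measure R).
Notation R3 := (R * R * R)%type.
Implicit Types (t s : R) (h : R3 -> R[i]).

Lemma pexp_laplace_comb (a b z : R[i]) : Re z <= 0 ->
 laplace (fun t => a * pexp 0 1 t + b * pexp 1 1 t) z = a / (1 - z) + b / (1 - z) ^+ 2.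
Proof.
move=> z0; have i k := pexp_laplace_integrable k (@ltr01 R) z0.
rewrite /laplace (eq_cintegral mu (g := fun t => a * (pexp 0 1 t * cexp (t%:C * z)) + b * (pexp 1 1 t * cexp (t%:C * z)))).
 rewrite (cintegralD (cintegrZl a (i 0%N)) (cintegrZl b (i 1%N))).
 rewrite (cintegralZl a (i 0%N)) (cintegralZl b (i 1%N)).
 by rewrite -!/(laplace _ z) !laplace_pexp// !factS fact0 !mul1r.
by move=> t; rewrite mulrDl !mulrA.
Qed.

(** The equation couples f to conjugates only through the value at -1, so its
 real and imaginary parts can be solved separately. *)
Lemma kernel_component (c : R[i] -> R) (f : R -> R[i]) : (c = @complex.Re R \/ c = @complex.Im R) -> expint f ->
 (forall (a b : R) u, 0 < a -> a < b -> bumpy a b u ->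
  let eta t := (u t)%:C in
  cintegral mu (fun t => f t * eta t) =
  4 * cintegral mu (fun t => conv f (pexp 0 1) t * ((conv eta (pexp 0 1) t)^* / t%:C)) +
  2 * (laplace f (-1) * laplace eta (-1))^*) ->
 exists A, {ae mu, forall t, c (f t) =
  if 0 < t then expR (- t) * (A * (1 - 2 * t) - 2 * c (laplace f (-1))^*) else 0}.
Proof.
move=> cRI ef weak; have [mf f0 fd] := ef.
have cM z (x : R) : c (z * x%:C) = c z * x.
 by case: cRI => ->; case: z => p q /=; rewrite ?mulr0 ?subr0 ?addr0 ?add0r.
have cD z w : c (z + w) = c z + c w by case: cRI => ->; case: z w => p q [].
have c4 (n : nat) z : c (n%:R * z) = n%:R * c z.
 by rewrite mulrC -(rmorph_nat (real_complex R)) cM mulrC.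
have cI g : c (cintegral mu g) = \int[mu]_t (c (g t)) by case: cRI => ->.
have ci g : cintegrable mu g -> Rintegrable mu (fun t => c (g t)) by case: cRI => -> [].
have mc : measurable_fun setT (fun t => c (f t)) by case: cRI => ->; case: mf.
have c0 : c 0 = 0 by case: cRI => ->.
have fd' d : 0 < d -> Rintegrable mu (fun t => c (f t) * expR (- (d * t))).
 by move=> d0; have := ci _ (fd d d0); apply: eq_integrable => // t _ /=; rewrite cM.
have convE t : c (conv f (pexp 0 1) t) = expR (- t) * primitive (fun s => c (f s) * expR s) t.
 rewrite /conv cI /primitive -RintegralZl//; last first.
  apply: (le_integrable measurableT _ _ (RintegrableZl (expR (2 * t)) (fd' _ ltr01))) => [|s _].
   apply/measurable_EFinP; apply: measurable_fun_if => //; [exact: measurable_ltl|].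
   by apply: measurable_funTS; apply: measurable_funM => //; exact: measurable_expR.
  rewrite /= lee_fin; case: ifP => st; last by rewrite normr0.
  rewrite mulrCA !normrM ler_wpM2l// -normrM -expRD !ger0_norm ?expR_ge0// ler_expR; lra.
 congr Rintegral; apply/funext => s; rewrite pexp01E subr_gt0.
 case: ifP => _; last by rewrite !mulr0 c0.
 by rewrite cM mulrCA -expRD opprB addrC.
apply: profile_solution => //.
- by move=> t /f0 ->.
- have e1 : expint (pexp 0 1 : R -> R[i]) by apply: pexp_expint.
 have [_ _ h] := conv_expint ef e1 (@pexp01_le1 R); have := ci _ (h 1 ltr01).
 apply: eq_integrable => // t _ /=; rewrite cM convE; congr EFin.
 have e2 : expR (- (2 * t)) = expR (- t) * expR (- (1 * t)) by rewrite -expRD; congr expR; ring.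
 by rewrite e2; ring.
- move=> a b u a0 ab bu; have := congr1 c (weak a b u a0 ab bu).
 rewrite cI cD !c4 cI => w; rewrite (_ : \int[mu]_t _ = \int[mu]_t (c (f t * (u t)%:C))); last first.
  by congr Rintegral; apply/funext => t; rewrite cM.
 rewrite w; congr (_ * _ + _).
  congr Rintegral; apply/funext => t.
  set x := expR (- t) * primitive (fun s => u s * expR s) t.
  rewrite -(_ : (x / t)%:C = (conv (fun t0 => (u t0)%:C) (pexp 0 1) t)^* / t%:C).
   by rewrite cM convE; congr (_ * _); rewrite mulrC.
  rewrite (conv_bumpyE ab bu) -/x rmorphM fmorphV; congr (_ * _); exact/esym/conjR.
 have -> : laplace (fun t => (u t)%:C) (-1) = (\int[mu]_t (u t * expR (- t)))%:C.
  rewrite /laplace -cintegral_real; apply: eq_cintegral => t.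
  by rewrite mulrN1 -rmorphN cexp_real -rmorphM.
 rewrite -mulrA; congr (_ * _); set I := \int[mu]_t _.
 transitivity (c ((laplace f (-1))^* * I%:C)); last exact: cM.
 by congr c; rewrite mulrC; exact: etrans (conjMR _ _) (mulrC _ _).
Qed.

(** The profile found from the integral equation must reproduce its own value
  at -1, which forces that value to be imaginary. *)
Lemma kernel_form h : KerL h -> exists a b : R[i], Re a + Re b / 2 = 0 /\
 {ae (@muHs R), forall p : R3, h p = a * zi p + b * zi p ^+ 2}.
Proof.
move=> /kernel_weak[f [ef hf] weak].
set g := laplace f (-1).
have [A1 H1] := kernel_component (or_introl erefl) ef weak.
have [A2 H2] := kernel_component (or_intror erefl) ef weak.
rewrite -/g in H1 H2; have [mf _ _] := ef.
pose A : R[i] := A1 +i* A2.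
pose a := A - (g^* + g^*); pose b := - (A + A).
pose F t := a * pexp 0 1 t + b * pexp 1 1 t.
have fF : {ae mu, forall t, f t = F t}.
 apply: (ae_imp (ae_and H1 H2)) => t [h1 h2]; rewrite /F pexp01E /pexp; case: ifP => t0; last first.
  by rewrite !mulr0 addr0; apply: eqcE; rewrite ?h1 ?h2 t0.
 rewrite t0 in h1 h2; apply: eqcE; rewrite ?h1 ?h2 /a /b.
  by rewrite ReD !ReM !ReD !ReN !ReD /= mul1r expr1; ring.
 by rewrite ImD !ImM !ImD !ImN !ImD /= mul1r expr1; ring.
have LF z : Re z <= 0 -> laplace f z = a / (1 - z) + b / (1 - z) ^+ 2.
 move=> z0; rewrite -pexp_laplace_comb//; apply: ae_eq_cintegral.
 - by apply: cmeasM => //; exact: cmeas_cexpX.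
 - apply: cmeasM; last exact: cmeas_cexpX.
  by apply: cmeasD; apply: cmeasM; (exact: cmeas_cst || exact: pexp_measurable).
 - by apply: (ae_imp fF) => t ->.
have gg : g = - g^*.
 have n1 : Re (- 1 : R[i]) <= 0 by rewrite /= oppr_le0.
 rewrite [LHS](LF _ n1) /a /b opprK.
 have t2 : (2 : R[i]) != 0 by rewrite pnatr_eq0.
 rewrite (_ : 1 + 1 = 2 :> R[i])//; field; exact: isT.
have g0 : Re g = 0.
 by have := congr1 (@complex.Re R) gg; rewrite ReN Re_conj; lra.
exists a, b; split.
 rewrite /a /b ReD !ReN !ReD Re_conj g0 /=; by field.
apply: (ae_imp hf) => p ->; rewrite LF ?Re_zc_le0//.
by rewrite /zi exprVn.
Qed.

End kernel_form.

(** * Integration by parts for the sub-Laplacian *)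

Section gradient.
Context {R : realType}.
Notation mu := (@lebesgue_measure R).
Notation R3 := (R * R * R)%type.
Implicit Types (p : R3) (u v a b : H1 R -> R[i]) (i : nat).

Definition line i p t : R3 :=
 match i with 0%N => ((t, p.1.2), p.2) | 1%N => ((p.1.1, t), p.2) | _ => (p.1, t) end.

Definition coord i p : R := match i with 0%N => p.1.1 | 1%N => p.1.2 | _ => p.2 end.

Definition pdiff i : (H1 R -> R[i]) -> H1 R -> R[i] :=
 match i with 0%N => @dx R | 1%N => @dy R | _ => @ds R end.

(** Fubini: it suffices that the integrals along the lines of one direction
 vanish. *)
Lemma cintegral_lines0 i (g : R3 -> R[i]) : cmeasurable g -> rapid3 g ->
 (forall p, cintegral mu (fun t => g (line i p t)) = 0) -> cintegral (@muH R) g = 0.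
Proof.
move=> mg rg; have ig := rapid3_integrable mg rg.
have [M hM] := rg.
have i2 s : cintegrable (@mu2 R) (fun q => g (q, s)).
 have ii := @integrable_prod R _ _ _ _ mu mu _ _ (@integrable_iker R) (@integrable_iker R).
 apply: (cintegr_le (@mu2 R) _ _ _ (RintegrableZl `|M| ii)) => [|q].
  exact: (cmeas_comp mg (measurable_pair2 _)).
 apply: le_trans (hM _) _; rewrite /iker3 /=.
 have k0 (t : R) := ltW (iker_gt0 t).
 apply: (@le_trans _ _ (`|M| * (iker q.1 * iker q.2 * iker s))).
  by rewrite ler_wpM2r ?ler_norm// !mulr_ge0.
 by rewrite ler_wpM2l// ler_piMr ?mulr_ge0// iker_le1.
have z d (S : measurableType d) (m : {measure set S -> \bar R}) (f : S -> R[i]) :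
  (forall x, f x = 0) -> cintegral m f = 0.
 by move=> f0; rewrite (eq_cintegral m f0) cintegral0.
case: i => [|[|i]] h.
- rewrite (@cfubini2 R _ _ _ _ (@mu2 R) mu g ig); apply: (z _ _ _ _) => // s.
 rewrite (@cfubini2 R _ _ _ _ mu mu _ (i2 s)); apply: (z _ _ _ _) => // y; exact: (h ((0, y), s)).
- rewrite (@cfubini2 R _ _ _ _ (@mu2 R) mu g ig); apply: (z _ _ _ _) => // s.
 rewrite (@cfubini1 R _ _ _ _ mu mu _ (i2 s)); apply: (z _ _ _ _) => // x; exact: (h ((x, 0), s)).
- by rewrite (@cfubini1 R _ _ _ _ (@mu2 R) mu g ig); apply: (z _ _ _ _) => // q; exact: (h (q, 0)).
Qed.

(** [du] is the derivative of [u] in the direction [i], with the regularity and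
  decay needed to integrate by parts. *)
Definition sder i u du := [/\ cmeasurable (u : R3 -> R[i]) /\ cmeasurable (du : R3 -> R[i]),
 rapid u, rapid du, forall p, cderiv (fun t => u (line i p t)) (coord i p) (du p) &
 forall p, ccont (fun t => du (line i p t))].

Lemma sder_pdiff i u : cdifferentiable u -> cdifferentiable (pdiff i u) -> rapid u ->
 rapid (pdiff i u) -> sder i u (pdiff i u).
Proof.
move=> du ddu ru rdu; split => //.
- by split; exact: cdifferentiable_measurable.
- case: i {ddu rdu} => [|[|i]] [[x y] s] /=; [exact: cslice_x|exact: cslice_y|exact: cslice_s].
- have [h1 h2 h3] := ccont_slices ddu.
 by case: i {ddu rdu} h1 h2 h3 => [|[|i]] h1 h2 h3 [[x y] s] /=; [exact: h1|exact: h2|exact: h3].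
Qed.

Lemma sder_schwartz i u : schwartz u -> sder i u (pdiff i u).
Proof.
move=> su; have [d0 r0] := schwartzE 0 0 0 su.
have [[dX rX] [dY rY] [dS rS]] := And3 (schwartzE 1 0 0 su) (schwartzE 0 1 0 su) (schwartzE 0 0 1 su).
case: i => [|[|i]].
- exact: (@sder_pdiff 0 u d0 dX r0 rX).
- exact: (@sder_pdiff 1 u d0 dY r0 rY).
- exact: (@sder_pdiff i.+2 u d0 dS r0 rS).
Qed.

Lemma sder_schwartz2 i u : schwartz u -> sder i (pdiff i u) (pdiff i (pdiff i u)).
Proof.
move=> su.
have [[dX rX] [dY rY] [dS rS]] := And3 (schwartzE 1 0 0 su) (schwartzE 0 1 0 su) (schwartzE 0 0 1 su).
have [[eX qX] [eY qY] [eS qS]] := And3 (schwartzE 2 0 0 su) (schwartzE 0 2 0 su) (schwartzE 0 0 2 su).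
case: i => [|[|i]].
- exact: (@sder_pdiff 0 _ dX eX rX qX).
- exact: (@sder_pdiff 1 _ dY eY rY qY).
- exact: (@sder_pdiff i.+2 _ dS eS rS qS).
Qed.

Lemma sder_conj i u du : sder i u du -> sder i (fun p => (u p)^*) (fun p => (du p)^*).
Proof.
move=> [[mu_ mdu] ru rdu h c]; split.
- by split; exact: cmeas_conj.
- by move=> N; have [M hM] := ru N; exists M => p; rewrite normc_conj.
- by move=> N; have [M hM] := rdu N; exists M => p; rewrite normc_conj.
- move=> p; have [h1 h2] := h p; split.
  rewrite Re_conj; have := h1; congr (is_derive _ _ _ _).
  by apply/funext => t; rewrite Re_conj.
 rewrite Im_conj; have := is_deriveN h2; congr (is_derive _ _ _ _).
 by apply/funext => t; rewrite Im_conj.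
- move=> p; have [h1 h2] := c p; split => x.
  by under eq_fun do rewrite Re_conj; exact: h1.
 by under eq_fun do rewrite Im_conj; apply: cvgN; exact: h2.
Qed.

Lemma rapid_rho u : rapid u -> rapid (fun p => (rho2 p)%:C * u p).
Proof.
move=> ru N; have [M hM] := ru N.+1; exists M => p; apply: le_trans (hM p).
have r0 : 0 <= rho2 p by rewrite addr_ge0 ?sqr_ge0.
rewrite normcM normc_real ger0_norm//; set w := 1 + rho2 p + _.
have rw : rho2 p <= w by rewrite /w addrAC lerDr addr_ge0 ?sqr_ge0.
rewrite mulrCA [w ^+ N.+1]exprS -mulrA; apply: ler_wpM2r => //.
by rewrite mulr_ge0 ?normc_ge0// exprn_ge0// (le_trans r0).
Qed.

Lemma cmeas_rho2 : cmeasurable (fun p : R3 => (rho2 (p : H1 R))%:C).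
Proof.
apply: cmeas_real; apply: measurable_funD; apply: measurable_funX.
 by apply: (measurableT_comp measurable_fst); exact: measurable_fst.
by apply: (measurableT_comp measurable_snd); exact: measurable_fst.
Qed.

(** The coefficient of the second derivative in the direction [i] does not
  depend on the [i]-th coordinate, hence commutes with that derivative. *)
Definition weight i p : R := match i with 0%N | 1%N => 4^-1 | _ => rho2 (p : H1 R) end.

Lemma weight_ge0 i p : 0 <= weight i p.
Proof. by case: i => [|[|i]] /=; rewrite ?invr_ge0// addr_ge0 ?sqr_ge0. Qed.

Lemma rapidZ (c : R[i]) u : rapid u -> rapid (fun p => c * u p).
Proof.
move=> ru N; have [M hM] := ru N; exists (normc c * M) => p.
by rewrite normcM mulrCA; apply: ler_wpM2l => //; exact: normc_ge0.
Qed.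

Lemma rapid_weight i u : rapid u -> rapid (fun p => (weight i p)%:C * u p).
Proof. by case: i => [|[|i]]; [exact: (@rapidZ (4^-1)%:C u)|exact: (@rapidZ (4^-1)%:C u)|exact: rapid_rho]. Qed.

Lemma cmeas_weight i : cmeasurable (fun p : R3 => (weight i p)%:C).
Proof. by case: i => [|[|i]]; [exact: (cmeas_cst (4^-1)%:C)|exact: (cmeas_cst (4^-1)%:C)|exact: cmeas_rho2]. Qed.

Lemma weight_line i p t : weight i (line i p t) = weight i p.
Proof. by case: i => [|[|i]]. Qed.

Lemma sder_weight i u du : sder i u du ->
 sder i (fun p => (weight i p)%:C * u p) (fun p => (weight i p)%:C * du p).
Proof.
move=> [[mu_ mdu] ru rdu h c]; split.
- by split; apply: cmeasM => //; exact: cmeas_weight.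
- exact: rapid_weight.
- exact: rapid_weight.
- move=> p; under eq_fun do rewrite weight_line; exact: (cderivZ (weight i p)%:C (h p)).
- move=> p; under eq_fun do rewrite weight_line.
 exact: (ccontM (ccont_cst (weight i p)%:C) (c p)).
Qed.

Lemma rapid_bounded u : rapid u -> exists M, forall p, normc (u p) <= M.
Proof. by move=> /(_ 0%N)[M hM]; exists M => p; have := hM p; rewrite mul1r. Qed.

Lemma rapidM u v : rapid u -> rapid v -> rapid (fun p => u p * v p).
Proof.
move=> ru rv N; have [M hM] := ru N; have [K hK] := rapid_bounded rv; exists (M * K) => p.
rewrite normcM mulrA; apply: ler_pM => //; rewrite ?normc_ge0// mulr_ge0 ?normc_ge0//.
by rewrite exprn_ge0// !addr_ge0 ?sqr_ge0.
Qed.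

Lemma rapid_integrable u : cmeasurable (u : R3 -> R[i]) -> rapid u -> cintegrable (@muH R) u.
Proof. by move=> m_ /rapid_rapid3; exact: rapid3_integrable. Qed.

Lemma iker3_line i p t : iker3 (line i p t) <= iker t.
Proof.
have k0 (x : R) := ltW (iker_gt0 x); have k1 := @iker_le1 R.
rewrite /iker3; case: i => [|[|i]] /=.
- by rewrite -mulrA ler_piMr// mulr_ile1.
- by rewrite mulrAC ler_piMl// mulr_ile1.
- by rewrite ler_piMl// mulr_ile1.
Qed.

Lemma lineK i p t x : line i (line i p t) x = line i p x.
Proof. by case: i => [|[|i]]. Qed.

Lemma coord_line i p t : coord i (line i p t) = t.
Proof. by case: i => [|[|i]]. Qed.

Lemma sder_is_cderive i u du p t : sder i u du ->
 cderiv (fun x => u (line i p x)) t (du (line i p t)).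
Proof.
move=> [_ _ _ h _]; have := h (line i p t); rewrite coord_line.
by under eq_fun do rewrite lineK.
Qed.

Lemma sder_ibp i a da b db : sder i a da -> sder i b db ->
 cintegral (@muH R) (fun p => da p * b p) = - cintegral (@muH R) (fun p => a p * db p).
Proof.
move=> sa sb; have [[ma mda] ra rda ha ca] := sa; have [[mb mdb] rb rdb hb cb] := sb.
have m1 : cmeasurable (fun p : R3 => da p * b p) by exact: cmeasM.
have m2 : cmeasurable (fun p : R3 => a p * db p) by exact: cmeasM.
have i1 := rapid_integrable m1 (rapidM rda rb); have i2 := rapid_integrable m2 (rapidM ra rdb).
apply/eqP; rewrite -addr_eq0 -(cintegralD i1 i2); apply/eqP.
have [M1 h1] := rapid_rapid3 (rapidM rda rb); have [M2 h2] := rapid_rapid3 (rapidM ra rdb).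
have [M0 h0] := rapid_rapid3 (rapidM ra rb).
have k0 (p : R3) := ltW (iker3_gt0 p).
have bd (M : R) p t (x : R[i]) : normc x <= M * iker3 (line i p t) -> normc x <= `|M| * iker t.
 move=> h; apply: (le_trans h); apply: (@le_trans _ _ (`|M| * iker3 (line i p t))).
  by rewrite ler_wpM2r ?ler_norm.
 by rewrite ler_wpM2l// iker3_line.
apply: (cintegral_lines0 (i := i)).
- exact: cmeasD.
- exists (M1 + M2) => p; rewrite mulrDl; apply: le_normcD_trans; exact: lerD.
move=> p; pose F t := a (line i p t) * b (line i p t).
have dF t : cderiv F t (da (line i p t) * b (line i p t) + a (line i p t) * db (line i p t)).
 by apply: cderivM; exact: sder_is_cderive.
have cF : ccont (fun t => da (line i p t) * b (line i p t) + a (line i p t) * db (line i p t)).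
 apply: ccontD; apply: ccontM => //.
  by apply: ccont_is_cderive => t; exact: sder_is_cderive sb.
 by apply: ccont_is_cderive => t; exact: sder_is_cderive sa.
have [l1 l2] := normc_cvg_iker (fun t => bd _ p t (F t) (h0 _)).
apply: (cintegral_derive0 dF cF _ l1 l2).
apply: (cintegr_iker (M := `|M1| + `|M2|)) => [|t]; first exact: ccont_measurable.
rewrite mulrDl; apply: le_normcD_trans; apply: lerD; exact: bd.
Qed.

Definition wpair i (a b : R3 -> R[i]) : R[i] :=
 cintegral (@muH R) (fun p => (weight i p)%:C * a p * b p).

Lemma wpairC i a b : wpair i a b = wpair i b a.
Proof. by apply: eq_cintegral => p; rewrite mulrAC. Qed.

Definition wsq i (a : R3 -> R[i]) : R := Rintegral (@muH R) setT (fun p => weight i p * normc (a p) ^+ 2).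

Lemma wpair_conj i a : wpair i a (fun p => (a p)^*) = (wsq i a)%:C.
Proof.
by rewrite -cintegral_real; apply: eq_cintegral => p; rewrite -mulrA mulc_conj -rmorphM.
Qed.

Lemma wsq_ge0 i a : 0 <= wsq i a.
Proof. by apply: Rintegral_ge0 => p _; rewrite mulr_ge0 ?sqr_ge0// weight_ge0. Qed.

(** The additive form of Cauchy-Schwarz suffices, since the two energies are
 only used when they are bounded. *)
Lemma wpair_bound i a b : cmeasurable (a : R3 -> R[i]) -> cmeasurable (b : R3 -> R[i]) -> rapid a -> rapid b ->
 normc (wpair i a b) <= wsq i a + wsq i b.
Proof.
move=> ma mb ra rb.
have sq (w : R3 -> R[i]) : cmeasurable w -> rapid w ->
  Rintegrable (@muH R) (fun p => weight i p * normc (w p) ^+ 2).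
 move=> mw rw; have m2 : cmeasurable (fun p : R3 => (weight i p)%:C * w p * w p).
  by apply: cmeasM => //; apply: cmeasM => //; exact: cmeas_weight.
 have := integrable_normc (rapid_integrable m2 (rapidM (rapid_weight i rw) rw)).
 apply: eq_integrable => // p _ /=; congr EFin.
 by rewrite !normcM normc_real ger0_norm ?weight_ge0// -mulrA.
have mab : cmeasurable (fun p : R3 => (weight i p)%:C * a p * b p).
 by apply: cmeasM => //; apply: cmeasM => //; exact: cmeas_weight.
have iab := rapid_integrable mab (rapidM (rapid_weight i ra) rb).
apply: le_trans (normc_cintegral iab) _.
rewrite /wsq -(RintegralD measurableT (sq _ ma ra) (sq _ mb rb)).
apply: le_Rintegral => //.
- exact: (integrable_normc iab).
- exact: (RintegrableD (sq _ ma ra) (sq _ mb rb)).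
- move=> p _; rewrite !normcM normc_real ger0_norm ?weight_ge0// -mulrA -mulrDr.
 apply: ler_wpM2l; first exact: weight_ge0.
 move: (normc (a p)) (normc (b p)) (normc_ge0 (a p)) (normc_ge0 (b p)) => x y x0 y0.
 have := sqr_ge0 (x - y); have := mulr_ge0 x0 y0; rewrite sqrrB mulr2n; lra.
Qed.

Lemma cintegralN3 (A B C : R3 -> R[i]) : cintegrable (@muH R) A -> cintegrable (@muH R) B ->
 cintegrable (@muH R) C -> cintegral (@muH R) (fun p => -1 * (A p + B p + C p)) =
 - cintegral (@muH R) A - cintegral (@muH R) B - cintegral (@muH R) C.
Proof.
move=> iA iB iC; have iAB := cintegrD iA iB.
rewrite (cintegralZl _ (cintegrD iAB iC)) (cintegralD iAB iC) (cintegralD iA iB).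
by ring.
Qed.

(** Integration by parts turns the sub-Laplacian into its gradient form. *)
Lemma Lap_ibp u b (db : nat -> R3 -> R[i]) : schwartz u -> (forall i, sder i b (db i)) ->
 cintegral (@muH R) (fun p => - Lap u p * b p) =
 wpair 0 (pdiff 0 u) (db 0%N) + wpair 1 (pdiff 1 u) (db 1%N) + wpair 2 (pdiff 2 u) (db 2%N).
Proof.
move=> su sb; pose A i p := (weight i p)%:C * pdiff i (pdiff i u) p * b p.
have t i := sder_weight (sder_schwartz2 i su).
have iA i : cintegrable (@muH R) (A i).
 have [[_ m1] _ r1 _ _] := t i; have [[m2 _] r2 _ _ _] := sb i.
 by apply: (rapid_integrable _ (rapidM r1 r2)); exact: cmeasM.
have e i : cintegral (@muH R) (A i) = - wpair i (pdiff i u) (db i) := sder_ibp (t i) (sb i).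
transitivity (cintegral (@muH R) (fun p => -1 * (A 0%N p + A 1%N p + A 2%N p))).
 by apply: eq_cintegral => p; rewrite /A /Lap /weight /pdiff; ring.
clearbody A; have h := cintegralN3 (iA 0%N) (iA 1%N) (iA 2%N).
have e0 := e 0%N; have e1 := e 1%N; have e2 := e 2%N.
move: (wpair 0 _ _) (wpair 1 _ _) (wpair 2 _ _) e0 e1 e2 => X Y Z e0 e1 e2.
by apply: (etrans h); rewrite e0 e1 e2 !opprK.
Qed.

(** Both sides are the same gradient form. *)
Lemma Lap_sym u v : schwartz u -> schwartz v ->
 cintegral (@muH R) (fun p => - Lap u p * v p) = cintegral (@muH R) (fun p => - Lap v p * u p).
Proof.
move=> su sv; rewrite (Lap_ibp su (fun i => sder_schwartz i sv)) (Lap_ibp sv (fun i => sder_schwartz i su)).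
by rewrite (wpairC 0) (wpairC 1) (wpairC 2).
Qed.

Definition energy u : R := wsq 0 (pdiff 0 u) + wsq 1 (pdiff 1 u) + wsq 2 (pdiff 2 u).

Lemma energy_ge0 u : 0 <= energy u.
Proof. by rewrite !addr_ge0 ?wsq_ge0. Qed.

Lemma energyE u : schwartz u ->
 cintegral (@muH R) (fun p => - Lap u p * (u p)^*) = (energy u)%:C.
Proof.
move=> su; rewrite (Lap_ibp su (fun i => sder_conj (sder_schwartz i su))).
by rewrite !wpair_conj /energy !rmorphD.
Qed.

Lemma Hdot1_normE u : schwartz u -> Hdot1_norm u = Num.sqrt (energy u).
Proof. by move=> su; rewrite /Hdot1_norm energyE. Qed.

Lemma Lap_bound u v : schwartz u -> schwartz v ->
 normc (cintegral (@muH R) (fun p => - Lap u p * v p)) <= energy u + energy v.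
Proof.
move=> su sv; rewrite (Lap_ibp su (fun i => sder_schwartz i sv)).
have W i : normc (wpair i (pdiff i u) (pdiff i v)) <= wsq i (pdiff i u) + wsq i (pdiff i v).
 have [[_ m1] _ r1 _ _] := sder_schwartz i su; have [[_ m2] _ r2 _ _] := sder_schwartz i sv.
 exact: wpair_bound.
apply: le_normcD_trans; apply: (@le_trans _ _ (_ + _)).
 by apply: lerD; [exact: le_normcD|exact: lexx].
have H (x y z a b c a' b' c' : R) : x <= a + a' -> y <= b + b' -> z <= c + c' ->
 x + y + z <= a + b + c + (a' + b' + c') by lra.
exact: (H _ _ _ _ _ _ _ _ _ (W 0%N) (W 1%N) (W 2%N)).
Qed.

End gradient.

(** * Schwartz approximants *)

Section approx.
Context {R : realType}.
Notation mu := (@lebesgue_measure R).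
Notation R3 := (R * R * R)%type.
Implicit Types (p : R3) (z : R[i]) (n k : nat) (r : R).
Variables (a b : R) (u : R -> R).
Hypotheses (a0 : 0 <= a) (ab : a < b) (bu : bumpy a b u) (u1 : \int[mu]_t (u t) = 1).

Let rr n : R := n.+1%:R^-1.
Let rr0 n : 0 < rr n. Proof. by rewrite invr_gt0. Qed.
Let rr1 n : rr n <= 1. Proof. by rewrite invf_le1// ler1n. Qed.
Let tu := fun t => t * u t.
Let btu : bumpy a b tu := bumpy_mulX bu.

(** The second bound trades a factor r for a power of zeta: r |1 - z| is at most
 1 + r |z|, which the decay of the transform absorbs. *)
Lemma hfun_bound k f : bumpy a b f -> exists2 C, 0 <= C & forall r p, 0 < r -> r <= 1 ->
 normc (hfun k f r (zc 1 p)) <= C * normc (zi p) ^+ k /\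
 r * normc (hfun k f r (zc 1 p)) <= C * normc (zi p) ^+ k.+1.
Proof.
move=> bf; have [C hC] := blaplace_weight 1 a0 ab bf.
have C0 : 0 <= C.
 apply: le_trans (hC 0 (lexx _)); rewrite mulr_ge0 ?normc_ge0// exprn_ge0// addr_ge0 ?normc_ge0//.
exists C => // r p r0 r1; set z := zc 1 p.
have z0 : Re z <= 0 := Re_zc_le0 1 p.
have rz : Re (r%:C * z) <= 0 by rewrite ReCM mulr_ge0_le0// ltW.
have := hC _ rz; rewrite expr1; set B := normc (blaplace _ _); set m := normc (r%:C * z) => h.
have B0 : 0 <= B by exact: normc_ge0.
have m0 : 0 <= m by exact: normc_ge0.
have zE : normc (zi p) = normc (1 - z)^-1 by [].
have q0 : 0 <= normc (zi p) ^+ k by rewrite exprn_ge0 ?normc_ge0.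
have nE : normc (hfun k f r z) = normc (zi p) ^+ k * B by rewrite /hfun normcM normcX.
split.
 rewrite nE mulrC; apply: ler_wpM2r => //; apply: le_trans h.
 by rewrite mulrDl mul1r lerDl mulr_ge0.
rewrite nE exprSr mulrCA mulrA [C * _]mulrC -mulrA; rewrite -mulrA.
apply: ler_wpM2l => //.
have n1 : 0 < normc (1 - z) by rewrite normc_gt0 neq_1B.
rewrite zE normcV ler_pdivlMl// mulrA; apply: le_trans h; apply: ler_wpM2r => //.
rewrite mulrC; apply: (@le_trans _ _ (r * (1 + normc z))).
 by rewrite ler_wpM2l ?(ltW r0)//; apply: normcB_trans; rewrite normc1.
by rewrite mulrDr mulr1 /m normcM normc_real (gtr0_norm r0) lerD2r.
Qed.

Let bl n p : R := normc (blaplace u ((rr n)%:C * zc 1 p) - 1).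

Lemma bl_cvg p : bl n p @[n --> \oo] --> (0 : R).
Proof.
have [K hK] := hol_blaplace a0 ab bu (lexx (0 : R) : Re (0 : R[i]) <= 0).
have b0 : blaplace u 0 = 1.
 rewrite /blaplace /laplace (eq_cintegral mu (g := fun t => (u t)%:C)) ?cintegral_real ?u1//.
 by move=> t; rewrite mulr0 cexp0 mulr1.
set c := normc (blaplace (fun t => t * u t) 0) in hK.
pose N := normc (zc 1 p).
have w n : normc ((rr n)%:C * zc 1 p) = rr n * N by rewrite normcM normc_real gtr0_norm.
have cv : (fun n => rr n * N * (c + `|K| * (rr n * N))) @ \oo --> (0 : R).
 have h : (fun n => rr n * N) @ \oo --> (0 : R).
  by rewrite -[X in _ --> X](mul0r N); apply: cvgM; [exact: cvg_harmonic|exact: cvg_cst].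
 rewrite -[X in _ --> X](mul0r (c + `|K| * 0)); apply: cvgM => //.
 by apply: cvgD; [exact: cvg_cst|apply: cvgM; [exact: cvg_cst|]].
apply: (@squeeze_cvgr _ _ _ _ (fun=> 0) (fun n => rr n * N * (c + `|K| * (rr n * N)))) => //; last exact: cvg_cst.
have sm : \forall n \near \oo, rr n * N <= 1.
 have h : (fun n => rr n * N) @ \oo --> (0 : R).
  by rewrite -[X in _ --> X](mul0r N); apply: cvgM; [exact: cvg_harmonic|exact: cvg_cst].
 by have /cvgr_lt/(_ 1 ltr01) := h; apply: filterS => n /ltW.
near=> n; rewrite normc_ge0 /=.
have rz : Re (0 + (rr n)%:C * zc 1 p) <= 0.
 by rewrite add0r ReCM mulr_ge0_le0 ?Re_zc_le0// ltW.
have ws : normc ((rr n)%:C * zc 1 p) <= 1 by rewrite w; near: n.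
have := hK _ rz ws; rewrite add0r b0 w => h.
set B := blaplace u _ in h *; set W := _ * _ in h.
have nW : normc W = rr n * N * c by rewrite /W normcM w.
rewrite /bl -/B (_ : B - 1 = (B - 1 - W) + W); last by ring.
apply: le_normcD_trans; rewrite nW mulrDr addrC; apply: lerD => //.
apply: le_trans h _; have x0 : 0 <= rr n * N by rewrite mulr_ge0 ?normc_ge0// ltW.
move: (rr n * N) x0 => x x0; rewrite expr2 [leRHS]mulrCA.
by apply: ler_wpM2r; [exact: mulr_ge0|exact: ler_norm].
Unshelve. all: by end_near. Qed.

Variables (al be : R[i]).

(** The truncation of a/zeta + b/zeta^2 by the transform of a bump of mass 1,
 dilated by r = 1/(n+1): it is Schwartz, and tends to the function itself as
 r tends to 0. Its sub-Laplacian is minus its complex derivative [dapp]. *)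
Definition app n z := al * hfun 1 u (rr n) z + be * hfun 2 u (rr n) z.

Definition dapp n z := al * (1%:R * hfun 2 u (rr n) z + (rr n)%:C * hfun 1 tu (rr n) z) +
 be * (2%:R * hfun 3 u (rr n) z + (rr n)%:C * hfun 2 tu (rr n) z).

Lemma hol_app n : hol (app n) (dapp n).
Proof. by apply: holD; apply: holZ; exact: (hol_hfun _ a0 ab bu (ltW (rr0 n)) (rr1 n)). Qed.

Lemma hol_dapp n : exists D, hol (dapp n) D.
Proof.
have H k f (bf : bumpy a b f) := hol_hfun k a0 ab bf (ltW (rr0 n)) (rr1 n).
eexists; apply: holD; apply: holZ; apply: holD; apply: holZ; [exact: H|exact: H|exact: H|exact: H].
Qed.

Definition apx n (p : H1 R) := app n (zc 1 p).

Lemma cspan_apx n : cspan (hgen a b 1) (apx n).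
Proof.
apply: cspan_add; apply: cspan_scale; apply: cspan_gen; exact: (hgen_hfun _ _ bu (rr0 n) (rr1 n)).
Qed.

Lemma schwartz_apx n : schwartz (apx n).
Proof. exact: (schwartz_hspan a0 ab (expr1n _ _) (cspan_apx n)). Qed.

Lemma Lap_apx n p : - Lap (apx n) p = dapp n (zc 1 p).
Proof. by have [D hD] := hol_dapp n; rewrite (Lap_hol p (expr1n _ _) (hol_app n) hD). Qed.

Lemma schwartz_apxB n m : schwartz (fun p => apx n p - apx m p).
Proof.
have := cspan_add (cspan_apx n) (cspan_scale (-1) (cspan_apx m)).
move=> /(schwartz_hspan a0 ab (expr1n _ _)); congr schwartz; apply/funext => p; by rewrite mulN1r.
Qed.

Lemma Lap_apxB n m p : - Lap (fun p => apx n p - apx m p) p = dapp n (zc 1 p) - dapp m (zc 1 p).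
Proof.
have [D hD] := hol_dapp n; have [E hE] := hol_dapp m.
have := Lap_hol p (expr1n _ _) (holD (hol_app n) (holZ (-1) (hol_app m))) (holD hD (holZ (-1) hE)).
by rewrite mulN1r => <-; congr (- Lap _ p); apply/funext => q; rewrite mulN1r.
Qed.

Let n2 : normc (2%:R : R[i]) = 2.
Proof. by rewrite -(rmorph_nat (real_complex R)) normc_real ger0_norm. Qed.

Lemma apx_bound : exists2 C, 0 <= C & forall n p, normc (apx n p) <= C * normc (zi p) /\
 normc (dapp n (zc 1 p)) <= C * normc (zi p) ^+ 2.
Proof.
have [C1 c1 h1] := hfun_bound 1 bu; have [C2 c2 h2] := hfun_bound 2 bu.
have [C3 c3 h3] := hfun_bound 3 bu; have [D1 d1 g1] := hfun_bound 1 btu.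
have [D2 d2 g2] := hfun_bound 2 btu.
have A0 := normc_ge0 al; have B0 := normc_ge0 be.
exists (normc al * C1 + normc be * C2 + normc al * (C2 + D1) + normc be * (2 * C3 + D2)).
 by rewrite !addr_ge0 ?mulr_ge0// !addr_ge0// mulr_ge0.
move=> n p; have z0 := normc_ge0 (zi p); have z1 := normc_zi_le1 p.
have z2 : normc (zi p) ^+ 2 <= normc (zi p) by rewrite expr2 ler_piMr.
have z3 : normc (zi p) ^+ 3 <= normc (zi p) ^+ 2 by rewrite exprSr ler_piMr// exprn_ge0.
have [e1 _] := h1 _ p (rr0 n) (rr1 n); have [e2 _] := h2 _ p (rr0 n) (rr1 n).
have [e3 _] := h3 _ p (rr0 n) (rr1 n); have [_ e4] := g1 _ p (rr0 n) (rr1 n).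
have [_ e5] := g2 _ p (rr0 n) (rr1 n).
rewrite expr1 in e1.
have ee2 := le_trans e2 (ler_wpM2l c2 z2); have ee3 := le_trans e3 (ler_wpM2l c3 z3).
have ee5 := le_trans e5 (ler_wpM2l d2 z3).
have r0 := ltW (rr0 n).
split.
 rewrite /apx /app; apply: le_normcD_trans; rewrite (normcM al) (normcM be).
 move: (ler_wpM2l A0 e1) (ler_wpM2l B0 ee2) => x1 x2.
 apply: (@le_trans _ _ ((normc al * C1 + normc be * C2) * normc (zi p))).
  by rewrite [leRHS]mulrDl -(mulrA (normc al)) -(mulrA (normc be)); exact: lerD.
 by apply: ler_wpM2r => //; rewrite -addrA lerDl addr_ge0 ?mulr_ge0 ?addr_ge0// mulr_ge0.
rewrite /dapp; apply: le_normcD_trans; rewrite (normcM al) (normcM be).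
apply: (@le_trans _ _ ((normc al * (C2 + D1) + normc be * (2 * C3 + D2)) * normc (zi p) ^+ 2)).
 rewrite [leRHS]mulrDl -(mulrA (normc al)) -(mulrA (normc be)); apply: lerD.
  apply: ler_wpM2l => //; apply: le_normcD_trans.
  rewrite [leRHS]mulrDl mul1r (normcM (rr n)%:C) normc_real (ger0_norm r0); exact: lerD.
 apply: ler_wpM2l => //; apply: le_normcD_trans.
 rewrite [leRHS]mulrDl (normcM 2%:R) (normcM (rr n)%:C) normc_real (ger0_norm r0) n2 -(mulrA 2 C3).
 by apply: lerD => //; apply: ler_wpM2l.
apply: ler_wpM2r; first by rewrite exprn_ge0.
by rewrite -addrA lerDr addr_ge0// mulr_ge0.
Qed.

Lemma apx_cvg p : normc (apx n p - (al * zi p + be * zi p ^+ 2)) @[n --> \oo] --> (0 : R) /\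
 normc (dapp n (zc 1 p) - (al * zi p ^+ 2 + 2%:R * be * zi p ^+ 3)) @[n --> \oo] --> (0 : R).
Proof.
have [C1 c1 h1] := hfun_bound 1 btu; have [C2 c2 h2] := hfun_bound 2 btu.
have A0 := normc_ge0 al; have B0 := normc_ge0 be.
have z1 k : normc (zi p) ^+ k <= 1 by rewrite exprn_ile1 ?normc_ge0// normc_zi_le1.
have hb n k : hfun k u (rr n) (zc 1 p) - zi p ^+ k = zi p ^+ k * (blaplace u ((rr n)%:C * zc 1 p) - 1).
 by rewrite /hfun mulrBr mulr1.
have hn n k : normc (hfun k u (rr n) (zc 1 p) - zi p ^+ k) <= bl n p.
 by rewrite hb (normcM (zi p ^+ k)) normcX ler_piMl// normc_ge0.
have r0 n := ltW (rr0 n).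
have hr n k f C : (forall r p, 0 < r -> r <= 1 -> normc (hfun k f r (zc 1 p)) <= C * normc (zi p) ^+ k /\
 r * normc (hfun k f r (zc 1 p)) <= C * normc (zi p) ^+ k.+1) -> 0 <= C ->
  normc ((rr n)%:C * hfun k f (rr n) (zc 1 p)) <= rr n * C.
 move=> h C0; have [e _] := h _ p (rr0 n) (rr1 n); rewrite (normcM (rr n)%:C) normc_real (ger0_norm (r0 n)).
 by apply: ler_wpM2l => //; apply: (le_trans e); rewrite ler_piMr.
have ch : rr n @[n --> \oo] --> (0 : R) by exact: cvg_harmonic.
have cb := bl_cvg p.
split.
- apply: (@squeeze0 R _ (fun n => (normc al + normc be) * bl n p)).
  move=> n; rewrite normc_ge0 /=.
  rewrite (_ : apx n p - _ = al * (hfun 1 u (rr n) (zc 1 p) - zi p ^+ 1) + be * (hfun 2 u (rr n) (zc 1 p) - zi p ^+ 2)); last first.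
   by rewrite /apx /app expr1; ring.
  apply: le_normcD_trans; rewrite (normcM al) (normcM be) mulrDl.
  by apply: lerD; apply: ler_wpM2l => //; exact: hn.
 by rewrite -[X in _ --> X](mulr0 (normc al + normc be)); apply: cvgM => //; exact: cvg_cst.
- apply: (@squeeze0 R _ (fun n => normc al * (bl n p + rr n * C1) + normc be * (2 * bl n p + rr n * C2))).
  move=> n; rewrite normc_ge0 /=.
  rewrite (_ : dapp n _ - _ = al * ((hfun 2 u (rr n) (zc 1 p) - zi p ^+ 2) + (rr n)%:C * hfun 1 tu (rr n) (zc 1 p)) +
    be * (2%:R * (hfun 3 u (rr n) (zc 1 p) - zi p ^+ 3) + (rr n)%:C * hfun 2 tu (rr n) (zc 1 p))); last first.
   by rewrite /dapp; ring.
  apply: le_normcD_trans; rewrite (normcM al) (normcM be).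
  apply: lerD; apply: ler_wpM2l => //; apply: le_normcD_trans; apply: lerD.
  - exact: hn.
  - exact: hr.
  - by rewrite (normcM 2%:R) n2; apply: ler_wpM2l => //; exact: hn.
  - exact: hr.
 have c0 (c : R) : rr n * c @[n --> \oo] --> (0 : R).
  by rewrite -[X in _ --> X](mul0r c); apply: cvgM => //; exact: cvg_cst.
 have -> : (0 : R) = normc al * (0 + 0) + normc be * (2 * 0 + 0) by rewrite !(mulr0, addr0).
 by apply: cvgD; apply: cvgM; [exact: cvg_cst|apply: cvgD|exact: cvg_cst|
  apply: cvgD => //; apply: cvgM => //; exact: cvg_cst].
Qed.

End approx.

Section zi_energy.
Context {R : realType}.
Notation mu := (@lebesgue_measure R).
Notation R3 := (R * R * R)%type.
Implicit Types (p : R3) (phi : H1 R -> R[i]).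

(** Otherwise all bumps would have integral 0, and the indicator of ]0, 1[ would
 vanish almost everywhere. *)
Lemma unit_bump : exists a b (u : R -> R), [/\ 0 <= a, a < b, bumpy a b u & \int[mu]_t (u t) = 1].
Proof.
apply: contrapT => H.
have Z (a b : R) (n : nat) : 0 <= a -> a < b -> \int[mu]_t (bump a b n.+1%:R t) = 0.
 move=> a0 ab; apply/eqP; apply/negPn/negP => I0; apply: H.
 have bu : bumpy a b (bump a b n.+1%:R) by apply: bump_bumpy.
 set I := Rintegral _ _ _ in I0; exists a, b, (fun t => I^-1 * bump a b n.+1%:R t); split => //.
  exact: bumpyZ.
 rewrite RintegralZl ?mulVf//; have [h _] := bumpy_cexp_integrable 0 ab bu.
 by move: h; apply: eq_integrable => // t _ /=; rewrite mulr0 cexp0 mulr1.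
have i1 : Rintegrable mu (fun t : R => if 0 < t < 1 then 1 else 0 : R).
 apply: (le_integrable measurableT _ _ (RintegrableZl 2 (@integrable_iker R))) => [|t _].
  by apply/measurable_EFinP; apply: measurable_fun_if => //; exact: measurable_itvo.
 rewrite /= lee_fin [leRHS]ger0_norm ?mulr_ge0 ?(ltW (iker_gt0 t))//.
 case: ifP => [/andP[t0 t1]|_]; last by rewrite normr0 mulr_ge0// ltW// iker_gt0.
 rewrite normr1 /iker ler_pdivlMr ?mul1r; last by rewrite ltr_wpDr ?sqr_ge0.
 by rewrite -[2]/(1 + 1) lerD2l exprn_ile1// ltW.
have := @bump_null R (fun=> 1) 0 1 ltr01 i1.
have -> : (forall a' b' n, 0 <= a' -> a' < b' -> b' <= 1 ->
  \int[mu]_t ((if 0 < t < 1 then 1 else 0) * bump a' b' n.+1%:R t) = 0) <-> True.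
 split => // _ a b n a0 ab b1; rewrite -[RHS](Z a b n a0 ab); congr Rintegral; apply/funext => t.
 case: ifP => [_|/negbT h]; first by rewrite mul1r.
 rewrite mul0r (bumpy_supp (bump_bumpy (ltr0Sn _ n) ab))//.
 apply: contra h => /andP[h1 h2]; by rewrite (le_lt_trans a0 h1) (lt_le_trans h2 b1).
move=> /(_ I)[N [mN N0 hN]].
have mi : measurable (`]0, 1[%classic : set (measurableTypeR R)) by exact: measurable_itv.
have sub : (`]0, 1[%classic : set R) `<=` N.
 by move=> t; rewrite /= in_itv/= => h; apply: hN => /= /(_ h)/eqP; rewrite oner_eq0.
have := le_measure mu (mem_set mi) (mem_set mN) sub.
have e1 : mu `]0, 1[%classic = 1%:E.
 by have := lebesgue_measure_itv (`]0, 1[ : interval R); rewrite /= lte_fin ltr01 oppr0 adde0 => <-.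
by rewrite [X in (X <= _)%E]e1 [X in (_ <= X)%E]N0 lee_fin ler10.
Qed.

Lemma schwartz_Lap phi : schwartz phi -> cmeasurable (fun p : R3 => - Lap phi p) /\ cintegrable (@muH R) (fun p => - Lap phi p).
Proof.
move=> sp; pose A i (p : R3) := (weight i p)%:C * pdiff i (pdiff i phi) p.
have iA i : cintegrable (@muH R) (A i).
 have [[_ m1] _ r1 _ _] := sder_weight (sder_schwartz2 i sp); exact: rapid_integrable.
have e : (fun p : R3 => - Lap phi p) = fun p => -1 * (A 0%N p + A 1%N p + A 2%N p).
 by apply/funext => p; rewrite /A /Lap /weight /pdiff; ring.
have h : cintegrable (@muH R) (fun p => - Lap phi p).
 by rewrite e; apply: cintegrZl; apply: cintegrD; [apply: cintegrD|]; exact: iA.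
by split => //; exact: cintegr_measurable h.
Qed.

Lemma bounded_mul_integrable (B f : R3 -> R[i]) K : cmeasurable B -> (forall p, normc (B p) <= K) ->
 cintegrable (@muH R) f -> cintegrable (@muH R) (fun p => B p * f p).
Proof.
move=> mB hB jf; have mf := cintegr_measurable jf.
apply: (cintegr_le (@muH R) _ _ _ (RintegrableZl K (integrable_normc jf))) => [|p].
 exact: cmeasM.
by rewrite normcM; apply: ler_wpM2r => //; exact: normc_ge0.
Qed.

Variables (al be : R[i]).
Let H p : R[i] := al * zi p + be * zi p ^+ 2.
Let D p : R[i] := al * zi p ^+ 2 + 2%:R * be * zi p ^+ 3.

Let zX k := cmeasX k (@zi_measurable R).

Let mH : cmeasurable H.
Proof.
by apply: cmeasD; apply: cmeasM; [exact: cmeas_cst|exact: zi_measurable|exact: cmeas_cst|exact: zX].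
Qed.

Let mD : cmeasurable D.
Proof.
by apply: cmeasD; apply: cmeasM; [exact: cmeas_cst|exact: zX|exact: cmeas_cst|exact: zX].
Qed.

Lemma comb_bound : exists2 C, 0 <= C & forall p, normc (H p) <= C * normc (zi p) /\ normc (D p) <= C * normc (zi p) ^+ 2.
Proof.
have A0 := normc_ge0 al; have B0 := normc_ge0 (2%:R * be); have b0 := normc_ge0 be.
exists (normc al + normc (2%:R * be) + normc be); first by rewrite !addr_ge0.
move=> p; have z0 := normc_ge0 (zi p); have z1 := normc_zi_le1 p; split.
 apply: le_normcD_trans; rewrite (normcM al) (normcM be) normcX.
 have h : normc be * normc (zi p) ^+ 2 <= normc be * normc (zi p) by apply: ler_wpM2l => //; rewrite expr2 ler_piMr.
 apply: le_trans (lerD (lexx _) h) _; rewrite -mulrDl; apply: ler_wpM2r => //.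
 by rewrite addrAC lerDl.
apply: le_normcD_trans; rewrite (normcM al) (normcM (2%:R * be)) !normcX.
have h : normc (2%:R * be) * normc (zi p) ^+ 3 <= normc (2%:R * be) * normc (zi p) ^+ 2.
 by apply: ler_wpM2l => //; rewrite exprSr ler_piMr// exprn_ge0.
apply: le_trans (lerD (lexx _) h) _; rewrite -mulrDl; apply: ler_wpM2r; rewrite ?exprn_ge0//.
by rewrite lerDl.
Qed.

Let approximants : exists ap dp : nat -> R3 -> R[i], exists2 C, 0 <= C &
 [/\ forall n, schwartz (ap n : H1 R -> R[i]) /\ (forall p, - Lap (ap n : H1 R -> R[i]) p = dp n p),
   forall n m, schwartz (fun p : H1 R => ap n p - ap m p) /\
    (forall p : H1 R, - Lap (fun p : H1 R => ap n p - ap m p) p = dp n p - dp m p),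
   forall n p, normc (ap n p) <= C * normc (zi p) /\ normc (dp n p) <= C * normc (zi p) ^+ 2 &
   (forall p, normc (ap n p - H p) @[n --> \oo] --> (0 : R)) /\
   (forall p, normc (dp n p - D p) @[n --> \oo] --> (0 : R))].
Proof.
have [a [b [u [a0 ab bu u1]]]] := unit_bump.
have [C C0 hC] := apx_bound a0 ab bu al be.
exists (apx u al be), (fun n p => dapp u al be n (zc 1 p)), C => //; split.
- by move=> n; split; [exact: (schwartz_apx a0 ab bu)|move=> p; exact: (Lap_apx a0 ab bu)].
- by move=> n m; split; [exact: (schwartz_apxB a0 ab bu)|move=> p; exact: (Lap_apxB a0 ab bu)].
- exact: hC.
- by split => p; have [] := apx_cvg a0 ab bu u1 al be p.
Qed.

Let dp_measurable (w : R3 -> R[i]) (v : H1 R -> R[i]) : schwartz v -> (forall p, - Lap v p = w p) -> cmeasurable w.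
Proof. by move=> sv e; have [h _] := schwartz_Lap sv; move: h; rewrite (funext e). Qed.

Let zb k p : normc (zi p) ^+ k <= 1.
Proof. by rewrite exprn_ile1 ?normc_ge0// normc_zi_le1. Qed.

(** The symmetry of the sub-Laplacian passes from the approximants to the
 limit by dominated convergence. *)
Lemma Lap_comb phi : schwartz phi ->
 cintegral (@muH R) (fun p => H p * - Lap phi p) = cintegral (@muH R) (fun p => D p * phi p).
Proof.
move=> sp; have [ap [dp [C C0 [h1 _ h3 [h4 h5]]]]] := approximants.
have [C' C'0 hC'] := comb_bound.
have [mL iL] := schwartz_Lap sp; have iphi := schwartz_integrable sp; have mphi := schwartz_measurable sp.
have map_ n : cmeasurable (ap n) by have [s _] := h1 n; exact: schwartz_measurable.
have mdp n : cmeasurable (dp n) by have [s e] := h1 n; exact: dp_measurable s e.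
have bz (K x : R) k p : 0 <= K -> x <= K * normc (zi p) ^+ k -> x <= K.
 by move=> K0 h; apply: (le_trans h); rewrite ler_piMr.
have bap n p : normc (ap n p) <= C by have [e _] := h3 n p; apply: (bz _ _ 1%N p C0); rewrite expr1.
have bdp n p : normc (dp n p) <= C by have [_ e] := h3 n p; apply: (bz _ _ 2%N p C0).
have bH p : normc (H p) <= C' by have [e _] := hC' p; apply: (bz _ _ 1%N p C'0); rewrite expr1.
have bD p : normc (D p) <= C' by have [_ e] := hC' p; apply: (bz _ _ 2%N p C'0).
have iHL := bounded_mul_integrable mH bH iL.
have iDp := bounded_mul_integrable mD bD iphi.
have i1 n := bounded_mul_integrable (map_ n) (bap n) iL.
have i2 n := bounded_mul_integrable (mdp n) (bdp n) iphi.
apply/eqP; rewrite -subr_eq0 -(cintegralB iHL iDp); apply/eqP.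
have ig := RintegrableD (RintegrableZl C (integrable_normc iL)) (RintegrableZl C (integrable_normc iphi)).
apply: (@cintegral_dct R _ _ (@muH R) (fun n p => ap n p * - Lap phi p - dp n p * phi p) _ _ 0
  (fun n => cintegrB (i1 n) (i2 n)) (cintegrB iHL iDp) ig).
- move=> n p; apply: normcB_trans; rewrite (normcM (ap n p)) (normcM (dp n p)).
 by apply: lerD; apply: ler_wpM2r; rewrite ?normc_ge0.
- move=> p; apply: (@squeeze0 R _ (fun n => normc (ap n p - H p) * normc (- Lap phi p) + normc (dp n p - D p) * normc (phi p))).
  move=> n; rewrite normc_ge0 /= -(normcM (ap n p - H p)) -(normcM (dp n p - D p)).
  rewrite [X in normc X <= _](_ : _ = (ap n p - H p) * - Lap phi p - (dp n p - D p) * phi p); last by ring.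
  exact: normcB.
 rewrite -[X in _ --> X](addr0 0) -[X in X + _](mul0r (normc (- Lap phi p))) -[X in _ + X](mul0r (normc (phi p))).
 by apply: cvgD; apply: cvgM; [exact: h4|exact: cvg_cst|exact: h5|exact: cvg_cst].
- rewrite (_ : (fun n => _) = fun=> 0); first exact: cvg_cst.
 apply/funext => n; rewrite (cintegralB (i1 n) (i2 n)).
 have [s e] := h1 n.
 have e1 : cintegral (@muH R) (fun p => dp n p * phi p) = cintegral (@muH R) (fun p => - Lap (ap n : H1 R -> R[i]) p * phi p).
  by apply: eq_cintegral => p; rewrite e.
 have e2 : cintegral (@muH R) (fun p => - Lap phi p * ap n p) = cintegral (@muH R) (fun p => ap n p * - Lap phi p).
  by apply: eq_cintegral => p; exact: mulrC.
 by rewrite e1 (Lap_sym s sp) e2 subrr subr0 normc0.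
Qed.

Let dist n (ap : nat -> R3 -> R[i]) : R := Rintegral (@muH R) setT (fun p => normc (zi p) ^+ 2 * normc (ap n p - H p)).

(** By the energy identity the approximants of [D], being images of Schwartz
 functions of bounded energy, are uniformly bounded on the unit ball. *)
Lemma comb_dual : exists K, forall phi, schwartz phi -> energy phi <= 1 ->
 normc (cintegral (@muH R) (fun p => D p * phi p)) <= K.
Proof.
have [ap [dp [C C0 [h1 _ h3 [_ h5]]]]] := approximants.
have [C' C'0 hC'] := comb_bound.
pose K0 := Rintegral (@muH R) setT (fun p => C ^+ 2 * normc (zi p) ^+ 3).
have iK := RintegrableZl (C ^+ 2) (@integrable_zi3 R).
have map_ n : cmeasurable (ap n) by have [s _] := h1 n; exact: schwartz_measurable.
have mdp n : cmeasurable (dp n) by have [s e] := h1 n; exact: dp_measurable s e.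
have bz (K x : R) k p : 0 <= K -> x <= K * normc (zi p) ^+ k -> x <= K.
 by move=> K0' h; apply: (le_trans h); rewrite ler_piMr.
have bdp n p : normc (dp n p) <= C by have [_ e] := h3 n p; apply: (bz _ _ 2%N p C0).
have bD p : normc (D p) <= C' by have [_ e] := hC' p; apply: (bz _ _ 2%N p C'0).
have en n : energy (ap n : H1 R -> R[i]) <= K0.
 have [s e] := h1 n; have E := energyE s.
 have mw : cmeasurable (fun p : R3 => - Lap (ap n : H1 R -> R[i]) p * (ap n p)^*).
  by have [m1 _] := schwartz_Lap s; apply: cmeasM => //; exact: cmeas_conj.
 have bw p : normc (- Lap (ap n : H1 R -> R[i]) p * (ap n p)^*) <= C ^+ 2 * normc (zi p) ^+ 3.
  rewrite normcM normc_conj e; have [x1 x2] := h3 n p.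
  apply: le_trans (ler_pM (normc_ge0 _) (normc_ge0 _) x2 x1) _.
  by rewrite mulrACA -expr2 -exprSr.
 have iw := cintegr_le (@muH R) _ _ mw iK bw.
 have := normc_cintegral iw; rewrite E normc_real (ger0_norm (energy_ge0 _)) => h.
 apply: (le_trans h); apply: le_Rintegral => //; first exact: (integrable_normc iw).
exists (K0 + 1) => phi sp e1.
have iphi := schwartz_integrable sp; have mphi := schwartz_measurable sp.
have iDp := bounded_mul_integrable mD bD iphi.
have i2 n := bounded_mul_integrable (mdp n) (bdp n) iphi.
pose r n := Rintegral (@muH R) setT (fun p => normc (dp n p * phi p - D p * phi p)).
have lim : r n @[n --> \oo] --> (0 : R).
 apply: (@R_dct R _ _ (@muH R) _ (fun p => (C + C') * normc (phi p))).
 - by move=> n; apply: measurable_normc; exact: cmeasB (cintegr_measurable (i2 n)) (cintegr_measurable iDp).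
 - move=> n p; rewrite normc_ge0 /= -mulrBl normcM; apply: ler_wpM2r; first exact: normc_ge0.
  by apply: normcB_trans; exact: lerD.
 - exact: (RintegrableZl (C + C') (integrable_normc iphi)).
 - move=> p; rewrite (_ : (fun n => _) = fun n => normc (dp n p - D p) * normc (phi p)).
   by rewrite -[X in _ --> X](mul0r (normc (phi p))); apply: cvgM; [exact: h5|exact: cvg_cst].
  by apply/funext => n; rewrite -mulrBl normcM.
have B n : normc (cintegral (@muH R) (fun p => D p * phi p)) <= K0 + 1 + r n.
 have [s e] := h1 n.
 have x1 := Lap_bound s sp.
 have e2 : cintegral (@muH R) (fun p => - Lap (ap n : H1 R -> R[i]) p * phi p) = cintegral (@muH R) (fun p => dp n p * phi p).
  by apply: eq_cintegral => p; rewrite e.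
 rewrite e2 in x1; set I := cintegral _ _ in x1; set J := cintegral _ _.
 rewrite (_ : J = I - (I - J)); last by ring.
 apply: normcB_trans; apply: lerD.
  by apply: (le_trans x1); apply: lerD.
 by rewrite /I /J -(cintegralB (i2 n) iDp); exact: normc_cintegral (cintegrB (i2 n) iDp).
have c1 : (fun n => K0 + 1 + r n) @ \oo --> K0 + 1 + 0 by apply: cvgD => //; exact: cvg_cst.
rewrite addr0 in c1; rewrite -(cvg_lim _ c1)//; apply: limr_ge; first by apply/cvg_ex; eexists; exact: c1.
by apply: nearW => n; exact: B.
Qed.

(** The energy of a difference of approximants is the integral of the product of
 their derivatives, dominated by zeta^-2, and of their differences, which
 tend to 0: the dominating function |zeta|^-3 is integrable. *)
Lemma Hdot1_comb : Hdot1 (H : H1 R -> R[i]).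
Proof.
have [ap [dp [C C0 [h1 h2 h3 [h4 _]]]]] := approximants.
have [C' C'0 hC'] := comb_bound.
have map_ n : cmeasurable (ap n) by have [s _] := h1 n; exact: schwartz_measurable.
have z4 p : normc (zi p) ^+ 4 <= normc (zi p) ^+ 3.
 by rewrite exprSr ler_piMr ?normc_zi_le1// exprn_ge0 ?normc_ge0.
have nz p : 0 <= normc (zi p) by exact: normc_ge0.
have b4 n p : normc (ap n p - H p) ^+ 4 <= (C + C') ^+ 4 * normc (zi p) ^+ 3.
 have [x1 _] := h3 n p; have [x2 _] := hC' p.
 apply: (@le_trans _ _ (((C + C') * normc (zi p)) ^+ 4)).
  rewrite lerXn2r ?nnegrE ?normc_ge0 ?mulr_ge0 ?addr_ge0//.
  by apply: normcB_trans; rewrite mulrDl; exact: lerD.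
 by rewrite exprMn ler_wpM2l ?exprn_ge0 ?addr_ge0.
have i3 K := RintegrableZl K (@integrable_zi3 R).
have mdiff n : cmeasurable (fun p => ap n p - H p) by exact: cmeasB.
split.
 apply: (@cLp_nat R _ _ (@muH R) 4 H (fun p => C' ^+ 4 * normc (zi p) ^+ 3) isT mH (i3 _)) => p.
 have [x2 _] := hC' p; apply: (@le_trans _ _ ((C' * normc (zi p)) ^+ 4)).
  by rewrite lerXn2r ?nnegrE ?normc_ge0 ?mulr_ge0.
 by rewrite exprMn ler_wpM2l ?exprn_ge0.
have m4 n : measurable_fun setT (fun p => normc (ap n p - H p) ^+ 4) by apply: measurable_funX; exact: measurable_normc (mdiff n).
exists ap; split.
- by move=> n; have [] := h1 n.
- pose ep n := dist n ap.
 have iep n : Rintegrable (@muH R) (fun p => normc (zi p) ^+ 2 * normc (ap n p - H p)).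
  apply: (le_integrable measurableT _ _ (i3 (C + C'))) => [|p _].
   apply/measurable_EFinP; apply: measurable_funM; last exact: measurable_normc (mdiff n).
   by apply: measurable_funX; exact: measurable_normc (@zi_measurable R).
  have [x1 _] := h3 n p; have [x2 _] := hC' p.
  rewrite /= lee_fin !ger0_norm ?mulr_ge0 ?exprn_ge0 ?addr_ge0 ?normc_ge0//.
  rewrite [leRHS](_ : _ = normc (zi p) ^+ 2 * ((C + C') * normc (zi p))); last by ring.
  apply: ler_wpM2l; rewrite ?exprn_ge0//.
  by apply: normcB_trans; rewrite mulrDl; exact: lerD.
 have lim : ep n @[n --> \oo] --> (0 : R).
  apply: (@R_dct R _ _ (@muH R) _ (fun p => (C + C') * normc (zi p) ^+ 3)) => //.
  - by move=> n; have /measurable_EFinP := measurable_int _ (iep n).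
  - move=> n p; have [x1 _] := h3 n p; have [x2 _] := hC' p.
   rewrite mulr_ge0 ?exprn_ge0 ?normc_ge0//=.
   rewrite [leRHS](_ : _ = normc (zi p) ^+ 2 * ((C + C') * normc (zi p))); last by ring.
   apply: ler_wpM2l; rewrite ?exprn_ge0//.
   by apply: normcB_trans; rewrite mulrDl; exact: lerD.
  - exact: i3.
  - move=> p; rewrite -[X in _ --> X](mulr0 (normc (zi p) ^+ 2)); apply: cvgM; [exact: cvg_cst|exact: h4].
 have EB n m : energy (fun p : H1 R => ap n p - ap m p) <= 2 * C * (ep n + ep m).
  have [s e] := h2 n m; have E := energyE s.
  have mw : cmeasurable (fun p : R3 => - Lap (fun p : H1 R => ap n p - ap m p) p * (ap n p - ap m p)^*).
   by have [m1 _] := schwartz_Lap s; apply: cmeasM => //; apply: cmeas_conj; exact: cmeasB.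
  have ig := RintegrableZl (2 * C) (RintegrableD (iep n) (iep m)).
  have bw p : normc (- Lap (fun p : H1 R => ap n p - ap m p) p * (ap n p - ap m p)^*) <=
    2 * C * (normc (zi p) ^+ 2 * normc (ap n p - H p) + normc (zi p) ^+ 2 * normc (ap m p - H p)).
   rewrite normcM normc_conj e; have [_ x1] := h3 n p; have [_ x2] := h3 m p.
   have y1 : normc (dp n p - dp m p) <= 2 * C * normc (zi p) ^+ 2.
    by apply: normcB_trans; rewrite mulrDl mul1r mulrDl; exact: lerD.
   have y2 : normc (ap n p - ap m p) <= normc (ap n p - H p) + normc (ap m p - H p).
    by rewrite (_ : ap n p - ap m p = (ap n p - H p) - (ap m p - H p)); [exact: normcB|ring].
   apply: le_trans (ler_pM (normc_ge0 _) (normc_ge0 _) y1 y2) _.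
   by rewrite -mulrDr mulrA.
  have iw := cintegr_le (@muH R) _ _ mw ig bw.
  have := normc_cintegral iw; rewrite E normc_real (ger0_norm (energy_ge0 _)) => h.
  apply: (le_trans h); rewrite /ep /dist -(RintegralD measurableT (iep n) (iep m)) -RintegralZl//; last first.
   exact: (RintegrableD (iep n) (iep m)).
  by apply: le_Rintegral => //; first exact: (integrable_normc iw).
 move=> e e0; have k0 : 0 < e ^+ 2 / (4 * C + 1).
  by rewrite divr_gt0 ?exprn_gt0// ltr_wpDl// mulr_ge0.
 have /cvgrPdist_lt/(_ _ k0)[N _ hN] := lim.
 exists N => m n Nm Nn; have [s _] := h2 m n; rewrite (Hdot1_normE s).
 have sm k : (N <= k)%N -> ep k < e ^+ 2 / (4 * C + 1).
  by move=> /hN; rewrite /= sub0r normrN => h; apply: le_lt_trans h; exact: ler_norm.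
 have q : energy (fun p : H1 R => ap m p - ap n p) < e ^+ 2.
  apply: le_lt_trans (EB m n) _; have := sm _ Nm; have := sm _ Nn; rewrite !ltr_pdivlMr ?ltr_wpDl ?mulr_ge0//.
  have p1 : 0 <= ep m by apply: Rintegral_ge0 => p _; rewrite mulr_ge0 ?exprn_ge0 ?normc_ge0.
  have p2 : 0 <= ep n by apply: Rintegral_ge0 => p _; rewrite mulr_ge0 ?exprn_ge0 ?normc_ge0.
  move: (ep m) (ep n) (e ^+ 2) p1 p2 => x y w; nra.
 by rewrite -(ltr_pXn2r (_ : (0 < 2)%N)) ?nnegrE ?sqrtr_ge0 ?(ltW e0)// sqr_sqrtr// energy_ge0.
- apply: cLnorm4_cvg0 => //.
  move=> n; apply: (le_integrable measurableT _ _ (i3 ((C + C') ^+ 4))) => [|p _]; first by apply/measurable_EFinP; exact: m4.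
  by rewrite /= lee_fin !ger0_norm ?mulr_ge0 ?exprn_ge0 ?addr_ge0 ?normc_ge0.
 apply: (@R_dct R _ _ (@muH R) _ (fun p => (C + C') ^+ 4 * normc (zi p) ^+ 3)) => //.
 - by move=> n p; rewrite exprn_ge0 ?normc_ge0//= b4.
 - exact: i3.
 - move=> p; have c := h4 p; pose x n := normc (ap n p - H p).
  have c4 : (fun n => x n * (x n * (x n * x n))) @ \oo --> (0 * (0 * (0 * 0)) : R).
   by apply: cvgM => //; apply: cvgM => //; exact: cvgM.
  rewrite !mul0r in c4.
  by apply: (cvg_trans _ c4); apply: near_eq_cvg; apply: nearW => n; rewrite /= !exprS expr0 mulr1.
Qed.

End zi_energy.

(** * Moments of Laplace transforms *)

Section zi_moments.
Context {R : realType}.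
Notation mu := (@lebesgue_measure R).
Notation R3 := (R * R * R)%type.
Implicit Types (p : R3).

Lemma expint_mulX (f : R -> R[i]) : expint f -> expint (fun t => t%:C * f t).
Proof.
move=> [mf f0 fd]; have mt : cmeasurable (fun t : R => t%:C * f t).
 by apply: cmeasM => //; apply: cmeas_real.
split => // [t /f0 ->|d d0]; first by rewrite mulr0.
have d2 : 0 < d / 2 by rewrite divr_gt0.
apply: (cintegr_le mu _ _ _ (RintegrableZl (2%:R / (d / 2)) (integrable_normc (fd _ d2)))) => [|t].
 apply: cmeasM => //; apply: cmeas_real.
 by apply: measurableT_comp => //; apply: measurableT_comp => //; exact: measurable_funM.
have [t0|t0] := ltP 0 t; last first.
 rewrite f0// !(mulr0, mul0r) normc0 mulr_ge0// ?normc_ge0// divr_ge0// ltW//.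
have h := powle_expR 1 d2 (ltW t0); rewrite !expr1 in h.
rewrite !normcM !normc_real (gtr0_norm t0) !ger0_norm ?expR_ge0//.
rewrite mulrAC [leRHS]mulrCA mulrC; apply: ler_wpM2l; first exact: normc_ge0.
have -> : expR (- (d * t)) = expR (- (d / 2 * t)) * expR (- (d / 2 * t)) by rewrite -expRD; congr expR; field.
rewrite mulrA; apply: ler_wpM2r; first exact: expR_ge0.
apply: le_trans (ler_wpM2r (expR_ge0 _) h) _.
by rewrite -(mulrA _ (expR _)) -expRD subrr expR0 mulr1.
Qed.

Variable f : R -> R[i].
Hypothesis ef : expint f.
Let E p : R[i] := laplace f (zc 1 p).
Hypothesis LE : cLp (@muH R) 2 E.

Let mE : cmeasurable E. Proof. by have [mf _ _] := ef; exact: laplace_zc_measurable. Qed.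

Definition zmom j k : R[i] := cintegral (@muH R) (fun p => (zi p ^+ j)^* * zi p ^+ k * E p).

Let zX k := cmeasX k (@zi_measurable R).

Lemma zmom_integrable i k : cintegrable (@muH R) (fun p => (zi p ^+ i.+2)^* * zi p ^+ k * E p).
Proof.
have L2 : cLp (@muH R) 2 (fun p => (zi p ^+ 2)^*).
 apply: (@cLp_nat R _ _ (@muH R) 2 _ (fun p => normc (zi p) ^+ 3) isT _ (@integrable_zi3 R)) => [|p].
  exact: cmeas_conj (zX 2).
 rewrite normc_conj normcX -exprM -[(2 * 2)%N]/(3.+1) exprSr ler_piMr ?normc_zi_le1// exprn_ge0 ?normc_ge0//.
have [i2 _] := cLp_hoelder (ltr0Sn R 1) (ltr0Sn R 1) (@conj_22 R) L2 LE.
have mB : cmeasurable (fun p : R3 => (zi p ^+ i)^* * zi p ^+ k).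
 by apply: cmeasM => //; exact: cmeas_conj.
have := bounded_mul_integrable (K := 1) mB _ i2; move=> h.
apply: (eq_cintegrable _ (h _)) => [p|p].
 transitivity ((zi p ^+ i)^* * (zi p ^+ 2)^* * zi p ^+ k * E p).
  by rewrite mulrA; congr (_ * _); exact: mulrAC.
 congr (_ * _ * _); apply/esym; rewrite -[i.+2]addn2 exprD; exact: rmorphM.
rewrite normcM normc_conj !normcX; apply: mulr_ile1; rewrite ?exprn_ge0 ?normc_ge0//;
 by apply: exprn_ile1; rewrite ?normc_ge0 ?normc_zi_le1.
Qed.

Let n1 : Re (-1 : R[i]) < 0. Proof. by rewrite /= oppr_lt0. Qed.

Let ez : {ae (@muHs R), forall p : R3, Re (zc 1 p) < 0}.
Proof.
apply: (ae_imp (@ae_neq_x R 0)) => p x0; rewrite /= oppr_lt0.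
by rewrite ltr_pwDl ?sqr_ge0// exprn_even_gt0.
Qed.

Let conv_pexp k : exists2 F, expint F & [/\ F = conv f (pexp k 1),
 {ae (@muHs R), forall p : R3, laplace F (zc 1 p) = (k`!%:R)%:C * zi p ^+ k.+1 * E p} &
 laplace F (-1) = laplace f (-1) * ((k`!%:R)%:C / (1 + 1) ^+ k.+1)].
Proof.
have [M hM] := pexp_bounded k (@ltr01 R).
have ee : expint (pexp k (1 : R)) by apply: pexp_expint.
exists (conv f (pexp k 1)); first exact: conv_expint ef ee hM.
split => //.
 apply: (ae_imp ez) => p z0; have [_ ->] := conv_laplace ef ee hM z0.
 by rewrite zi_laplace mulrC.
have [_ ->] := conv_laplace ef ee hM n1; rewrite laplace_pexp ?opprK//; exact: ltW.
Qed.

Let ae_moment j k F : {ae (@muHs R), forall p : R3, laplace F (zc 1 p) = zi p ^+ k * E p} -> expint F ->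
 cintegrable (@muH R) (fun p => (zi p ^+ j.+2)^* * laplace F (zc 1 p)) /\
 cintegral (@muH R) (fun p => (zi p ^+ j.+2)^* * laplace F (zc 1 p)) = zmom j.+2 k.
Proof.
move=> h [mF _ _].
have m1 : cmeasurable (fun p : R3 => (zi p ^+ j.+2)^* * laplace F (zc 1 p)).
 by apply: cmeasM; [exact: cmeas_conj|exact: laplace_zc_measurable].
have e : {ae (@muHs R), forall p : R3, (zi p ^+ j.+2)^* * zi p ^+ k * E p = (zi p ^+ j.+2)^* * laplace F (zc 1 p)}.
 by apply: (ae_imp h) => p ->; rewrite mulrA.
have [x y] := ae_cintegrableH m1 e (zmom_integrable j k).
by split; [exact: x|exact: esym y].
Qed.

Let lap1 (g : R -> R[i]) : cintegral mu (fun t => g t * (expR (- t))%:C) = laplace g (-1).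
Proof. by apply: eq_cintegral => t; rewrite mulrN1 -rmorphN cexp_real. Qed.

Let fE : {ae (@muHs R), forall p : R3, laplace f (zc 1 p) = zi p ^+ 0 * E p}.
Proof. by apply: aeW => p; rewrite expr0 mul1r. Qed.

Let g := laplace f (-1).

(** Multiplying a transform by zeta^-1 convolves its profile with e^-t, so each
 moment is a value at -1 of a product of Laplace transforms. *)
Lemma zmom20 : zmom 2 0 = (pi ^+ 2)%:C * g.
Proof. by have [i <-] := ae_moment 0 fE ef; rewrite zi2_moment// lap1. Qed.

Lemma zmom21 : zmom 2 1 = (pi ^+ 2)%:C * (g / 2%:R).
Proof.
have [F eF [_ h e]] := conv_pexp 0; have h' : {ae (@muHs R), forall p : R3, laplace F (zc 1 p) = zi p ^+ 1 * E p}.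
 by apply: (ae_imp h) => p ->; rewrite fact0 mul1r.
by have [i <-] := ae_moment 0 h' eF; rewrite zi2_moment// lap1 e fact0 expr1 mul1r.
Qed.

Lemma zmom22 : zmom 2 2 = (pi ^+ 2)%:C * (g / 4%:R).
Proof.
have [F eF [_ h e]] := conv_pexp 1; have h' : {ae (@muHs R), forall p : R3, laplace F (zc 1 p) = zi p ^+ 2 * E p}.
 by apply: (ae_imp h) => p ->; rewrite factS fact0 mul1r.
have [i <-] := ae_moment 0 h' eF; rewrite zi2_moment// lap1 e factS fact0 mul1r; congr (_ * (_ / _)); ring.
Qed.

(** Leibniz' rule: t (f * e) = (t f) * e + f * (t e). *)
Lemma zmom3 : exists d, zmom 3 0 = (pi ^+ 2 / 2)%:C * d /\
 zmom 3 1 = (pi ^+ 2 / 2)%:C * (d / 2%:R + g / 4%:R).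
Proof.
pose tf t := t%:C * f t; have etf : expint tf := expint_mulX ef.
have te (F : R -> R[i]) : cintegral mu (fun t => F t * (t * expR (- t))%:C) = laplace (fun t => t%:C * F t) (-1).
 by rewrite -lap1; apply: eq_cintegral => t; rewrite rmorphM; ring.
exists (laplace tf (-1)); split.
 by have [i <-] := ae_moment 1 fE ef; rewrite zi3_moment// te.
have [F eF [FE h _]] := conv_pexp 0; have h' : {ae (@muHs R), forall p : R3, laplace F (zc 1 p) = zi p ^+ 1 * E p}.
 by apply: (ae_imp h) => p ->; rewrite fact0 mul1r.
have [i <-] := ae_moment 1 h' eF; rewrite zi3_moment// te; congr (_ * _).
have [M0 b0] := pexp_bounded 0 (@ltr01 R); have [M1 b1] := pexp_bounded 1 (@ltr01 R).
have e0 : expint (pexp 0 (1 : R)) by apply: pexp_expint.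
have e1 : expint (pexp 1 (1 : R)) by apply: pexp_expint.
have [j0 E0] := conv_laplace etf e0 b0 n1; have [j1 E1] := conv_laplace ef e1 b1 n1.
have FL t : t%:C * F t = conv tf (pexp 0 1) t + conv f (pexp 1 1) t.
 rewrite FE /conv -(cintegralZl _ (conv_section ef e0 b0 t)).
 rewrite -(cintegralD (conv_section etf e0 b0 t) (conv_section ef e1 b1 t)).
 apply: eq_cintegral => s; rewrite /pexp; case: ifP => _; last by rewrite !mulr0 addr0.
 by rewrite /tf expr0 expr1 !rmorphM rmorphB /=; ring.
rewrite /laplace (eq_cintegral mu (g := fun t => conv tf (pexp 0 1) t * cexp (t%:C * -1) + conv f (pexp 1 1) t * cexp (t%:C * -1))); last first.
 by move=> t; rewrite FL mulrDl.
rewrite (cintegralD j0 j1) -/(laplace (conv tf (pexp 0 1)) (-1)) -/(laplace (conv f (pexp 1 1)) (-1)) E0 E1.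
rewrite !laplace_pexp ?(ltW n1)// opprK factS fact0 !mul1r expr1; congr (_ + _ * _); congr (_^-1); ring.
Qed.

End zi_moments.

(** * The combinations with a real relation are in the kernel *)

Section kernel_converse.
Context {R : realType}.
Notation mu := (@lebesgue_measure R).
Notation R3 := (R * R * R)%type.
Implicit Types (p : R3) (h w : R3 -> R[i]) (phi : H1 R -> R[i]).

Lemma cLnorm_ae (q : R) h h0 : cmeasurable h -> cmeasurable h0 -> {ae (@muHs R), forall p, h p = h0 p} ->
 cLnorm (@muH R) q h = cLnorm (@muH R) q h0.
Proof.
move=> mh mh0 e; rewrite /cLnorm unlock /=.
have P (u : R3 -> R[i]) : cmeasurable u -> measurable_fun setT (fun p : R3 => (powR `|normc (u p)| q)%:E).
 move=> mu_; apply/measurable_EFinP; apply: (measurableT_comp (measurable_powR q)).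
 by apply: measurableT_comp => //; exact: measurable_normc mu_.
apply: (congr1 (fun x => poweR x q^-1)).
apply: (@ae_eq_integral _ _ R (@muHs R) setT _ _ measurableT (P _ mh) (P _ mh0)).
by apply: (ae_imp e) => p -> _.
Qed.

Lemma cLp_ae (q : R) h h0 : cmeasurable h -> {ae (@muHs R), forall p, h p = h0 p} ->
 cLp (@muH R) q h0 -> cLp (@muH R) q h.
Proof. by move=> mh e [m0 l0]; split => //; rewrite (cLnorm_ae q mh m0 e). Qed.

Lemma distr_ae h h0 (psi : R3 -> R[i]) : cmeasurable h -> cmeasurable h0 -> cmeasurable psi ->
 {ae (@muHs R), forall p, h p = h0 p} -> distr h psi = distr h0 psi.
Proof.
move=> mh m0 mp e; apply: (@ae_eq_cintegral R _ _ (@muHs R)); [exact: cmeasM|exact: cmeasM|].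
by apply: (ae_imp e) => p ->.
Qed.

Lemma Pi0p_ext_ae h h0 T : cmeasurable h -> {ae (@muHs R), forall p, h p = h0 p} ->
 is_Pi0p_ext h0 T -> is_Pi0p_ext h T.
Proof.
move=> mh e [L0 dT [gn [wn [Lg Pg cg cw]]]]; split => //; first exact: cLp_ae e L0.
exists gn, wn; split => //.
rewrite (_ : (fun n => _) = fun n => cLnorm (@muH R) (4 / 3) (fun p => gn n p - h0 p)) //.
apply/funext => n; have [mg _] := Lg n; have [m0 _] := L0.
by apply: cLnorm_ae; [exact: cmeasB|exact: cmeasB|apply: (ae_imp e) => p ->].
Qed.

Lemma Qp_measurable : cmeasurable (@Qp R : R3 -> R[i]).
Proof.
rewrite (funext (@QpE R)); apply: cmeasM; [exact: cmeas_cst|exact: zi_measurable].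
Qed.

Lemma normQ2_measurable : cmeasurable (fun p : R3 => (normc (@Qp R p) ^+ 2)%:C).
Proof.
by apply: cmeas_real; apply: measurable_funX; exact: measurable_normc Qp_measurable.
Qed.

(** All the conditions defining the kernel see h through integrals and norms. *)
Lemma KerL_ae h h0 : cmeasurable h -> {ae (@muHs R), forall p, h p = h0 p} -> KerL h0 -> KerL h.
Proof.
move=> mh e [[L0 [ps [sps cps lps]]] [f [mf Vf]] [T1 [T2 [P1 P2 eT]]]]; have [m0 _] := L0; split.
- split; first exact: cLp_ae e L0.
 exists ps; split => //.
 rewrite (_ : (fun n => _) = fun n => cLnorm (@muH R) 4 (fun p => ps n p - h0 p)) //.
 apply/funext => n; have mp := schwartz_measurable (sps n).
 by apply: cLnorm_ae; [exact: cmeasB|exact: cmeasB|apply: (ae_imp e) => p ->].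
- exists f; split => // phi sp; have [i1 <-] := Vf phi sp; split => //.
 exact: distr_ae mh m0 (Fourier_s_measurable sp) e.
exists T1, T2; split.
- apply: Pi0p_ext_ae P1; first by apply: cmeasM => //; exact: normQ2_measurable.
 by apply: (ae_imp e) => p ->.
- apply: Pi0p_ext_ae P2.
  apply: cmeasM; last exact: cmeas_conj.
  exact: cmeasX Qp_measurable.
 by apply: (ae_imp e) => p ->.
- move=> phi sp; rewrite (eT phi sp); congr (_ - _ - _).
 by have [mL _] := schwartz_Lap sp; apply/esym; exact: distr_ae mh m0 mL e.
Qed.

Definition lcomb (a b : R[i]) (k : nat) p : R[i] := a * zi p ^+ k + b * zi p ^+ k.+1.

Let zX k := cmeasX k (@zi_measurable R).

Lemma lcomb_measurable a b k : cmeasurable (lcomb a b k).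
Proof. by apply: cmeasD; apply: cmeasM; (exact: cmeas_cst || exact: zX). Qed.

Lemma lcomb_bound a b k p : normc (lcomb a b k p) <= (normc a + normc b) * normc (zi p) ^+ k.
Proof.
apply: le_normcD_trans; rewrite (normcM a) (normcM b) !normcX mulrDl; apply: lerD => //.
apply: ler_wpM2l; first exact: normc_ge0.
by rewrite exprS ler_piMl ?normc_zi_le1// exprn_ge0 ?normc_ge0.
Qed.

Lemma lcomb_bounded a b k p : normc (lcomb a b k p) <= normc a + normc b.
Proof.
apply: le_trans (lcomb_bound a b k p) _; rewrite ler_piMr ?addr_ge0 ?normc_ge0//.
by rewrite exprn_ile1 ?normc_ge0// normc_zi_le1.
Qed.

Lemma Hdotm1_lcomb a b : Hdotm1 (distr (lcomb a b 2 : H1 R -> R[i])).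
Proof.
have ip phi : schwartz phi -> cintegrable (@muH R) (fun p => lcomb a b 2 p * phi p).
 move=> sp; exact: bounded_mul_integrable (lcomb_measurable _ _ _) (lcomb_bounded a b 2) (schwartz_integrable sp).
split.
 move=> c phi psi s1 s2; rewrite /distr -(cintegralZl c (ip _ s1)) -(cintegralD (cintegrZl c (ip _ s1)) (ip _ s2)).
 by apply: eq_cintegral => p; ring.
have [K hK] := comb_dual a (b / 2%:R).
apply: (@le_lt_trans _ _ K%:E); last exact: ltry.
apply: ge_ereal_sup => _ [phi [sp np] <-]; rewrite lee_fin.
have e1 : energy phi <= 1.
 rewrite (Hdot1_normE sp) in np; rewrite -(sqr_sqrtr (energy_ge0 phi)).
 by rewrite exprn_ile1 ?sqrtr_ge0.
apply: le_trans (hK phi sp e1); rewrite le_eqVlt; apply/orP; left; apply/eqP; congr normc.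
apply: eq_cintegral => p; rewrite /lcomb; congr (_ * _); congr (_ + _ * _).
by rewrite mulrC mulfVK// pnatr_eq0.
Qed.

Lemma V0p_lcomb a b k : V0p (lcomb a b k.+1 : H1 R -> R[i]).
Proof.
pose F t := (a / (k`!%:R)) * pexp k 1 t + (b / (k.+1`!%:R)) * pexp k.+1 1 t.
have z0 : Re (0 : R[i]) <= 0 by [].
have i0 j : cintegrable mu (pexp j (1 : R)).
 have := pexp_laplace_integrable j (@ltr01 R) z0; move=> h; apply: (eq_cintegrable _ h) => t.
 by rewrite mulr0 cexp0 mulr1.
have iF : cintegrable mu F by apply: cintegrD; apply: cintegrZl; exact: i0.
have f0 t : t <= 0 -> F t = 0 by move=> t0; rewrite /F /pexp ltNge t0 /= !mulr0 addr0.
have := V0p_laplace iF f0; congr V0p; apply/funext => p.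
have iz j := pexp_laplace_integrable j (@ltr01 R) (Re_zc_le0 1 p).
rewrite /laplace (eq_cintegral mu (g := fun t => a / (k`!%:R) * (pexp k 1 t * cexp (t%:C * zc 1 p)) +
  b / (k.+1`!%:R) * (pexp k.+1 1 t * cexp (t%:C * zc 1 p)))); last by move=> t; rewrite mulrDl !mulrA.
rewrite (cintegralD (cintegrZl _ (iz k)) (cintegrZl _ (iz k.+1))).
rewrite (cintegralZl _ (iz k)) (cintegralZl _ (iz k.+1)) -!/(laplace _ _) !zi_laplace /lcomb.
have fn j : (j`!%:R)%:C = j`!%:R :> R[i] by exact: rmorph_nat.
have f1 j : j`!%:R != 0 :> R[i] by rewrite pnatr_eq0 -lt0n fact_gt0.
by rewrite !fn !mulrA !mulfVK.
Qed.

Lemma cLp2_lcomb a b : cLp (@muH R) 2 (lcomb a b 2).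
Proof.
apply: (@cLp_nat R _ _ (@muH R) 2 _ (fun p => (normc a + normc b) ^+ 2 * normc (zi p) ^+ 3) isT
 (lcomb_measurable _ _ _) (RintegrableZl _ (@integrable_zi3 R))) => p.
apply: (@le_trans _ _ (((normc a + normc b) * normc (zi p) ^+ 2) ^+ 2)).
 by rewrite lerXn2r ?nnegrE ?mulr_ge0 ?addr_ge0 ?exprn_ge0 ?normc_ge0// lcomb_bound.
rewrite exprMn -(exprM _ 2 2) -[(2 * 2)%N]/(3.+1); apply: ler_wpM2l; first by rewrite exprn_ge0// addr_ge0 ?normc_ge0.
by rewrite exprSr ler_piMr ?normc_zi_le1// exprn_ge0 ?normc_ge0.
Qed.

Lemma cLp_zi3 (q : R) (g : R3 -> R[i]) K : 1 <= q -> 0 <= K -> cmeasurable g ->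
 (forall p, normc (g p) <= K * normc (zi p) ^+ 3) -> cLp (@muH R) q g.
Proof.
move=> q1 K0 mg hg; apply: (cLp_bounded (M := K) q1) => [|p]; first exact: zi_integrable mg hg.
by apply: le_trans (hg p) _; rewrite ler_piMr// exprn_ile1 ?normc_ge0// normc_zi_le1.
Qed.

(** When g is already in L^2, the constant sequences g and w approximate. *)
Lemma Pi0p_ext_const (g : H1 R -> R[i]) a b : cLp (@muH R) (4 / 3) g ->
 is_Pi0p g (lcomb a b 2) -> is_Pi0p_ext g (distr (lcomb a b 2 : H1 R -> R[i])).
Proof.
move=> Lg Pg; split => //; first exact: Hdotm1_lcomb.
exists (fun=> g), (fun=> lcomb a b 2); split => //.
 rewrite (_ : (fun n => _) = fun=> 0%E); first exact: cvg_cst.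
 apply/funext => _; rewrite /cLnorm (_ : (fun p => _) = cst 0%E) ?Lnorm0 ?gt_eqF ?lte_fin ?divr_gt0//.
 by apply/funext => p; rewrite subrr normc0.
rewrite (_ : (fun n => _) = fun=> 0%E); first exact: cvg_cst.
apply/funext => _; rewrite /Hdotm1_norm; apply/le_anti/andP; split.
 by apply: ge_ereal_sup => _ [phi _ <-]; rewrite subrr normc0.
have [a' [b' [u [a0 ab bu _]]]] := @unit_bump R.
have [v [sv v0]] : exists v : H1 R -> R[i], schwartz v /\ forall p, v p = 0.
 exists (fun p => blaplace (fun t => 0 * u t) (zc 1 p)); split.
  exact: schwartz_blaplace a0 ab (bumpyZ 0 bu) (expr1n R 2).
 move=> p; rewrite /blaplace /laplace (eq_cintegral mu (g := fun=> 0)) ?cintegral0// => t.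
 by rewrite mul0r mul0r.
apply: ereal_sup_ubound; exists v; last by rewrite subrr normc0.
split => //; rewrite /Hdot1_norm (eq_cintegral (@muH R) (g := fun=> 0)) ?cintegral0 ?sqrtr0//.
move=> p; rewrite [X in _ * X](_ : _ = 0) ?mulr0//.
by apply: eqcE; rewrite ?Re_conj ?Im_conj v0 ?oppr0.
Qed.

(** Orthogonality to V0+ can be tested on the moments of the Laplace density
  of the test function. *)
Lemma orthogonal_moments (X v : R3 -> R[i]) (c20 c30 c21 c31 c22 : R[i]) : cLp (@muH R) 2 X ->
 cLp (@muH R) 2 v -> V0p (v : H1 R -> R[i]) ->
 (forall p, (X p)^* = c20 * (zi p ^+ 2)^* + c30 * (zi p ^+ 3)^* + c21 * ((zi p ^+ 2)^* * zi p ^+ 1)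
  + c31 * ((zi p ^+ 3)^* * zi p ^+ 1) + c22 * ((zi p ^+ 2)^* * zi p ^+ 2)) ->
 (forall q g d : R[i], c20 * (q * g) + c30 * (q / 2%:R * d) + c21 * (q * (g / 2%:R)) +
  c31 * (q / 2%:R * (d / 2%:R + g / 4%:R)) + c22 * (q * (g / 4%:R)) = 0) ->
 cintegral (@muH R) (fun p => X p * (v p)^*) = 0.
Proof.
move=> LX Lv Vv XE cE.
have [f ef vf] := V0p_Lp_repr (ltr0Sn R 1) (ler1n R 2) (@conj_22 R) Lv Vv.
pose E p := laplace f (zc 1 p).
have mE : cmeasurable E by have [mf _ _] := ef; exact: laplace_zc_measurable.
have LE : cLp (@muH R) 2 E.
 by apply: cLp_ae Lv => //; apply: (ae_imp vf) => p ->.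
have [mX _] := LX; have [mv _] := Lv.
pose Y p := (X p)^* * E p.
have mY : cmeasurable Y by apply: cmeasM => //; exact: cmeas_conj.
have e1 : cintegral (@muH R) (fun p => X p * (v p)^*) = cintegral (@muH R) (fun p => (Y p)^*).
 apply: (@ae_eq_cintegral R _ _ (@muHs R)).
 - exact: (cmeasM mX (cmeas_conj mv)).
 - exact: (cmeas_conj mY).
 apply: (ae_imp vf) => p ->; rewrite /Y -/(E p); move: (X p) (E p) => [x1 x2] [y1 y2].
 by apply: eqcE => /=; ring.
pose m j k p : R[i] := (zi p ^+ j)^* * zi p ^+ k * E p.
have i20 := zmom_integrable LE 0 0; have i30 := zmom_integrable LE 1 0.
have i21 := zmom_integrable LE 0 1; have i31 := zmom_integrable LE 1 1.
have i22 := zmom_integrable LE 0 2.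
have YE p : Y p = c20 * m 2 0 p + c30 * m 3 0 p + c21 * m 2 1 p + c31 * m 3 1 p + c22 * m 2 2 p.
 apply: (etrans (congr1 (fun z => z * E p) (XE p))); rewrite /m expr0.
 by rewrite !mulrDl !mulr1 !mulrA.
have j1 := cintegrZl c20 i20; have j2 := cintegrZl c30 i30; have j3 := cintegrZl c21 i21.
have j4 := cintegrZl c31 i31; have j5 := cintegrZl c22 i22.
have k2 := cintegrD j1 j2; have k3 := cintegrD k2 j3; have k4 := cintegrD k3 j4.
have k5 := cintegrD k4 j5.
have iY : cintegrable (@muH R) Y by apply: (eq_cintegrable _ k5) => p; rewrite YE.
rewrite e1 (cintegral_conj iY).
rewrite (_ : cintegral (@muH R) Y = 0); first by apply: eqcE; rewrite ?Re_conj ?Im_conj ?oppr0.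
rewrite (eq_cintegral (@muH R) YE).
rewrite (cintegralD k4 j5) (cintegralD k3 j4) (cintegralD k2 j3) (cintegralD j1 j2).
rewrite (cintegralZl _ i20) (cintegralZl _ i30) (cintegralZl _ i21) (cintegralZl _ i31) (cintegralZl _ i22).
have [d [z30 z31]] := zmom3 ef LE.
rewrite -![cintegral _ _]/(zmom f _ _) (zmom20 ef LE) (zmom21 ef LE) (zmom22 ef LE) z30 z31.
have e2 : (pi ^+ 2 / 2)%:C = (pi ^+ 2)%:C / 2%:R :> R[i] by rewrite rmorphM fmorphV rmorph_nat.
by rewrite e2 cE.
Qed.

Variables (al be : R[i]).
Hypothesis real_rel : Re al + Re be / 2 = 0.
Let h0 := lcomb al be 1.
Let w1 := lcomb (al + (4^-1)%:C * be) be 2.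
Let w2 := lcomb (al^* + (2^-1)%:C * be^*) 0 2.
Let g1 : R3 -> R[i] := fun p => (normc (Qp p) ^+ 2)%:C * h0 p.
Let g2 : R3 -> R[i] := fun p => Qp p ^+ 2 * (h0 p)^*.
Let K : R := normc al + normc be.
Let K0 : 0 <= 2 * K. Proof. by rewrite mulr_ge0// addr_ge0 ?normc_ge0. Qed.

Let mg1 : cmeasurable g1.
Proof. by apply: cmeasM; [exact: normQ2_measurable|exact: lcomb_measurable]. Qed.

Let mg2 : cmeasurable g2.
Proof.
apply: cmeasM; last exact: cmeas_conj (lcomb_measurable _ _ _).
exact: cmeasX Qp_measurable.
Qed.

Let nQ p : normc (Qp p) ^+ 2 = 2 * normc (zi p) ^+ 2.
Proof. by rewrite QpE normcM normc_real ger0_norm ?sqrtr_ge0// exprMn sqr_sqrtr. Qed.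

Let bg p (x y : R[i]) : normc x = 2 * normc (zi p) ^+ 2 -> normc y = normc (h0 p) ->
 normc (x * y) <= 2 * K * normc (zi p) ^+ 3.
Proof.
move=> ex ey; rewrite normcM ex ey -(mulrA 2) -(mulrA 2 K); apply: ler_wpM2l => //.
rewrite [leRHS](_ : _ = normc (zi p) ^+ 2 * (K * normc (zi p))); last by ring.
apply: ler_wpM2l; first by rewrite exprn_ge0 ?normc_ge0.
exact: (lcomb_bound al be 1 p).
Qed.

Let bg1 p : normc (g1 p) <= 2 * K * normc (zi p) ^+ 3.
Proof. by apply: bg => //; rewrite normc_real ger0_norm ?sqr_ge0 ?nQ. Qed.

Let bg2 p : normc (g2 p) <= 2 * K * normc (zi p) ^+ 3.
Proof. by apply: bg; rewrite ?normc_conj// normcX nQ. Qed.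

Let two1 : (1 : R) <= 2. Proof. by rewrite ler1n. Qed.
Let p43 : (1 : R) <= 4 / 3. Proof. by rewrite ler_pdivlMr// mul1r ler_nat. Qed.

Let L2B (g w : R3 -> R[i]) : cmeasurable g -> (forall p, normc (g p) <= 2 * K * normc (zi p) ^+ 3) ->
 forall a b, cLp (@muH R) 2 (fun p => g p - lcomb a b 2 p).
Proof.
move=> mg bg_ a b.
apply: (@cLp_nat R _ _ (@muH R) 2 _ (fun p => (2 * K + (normc a + normc b)) ^+ 2 * normc (zi p) ^+ 3) isT
 _ (RintegrableZl _ (@integrable_zi3 R))) => [|p].
 by apply: cmeasB => //; exact: lcomb_measurable.
have ab0 : 0 <= normc a + normc b by rewrite addr_ge0 ?normc_ge0.
have z0 := normc_ge0 (zi p); have z1 := normc_zi_le1 p.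
apply: (@le_trans _ _ (((2 * K + (normc a + normc b)) * normc (zi p) ^+ 2) ^+ 2)).
 have B : normc (g p - lcomb a b 2 p) <= (2 * K + (normc a + normc b)) * normc (zi p) ^+ 2.
  apply: normcB_trans; rewrite mulrDl; apply: lerD; last exact: lcomb_bound.
  apply: le_trans (bg_ p) _; apply: ler_wpM2l => //.
  by rewrite exprSr ler_piMr// exprn_ge0.
 have B0 : 0 <= (2 * K + (normc a + normc b)) * normc (zi p) ^+ 2.
  by apply: mulr_ge0; [exact: addr_ge0|exact: exprn_ge0].
 by rewrite lerXn2r ?nnegrE ?normc_ge0.
rewrite exprMn -(exprM _ 2 2) -[(2 * 2)%N]/(3.+1); apply: ler_wpM2l; first by rewrite exprn_ge0// addr_ge0.
by rewrite exprSr ler_piMr// exprn_ge0.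
Qed.

Let Pi1 : is_Pi0p (g1 : H1 R -> R[i]) w1.
Proof.
split; [exact: cLp_zi3 two1 K0 mg1 bg1|exact: cLp2_lcomb|exact: V0p_lcomb|idtac].
move=> v Lv Vv.
apply: (@orthogonal_moments (fun p => g1 p - w1 p) v (- (al^* + (4^-1)%:C * be^*)) (- be^*) (2%:R * al^*) (2%:R * be^*) 0 _ Lv Vv).
- exact: (L2B (fun=> 0) mg1 bg1).
- move=> p; rewrite /g1 normQp2E /w1 /h0 /lcomb expr1 !exprS expr0 !mulr1.
 move: (zi p) al be => [x y] [a1 a2] [b1 b2].
 by apply: eqcE => /=; ring.
- move=> q g d; have -> : (4^-1)%:C = 4%:R^-1 :> R[i] by rewrite fmorphV rmorph_nat.
 by field.
Qed.

Let Pi2 : is_Pi0p (g2 : H1 R -> R[i]) w2.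
Proof.
split; [exact: cLp_zi3 two1 K0 mg2 bg2|exact: cLp2_lcomb|exact: V0p_lcomb|].
move=> v Lv Vv.
apply: (@orthogonal_moments (fun p => g2 p - w2 p) v (- (al + (2^-1)%:C * be)) 0 (2%:R * al) 0 (2%:R * be) _ Lv Vv).
- exact: (L2B (fun=> 0) mg2 bg2).
- move=> p; rewrite /g2 Qp2E /w2 /h0 /lcomb expr1 !exprS expr0 !mulr1.
 move: (zi p) al be => [x y] [a1 a2] [b1 b2].
 by apply: eqcE => /=; ring.
- move=> q g d; have -> : (2^-1)%:C = 2%:R^-1 :> R[i] by rewrite fmorphV rmorph_nat.
 by field.
Qed.

(** The projections w1 and w2 have been chosen so that 2 w1 + w2 is the image of
 h0 by -Lap up to the term 2 Re al + Re be, which vanishes. *)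
Lemma KerL_lcomb : KerL (h0 : H1 R -> R[i]).
Proof.
split; [exact: Hdot1_comb|exact: V0p_lcomb|].
exists (distr w1), (distr w2); split.
- by apply: Pi0p_ext_const Pi1; exact: cLp_zi3 p43 K0 mg1 bg1.
- by apply: Pi0p_ext_const Pi2; exact: cLp_zi3 p43 K0 mg2 bg2.
move=> phi sp; have ip a b : cintegrable (@muH R) (fun p => lcomb a b 2 p * phi p).
 exact: bounded_mul_integrable (lcomb_measurable _ _ _) (lcomb_bounded a b 2) (schwartz_integrable sp).
have L : distr (h0 : H1 R -> R[i]) (fun p => - Lap phi p) =
  cintegral (@muH R) (fun p => (al * zi p ^+ 2 + 2%:R * be * zi p ^+ 3) * phi p) := Lap_comb al be sp.
rewrite L.
have eD p : (al * zi p ^+ 2 + 2%:R * be * zi p ^+ 3) * phi p = 2%:R * (w1 p * phi p) + w2 p * phi p.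
 have e : al = 2%:R * (al + (4^-1)%:C * be) + (al^* + (2^-1)%:C * be^*).
  move: al be real_rel => [a1 a2] [b1 b2] /= r; apply: eqcE => /=; last by field.
  by rewrite (_ : a1 = - (b1 / 2)); [field|lra].
 by rewrite /w1 /w2 /lcomb [in LHS]e; ring.
rewrite (eq_cintegral (@muH R) eD) (cintegralD (cintegrZl 2%:R (ip _ _)) (ip _ _)) (cintegralZl 2%:R (ip _ _)).
by rewrite /distr; ring.
Qed.

End kernel_converse.

(** * The three generators *)

Section span.
Context {R : realType}.
Notation R3 := (R * R * R)%type.

Lemma ds_Qp (p : H1 R) : ds (@Qp R) p = (Num.sqrt 2)%:C * ('i%C * zi p ^+ 2).
Proof.
have hQ := holZ (Num.sqrt 2 : R)%:C (@hol_inv R).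
have [_ _ e] := cdiff_partials (cdiff_hol 1 p hQ).
transitivity (ds (fun q : H1 R => (Num.sqrt 2)%:C * (1 - zc 1 q)^-1) p).
 by congr (ds _ p); apply/funext => q; exact: QpE.
by rewrite e /zi mulr1 mulrCA.
Qed.

(** In terms of the basis (zeta^-1, zeta^-2) the three generators have the
  coordinates sqrt 2 times (0, i), (i, 0) and (1, -2). *)
Lemma span_lcomb (a0 a1 a2 : R) (p : H1 R) :
 a0%:C * ds (@Qp R) p + (a1%:C * ('i%C * Qp p) + a2%:C * (Qp p + 2 * 'i%C * ds (@Qp R) p)) =
 lcomb ((Num.sqrt 2 * a2) +i* (Num.sqrt 2 * a1)) ((- (2 * (Num.sqrt 2 * a2))) +i* (Num.sqrt 2 * a0)) 1 p.
Proof.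
rewrite ds_Qp QpE /lcomb expr1 !exprS expr0 !mulr1; move: (Num.sqrt 2) (zi p) => c [x y].
by apply: eqcE => /=; ring.
Qed.

Lemma VectR_lcomb (h : H1 R -> R[i]) :
 VectR [:: ds (@Qp R); (fun p => 'i%C * Qp p); (fun p => Qp p + 2 * 'i%C * ds (@Qp R) p)] h <->
 cmeasurable (h : R3 -> R[i]) /\ exists a b : R[i], Re a + Re b / 2 = 0 /\
  {ae (@muHs R), forall p : R3, h p = lcomb a b 1 p}.
Proof.
have s0 : Num.sqrt 2 != 0 :> R by rewrite gt_eqF// sqrtr_gt0.
split => [[mh [c hc]]|[mh [a [b [r hab]]]]]; split => //.
 pose a0 := c ord0; pose a1 := c (lift ord0 ord0); pose a2 := c (lift ord0 (lift ord0 ord0)).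
 exists ((Num.sqrt 2 * a2) +i* (Num.sqrt 2 * a1)), ((- (2 * (Num.sqrt 2 * a2))) +i* (Num.sqrt 2 * a0)).
 split => /=; first by field.
 apply: (ae_imp hc) => p ->; rewrite -span_lcomb /=.
 by rewrite !big_ord_recl big_ord0 addr0.
pose c : seq R := [:: Im b / Num.sqrt 2; Im a / Num.sqrt 2; Re a / Num.sqrt 2].
exists (fun i => nth 0 c i); apply: (ae_imp hab) => p ->.
rewrite !big_ord_recl big_ord0 addr0 /= span_lcomb.
rewrite ![Num.sqrt 2 * (_ / _)]mulrC !mulfVK//; congr (lcomb _ _ 1 p); first by case: (a).
by apply: eqcE => //=; lra.
Qed.

End span.

Theorem corollary4p16 (R : realType) (h : H1 R -> R[i]) :
 KerL h <->
 VectR [:: ds (@Qp R);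
      (fun p => 'i%C * Qp p);
      (fun p => Qp p + 2 * 'i%C * ds (@Qp R) p)] h.
Proof.
rewrite VectR_lcomb; split => [hK|[mh [a [b [r hab]]]]].
 have [[[mh _] _] _ _] := hK; split => //.
 have [a [b [r hab]]] := kernel_form hK; exists a, b; split => //.
exact: KerL_ae mh hab (KerL_lcomb r).
Qed.
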